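(* Let $\alpha>0$, $p\in(0,\infty]$, and let $(\mathbf X_t)_{t\in\mathbb Z}$ be an $\mathbb R^d$-valued stationary time series satisfying $\mathbf{RV}_\alpha$ with spectral tail process $\boldsymbol\Theta=(\boldsymbol\Theta_t)_{t\in\mathbb Z}$, such that $\|\boldsymbol\Theta\|_p+\|\boldsymbol\Theta\|_\alpha<\infty$ a.s. Let $(x_n)$ be a sequence of positive numbers with $n\,\mathbb P(|\mathbf X_0|>x_n)\to0$ such that for every $\delta>0$ $$\lim_{k\to\infty}\limsup_{n\to\infty}\mathbb P\big(\|\mathbf X_{[k,n]}\|_\infty>\delta x_n\,\big|\,|\mathbf X_0|>\delta x_n\big)=0,\qquad \lim_{\epsilon\to0}\limsup_{n\to\infty}\frac{\mathbb P\big(\|\overline{x_n^{-1}\mathbf X_{[0,n]}}^{\epsilon}\|_p>\delta\big)}{n\,\mathbb P(|\mathbf X_0|>x_n)}=0,$$ and such that $n/x_n^p\to0$ if $p<\alpha$, and $n/x_n^{\alpha-\kappa}\to0$ for some $\kappa>0$ if $p=\alpha$. Then the constant $$c(p):=\lim_{n\to\infty}\frac{\mathbb P(\|\mathbf X_{[0,n]}\|_p>x_n)}{n\,\mathbb P(|\mathbf X_0|>x_n)}$$ admits the representation $$c(p)=\mathbb E\Big[\big\|\boldsymbol\Theta/\|\boldsymbol\Theta\|_\alpha\big\|_p^\alpha\Big].$$ If in addition $c(p)<\infty$, then the distribution of the spectral cluster process $\mathbf Q^{(p)}$ (see context) is given by $$\mathbb P(\mathbf Q^{(p)}\in\cdot)=c(p)^{-1}\,\mathbb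 E\Big[\big\|\boldsymbol\Theta/\|\boldsymbol\Theta\|_\alpha\big\|_p^\alpha\,\mathbf 1\big(\boldsymbol\Theta/\|\boldsymbol\Theta\|_p\in\cdot\big)\Big]$$ in the space $(\ell^p,d_p)$; that is, the right-hand side is a probability law on $\ell^p$, and its image under $\mathbf x\mapsto[\mathbf x]\in\tilde\ell^p$ is the law of the limit $\mathbf Q^{(p)}$ in $\tilde\ell^p$.
   Context: $|\cdot|$ is a norm on $\mathbb R^d$. For $\mathbf x=(\mathbf x_t)_{t\in\mathbb Z}\in(\mathbb R^d)^{\mathbb Z}$ put $\|\mathbf x\|_p=(\sum_t|\mathbf x_t|^p)^{1/p}$ for $0<p<\infty$, $\|\mathbf x\|_\infty=\sup_t|\mathbf x_t|$, and $\ell^p=\{\mathbf x:\|\mathbf x\|_p<\infty\}$ with metric $d_p(\mathbf x,\mathbf y)=\|\mathbf x-\mathbf y\|_p$ for $p\in[1,\infty]$ and $\|\mathbf x-\mathbf y\|_p^p$ for $p\in(0,1)$. $\mathbf X_{[a,b]}=(\mathbf X_a,\dots,\mathbf X_b)$ is embedded in $(\mathbb R^d)^{\mathbb Z}$ by zeros outside $[a,b]$. Truncation: $\overline{\mathbf x}^{\epsilon}=(\mathbf x_t\mathbf 1(|\mathbf x_t|\le\epsilon))_t$. Shift: $B^k\mathbf x=(\mathbf x_{t-k})_t$. $\tilde\ell^p=\ell^p/\!\sim$, where $\mathbf x\sim\mathbf y$ iff $B^k\mathbf x=\mathbf y$ for some $k\in\mathbb Z$; $\tilde d_p([\mathbf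 x],[\mathbf y])=\inf_{k\in\mathbb Z}\{d_p(B^k\mathbf a,\mathbf b):\mathbf a\in[\mathbf x],\mathbf b\in[\mathbf y]\}$. $\mathbf{RV}_\alpha$: there is a sequence $\boldsymbol\Theta$ in $(\mathbb R^d)^{\mathbb Z}$ with $|\boldsymbol\Theta_0|=1$ (the spectral tail process) such that for every $h\ge0$, $\mathbb P(x^{-1}(\mathbf X_t)_{t\in[-h,h]}\in\cdot\mid|\mathbf X_0|>x)\xrightarrow{w}\mathbb P(Y(\boldsymbol\Theta_t)_{t\in[-h,h]}\in\cdot)$ as $x\to\infty$, with $Y$ Pareto$(\alpha)$ ($\mathbb P(Y>y)=y^{-\alpha}$, $y>1$) independent of $\boldsymbol\Theta$. Spectral cluster process: under the stated hypotheses the limit $c(p)\in(0,\infty]$ exists, and if $c(p)<\infty$ there is a random element $\mathbf Q^{(p)}$ of $\tilde\ell^p$ with $\|\mathbf Q^{(p)}\|_p=1$ a.s. such that $\mathbb P(x_n^{-1}\mathbf X_{[0,n]}\in\cdot\mid\|\mathbf X_{[0,n]}\|_p>x_n)\xrightarrow{w}\mathbb P(Y\mathbf Q^{(p)}\in\cdot)$ in $(\tilde\ell^p,\tilde d_p)$, with $Y$ Pareto$(\alpha)$ independent of $\mathbf Q^{(p)}$. *)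

(* Defs.v *)
From HB Require Import structures.
From mathcomp Require Import all_boot all_order all_algebra generic_quotient.
From mathcomp Require Import all_classical all_reals all_analysis.
From mathcomp Require Import zify.

Set Implicit Arguments.
Unset Strict Implicit.
Unset Printing Implicit Defensive.

Import Order.TTheory GRing.Theory Num.Theory numFieldNormedType.Exports.

Local Open Scope classical_set_scope.
Local Open Scope ring_scope.
Local Open Scope quotient_scope.

Definition borel (S : ptopologicalType) := g_sigma_algebraType (@open S).

(* The family is filtered by [F] and consists of set functions that are meant
   to be probability measures on the Borel sets of [S]. *)
Definition weak_cvg (R : realType) (S : ptopologicalType) (I : Type)
    (F : set_system I) (mu_ : I -> set (borel S) -> \bar R)
    (mu : set (borel S) -> \bar R) : Prop :=
  forall f : S -> R, continuous f -> (exists M : R, forall s, `|f s| <= M) ->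
    (\int[mu_ i]_(s in [set: borel S]) (f s)%:E)%E @[i --> F] -->
    (\int[mu]_(s in [set: borel S]) (f s)%:E)%E.

Section conditioning.
Context (dO : measure_display) (O : measurableType dO) (R : realType).
Variable P : probability O R.

(* Equal to 0 when [P B = 0]. *)
Definition cprob (A B : set O) : R := fine (P (A `&` B)) / fine (P B).

Definition cond_law (S : ptopologicalType) (Z : O -> borel S) (B : set O) :
    set (borel S) -> \bar R :=
  fun A => (cprob (Z @^-1` A) B)%:E.

Definition pareto (alpha : R) (Y : O -> R) : Prop :=
  measurable_fun [set: O] Y /\
  forall y : R, 1 < y -> P [set w | y < Y w] = (y `^ (- alpha))%:E.

Definition indep_elements d1 (T1 : measurableType d1) d2 (T2 : measurableType d2)
    (Y : O -> T1) (Z : O -> T2) : Prop :=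
  forall (A : set T1) (B : set T2), measurable A -> measurable B ->
    P (Y @^-1` A `&` Z @^-1` B) = (P (Y @^-1` A) * P (Z @^-1` B))%E.

End conditioning.

Section dist_open.
Context (R : realType) (T : Type) (dist : T -> T -> \bar R).

Definition dist_open : set_system T :=
  [set U | forall x, U x ->
     exists2 e : R, 0 < e & forall y, (dist x y < e%:E)%E -> U y].

Lemma dist_openT : dist_open setT.
Proof. by move=> x _; exists 1. Qed.

Lemma dist_openI : setI_closed dist_open.
Proof.
move=> U V oU oV x [Ux Vx].
have [e e0 eU] := oU _ Ux; have [f f0 fV] := oV _ Vx.
exists (Num.min e f) => [|y xy]; first by rewrite lt_min e0.
by split; [apply: eU|apply: fV]; apply: (lt_le_trans xy);
  rewrite lee_fin ge_min lexx ?orbT.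
Qed.

Lemma dist_open_bigU (I : Type) (U : I -> set T) :
  (forall i, dist_open (U i)) -> dist_open (\bigcup_i U i).
Proof.
move=> oU x [i _ Uix]; have [e e0 eU] := oU i _ Uix.
by exists e => // y /eU Uiy; exists i.
Qed.

End dist_open.

Record vnorm (R : realType) (d : nat) := VNorm {
  vnorm_val :> 'rV[R]_d -> R ;
  vnorm_eq0 : forall v, vnorm_val v = 0 -> v = 0 ;
  vnormZ : forall (a : R) v, vnorm_val (a *: v) = `|a| * vnorm_val v ;
  vnormD : forall u v, vnorm_val (u + v) <= vnorm_val u + vnorm_val v
}.

Lemma vnorm0 (R : realType) (d : nat) (N : vnorm R d) : N 0 = 0.
Proof. by rewrite -(scale0r 0) vnormZ normr0 mul0r. Qed.

Lemma vnorm_ge0 (R : realType) (d : nat) (N : vnorm R d) v : 0 <= N v.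
Proof.
have := vnormD N v (- v); rewrite subrr vnorm0 -scaleN1r vnormZ normrN1 mul1r.
by move=> ge0; rewrite -(@pmulrn_lge0 _ _ 2) ?mulr2n.
Qed.

Section sequences.
Context (R : realType) (d : nat).

Definition pathZ : Type := int -> 'rV[R]_d.
Implicit Types x y : pathZ.

Definition bshift (k : int) x : pathZ := fun t => x (t - k).

Definition scale (a : R) x : pathZ := fun t => a *: x t.

(* The block x_[a,b], embedded by zeros. *)
Definition block (a b : int) x : pathZ :=
  fun t => if a <= t <= b then x t else 0.

(* The (n x d)-matrix with rows x_a, ..., x_(a+n-1). *)
Definition window (a : int) (n : nat) x : 'M[R]_(n, d) :=
  \matrix_(i < n, j < d) x (a + i%:Z) ord0 j.

Variable N : vnorm R d.

Definition trunc (eps : R) x : pathZ := fun t => if N (x t) <= eps then x t else 0.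

(* Only 0 < p <= +oo is meaningful. *)
Definition lpnorm (p : \bar R) x : \bar R :=
  match p with
  | r%:E => ((\esum_(t in [set: int]) (N (x t) `^ r)%:E) `^ r^-1)%E
  | +oo%E => ereal_sup [set (N (x t))%:E | t in [set: int]]
  | -oo%E => 0%E
  end.

Definition pathB x y : pathZ := fun t => x t - y t.

Definition lpdist (p : \bar R) x y : \bar R :=
  if (1 <= p)%E then lpnorm p (pathB x y)
  else (lpnorm p (pathB x y) `^ fine p)%E.

(* x / |x|_p, meaningful when 0 < |x|_p < +oo. *)
Definition normalize (p : \bar R) x : pathZ := scale (fine (lpnorm p x))^-1 x.

Lemma lpnormZ_fin p (a : R) x :
  (lpnorm p x < +oo)%E -> (lpnorm p (scale a x) < +oo)%E.
Proof.
case: p => [r||] //=.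
- have [->|r0] := eqVneq r 0; first by rewrite invr0 !poweRe0.
  move=> /lty_poweRy; rewrite invr_eq0 => /(_ r0) xoo; apply: poweR_lty.
  rewrite (_ : esum _ _ = ((`|a| `^ r)%:E *
      \esum_(t in [set: int]) (N (x t) `^ r)%:E)%E).
    by rewrite lte_mul_pinfty // ?lee_fin ?powR_ge0.
  rewrite /esum -ereal_supZl ?powR_ge0//; last first.
    by apply/set0P; exists (\sum_(t \in set0) (N (x t) `^ r)%:E)%E;
      exists set0 => //; split.
  congr ereal_sup; rewrite image_comp; apply: eq_imagel => A [finA _] /=.
  rewrite ge0_mule_fsumr; last by move=> t; rewrite lee_fin powR_ge0.
  by apply: eq_fsbigr => t _; rewrite vnormZ powRM ?vnorm_ge0.
- move=> xoo; rewrite (_ : [set _ | _ in _] =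
      [set (`|a|%:E * e)%E | e in [set (N (x t))%:E | t in [set: int]]]).
    rewrite ereal_supZl ?lte_mul_pinfty //.
    by apply/set0P; exists (N (x 0))%:E; exists 0.
  by rewrite image_comp; apply: eq_imagel => t _ /=; rewrite vnormZ EFinM.
Qed.

Lemma lpnorm_block_fin p (a b : int) x : (lpnorm p (block a b x) < +oo)%E.
Proof.
have finab : finite_set [set t : int | a <= t <= b].
  apply: (@sub_finite_set _ _ [set a + n%:Z | n in `I_(`|(b - a)%R|%N).+1]).
    move=> t /= /andP[at_ tb]; exists `|(t - a)%R|%N; last first.
      by rewrite gez0_abs ?subr_ge0// addrC addrNK.
    by rewrite /= ltnS; lia.
  exact/finite_image/finite_II.
have sum_fin r : r != 0 ->
    (\esum_(t in [set: int]) (N (block a b x t) `^ r)%:E < +oo)%E.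
  move=> r0; rewrite (_ : esum _ _ = \esum_(t in [set t : int | a <= t <= b])
      (N (x t) `^ r)%:E).
    rewrite esum_fset ?fsumEFin ?ltry// => t _.
    by rewrite lee_fin powR_ge0.
  rewrite [RHS]esum_mkcond; apply: eq_esum => t _.
  rewrite /block; case: ifPn => abt; first by rewrite mem_set.
  by rewrite vnorm0 powR0 // memNset //; exact/negP.
case: p => [r||] //=.
- have [->|r0] := eqVneq r 0; first by rewrite invr0 poweRe0 ltry.
  by apply: poweR_lty; exact: sum_fin.
- apply: le_lt_trans (sum_fin 1 (oner_neq0 _)).
  apply: ub_ereal_sup => _ [t _ <-]; apply: esum_ge.
  exists [set t]; first by split.
  by rewrite fsbig_set1 powRr1 ?vnorm_ge0.
Qed.

Definition ell (p : \bar R) : Type := {x : pathZ | (lpnorm p x < +oo)%E}.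

Definition ell_val p (x : ell p) : pathZ := \val x.

Definition ellblock p (a b : int) x : ell p :=
  exist _ (block a b x) (lpnorm_block_fin p a b x).

Definition ellscale p (a : R) (x : ell p) : ell p :=
  exist _ (scale a (ell_val x)) (lpnormZ_fin a (valP x)).

Definition elldist p (x y : ell p) : \bar R := lpdist p (ell_val x) (ell_val y).

Section ell_topology.
Variable p : \bar R.

HB.instance Definition _ := Choice.on (ell p).
HB.instance Definition _ := isPointed.Build (ell p) (ellblock p 0 0 (fun=> 0)).
HB.instance Definition _ := isOpenTopological.Build (ell p)
  (dist_openT (@elldist p)) (@dist_openI _ _ (@elldist p))
  (@dist_open_bigU _ _ (@elldist p)).

Definition shift_rel : rel (ell p) :=
  fun (x y : ell p) => `[< exists k : int, bshift k (ell_val x) = ell_val y >].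

Lemma shift_rel_refl : reflexive shift_rel.
Proof.
by move=> x; apply/asboolP; exists 0; apply/funext => t; rewrite /bshift subr0.
Qed.

Lemma shift_rel_sym : symmetric shift_rel.
Proof.
have imp (x y : ell p) : shift_rel x y -> shift_rel y x.
  move=> /asboolP[k xy]; apply/asboolP; exists (- k).
  by rewrite -xy; apply/funext => t; rewrite /bshift opprK addrK.
by move=> x y; apply/idP/idP; exact: imp.
Qed.

Lemma shift_rel_trans : transitive shift_rel.
Proof.
move=> y x z /asboolP[k xy] /asboolP[l yz]; apply/asboolP; exists (k + l).
by rewrite -yz -xy; apply/funext => t; rewrite /bshift opprD addrA addrAC.
Qed.

Canonical shift_equiv : equiv_rel (ell p) :=
  EquivRel shift_rel shift_rel_refl shift_rel_sym shift_rel_trans.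

Definition ell_tilde : Type := {eq_quot shift_equiv}.

Definition shift_class (x : ell p) : ell_tilde := \pi_({eq_quot shift_equiv}) x.

Definition representative (q : ell_tilde) : ell p :=
  repr (q : {eq_quot shift_equiv}).

Definition tilde_dist (q r : ell_tilde) : \bar R :=
  ereal_inf [set e : \bar R | exists (k : int) (a b : ell p),
    [/\ shift_class a = q, shift_class b = r &
        e = lpdist p (bshift k (ell_val a)) (ell_val b)]].

HB.instance Definition _ := Choice.copy ell_tilde {eq_quot shift_equiv}.
HB.instance Definition _ := isPointed.Build ell_tilde
  (shift_class (ellblock p 0 0 (fun=> 0))).
HB.instance Definition _ := isOpenTopological.Build ell_tilde
  (dist_openT tilde_dist) (@dist_openI _ _ tilde_dist)
  (@dist_open_bigU _ _ tilde_dist).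

(* Neither depends on the representative of the class. *)
Definition tilde_norm (q : ell_tilde) : \bar R :=
  lpnorm p (ell_val (representative q)).

Definition tilde_scale (a : R) (q : ell_tilde) : ell_tilde :=
  shift_class (ellscale a (representative q)).

End ell_topology.

End sequences.

Section time_series.
Context (R : realType) (d : nat).

(* The product of the Borel sigma-algebras of the coordinate spaces. *)
Definition path_space :=
  g_sigma_algebraType [set E : set (int -> 'rV[R]_d) |
    exists (t : int) (B : set (borel 'rV[R]_d)),
      measurable B /\ E = [set x | B (x t)]].

Variable N : vnorm R d.

Section processes.
Context (dO : measure_display) (O : measurableType dO).
Variable P : probability O R.

Definition process (X : int -> O -> 'rV[R]_d) : Prop :=
  forall t : int, measurable_fun [set: O] (X t : O -> borel 'rV[R]_d).

Definition stationary (X : int -> O -> 'rV[R]_d) : Prop :=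
  forall (k : int) (A : set path_space), measurable A ->
    P [set w | A (bshift k (X ^~ w))] = P [set w | A (X ^~ w)].

End processes.

Section limit_objects.
Context (dO : measure_display) (O : measurableType dO) (P : probability O R).
Context (dO' : measure_display) (O' : measurableType dO')
  (P' : probability O' R).
Variables (alpha : R) (X : int -> O -> 'rV[R]_d).

(* [Theta] is a spectral tail process of [X], and [Y] is the Pareto variable
   that goes with it. *)
Definition spectral_tail_process (Theta : int -> O' -> 'rV[R]_d)
    (Y : O' -> R) : Prop :=
  [/\ process Theta,
      {ae P', forall w, N (Theta 0 w) = 1},
      pareto P' alpha Y,
      indep_elements P' Y (fun w => (Theta ^~ w : path_space)) &
      forall h : nat,
        weak_cvg (pinfty_nbhs R)
          (fun u : R => cond_law P
             (fun w => window (- h%:Z) h.*2.+1 (scale u^-1 (X ^~ w))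
                : borel 'M[R]_(h.*2.+1, d))
             [set w | u < N (X 0 w)])
          (pushforward P'
             (fun w => window (- h%:Z) h.*2.+1 (scale (Y w) (Theta ^~ w))
                : borel 'M[R]_(h.*2.+1, d)))].

(* [Q] is a spectral cluster process of [X] along the levels [x], and [Y] is the
   Pareto variable that goes with it. *)
Definition spectral_cluster_process (p : \bar R) (x : nat -> R)
    (Q : O' -> ell_tilde N p) (Y : O' -> R) : Prop :=
  [/\ measurable_fun [set: O'] (Q : O' -> borel (ell_tilde N p)),
      {ae P', forall w, tilde_norm (Q w) = 1%E},
      pareto P' alpha Y,
      indep_elements P' Y (Q : O' -> borel (ell_tilde N p)) &
      weak_cvg \oo
        (fun n : nat => cond_law P
           (fun w => shift_class
              (ellscale (x n)^-1 (ellblock N p 0 n%:Z (X ^~ w)))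
              : borel (ell_tilde N p))
           [set w | ((x n)%:E < lpnorm N p (block 0 n%:Z (X ^~ w)))%E])
        (pushforward P'
           (fun w => tilde_scale (Y w) (Q w) : borel (ell_tilde N p)))].

End limit_objects.

End time_series.

(* Main.v *)
(** Let beta be the product of the measure alpha y^(-alpha-1) dy on ]0, +oo[ and
    the law of Theta, S0 = y Theta and S1 = y Theta / |Theta|_alpha.  Regular
    variation says that the path seen from an exceedance at time 0 converges to
    S0 under beta restricted to |S0_0| > 1.  Together with stationarity it gives
    a mass transport formula for S0 under beta, which identifies S1, up to shifts,
    with S0 weighted by |S0_0|^alpha / |S0|_alpha^alpha.

    Let f be shift-invariant and depend only on the entries larger than epsilon.
    Then f(X_[0,n]) is the sum over m of f(X_[m,n]) - f(X_[m+1,n]).  A summand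
    vanishes unless |X_m| > epsilon x_n, and by anticlustering it depends on a
    bounded window up to a negligible error.  Hence E f(x_n^-1 X_[0,n]), divided
    by n P(|X_0| > x_n), tends to the beta-integral of
    (f(S0_[0,oo[) - f(S0_[1,oo[)) 1(|S0_0| > epsilon), and by mass transport this
    is the beta-integral of f(S1).  The condition on small values removes the
    restriction on f.

    For f = 1(|.|_p > 1) this gives c(p) = beta(|S1|_p > 1), which is the
    expectation of (|Theta|_p / |Theta|_alpha)^alpha.  If it is finite, then under
    the normalized restriction of beta to |S1|_p > 1 the length |S1|_p is
    Pareto(alpha) and independent of S1 / |S1|_p = Theta / |Theta|_p. *)

Require Import Defs.
From HB Require Import structures.
From mathcomp Require Import all_boot all_order all_algebra.
From mathcomp Require Import finmap generic_quotient.
From mathcomp Require Import all_classical all_reals all_analysis measurable_realfun.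
From mathcomp Require Import zify ring lra.

Set Implicit Arguments.
Unset Strict Implicit.
Unset Printing Implicit Defensive.

Import Order.TTheory GRing.Theory Num.Theory numFieldNormedType.Exports.

Local Open Scope classical_set_scope.
Local Open Scope ring_scope.

(** The measure beta is infinite near the zero path, so limits are taken only for functionals that
    vanish there. Neither 1(|.|_p > 1) nor a sharp truncation is continuous: the cut-off is
    therefore a continuous ramp, the test functionals are Lipschitz for d_p, and indicators are
    reached through Lipschitz minorants. Applied to f 1(|.|_p > 1) and to (M - f) 1(|.|_p > 1),
    lower bounds alone give convergence once the total mass is known to converge. If c(p) is
    infinite, the cut-off functionals still have finite limits, and these increase to infinity.

    Since ell^oo is not separable, a limit law must be shown to live on the Borel sets. The entries
    of Theta tend to 0 because |Theta|_alpha is finite, so Theta is a limit in d_p of finite blocks;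
    the same decay makes a cut-off functional depend on finitely many entries of Theta.

    The levels x_n tend to infinity because n P(|X_0| > x_n) tends to 0 while the tail stays
    positive. All p are treated together through the subadditive |.|_p^q, with q = 1 or q = p. *)

Lemma matrix_continuousP (R : realType) m n (f : 'M[R]_(m, n) -> R) :
  (forall v e, 0 < e -> exists2 r, 0 < r & forall u, `|v - u| < r -> `|f v - f u| < e) ->
  continuous f.
Proof.
move=> H v; apply/(@cvgrPdist_lt R R^o _ (nbhs v) (nbhs_filter v)) => e e0; have [r r0 Hr] := H v e e0.
have : nbhs (v : 'M[R]_(m,n)) (ball v r) by exact: nbhsx_ballx.
by apply: filterS => u; rewrite mx_norm_ball; exact: Hr.
Qed.

(** * Norms and moduli of sequences *)

Section vnorm_theory.
Context (R : realType) (d : nat) (N : vnorm R d).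
Implicit Types u v : 'rV[R]_d.

Lemma vnormN v : N (- v) = N v.
Proof. by rewrite -scaleN1r vnormZ normrN1 mul1r. Qed.

Lemma vnormB u v : N (u - v) <= N u + N v.
Proof. by rewrite -(vnormN v) vnormD. Qed.

Lemma vnorm_distC u v : N (u - v) = N (v - u).
Proof. by rewrite -vnormN opprB. Qed.

Lemma vnorm_dist_dist u v : `|N u - N v| <= N (u - v).
Proof.
have h a b : N a - N b <= N (a - b).
  by rewrite lerBlDr -{1}(subrK b a) vnormD.
by rewrite ler_norml h andbT lerNl opprB vnorm_distC h.
Qed.

Lemma vnorm_le_norm : exists2 C : R, 0 < C & forall v, N v <= C * `|v|.
Proof.
(* The summand 1 keeps the constant positive even when [d] is 0. *)
exists (1 + \sum_(j < d) N (delta_mx 0 j)) => [|v].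
  by rewrite ltr_pwDl// sumr_ge0// => j _; exact: vnorm_ge0.
rewrite {1}(row_sum_delta v).
apply: (@le_trans _ _ (\sum_(j < d) `|v| * N (delta_mx 0 j))).
  elim/big_ind2 : _ => [|a b x y ab xy|j _].
  - by rewrite vnorm0.
  - by rewrite (le_trans (vnormD _ _ _))// lerD.
  rewrite vnormZ ler_wpM2r ?vnorm_ge0//.
  by rewrite [leRHS]/Num.norm/= mx_normrE; apply/bigmax_geP; right => /=; exists (ord0, j).
rewrite -mulr_sumr mulrC ler_wpM2r//.
by rewrite lerDr.
Qed.

Lemma vnorm_continuous : continuous (N : 'rV[R]_d -> R).
Proof.
have [C C0 NC] := vnorm_le_norm.
apply: matrix_continuousP => v e e0; exists (e / C) => [|u vu]; first by rewrite divr_gt0.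
rewrite (le_lt_trans (vnorm_dist_dist _ _))// (le_lt_trans (NC _))//.
by rewrite mulrC -ltr_pdivlMr.
Qed.

End vnorm_theory.

Lemma esumZ (R : realType) (T : choiceType) (k : R) (a : T -> \bar R) :
  0 <= k -> (forall t, (0 <= a t)%E) ->
  (\esum_(t in [set: T]) (k%:E * a t) = k%:E * \esum_(t in [set: T]) a t)%E.
Proof.
move=> k0 a0; rewrite /esum -ereal_supZl//; last first.
  by apply/set0P; exists (\sum_(t \in set0) a t)%E; exists set0 => //; split.
congr ereal_sup; rewrite image_comp; apply: eq_imagel => A [finA _] /=.
by rewrite ge0_mule_fsumr.
Qed.

(** Convexity of t^r at the point (x + y)/(a + b), which is the mean of x/a and y/b with weights
    a/(a + b) and b/(a + b). At x = a, y = b the right-hand side is (a + b)^r, as Minkowski's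
    inequality needs. *)
Lemma powR_conv (R : realType) (r a b x y : R) : 1 <= r -> 0 < a -> 0 < b ->
  0 <= x -> 0 <= y ->
  (x + y) `^ r <= (a + b) `^ r * (a / (a + b) / a `^ r) * x `^ r +
    (a + b) `^ r * (b / (a + b) / b `^ r) * y `^ r.
Proof.
move=> r1 a0 b0 x0 y0; have r0 : 0 < r by rewrite (lt_le_trans _ r1).
have ab0 : 0 < a + b by rewrite addr_gt0.
have t0 : 0 <= a / (a + b) by rewrite divr_ge0// ltW.
have t1 : a / (a + b) <= 1 by rewrite ler_pdivrMr// mul1r lerDl ltW.
pose t := Itv01 t0 t1.
have xa0 : 0 <= x / a by rewrite divr_ge0// ltW.
have yb0 : 0 <= y / b by rewrite divr_ge0// ltW.
have := @convex_powR R r r1 t (x / a) (y / b).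
rewrite !inE/= !in_itv/= !xa0 !yb0 => /(_ erefl erefl).
rewrite convRE [X in X `^ _ <= _ -> _]convRE/= /unstable.onem.
have -> : 1 - a / (a + b) = b / (a + b) by field; lra.
have -> : a / (a + b) * (x / a) + b / (a + b) * (y / b) = (x + y) / (a + b).
  by field; rewrite !gt_eqF.
have powRV c : 0 < c -> c^-1 `^ r = (c `^ r)^-1.
  by move=> c0; rewrite -(powR_inv1 (ltW c0)) -powRrM mulN1r powRN.
rewrite !powRM ?invr_ge0 ?(ltW ab0) ?(ltW a0) ?(ltW b0) ?addr_ge0// !powRV//.
rewrite ler_pdivrMr ?powR_gt0// => /le_trans; apply.
by rewrite le_eqVlt; apply/orP; left; apply/eqP; ring.
Qed.

Section lpnorm_theory.
Context (R : realType) (d : nat) (N : vnorm R d).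
Implicit Types (x y : pathZ R d) (p : \bar R).
Local Notation lpn := (lpnorm N).

Definition padd x y : pathZ R d := fun t => x t + y t.
Definition psum (r : R) x : \bar R := (\esum_(t in [set: int]) (N (x t) `^ r)%:E)%E.

Lemma psum_ge0 r x : (0 <= psum r x)%E.
Proof. by apply: esum_ge0 => t _; rewrite lee_fin powR_ge0. Qed.

Lemma lpnorm_ge0 p x : (0 <= lpn p x)%E.
Proof.
case: p => [r||] //=; first exact: poweR_ge0.
by apply: ereal_sup_ge => //; exists (N (x 0))%:E; [exists 0|rewrite lee_fin vnorm_ge0].
Qed.

Lemma le_lpnorm p x y : (0 < p)%E -> (forall t, N (x t) <= N (y t)) ->
  (lpn p x <= lpn p y)%E.
Proof.
case: p => [r||] //=; rewrite ?lte_fin => r0 xy.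
- apply: gt0_ler_poweR; rewrite ?invr_ge0 ?(ltW r0)// ?in_itv/= ?leey ?psum_ge0//.
  apply: le_esum => t _; rewrite lee_fin ge0_ler_powR ?nnegrE ?vnorm_ge0// ltW//.
- apply: ub_ereal_sup => _ [t _ <-]; apply: ereal_sup_ge => //.
  by exists (N (y t))%:E; [exists t|rewrite lee_fin].
Qed.

Lemma lpnorm_ge p x t : (0 < p)%E -> ((N (x t))%:E <= lpn p x)%E.
Proof.
case: p => [r||] //=; rewrite ?lte_fin => r0; last first.
  by apply: ereal_sup_ge => //; exists (N (x t))%:E; [exists t|].
have -> : (N (x t))%:E = (((N (x t))%:E `^ r) `^ r^-1)%E.
  by rewrite -poweRrM mulfV ?gt_eqF// poweRe1// lee_fin vnorm_ge0.
apply: gt0_ler_poweR; rewrite ?invr_ge0 ?(ltW r0)// ?in_itv/= ?leey ?psum_ge0 ?poweR_ge0//.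
  by rewrite andbT lee_fin powR_ge0.
by apply: esum_ge; exists [set t]; [split|rewrite fsbig_set1].
Qed.

Lemma bshift_set_bij (k : int) : set_bij [set: int] [set: int] (fun t : int => t - k).
Proof.
split=> // [t1 t2 _ _ /addIr //|t _ /=].
by exists (t + k) => //; rewrite addrK.
Qed.

Lemma lpnorm_bshift p k x : lpn p (bshift k x) = lpn p x.
Proof.
case: p => [r||] //=.
  by congr (_ `^ _)%E; rewrite /bshift [RHS](reindex_esum [set: int] [set: int] _ _ (bshift_set_bij k)).
congr ereal_sup; apply/seteqP; split => _ [t _ <-].
  by exists (t - k).
by exists (t + k) => //; rewrite /bshift addrK.
Qed.

Lemma psumZ r (a : R) x : psum r (scale a x) = ((`|a| `^ r)%:E * psum r x)%E.
Proof.
rewrite -esumZ ?powR_ge0// => [|t]; last by rewrite lee_fin powR_ge0.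
by apply: eq_esum => t _; rewrite vnormZ powRM ?vnorm_ge0.
Qed.

Lemma lpnormZ p (a : R) x : (0 < p)%E -> lpn p (scale a x) = (`|a|%:E * lpn p x)%E.
Proof.
case: p => [r||] //=; rewrite ?lte_fin => r0; last first.
  rewrite -ereal_supZl//; last by apply/set0P; exists (N (x 0))%:E; exists 0.
  by rewrite image_comp; congr ereal_sup; apply: eq_imagel => t _ /=; rewrite vnormZ EFinM.
rewrite -/(psum r _) psumZ poweRM ?psum_ge0 ?lee_fin ?powR_ge0//; congr (_ * _)%E.
by rewrite poweR_EFin -powRrM mulfV ?gt_eqF// powRr1.
Qed.

(** The entrywise convexity bound, summed over t: Minkowski's inequality in terms of bounds a and b
    on the two norms. *)
Lemma psum_padd r a b x y : 1 <= r -> 0 < a -> 0 < b ->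
  (psum r x <= (a `^ r)%:E)%E -> (psum r y <= (b `^ r)%:E)%E ->
  (psum r (padd x y) <= ((a + b) `^ r)%:E)%E.
Proof.
move=> r1 a0 b0 xa yb; have r0 : 0 < r by rewrite (lt_le_trans _ r1).
have [A [B [A0 B0 AB H]]] : exists A B, [/\ 0 <= A, 0 <= B,
    A * a `^ r + B * b `^ r = (a + b) `^ r &
    forall u v, 0 <= u -> 0 <= v -> (u + v) `^ r <= A * u `^ r + B * v `^ r].
  exists ((a + b) `^ r * (a / (a + b) / a `^ r)).
  exists ((a + b) `^ r * (b / (a + b) / b `^ r)).
  have ab0 : 0 < a + b by rewrite addr_gt0.
  have ar : a `^ r != 0 by rewrite gt_eqF ?powR_gt0.
  have br : b `^ r != 0 by rewrite gt_eqF ?powR_gt0.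
  split; try by rewrite !mulr_ge0 ?invr_ge0 ?powR_ge0 ?ltW.
  - by field; rewrite ar br (gt_eqF ab0).
  - by move=> u v u0 v0; exact: powR_conv.
apply: (@le_trans _ _ (A%:E * psum r x + B%:E * psum r y)%E); last first.
  by rewrite -AB EFinD !EFinM leeD// lee_pmul// ?lee_fin// psum_ge0.
rewrite /psum -!esumZ//; try by move=> t; rewrite lee_fin powR_ge0.
rewrite -esumD; try by move=> t _; rewrite -EFinM lee_fin mulr_ge0 ?powR_ge0.
apply: le_esum => t _; rewrite -!EFinM -EFinD lee_fin.
apply: le_trans (H _ _ (vnorm_ge0 _ _) (vnorm_ge0 _ _)).
by rewrite ge0_ler_powR ?nnegrE ?addr_ge0 ?vnorm_ge0 ?vnormD// ltW.
Qed.

Lemma lpnormD p x y : (1 <= p)%E -> (lpn p (padd x y) <= lpn p x + lpn p y)%E.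
Proof.
case: p => [r||] //=; rewrite ?lee_fin => r1; last first.
  apply: ub_ereal_sup => _ [t _ <-].
  apply: (@le_trans _ _ ((N (x t))%:E + (N (y t))%:E)%E).
    by rewrite -EFinD lee_fin vnormD.
  by apply: leeD; apply: ereal_sup_ge => //; [exists (N (x t))%:E|exists (N (y t))%:E] => //; exists t.
have r0 : 0 < r by rewrite (lt_le_trans _ r1).
rewrite -!/(psum r _).
have key a x' : 0 < a -> (psum r x' `^ r^-1 < a%:E)%E -> (psum r x' <= (a `^ r)%:E)%E.
  move=> a0 xa; have -> : psum r x' = ((psum r x' `^ r^-1) `^ r)%E.
    by rewrite -poweRrM mulVf ?gt_eqF// poweRe1// psum_ge0.
  rewrite -poweR_EFin; apply: gt0_ler_poweR; rewrite ?(ltW r0) ?in_itv/= ?leey ?poweR_ge0//.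
    by rewrite lee_fin ltW.
  exact: ltW.
have [->|xoo] := eqVneq (psum r x `^ r^-1)%E +oo%E.
  by rewrite addye ?leey// gt_eqF// (lt_le_trans _ (poweR_ge0 _ _)).
have [->|yoo] := eqVneq (psum r y `^ r^-1)%E +oo%E.
  by rewrite addey ?leey// gt_eqF// (lt_le_trans _ (poweR_ge0 _ _)).
have xf : (psum r x `^ r^-1)%E \is a fin_num by rewrite ge0_fin_numE ?poweR_ge0// ltey.
have yf : (psum r y `^ r^-1)%E \is a fin_num by rewrite ge0_fin_numE ?poweR_ge0// ltey.
apply/lee_addgt0Pr => e e0.
(* Adding e/2 makes both bounds positive, also when a norm is 0, as [psum_padd] demands. *)
pose a := fine (psum r x `^ r^-1)%E + e / 2.
pose b := fine (psum r y `^ r^-1)%E + e / 2.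
have a0 : 0 < a by rewrite ltr_wpDl ?fine_ge0 ?poweR_ge0// divr_gt0.
have b0 : 0 < b by rewrite ltr_wpDl ?fine_ge0 ?poweR_ge0// divr_gt0.
have ab0 : 0 < a + b by rewrite addr_gt0.
have xa := key a x a0; have yb := key b y b0.
have {}xa : (psum r x <= (a `^ r)%:E)%E.
  by apply: xa; rewrite -(fineK xf) lte_fin ltrDl divr_gt0.
have {}yb : (psum r y <= (b `^ r)%:E)%E.
  by apply: yb; rewrite -(fineK yf) lte_fin ltrDl divr_gt0.
have -> : (psum r x `^ r^-1 + psum r y `^ r^-1 + e%:E = (a + b)%:E)%E.
  by rewrite -(fineK xf) -(fineK yf) -!EFinD; congr EFin; rewrite /a /b; lra.
have -> : (a + b)%:E = (((a + b) `^ r)%:E `^ r^-1)%E.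
  by rewrite poweR_EFin -powRrM mulfV ?gt_eqF// powRr1// ltW.
apply: gt0_ler_poweR; rewrite ?invr_ge0 ?(ltW r0) ?in_itv/= ?leey ?psum_ge0//.
  by rewrite lee_fin powR_ge0.
exact: psum_padd.
Qed.

(* |x|_p for p >= 1 and |x|_p^p for p < 1, so that d_p(x, y) = modulus (x - y) *)
Definition modulus p x : \bar R := if (1 <= p)%E then lpn p x else (lpn p x `^ fine p)%E.

(** The exponent q with [modulus] = [lpnorm]^q. What is proved for the subadditive [modulus] returns
    to the norm through the power 1/q, with no case distinction on p. *)
Definition mexp p : R := if (1 <= p)%E then 1 else fine p.

Lemma lpdistE p x y : lpdist N p x y = modulus p (pathB x y).
Proof. by []. Qed.

Lemma mexp_gt0 p : (0 < p)%E -> 0 < mexp p.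
Proof. by case: p => [r||]; rewrite /mexp ?leey//; case: ifP. Qed.

Lemma modulusE p x : (0 < p)%E -> modulus p x = (lpn p x `^ mexp p)%E.
Proof. by move=> p0; rewrite /modulus /mexp; case: ifP; rewrite ?poweRe1 ?lpnorm_ge0. Qed.

Lemma lpnormE p x : (0 < p)%E -> lpn p x = (modulus p x `^ (mexp p)^-1)%E.
Proof.
move=> p0; rewrite modulusE// -poweRrM mulfV ?gt_eqF ?mexp_gt0//.
by rewrite poweRe1 ?lpnorm_ge0.
Qed.

Lemma modulus_ge0 p x : (0 <= modulus p x)%E.
Proof. by rewrite /modulus; case: ifP => _; rewrite ?poweR_ge0 ?lpnorm_ge0. Qed.

Lemma modulus_lty p x : (0 < p)%E -> (modulus p x < +oo)%E = (lpn p x < +oo)%E.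
Proof.
move=> p0; apply/idP/idP; last by rewrite modulusE//; exact: poweR_lty.
by rewrite lpnormE//; exact: poweR_lty.
Qed.

Lemma gt_poweR (y : \bar R) (r a : R) : 0 < r -> 0 <= a -> (0 <= y)%E ->
  ((a `^ r)%:E < y `^ r)%E = (a%:E < y)%E.
Proof.
move=> r0 a0; case: y => [y||]//; last by rewrite poweRyr ?gt_eqF// !ltry.
rewrite lee_fin => y0; rewrite poweR_EFin !lte_fin; apply/idP/idP; last first.
  by move=> ay; rewrite gt0_ltr_powR// nnegrE.
by apply: contraTT; rewrite -!leNgt => ya; rewrite ge0_ler_powR ?nnegrE// ltW.
Qed.

Lemma modulus_gt p x (a : R) : (0 < p)%E -> 0 <= a ->
  ((a `^ mexp p)%:E < modulus p x)%E = (a%:E < lpn p x)%E.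
Proof. by move=> p0 a0; rewrite modulusE// gt_poweR ?mexp_gt0 ?lpnorm_ge0. Qed.

Lemma le_modulus p x y : (0 < p)%E -> (forall t, N (x t) <= N (y t)) ->
  (modulus p x <= modulus p y)%E.
Proof.
move=> p0 xy; rewrite !modulusE//; apply: gt0_ler_poweR.
- by rewrite ltW// mexp_gt0.
- by rewrite in_itv/= lpnorm_ge0 leey.
- by rewrite in_itv/= lpnorm_ge0 leey.
- exact: le_lpnorm.
Qed.

Lemma modulus_bshift p k x : modulus p (bshift k x) = modulus p x.
Proof. by rewrite /modulus lpnorm_bshift. Qed.

Lemma modulusZ p (a : R) x : (0 < p)%E ->
  modulus p (scale a x) = ((`|a| `^ mexp p)%:E * modulus p x)%E.
Proof.
by move=> p0; rewrite !modulusE// lpnormZ// poweRM ?lpnorm_ge0// lee_fin.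
Qed.

Lemma modulus_lt1 r x : 0 < r < 1 -> modulus r%:E x = psum r x.
Proof.
move=> /andP[r0 r1]; rewrite /modulus lee_fin leNgt r1/= -/(psum r x).
by rewrite -poweRrM mulVf ?gt_eqF// poweRe1// psum_ge0.
Qed.

(** The shares a/(a + b) and b/(a + b) lie in [0, 1], where t <= t^r, and they add up to 1. *)
Lemma powRD_le (a b r : R) : 0 <= a -> 0 <= b -> 0 < r <= 1 ->
  (a + b) `^ r <= a `^ r + b `^ r.
Proof.
move=> a0 b0 /andP[r0 r1].
have [ab0|ab0] := eqVneq (a + b) 0.
  by rewrite ab0 powR0 ?gt_eqF// addr_ge0 ?powR_ge0.
have abp : 0 < a + b by rewrite lt_neqAle eq_sym ab0 addr_ge0.
have h c : 0 <= c -> c <= a + b -> c / (a + b) <= (c / (a + b)) `^ r.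
  move=> c0 cab; have [->|cn0] := eqVneq c 0; first by rewrite mul0r powR_ge0.
  have cp : 0 < c by rewrite lt_neqAle eq_sym cn0.
  by apply: ger1_powR => //; rewrite divr_gt0//= ler_pdivrMr ?mul1r.
have : a / (a + b) + b / (a + b) <= (a / (a + b)) `^ r + (b / (a + b)) `^ r.
  by rewrite lerD// h// ?lerDl ?lerDr.
rewrite -mulrDl divff// => h1.
have E c : 0 <= c -> c `^ r = (c / (a + b)) `^ r * (a + b) `^ r.
  by move=> c0; rewrite -powRM ?divr_ge0 ?addr_ge0// divfK.
by rewrite (E a)// (E b)// -mulrDl ler_peMl ?powR_ge0.
Qed.

Lemma modulusD p x y : (0 < p)%E -> (modulus p (padd x y) <= modulus p x + modulus p y)%E.
Proof.
move=> p0; have [p1|p1] := leP 1%E p; first by rewrite /modulus p1 lpnormD.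
case: p p0 p1 => [r||]//; rewrite !lte_fin => r0 r1.
rewrite !modulus_lt1 ?r0// /psum -esumD; try by move=> t _; rewrite lee_fin powR_ge0.
apply: le_esum => t _; rewrite -EFinD lee_fin.
apply: le_trans (powRD_le (vnorm_ge0 _ _) (vnorm_ge0 _ _) _); last by rewrite r0 ltW.
by rewrite ge0_ler_powR ?nnegrE ?addr_ge0 ?vnorm_ge0 ?vnormD// ltW.
Qed.

Lemma modulusB p x y z : (0 < p)%E ->
  (modulus p (pathB x z) <= modulus p (pathB x y) + modulus p (pathB y z))%E.
Proof.
move=> p0; apply: le_trans (modulusD _ _ p0); apply: le_modulus => // t.
by rewrite /padd /pathB addrA subrK.
Qed.

Lemma modulus_distC p x y : (0 < p)%E -> modulus p (pathB x y) = modulus p (pathB y x).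
Proof.
by move=> p0; apply/eqP; rewrite eq_le !le_modulus// => t; rewrite /pathB vnorm_distC.
Qed.

Lemma modulus0 p x : (0 < p)%E -> (forall t, x t = 0) -> modulus p x = 0%E.
Proof.
move=> p0 x0; suff -> : x = scale 0 x.
  by rewrite modulusZ// normr0 powR0 ?mul0e// gt_eqF ?mexp_gt0.
by apply/funext => t; rewrite /scale scale0r x0.
Qed.

Lemma psum_single r x t0 : 0 < r -> (forall t, t != t0 -> x t = 0) ->
  psum r x = (N (x t0) `^ r)%:E.
Proof.
move=> r0 xt0; rewrite /psum (esumID [set t0]) ?setTI; last first.
  by move=> t _; rewrite lee_fin powR_ge0.
rewrite esum_set1 ?lee_fin ?powR_ge0// esum1 ?adde0// => t /eqP tt0.
by rewrite xt0// vnorm0 powR0 ?gt_eqF.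
Qed.

Lemma modulus_single p x t0 : (0 < p)%E -> (forall t, t != t0 -> x t = 0) ->
  modulus p x = (N (x t0) `^ mexp p)%:E.
Proof.
move=> p0 xt0; rewrite modulusE// -poweR_EFin; congr (_ `^ _)%E.
case: p p0 => [r||]//=; rewrite ?lte_fin => r0.
  by rewrite -/(psum r x) (psum_single r0 xt0) poweR_EFin -powRrM mulfV ?gt_eqF// powRr1 ?vnorm_ge0.
apply/eqP; rewrite eq_le; apply/andP; split; last first.
  by apply: ereal_sup_ge => //; exists (N (x t0))%:E => //; exists t0.
apply: ub_ereal_sup => _ [t _ <-]; have [->//|tt0] := eqVneq t t0.
by rewrite xt0// vnorm0 lee_fin vnorm_ge0.
Qed.

(** Subadditivity, peeling off the last entry. It turns entrywise smallness on a bounded window into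
    smallness of [modulus], for every p at once. *)
Lemma modulus_le_sum p x (a : int) n : (0 < p)%E ->
  (forall t, ~~ (a <= t < a + n%:Z) -> x t = 0) ->
  (modulus p x <= (\sum_(i < n) N (x (a + i%:Z)) `^ mexp p)%:E)%E.
Proof.
move=> p0; elim: n x => [|n IHn] x x0.
  by rewrite big_ord0 modulus0// => t; apply: x0; lia.
rewrite big_ord_recr/= EFinD.
pose u : pathZ R d := fun t => if t == a + n%:Z then 0 else x t.
pose v : pathZ R d := fun t => if t == a + n%:Z then x t else 0.
have -> : x = padd u v.
  by apply/funext => t; rewrite /padd /u /v; case: ifP; rewrite ?add0r ?addr0.
apply: le_trans (modulusD _ _ p0) _; apply: leeD.
  apply: le_trans (IHn u _) _.
    by move=> t tn; rewrite /u; case: eqP => // tan; apply: x0; lia.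
  rewrite lee_fin ler_sum// => i _; rewrite /padd /u /v.
  have -> : (a + i%:Z == a + n%:Z) = false by have := ltn_ord i; lia.
  by rewrite addr0.
rewrite (@modulus_single _ _ (a + n%:Z))//; last by move=> t /negPf tn; rewrite /v tn.
by rewrite /padd /u /v eqxx add0r.
Qed.

(** A finite set of times carries all of the sum but e, and a symmetric block that contains this set
    leaves less than e outside. *)
Lemma psum_tail r x : 0 < r -> (psum r x < +oo)%E -> forall e : R, 0 < e ->
  exists K : nat, forall k : nat, (K <= k)%N ->
    (psum r (pathB x (block (- k%:Z) k%:Z x)) < e%:E)%E.
Proof.
move=> r0 xoo e e0; have xf : psum r x \is a fin_num by rewrite ge0_fin_numE ?psum_ge0.
have : (psum r x - e%:E < psum r x)%E by rewrite lteBlDr// lteDl// lte_fin.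
move=> /ereal_sup_gt[_ [A [finA _] <-]] xeA.
have [K HK] : exists K : nat, forall t, A t -> (`|t| <= K)%N.
  exists (\max_(t <- enum_fset (fset_set A)) `|t|)%N => t At.
  by apply: leq_bigmax_seq => //; rewrite in_fset_set// inE.
exists K => k Kk; pose B := [set t : int | - k%:Z <= t <= k%:Z].
have AB : A `<=` B by move=> t /HK; rewrite /B/=; lia.
have E : psum r (pathB x (block (- k%:Z) k%:Z x)) =
    (\esum_(t in [set: int] `&` ~` B) (N (x t) `^ r)%:E)%E.
  rewrite esum_mkcondr; apply: eq_esum => t _; rewrite /pathB /block.
  case: ifPn => tk; first by rewrite subrr vnorm0 powR0 ?gt_eqF// memNset//=; apply.
  by rewrite subr0 mem_set//= /B/=; exact/negP.
pose S := (\esum_(t in [set: int] `&` B) (N (x t) `^ r)%:E)%E.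
have ES : psum r x = (S + psum r (pathB x (block (- k%:Z) k%:Z x)))%E.
  by rewrite E /psum (esumID B)// => t _; rewrite lee_fin powR_ge0.
have S0 : (0 <= S)%E by apply: esum_ge0 => t _; rewrite lee_fin powR_ge0.
have Sx : (S <= psum r x)%E by rewrite ES leeDl// psum_ge0.
have Sf : S \is a fin_num by rewrite ge0_fin_numE// (le_lt_trans Sx).
have AS : (\sum_(t \in A) (N (x t) `^ r)%:E <= S)%E.
  by apply: esum_ge; exists A => //; split=> // t At; split=> //; exact: AB.
have := lt_le_trans xeA AS; rewrite lteBlDr// ES addeC.
by rewrite [X in (_ < X)%E]addeC lteD2rE.
Qed.
End lpnorm_theory.

(** * Cutting off small entries *)

Section cut_theory.
Context (R : realType) (d : nat) (N : vnorm R d).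
Implicit Types (x y : pathZ R d) (v u : 'rV[R]_d).

Definition clamp (s : R) : R := Num.max 0 (Num.min 1 s).

Lemma clamp_ge0 s : 0 <= clamp s.
Proof. by rewrite /clamp le_max lexx. Qed.

Lemma clamp_le1 s : clamp s <= 1.
Proof. by rewrite /clamp ge_max ler01 ge_min lexx. Qed.

Lemma clamp0 s : s <= 0 -> clamp s = 0.
Proof. by move=> s0; apply/max_idPl; rewrite ge_min s0 orbT. Qed.

Lemma clamp1 s : 1 <= s -> clamp s = 1.
Proof. by move=> s1; rewrite /clamp (min_idPl s1); apply/max_idPr. Qed.

Lemma le_clamp s t : s <= t -> clamp s <= clamp t.
Proof.
move=> st; rewrite /clamp; case: (lerP 1 s); case: (lerP 1 t) => h1 h2.
all: by rewrite ge_max !le_max; lra.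
Qed.

Lemma clamp_dist s t : `|clamp s - clamp t| <= `|s - t|.
Proof.
wlog st : s t / s <= t.
  by move=> H; have [/H//|/ltW /H] := leP s t; rewrite distrC [in leRHS]distrC.
rewrite distrC [in leRHS]distrC !ger0_norm ?subr_ge0// ?le_clamp//.
rewrite /clamp; case: (lerP 1 s); case: (lerP 1 t) => h1 h2.
all: rewrite ?(max_idPr (@ler01 R)).
all: try (case: (lerP 0 t) => h3).
all: try (case: (lerP 0 s) => h4).
all: lra.
Qed.

(* A continuous substitute for v |-> v 1(|v| > eps). *)
Definition cutv (eps : R) v := clamp (N v / eps - 1) *: v.

Definition pathmap (h : 'rV[R]_d -> 'rV[R]_d) x : pathZ R d := fun t => h (x t).

Definition cutoff eps := pathmap (cutv eps).

Lemma cutv_le eps v : N (cutv eps v) <= N v.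
Proof.
by rewrite vnormZ ger0_norm ?clamp_ge0// ler_piMl ?vnorm_ge0 ?clamp_le1.
Qed.

Lemma cutv0 eps v : 0 < eps -> N v <= eps -> cutv eps v = 0.
Proof.
by move=> e0 ve; rewrite /cutv clamp0 ?scale0r// subr_le0 ler_pdivrMr ?mul1r.
Qed.

Lemma cutv_00 eps : cutv eps 0 = 0.
Proof. by rewrite /cutv scaler0. Qed.

Lemma cutv_mono (e1 e2 : R) v : 0 < e1 -> e1 <= e2 -> N (cutv e2 v) <= N (cutv e1 v).
Proof.
move=> e0 e12; have e2p : 0 < e2 by exact: lt_le_trans e12.
rewrite !vnormZ !ger0_norm ?clamp_ge0// ler_wpM2r ?vnorm_ge0//.
by apply: le_clamp; rewrite lerD2r ler_wpM2l ?vnorm_ge0 ?lef_pV2.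
Qed.

(** The factor in [cutv] is 1 from 2 eps on, so only entries up to 2 eps are altered. This is why
    truncation at 2 eps later controls the cut-off at eps. *)
Lemma cutvB eps v : 0 < eps -> N (v - cutv eps v) <= (if N v <= 2 * eps then N v else 0).
Proof.
move=> e0; have -> : v - cutv eps v = (1 - clamp (N v / eps - 1)) *: v.
  by rewrite scalerBl scale1r.
rewrite vnormZ ger0_norm ?subr_ge0 ?clamp_le1//; case: ifPn => [_|].
  by rewrite ler_piMl ?vnorm_ge0// gerBl clamp_ge0.
rewrite -ltNge => ve; rewrite clamp1 ?subrr ?mul0r//.
by rewrite lerBrDr ler_pdivlMr// -[1 + 1]/(2%:R) ltW.
Qed.

(** Both sides are measured by [N], so that an estimate of the matrix norm by [N] is never called
    for. *)
Definition ncontinuous (h : 'rV[R]_d -> 'rV[R]_d) := forall v e, 0 < e ->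
  exists2 r : R, 0 < r & forall u, N (v - u) < r -> N (h v - h u) < e.

Lemma ncontinuous_id : ncontinuous id.
Proof. by move=> v e e0; exists e. Qed.

Lemma ncontinuous_cutv eps : 0 < eps -> ncontinuous (cutv eps).
Proof.
(* C bounds the rate of change near v: the scalar factor is at most 1 and has slope 1/eps in [N],
   and it multiplies a vector u with N u <= N v + 1. *)
move=> eps0 v e e0; pose C := 1 + eps^-1 * (N v + 1).
have C0 : 0 < C by rewrite ltr_pwDl// mulr_ge0 ?invr_ge0 ?addr_ge0 ?vnorm_ge0 ?ltW.
exists (Num.min 1 (e / C)) => [|u]; first by rewrite lt_min ltr01 divr_gt0.
rewrite lt_min => /andP[vu1]; rewrite ltr_pdivlMr// => vu.
apply: le_lt_trans vu; rewrite /cutv; set cv := clamp _; set cu := clamp _.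
have -> : cv *: v - cu *: u = cv *: (v - u) + (cv - cu) *: u.
  by rewrite scalerBr scalerBl addrA subrK.
rewrite (le_trans (vnormD _ _ _))// !vnormZ /C mulrDr mulr1 lerD//.
  by rewrite ger0_norm ?clamp_ge0// ler_piMl ?vnorm_ge0 ?clamp_le1.
rewrite mulrA ler_pM ?vnorm_ge0//.
  apply: le_trans (clamp_dist _ _) _.
  rewrite opprB addrA subrK -mulrBl normrM (ger0_norm (_ : 0 <= eps^-1)) ?invr_ge0 ?(ltW eps0)//.
  by rewrite ler_wpM2r ?invr_ge0 ?(ltW eps0)// vnorm_dist_dist.
rewrite -(subKr v u) (le_trans (vnormB _ _ _))// lerD2l.
by rewrite ltW.
Qed.

Lemma pathmap_block h a b x : h 0 = 0 -> pathmap h (block a b x) = block a b (pathmap h x).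
Proof. by move=> h0; apply/funext => t; rewrite /pathmap /block; case: ifP. Qed.

Lemma pathmap_bshift h k x : pathmap h (bshift k x) = bshift k (pathmap h x).
Proof. by []. Qed.

Lemma bshift_block k a b x : bshift k (block a b x) = block (a + k) (b + k) (bshift k x).
Proof.
apply/funext => t; rewrite /bshift /block.
by have -> : (a <= t - k <= b) = (a + k <= t <= b + k) by lia.
Qed.

Lemma block_bshift k a b x : block a b (bshift k x) = bshift k (block (a - k) (b - k) x).
Proof. by rewrite bshift_block !subrK. Qed.

Lemma bshift_scale k a x : bshift k (scale a x) = scale a (bshift k x).
Proof. by []. Qed.

Lemma block_scale a b c x : block a b (scale c x) = scale c (block a b x).
Proof. by apply/funext => t; rewrite /scale /block; case: ifP; rewrite ?scaler0. Qed.

Lemma bshiftD k l x : bshift k (bshift l x) = bshift (k + l) x.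
Proof. by apply/funext => t; rewrite /bshift -addrA opprD. Qed.

Lemma bshift0 x : bshift 0 x = x.
Proof. by apply/funext => t; rewrite /bshift subr0. Qed.

Lemma scaleA a b x : scale a (scale b x) = scale (a * b) x.
Proof. by apply/funext => t; rewrite /scale scalerA. Qed.

(** For p = oo a finite norm does not force the entries to decay. Here the decay comes from a finite
    |.|_alpha, see [psum_vanishing]. *)
Definition vanishing x := forall e, 0 < e ->
  exists K : nat, forall t : int, (K < `|t|)%N -> N (x t) <= e.

Lemma psum_vanishing r x : 0 < r -> (psum N r x < +oo)%E -> vanishing x.
Proof.
move=> r0 xoo e e0; have er : 0 < e `^ r by rewrite powR_gt0.
have [K HK] := psum_tail r0 xoo er; exists K => t Kt.
have := HK K (leqnn K); apply: contraTT; rewrite -ltNge -leNgt => et.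
apply: esum_ge; exists [set t]; first by split.
rewrite fsbig_set1 lee_fin ge0_ler_powR ?nnegrE ?vnorm_ge0 ?(ltW r0) ?(ltW e0)//.
by rewrite /pathB /block ifF ?subr0 ?(ltW et)//; lia.
Qed.

Variable p : \bar R.
Hypothesis p0 : (0 < p)%E.
Local Notation md := (modulus N p).

Lemma modulus_block_lty a b x : (md (block a b x) < +oo)%E.
Proof. by rewrite modulus_lty// lpnorm_block_fin. Qed.

Lemma modulus_cut_le eps x : (md (cutoff eps x) <= md x)%E.
Proof. by apply: le_modulus => // t; rewrite cutv_le. Qed.

Lemma modulusB_lty x y : (md x < +oo)%E -> (md y < +oo)%E -> (md (pathB x y) < +oo)%E.
Proof.
move=> xoo yoo; have -> : pathB x y = padd x (scale (-1) y).
  by apply/funext => t; rewrite /padd /scale scaleN1r.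
apply: le_lt_trans (modulusD _ _ _ p0) _.
by rewrite modulusZ// normrN1 powR1 mul1e lte_add_pinfty.
Qed.

(** For finite p this is the tail of a convergent series, for p = oo it is the decay of the
    entries. *)
Lemma modulus_tail x : (md x < +oo)%E -> vanishing x -> forall e : R, 0 < e ->
  exists K : nat, forall k : nat, (K <= k)%N ->
    (md (pathB x (block (- k%:Z) k%:Z x)) < e%:E)%E.
Proof.
rewrite modulus_lty// => xoo xv e e0; have q0 := mexp_gt0 p0.
have e'0 : 0 < e `^ (mexp p)^-1 by rewrite powR_gt0.
suff [K HK] : exists K : nat, forall k : nat, (K <= k)%N ->
    (lpnorm N p (pathB x (block (- k%:Z) k%:Z x)) < (e `^ (mexp p)^-1)%:E)%E.
  exists K => k /HK H; rewrite modulusE//.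
  have -> : e%:E = ((e `^ (mexp p)^-1)%:E `^ mexp p)%E.
    by rewrite poweR_EFin -powRrM mulVf ?gt_eqF// powRr1// ltW.
  rewrite poweR_EFin -(@fineK _ (lpnorm N p _)) ?ge0_fin_numE ?lpnorm_ge0 ?(lt_trans H) ?ltry//.
  rewrite poweR_EFin lte_fin gt0_ltr_powR ?nnegrE ?fine_ge0 ?lpnorm_ge0 ?(ltW e'0)//.
  by rewrite -lte_fin fineK// ge0_fin_numE ?lpnorm_ge0 ?(lt_trans H) ?ltry.
move: (e `^ (mexp p)^-1) e'0 => {e0}e e0 {q0}.
case: p p0 xoo => [r||]//=; rewrite ?lte_fin => r0 xoo.
  have {}xoo : (psum N r x < +oo)%E.
    by apply: lty_poweRy xoo; rewrite invr_eq0 gt_eqF.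
  have er : 0 < e `^ r by rewrite powR_gt0.
  have [K HK] := psum_tail r0 xoo er; exists K => k /HK H.
  have -> : e%:E = ((e `^ r)%:E `^ r^-1)%E.
    by rewrite poweR_EFin -powRrM mulfV ?gt_eqF// powRr1// ltW.
  rewrite -/(psum N r _) -(@fineK _ (psum N r _)) ?ge0_fin_numE ?psum_ge0 ?(lt_trans H) ?ltry//.
  rewrite !poweR_EFin lte_fin gt0_ltr_powR ?invr_gt0 ?nnegrE ?fine_ge0 ?psum_ge0 ?(ltW er)//.
  by rewrite -lte_fin fineK// ge0_fin_numE ?psum_ge0 ?(lt_trans H) ?ltry.
have [K HK] := xv _ (divr_gt0 e0 (ltr0Sn R 1)); exists K => k Kk.
apply: (@le_lt_trans _ _ (e / 2)%:E); last by rewrite lte_fin; lra.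
apply: ub_ereal_sup => _ [t _ <-]; rewrite lee_fin /pathB /block.
case: ifPn => tk; first by rewrite subrr vnorm0; lra.
by rewrite subr0 HK//; lia.
Qed.

(** Outside a large block the modulus is small anyway; inside it, each of the finitely many entries
    moves by at most 2 eps. *)
Lemma modulus_cutB x : (md x < +oo)%E -> vanishing x -> forall e : R, 0 < e ->
  exists2 r : R, 0 < r & forall eps, 0 < eps < r -> (md (pathB x (cutoff eps x)) < e%:E)%E.
Proof.
move=> xoo xv e e0; have q0 := mexp_gt0 p0.
have e20 : 0 < e / 2 by rewrite divr_gt0.
have [K HK] := modulus_tail xoo xv e20; have {}HK := HK K (leqnn _).
pose n := (K.*2.+1)%N; pose c : R := e / 2 / n%:R.
have c0 : 0 < c by rewrite divr_gt0// ltr0n.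
(* Below this threshold an altered entry contributes at most (2 eps)^q <= c, and the n entries of
   the block share e/2 equally. *)
exists (c `^ (mexp p)^-1 / 2) => [|eps /andP[eps0 epsr]]; first by rewrite divr_gt0 ?powR_gt0.
set z := pathB x (cutoff eps x).
have -> : z = padd (pathB z (block (- K%:Z) K%:Z z)) (block (- K%:Z) K%:Z z).
  by apply/funext => t; rewrite /padd /pathB subrK.
apply: le_lt_trans (modulusD _ _ _ p0) _; rewrite [X in (_ < X%:E)%E](splitr e) EFinD.
apply: lte_leD; first by rewrite ge0_fin_numE ?modulus_ge0 ?modulus_block_lty.
  apply: le_lt_trans HK; apply: le_modulus => // t.
  rewrite /pathB /block; case: ifP => _; first by rewrite !subrr.
  by rewrite !subr0 (le_trans (cutvB _ _))//; case: ifP; rewrite ?vnorm_ge0.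
apply: le_trans (@modulus_le_sum _ _ _ _ _ (- K%:Z) n p0 _) _.
  by move=> t tn; rewrite /block ifF//; apply: contraNF tn; rewrite /n; lia.
rewrite lee_fin; apply: (@le_trans _ _ (\sum_(i < n) c)); last first.
  by rewrite sumr_const card_ord -[c *+ _]mulr_natr /c divfK// pnatr_eq0.
apply: ler_sum => i _.
have -> : c = (c `^ (mexp p)^-1) `^ mexp p.
  by rewrite -powRrM mulVf ?gt_eqF// powRr1// ltW.
rewrite ge0_ler_powR ?nnegrE ?vnorm_ge0 ?powR_ge0 ?(ltW q0)//.
rewrite /block; case: ifP => _; last by rewrite vnorm0 powR_ge0.
rewrite (le_trans (cutvB _ _))//; case: ifP => [h|_]; last exact: powR_ge0.
by rewrite (le_trans h)// mulrC -ler_pdivlMr// ltW.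
Qed.

(** The test functionals: bounded, shift-invariant and hence defined on the quotient, and Lipschitz
    for d_p. A Lipschitz bound, rather than mere continuity, makes the error of the cut-off uniform
    over paths. The constant L may have any sign, hence the |L| in later bounds. *)
Definition good_functional (L M : R) (Psi : pathZ R d -> R) :=
  [/\ forall x, 0 <= Psi x <= M, forall k x, Psi (bshift k x) = Psi x &
      forall x y, (md x < +oo)%E -> (md y < +oo)%E ->
        `|Psi x - Psi y| <= L * fine (md (pathB x y))].

(** All the paths live on one bounded interval, so closeness of each entry adds up to closeness in
    d_p. *)
Lemma finitely_supported_close (m : nat) (z : 'M[R]_(m, d) -> pathZ R d) (a : int) (n : nat) :
  (forall A t, ~~ (a <= t < a + n%:Z) -> z A t = 0) ->
  (forall t A e, 0 < e -> exists2 r, 0 < r &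
     forall B, `|A - B| < r -> N (z A t - z B t) < e) ->
  forall A e, 0 < e -> exists2 r, 0 < r & forall B, `|A - B| < r ->
    (md (pathB (z A) (z B)) < e%:E)%E.
Proof.
move=> z0 zc A e e0; have q0 := mexp_gt0 p0.
pose c := e / n.+1%:R.
have c0 : 0 < c by rewrite divr_gt0.
have cq0 : 0 < c `^ (mexp p)^-1 by rewrite powR_gt0.
have [r r0 Hr] : exists2 r, 0 < r & forall (i : 'I_n) B, `|A - B| < r ->
    N (z A (a + i%:Z) - z B (a + i%:Z)) < c `^ (mexp p)^-1.
  pose f (i : 'I_n) := projT1 (cid2 (zc (a + i%:Z) A _ cq0)).
  exists (\big[Num.min/1]_(i < n) f i) => [|i B AB].
    by apply/bigmin_gtP; split=> // i _; rewrite /f; case: cid2.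
  have : `|A - B| < f i by apply: lt_le_trans AB _; exact: bigmin_le_cond.
  by rewrite /f; case: cid2 => /= r0 _; apply.
exists r => // B AB.
have AB0 t : ~~ (a <= t < a + n%:Z) -> pathB (z A) (z B) t = 0.
  by move=> ta; rewrite /pathB !z0// subrr.
apply: (le_lt_trans (@modulus_le_sum _ _ N _ _ a n p0 AB0)); rewrite lte_fin.
apply: (@le_lt_trans _ _ (\sum_(i < n) c)); last first.
  rewrite sumr_const card_ord -[c *+ _]mulr_natl /c mulrCA gtr_pMr//.
  by rewrite ltr_pdivrMr// mul1r ltr_nat.
apply: ler_sum => i _; have -> : c = (c `^ (mexp p)^-1) `^ mexp p.
  by rewrite -powRrM mulVf ?gt_eqF// powRr1// ltW.
by rewrite ge0_ler_powR ?nnegrE ?vnorm_ge0 ?powR_ge0 ?(ltW q0)// ltW// Hr.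
Qed.

Lemma finitely_supported_continuous (m : nat) (L M : R) (Psi : pathZ R d -> R)
    (z : 'M[R]_(m, d) -> pathZ R d) (a : int) (n : nat) :
  good_functional L M Psi ->
  (forall A t, ~~ (a <= t < a + n%:Z) -> z A t = 0) ->
  (forall t A e, 0 < e -> exists2 r, 0 < r &
     forall B, `|A - B| < r -> N (z A t - z B t) < e) ->
  continuous (Psi \o z).
Proof.
move=> [_ _ PsiL] z0 zc; apply: matrix_continuousP => A e e0 /=.
have zoo B : (md (z B) < +oo)%E.
  by apply: (le_lt_trans (@modulus_le_sum _ _ N _ _ a n p0 (z0 B))); rewrite ltry.
have c0 : 0 < e / (`|L| + 1) by rewrite divr_gt0// ltr_wpDl.
have [r r0 Hr] := finitely_supported_close z0 zc A c0.
exists r => // B /Hr AB; apply: le_lt_trans (PsiL _ _ (zoo A) (zoo B)) _.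
have fz : fine (md (pathB (z A) (z B))) < e / (`|L| + 1).
  by rewrite -lte_fin fineK// ge0_fin_numE ?modulus_ge0// (lt_trans AB) ?ltry.
apply: (@le_lt_trans _ _ (`|L| * (e / (`|L| + 1)))).
  rewrite (le_trans (ler_wpM2r _ (ler_norm L)))// ?fine_ge0 ?modulus_ge0//.
  by rewrite ler_wpM2l// ltW.
by rewrite mulrCA gtr_pMr// ltr_pdivrMr ?mul1r ?ltrDl// ltr_wpDl.
Qed.

End cut_theory.

(** * Windows of a path as matrices *)

Section windows.
Context (R : realType) (d : nat) (N : vnorm R d).
Implicit Types (x : pathZ R d).

(** A right inverse of [window], extended by zeros. The row index is found through an absolute
    value, which forgets the sign of t - a; the test a <= t restores it. *)
Definition unwin (a : int) (n : nat) (A : 'M[R]_(n, d)) : pathZ R d := fun t =>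
  if insub `|(t - a)%R|%N is Some i then if a <= t then row i A else 0 else 0.

Lemma unwinE a n A (i : 'I_n) : unwin a A (a + i%:Z) = row i A.
Proof.
rewrite /unwin (_ : `|(a + i%:Z - a)%R|%N = i); last by lia.
by rewrite valK lerDl.
Qed.

Lemma unwin0 (a : int) n (A : 'M[R]_(n, d)) (t : int) : ~~ (a <= t < a + n%:Z) -> unwin a A t = 0.
Proof.
move=> tn; rewrite /unwin; case: insubP => // i; case: ifP => // at_ ti _.
by move: tn; lia.
Qed.

Lemma unwin_window (a : int) n x (t : int) : a <= t < a + n%:Z -> unwin a (window a n x) t = x t.
Proof.
move=> tn; have tn' : (`|(t - a)%R| < n)%N by lia.
have -> : t = a + (Ordinal tn' : nat)%:Z by rewrite /=; lia.
by rewrite unwinE; apply/rowP => j; rewrite !mxE.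
Qed.

Lemma row_norm m n (A : 'M[R]_(m, n)) i : `|row i A| <= `|A|.
Proof.
rewrite [leLHS]/Num.norm/= mx_normrE; apply/bigmax_leP; split => [//|[i' j] _] /=.
by rewrite mxE [leRHS]/Num.norm/= mx_normrE; apply/bigmax_geP; right => /=; exists (i, j).
Qed.

Lemma unwin_continuous (a : int) n (t : int) (A : 'M[R]_(n, d)) e : 0 < e -> exists2 r, 0 < r &
  forall B : 'M[R]_(n, d), `|A - B| < r -> N (unwin a A t - unwin a B t) < e.
Proof.
move=> e0; have [tn|tn] := boolP (a <= t < a + n%:Z); last first.
  by exists 1 => // B _; rewrite !unwin0// subrr vnorm0.
have tn' : (`|(t - a)%R| < n)%N by lia.
have -> : t = a + (Ordinal tn' : nat)%:Z by rewrite /=; lia.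
have [C C0 NC] := vnorm_le_norm N.
exists (e / C) => [|B AB]; first by rewrite divr_gt0.
rewrite !unwinE -linearB/= (le_lt_trans (NC _))// mulrC -ltr_pdivlMr//.
exact: le_lt_trans (row_norm _ _) AB.
Qed.

Definition wfun (Psi : pathZ R d -> R) h (b c a : int) (n : nat) (A : 'M[R]_(n, d)) : R :=
  Psi (pathmap h (block b c (unwin a A))).

Lemma wfunE Psi h (b c a : int) n x : a <= b -> c < a + n%:Z ->
  wfun Psi h b c a (window a n x) = Psi (pathmap h (block b c x)).
Proof.
move=> ab ca; rewrite /wfun; congr (Psi (pathmap h _)); apply/funext => t.
by rewrite /block; case: ifP => // tbc; rewrite unwin_window//; lia.
Qed.

Variable p : \bar R.
Hypothesis p0 : (0 < p)%E.

Lemma wfun_continuous L M Psi h b c a n : good_functional N p L M Psi ->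
  ncontinuous N h -> h 0 = 0 -> continuous (@wfun Psi h b c a n).
Proof.
move=> gP hc h0.
apply: (finitely_supported_continuous p0 gP (a := a) (n := n) (z := fun A => pathmap h (block b c (unwin a A)))).
  by move=> A t tn; rewrite /pathmap /block; case: ifP; rewrite ?unwin0.
move=> t A e e0; rewrite /pathmap /block; case: ifP => _; last first.
  by exists 1 => // B _; rewrite subrr vnorm0.
have [r1 r10 Hr1] := hc (unwin a A t) _ e0.
have [r r0 Hr] := unwin_continuous a t A r10.
by exists r => // B /Hr/Hr1.
Qed.

End windows.

(** * Measurability on path space *)

Section borel_sets.
Context (R : realType).

Lemma continuous_borel (S : ptopologicalType) (f : S -> R) : continuous f ->
  measurable_fun [set: borel S] f.
Proof.
move=> /continuousP cf.
apply: (@measurability _ _ (borel S) _ setT (f : borel S -> R) _ (RGenOpens.measurableE R)).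
move=> _ [B [a [b ->]] <-]; rewrite setTI.
by apply: sub_sigma_algebra; apply: cf; exact: itv_open.
Qed.

Lemma open_measurable_borel (S : ptopologicalType) (U : set (borel S)) :
  open (U : set S) -> measurable U.
Proof. exact: sub_sigma_algebra. Qed.

Lemma measurable_to_borel d (T : measurableType d) (S : ptopologicalType)
    (f : T -> borel S) :
  (forall U : set S, open U -> measurable (f @^-1` U)) -> measurable_fun setT f.
Proof.
move=> H; apply: (@measurability _ _ _ _ setT f (@open S)) => //.
by move=> _ [B oB <-]; rewrite setTI; exact: H.
Qed.

Lemma continuous_measurable_borel (S S' : ptopologicalType) (f : S -> S') :
  continuous f -> measurable_fun setT (f : borel S -> borel S').
Proof.
move=> /continuousP cf; apply: measurable_to_borel => U oU.
by apply: open_measurable_borel; exact: cf.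
Qed.

Lemma measurable_ltr_set d (T : measurableType d) (f g : T -> R) :
  measurable_fun setT f -> measurable_fun setT g -> measurable [set t | f t < g t].
Proof.
move=> mf mg; have := measurable_fun_ltr mf mg measurableT (Y := [set true]) I.
by rewrite setTI.
Qed.

Lemma measurable_lte_set d (T : measurableType d) (f g : T -> \bar R) :
  measurable_fun setT f -> measurable_fun setT g -> measurable [set t | (f t < g t)%E].
Proof. by move=> mf mg; have := measurable_lte measurableT mf mg; rewrite setTI. Qed.

(** An open set of matrices is the union of the countably many rational boxes that it contains, and
    the preimage of a box is a finite intersection of conditions on entries. *)
Lemma measurable_to_matrix d (T : measurableType d) m n (f : T -> 'M[R]_(m, n)) :
  (forall i j, measurable_fun setT (fun t => f t i j)) ->
  measurable_fun setT (f : T -> borel 'M[R]_(m, n)).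
Proof.
move=> mf; apply: measurable_to_borel => U oU.
pose q (qk : 'M[rat]_(m, n) * nat) : 'M[R]_(m, n) := map_mx ratr qk.1.
pose rad (qk : 'M[rat]_(m, n) * nat) : R := qk.2.+1%:R^-1.
pose B qk : set 'M[R]_(m, n) :=
  [set A | forall ij : 'I_m * 'I_n, `|A ij.1 ij.2 - q qk ij.1 ij.2| < rad qk].
have mB qk : measurable (f @^-1` B qk).
  rewrite (_ : f @^-1` B qk = \bigcap_(ij in [set: 'I_m * 'I_n])
      [set t | `|f t ij.1 ij.2 - q qk ij.1 ij.2| < rad qk]); last first.
    by apply/seteqP; split => [t Et ij _|t Et ij]; exact: Et.
  apply: fin_bigcap_measurable => // ij _.
  apply: measurable_ltr_set => //; apply: measurableT_comp => //.
  exact: measurable_funB.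
pose D := [set qk | B qk `<=` U].
have -> : f @^-1` U = \bigcup_qk (if `[< D qk >] then f @^-1` B qk else set0).
  apply/seteqP; split => [t Ut|t [qk _]]; last first.
    by case: asboolP => // Dqk /Dqk.
  move: oU; rewrite openE => /(_ _ Ut) /nbhs_ballP[e e0 eU].
  (* A point of the box is within e/2 of the centre and the centre within e/2 of [f t], so the box
     stays inside the ball of radius e. *)
  have [k ke] : exists k : nat, k.+1%:R^-1 < e / 2.
    have e20 : 0 < e / 2 by rewrite divr_gt0.
    by have [k _ kP] := near_infty_natSinv_lt (PosNum e20); exists k; have /= := kP k (leqnn k).
  have H (ij : 'I_m * 'I_n) : exists s : rat, `|f t ij.1 ij.2 - ratr s| < k.+1%:R^-1 :> R.
    have : f t ij.1 ij.2 - k.+1%:R^-1 < f t ij.1 ij.2 + k.+1%:R^-1 :> R.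
      by rewrite ltrD2l gtrN.
    move=> /rat_in_itvoo[s]; rewrite in_itv/= => /andP[s1 s2]; exists s.
    by rewrite ltr_distlC s1 s2.
  pose s ij := projT1 (cid (H ij)).
  have sP ij : `|f t ij.1 ij.2 - ratr (s ij)| < k.+1%:R^-1 :> R by rewrite /s; case: cid.
  exists (\matrix_(i, j) s (i, j), k) => //.
  case: asboolP => [_ [i j]|]; first by rewrite /q !mxE; exact: sP.
  case=> A BA; apply: eU; split => // i j.
  rewrite -ball_normE/=; have := BA (i, j); have := sP (i, j); rewrite /q/= !mxE/rad/=.
  rewrite -[A i j - _]opprB normrN => h1 h2.
  rewrite (_ : _ - _ = (f t i j - ratr (s (i, j))) + (ratr (s (i, j)) - A i j)); last by ring.
  by rewrite (le_lt_trans (ler_normD _ _))// [e]splitr ltrD// (lt_trans _ ke).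
apply: countable_bigcupT_measurable => [|qk]; first exact: countableP.
by case: asboolP.
Qed.

Lemma measurable_matrix_entry d (T : measurableType d) m n (f : T -> 'M[R]_(m, n)) i j :
  measurable_fun setT (f : T -> borel 'M[R]_(m, n)) ->
  measurable_fun setT (fun t => f t i j).
Proof.
move=> mf; apply: (measurableT_comp (f := fun A : borel 'M[R]_(m, n) => A i j)) mf.
apply: continuous_borel; apply: matrix_continuousP => A e e0; exists e => // B.
by apply: le_lt_trans; rewrite [leRHS]/Num.norm/= mx_normrE; apply/bigmax_geP; right => /=; exists (i, j); rewrite ?mxE.
Qed.

Lemma open_approx_measure_unique (S : ptopologicalType)
    (mu1 mu2 : {measure set (borel S) -> \bar R}) :
  (mu1 setT < +oo)%E -> (forall U : set S, open U -> mu1 U = mu2 U) ->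
  forall A, measurable A -> mu1 A = mu2 A.
Proof.
move=> fin1 H A mA.
apply: (@measure_unique _ R (borel S) (@open S) (fun=> setT)) => //.
- by move=> U V; exact: openI.
- by move=> _; exact: openT.
- by rewrite bigcup_const.
Qed.

End borel_sets.

Section path_measurability.
Context (R : realType) (d : nat).

Lemma measurable_to_path d' (T : measurableType d') (f : T -> pathZ R d) :
  (forall t, measurable_fun setT (fun w => f w t : borel 'rV[R]_d)) ->
  measurable_fun setT (f : T -> path_space R d).
Proof.
move=> mf; apply: (@measurability _ _ T (path_space R d) setT f [set E : set (int -> 'rV[R]_d) |
    exists (t : int) (B : set (borel 'rV[R]_d)), measurable B /\ E = [set x | B (x t)]]) => //.
move=> _ [_ [t [B [mB ->]]] <-].
by rewrite (_ : f @^-1` _ = (fun w => f w t) @^-1` B)//; apply: mf.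
Qed.

Lemma measurable_coord (t : int) :
  measurable_fun setT (fun x : path_space R d => x t : borel 'rV[R]_d).
Proof.
move=> _ B mB; rewrite setTI; apply: sub_sigma_algebra.
by exists t, B.
Qed.

Lemma measurable_coord_entry (t : int) j :
  measurable_fun setT (fun x : path_space R d => x t ord0 j).
Proof. exact: (measurable_matrix_entry ord0 j (measurable_coord t)). Qed.

Lemma measurable_path d' (T : measurableType d') (f : T -> pathZ R d) :
  (forall t j, measurable_fun setT (fun w => f w t ord0 j)) ->
  measurable_fun setT (f : T -> path_space R d).
Proof.
move=> mf; apply: measurable_to_path => t; apply: measurable_to_matrix => i j.
by rewrite ord1; exact: mf.
Qed.

Lemma measurable_window a n :
  measurable_fun setT (window a n : path_space R d -> borel 'M[R]_(n, d)).
Proof.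
apply: measurable_to_matrix => i j.
rewrite (_ : (fun t => _) = (fun x : path_space R d => x (a + i%:Z) ord0 j)).
  exact: measurable_coord_entry.
by apply/funext => x; rewrite mxE.
Qed.

Lemma measurable_bshift k :
  measurable_fun setT (bshift k : path_space R d -> path_space R d).
Proof. by apply: measurable_path => t j; exact: measurable_coord_entry. Qed.

Lemma measurable_scale (a : R) :
  measurable_fun setT (scale a : path_space R d -> path_space R d).
Proof.
apply: measurable_path => t j.
rewrite (_ : (fun w => _) = (fun x : path_space R d => a * x t ord0 j)).
  by apply: measurable_funM => //; exact: measurable_coord_entry.
by apply/funext => x; rewrite mxE.
Qed.

Lemma measurable_block a b :
  measurable_fun setT (block a b : path_space R d -> path_space R d).
Proof.
apply: measurable_path => t j; rewrite /block; case: (a <= t <= b).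
  exact: measurable_coord_entry.
exact: measurable_cst.
Qed.

Lemma measurable_vnorm (N : vnorm R d) (t : int) :
  measurable_fun setT (fun x : path_space R d => N (x t)).
Proof.
apply: (measurableT_comp (f := fun v : borel 'rV[R]_d => N v)).
  by apply: continuous_borel; exact: vnorm_continuous.
exact: measurable_coord.
Qed.

End path_measurability.

(** * Lipschitz envelopes *)

Section inf_convolution.
Context (R : realType) (S : Type) (dist : S -> S -> R) (f : S -> R) (M : R).
Hypothesis dist_ge0 : forall x y, 0 <= dist x y.
Hypothesis distxx : forall x, dist x x = 0.
Hypothesis dist_tri : forall x y z, dist x z <= dist x y + dist y z.
Hypothesis fM : forall x, 0 <= f x <= M.

(** The largest minorant of [f] that is m-Lipschitz for [dist]. *)
Definition infconv (m : R) x : R := inf [set f y + m * dist x y | y in [set: S]].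

Let has_inf_infconv m x : 0 <= m -> has_inf [set f y + m * dist x y | y in [set: S]].
Proof.
move=> m0; split; first by exists (f x + m * dist x x), x.
exists 0 => _ [y _ <-]; rewrite addr_ge0 ?mulr_ge0//.
by have /andP[] := fM y.
Qed.

Lemma infconv_le m x y : 0 <= m -> infconv m x <= f y + m * dist x y.
Proof. by move=> m0; apply: ge_inf; [have [] := has_inf_infconv x m0|exists y]. Qed.

Lemma infconv_ge m x c : (forall y, c <= f y + m * dist x y) -> c <= infconv m x.
Proof.
by move=> H; apply: lb_le_inf => [|_ [y _ <-]//]; exists (f x + m * dist x x), x.
Qed.

Lemma infconv_le_fun m x : 0 <= m -> infconv m x <= f x.
Proof. by move=> m0; have := infconv_le x x m0; rewrite distxx mulr0 addr0. Qed.

Lemma infconv_bound m x : 0 <= m -> 0 <= infconv m x <= M.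
Proof.
move=> m0; apply/andP; split.
  by apply: infconv_ge => y; rewrite addr_ge0 ?mulr_ge0//; have /andP[] := fM y.
by apply: le_trans (infconv_le_fun x m0) _; have /andP[] := fM x.
Qed.

Lemma infconv_lipschitz m x z : 0 <= m -> infconv m x <= infconv m z + m * dist x z.
Proof.
move=> m0; rewrite -lerBlDr; apply: infconv_ge => y; rewrite lerBlDr.
apply: le_trans (infconv_le x y m0) _.
by rewrite -addrA lerD2l -mulrDr ler_wpM2l// addrC.
Qed.

Lemma le_infconv m1 m2 x : 0 <= m1 -> m1 <= m2 -> infconv m1 x <= infconv m2 x.
Proof.
move=> m10 m12; apply: infconv_ge => y; apply: le_trans (infconv_le x y m10) _.
by rewrite lerD2l ler_wpM2r.
Qed.

(** By lower semicontinuity, points within r of x do not bring the infimum below f x - e; a point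
    further away pays at least n r, which exceeds f x for large n. *)
Lemma infconv_cvg x :
  (forall e, 0 < e -> exists2 r, 0 < r & forall y, dist x y < r -> f x - e < f y) ->
  infconv n%:R x @[n --> \oo] --> f x.
Proof.
move=> lsc; apply/cvgrPdist_le => e e0; have [r r0 Hr] := lsc _ e0.
near=> n; have n0 : 0 <= n%:R :> R by [].
rewrite ger0_norm ?subr_ge0 ?infconv_le_fun// lerBlDr -lerBlDl.
apply: infconv_ge => y; have [xy|xy] := ltP (dist x y) r.
  by rewrite (le_trans (ltW (Hr _ xy)))// lerDl mulr_ge0.
have [f0 _] := andP (fM y).
apply: (@le_trans _ _ (n%:R * r)); last first.
  by rewrite (le_trans (ler_wpM2l n0 xy))// lerDr.
rewrite -ler_pdivrMr//; near: n; exact: nbhs_infty_ger.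
Unshelve. all: by end_near. Qed.

End inf_convolution.

(** What makes integrals of continuous functions determine measures of open sets, and pointwise
    limits of Borel maps Borel. It is a property and not a metric structure, since [ell] and
    [ell_tilde] carry only their families of open sets. *)
Definition open_approx (R : realType) (S : ptopologicalType) :=
  forall U : set S, open U -> exists f : nat -> S -> R,
    [/\ forall n, continuous (f n), forall n x, 0 <= f n x <= 1,
        forall n m x, (n <= m)%N -> f n x <= f m x &
        forall x, f n x @[n --> \oo] --> (\1_U x : R)].

Lemma open_approx_matrix (R : realType) m n : open_approx R 'M[R]_(m, n).
Proof.
move=> U oU; pose dist (A B : 'M[R]_(m, n)) := `|A - B|.
have d0 A B : 0 <= dist A B by exact: normr_ge0.
have dxx A : dist A A = 0 by rewrite /dist subrr normr0.
have dtri A B C : dist A C <= dist A B + dist B C by exact: ler_distD.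
have U01 A : 0 <= (\1_U A : R) <= 1 by rewrite indicE; case: (_ \in _); rewrite ?lexx ?ler01.
exists (fun k => infconv dist \1_U k%:R); split.
- move=> k; apply: matrix_continuousP => A e e0; exists (e / k.+1%:R) => [|B AB].
    by rewrite divr_gt0.
  apply: (@le_lt_trans _ _ (k%:R * dist A B)).
    have k0 : 0 <= k%:R :> R by [].
    have h1 := infconv_lipschitz d0 dtri U01 A B k0.
    have h2 := infconv_lipschitz d0 dtri U01 B A k0.
    by rewrite ler_distl h1 andbT lerBlDr (_ : dist A B = dist B A)// /dist distrC.
  rewrite ltr_pdivlMr// in AB; apply: le_lt_trans AB.
  by rewrite mulrC ler_wpM2l// ler_nat.
- by move=> k A; exact: infconv_bound.
- by move=> k l A kl; apply: le_infconv => //; rewrite ler_nat.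
- move=> A; apply: infconv_cvg => // e e0; rewrite !indicE.
  have [|AU] := boolP (A \in U); last first.
    exists 1 => // B _; have /andP[B0 _] := U01 B; rewrite /=; lra.
  rewrite inE => UA; move: oU; rewrite openE => /(_ _ UA) /nbhs_ballP[r r0 rU].
  exists r => // B; rewrite /dist => AB; rewrite indicE mem_set.
    by rewrite ltrBlDr ltrDl.
  by apply: rU; rewrite mx_norm_ball.
Qed.

(** * Image measures and restrictions *)

Section measure_tools.
Local Open Scope ereal_scope.
Context d1 d2 (T1 : measurableType d1) (T2 : measurableType d2) (R : realType).

Definition mpush (mu : {measure set T1 -> \bar R}) (f : T1 -> T2)
    (mf : measurable_fun setT f) : {measure set T2 -> \bar R} :=
  measure_function_pushforward__canonical__measure_function_Measure mu mf.

Lemma mpushE mu f mf A : @mpush mu f mf A = mu (f @^-1` A).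
Proof. by []. Qed.

Lemma ge0_integral_mpush mu f mf (g : T2 -> \bar R) : measurable_fun setT g ->
  (forall y, 0 <= g y) -> \int[@mpush mu f mf]_y g y = \int[mu]_x g (f x).
Proof. by move=> mg g0; rewrite [LHS]ge0_integral_pushforward. Qed.

End measure_tools.

Lemma measurable_preimage d1 d2 (T1 : measurableType d1) (T2 : measurableType d2)
    (f : T1 -> T2) B : measurable_fun setT f -> measurable B -> measurable (f @^-1` B).
Proof. by move=> mf mB; rewrite -[X in measurable X]setTI; exact: mf. Qed.

Lemma ge0_integral_mrestr d1 (T1 : measurableType d1) (R : realType)
    (mu : {measure set T1 -> \bar R}) D (mD : measurable D)
    (g : T1 -> \bar R) : measurable_fun setT g -> (forall y, 0 <= g y)%E ->
  (\int[mrestr mu mD]_x g x = \int[mu]_(x in D) g x)%E.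
Proof.
move=> mg g0; transitivity (\int[mrestr mu mD]_(x in D) g x)%E.
  rewrite (@ge0_negligible_integral _ _ _ _ setT (~` D))//.
  - by rewrite setTD setCK.
  - exact: measurableC.
  - by rewrite /= /mrestr setICl measure0.
apply: eq_measure_integral => A mA AD.
by rewrite /= /mrestr setIidl.
Qed.

(** * The Pareto measure *)

Section pareto_measure.
Context (R : realType).
Local Notation leb := (@lebesgue_measure R).

Lemma rayI (x y : R) :
  `]x, +oo[%classic `&` `]y, +oo[%classic = `](Num.max x y), +oo[%classic.
Proof.
by apply/seteqP; split => z /=; rewrite !in_itv/= !andbT gt_max => /andP.
Qed.

(** Both measures may be infinite near 0. They are therefore compared on ]1/(n+1), oo[, where they
    are finite and the rays are a generating family stable under intersection; the traces of A on
    these intervals increase to A. *)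
Lemma measure_eq_pos (mu1 mu2 : {measure set R -> \bar R}) :
  (forall y : R, 0 < y -> mu1 `]y, +oo[%classic = mu2 `]y, +oo[%classic) ->
  (forall y : R, 0 < y -> (mu1 `]y, +oo[%classic < +oo)%E) ->
  forall A : set R, measurable A -> A `<=` (`]0, +oo[%classic : set R) -> mu1 A = mu2 A.
Proof.
move=> H12 fin1 A mA A0.
pose D (n : nat) : set R := `]n.+1%:R^-1, +oo[%classic.
have mD n : measurable (D n) by exact: measurable_itv.
have n0 n : 0 < n.+1%:R^-1 :> R by rewrite invr_gt0.
have E n : mu1 (A `&` D n) = mu2 (A `&` D n).
  have /= := @measure_unique _ R R (RGenOInfty.G (R:=R)) (fun k => `]- k%:R, +oo[%classic) (RGenOInfty.measurableE R) _ _ _ (mrestr mu1 (mD n)) (mrestr mu2 (mD n)) _ _ A mA.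
  apply.
  - by move=> _ _ [x ->] [y ->]; exists (Num.max x y); exact: rayI.
  - by move=> k; exists (- k%:R).
  - rewrite -subTset => x _.
    near \oo => k; exists k => //=; rewrite in_itv/= andbT ltrNl.
    by near: k; exact: nbhs_infty_gtr.
  - move=> _ [x ->]; rewrite /mrestr /D.
    have -> : `]x, +oo[%classic `&` `]n.+1%:R^-1, +oo[%classic = `](Num.max x n.+1%:R^-1), +oo[%classic.
      exact: rayI.
    by rewrite H12// lt_max n0 orbT.
  - move=> k; apply: le_lt_trans (fin1 _ (n0 n)).
    by apply: le_measure; rewrite ?inE; [apply: measurableI|exact: mD|exact: subIsetr].
have UA : A = \bigcup_n (A `&` D n).
  apply/seteqP; split => [x Ax|x [n _ []//]].
  have x0 : 0 < x by have := A0 _ Ax; rewrite /= in_itv/= andbT.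
  have [k _ kP] := near_infty_natSinv_lt (PosNum x0); exists k => //; split => //.
  by have /= := kP k (leqnn k); rewrite /D/= in_itv/= andbT.
have ndA : nondecreasing_seq (fun n => A `&` D n).
  move=> n m nm; apply/subsetPset; apply: setIS => x; rewrite /D/= !in_itv/= !andbT.
  by apply: le_lt_trans; rewrite lef_pV2 ?posrE// ler_nat ltnS.
have mAD n : measurable (A `&` D n) by apply: measurableI.
have c1 := nondecreasing_cvg_mu (mu := mu1) mAD (bigcupT_measurable _ mAD) ndA.
have c2 := nondecreasing_cvg_mu (mu := mu2) mAD (bigcupT_measurable _ mAD) ndA.
rewrite -UA in c1 c2; apply: cvg_unique c1 _ => //.
by rewrite (_ : mu1 \o _ = mu2 \o (fun n => A `&` D n))//; apply/funext => n /=.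
Unshelve. all: by end_near. Qed.

Variable alpha : R.
Hypothesis alpha0 : 0 < alpha.

(* Under [pradius], Lebesgue measure on the whole line has image alpha y^(-alpha-1) dy on ]0, +oo[. *)
Definition pradius (u : R) : R := expR (- ln (2 * `|u|) / alpha).

Lemma pradius_gt0 u : 0 < pradius u. Proof. exact: expR_gt0. Qed.

Lemma measurable_pradius : measurable_fun setT pradius.
Proof.
apply: (measurableT_comp (f := expR)) => //.
apply: measurable_funM => //; apply: measurableT_comp => //.
apply: (measurableT_comp (f := @ln R)); first exact: measurable_ln.
by apply: measurable_funM => //; exact: measurable_normr.
Qed.

(** The radius exceeds y for |u| < y^(-alpha)/2, an interval whose length is the wanted mass. *)
Lemma pradius_tail y : 0 < y -> leb [set u | y < pradius u] = (y `^ (- alpha))%:E.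
Proof.
move=> y0; set a := y `^ (- alpha) / 2.
have a0 : 0 < a by rewrite divr_gt0// powR_gt0.
have E u : u != 0 -> (y < pradius u) = (u \in `]- a, a[).
  move=> u0; rewrite in_itv/= -ltr_norml /pradius.
  have u20 : 0 < 2 * `|u| by rewrite mulr_gt0// normr_gt0.
  rewrite -[X in X < _](lnK y0) ltr_expR ltr_pdivlMr// ltrNr -mulrN [ln y * _]mulrC -ln_powR.
  by rewrite ltr_ln ?posrE ?powR_gt0// mulrC -ltr_pdivlMr.
have m1 : measurable [set u | y < pradius u] by apply: measurable_ltr_set => //; exact: measurable_pradius.
have ml : leb (`]- a, a[%classic : set R) = (y `^ (- alpha))%:E.
  rewrite lebesgue_measure_itv/= lte_fin gtrN// -EFinD; congr EFin.
  by rewrite /a; lra.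
(* At u = 0 the logarithm takes a default value, so the equivalence is claimed for u != 0 only;
   removing a point does not change the measure. *)
rewrite -ml; have D1 (A : set R) : measurable A -> leb A = leb (A `\ 0).
  move=> mA; apply/eqP; rewrite eq_le; apply/andP; split; last first.
    by apply: le_measure; rewrite ?inE//; exact: measurableD.
  apply: (@le_trans _ _ (leb (A `\ 0 `|` [set 0]))).
    apply: le_measure; rewrite ?inE//; first by apply: measurableU => //; exact: measurableD.
    by move=> x Ax; have [->|/eqP x0] := eqVneq x 0; [right|left].
  apply: le_trans (measureU2 _ _ _) _ => //; first exact: measurableD.
  rewrite [X in (_ + X)%E](_ : _ = 0%E) ?adde0//; exact: lebesgue_measure_set1.
rewrite D1// [RHS]D1//; congr (leb _); apply/seteqP; split => u [/= h u0]; split=> //.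
- by rewrite -E//; exact/eqP.
- by rewrite E//; exact/eqP.
Qed.

Lemma pushforward_pradius_pos (b : R) (A : set R) : 0 < b ->
  pushforward leb (fun u => pradius u / b) A = pushforward leb (fun u => pradius u / b) (A `&` (`]0, +oo[%classic : set R)).
Proof.
move=> b0; rewrite /pushforward; congr (leb _); apply/seteqP; split => u //=; last by case.
by move=> Au; split=> //; rewrite in_itv/= andbT divr_gt0// pradius_gt0.
Qed.

(** Homogeneity of alpha y^(-alpha-1) dy: both sides give the ray beyond y the mass (b y)^(-alpha),
    and rays determine a measure on ]0, oo[. *)
Lemma pradius_scale (b : R) (g : R -> \bar R) : 0 < b -> measurable_fun setT g ->
  (forall y, 0 <= g y)%E ->
  (\int[leb]_u g (pradius u / b)%R = (b `^ (- alpha))%:E * \int[leb]_u g (pradius u))%E.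
Proof.
move=> b0 mg g0; have mrad := measurable_pradius.
have mr : measurable_fun setT (fun u => pradius u / b) by exact: measurable_funM.
have ba0 : 0 <= b `^ (- alpha) by exact: powR_ge0.
pose m1 : {measure set R -> \bar R} := mpush leb mr.
pose m2 : {measure set R -> \bar R} := [the measure _ _ of mscale (NngNum ba0) (mpush leb mrad)].
have E : forall A : set R, measurable A -> m1 A = m2 A.
  move=> A mA; rewrite /m1/= pushforward_pradius_pos//.
  have -> : m2 A = m2 (A `&` (`]0, +oo[%classic : set R)).
    have := @pushforward_pradius_pos 1 A ltr01; rewrite /m2/= /mscale/=.
    by under [X in pushforward leb X]eq_fun do rewrite divr1; move=> ->.
  apply: (@measure_eq_pos m1 m2).
  - move=> y y0; rewrite /m1 /m2/= /mscale/= /pushforward/=.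
    transitivity (leb [set u | y * b < pradius u]).
      by congr (leb _); apply/seteqP; split => u /=; rewrite in_itv/= andbT ltr_pdivlMr.
    rewrite pradius_tail ?mulr_gt0//.
    transitivity ((b `^ (- alpha))%:E * leb [set u | (y < pradius u)%R])%E.
      by rewrite pradius_tail// -EFinM -powRM ?(ltW b0) ?(ltW y0)// mulrC.
    by congr (_ * leb _)%E; apply/seteqP; split => u /=; rewrite in_itv/= andbT.
  - move=> y y0; rewrite /m1/= /pushforward/=.
    rewrite (_ : _ @^-1` _ = [set u | y * b < pradius u]).
      by rewrite pradius_tail ?mulr_gt0// ltry.
    by apply/seteqP; split => u /=; rewrite in_itv/= andbT ltr_pdivlMr.
  - by apply: measurableI => //; exact: measurable_itv.
  - exact: subIsetr.
transitivity (\int[m1]_y g y)%E; first by rewrite ge0_integral_mpush.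
transitivity (\int[m2]_y g y)%E; first by apply: eq_measure_integral => A mA _; exact: E.
by rewrite /m2 ge0_integral_mscale//= ge0_integral_mpush.
Qed.

Section pareto_variable.
Context (dO : measure_display) (O : measurableType dO) (P : probability O R) (Y : O -> R).
Hypothesis YP : pareto P alpha Y.

(** The tail formula is assumed for y > 1 only; the value at 1 is the limit along 1 + 1/(n+1), by
    continuity of the measure. *)
Lemma pareto_gt1 : P [set w | 1 < Y w] = 1%E.
Proof.
have [mY PY] := YP.
pose F (n : nat) := [set w | 1 + n.+1%:R^-1 < Y w].
have mF n : measurable (F n) by apply: measurable_ltr_set.
have ndF : nondecreasing_seq F.
  move=> n m nm; apply/subsetPset => w; rewrite /F/=; apply: le_lt_trans.
  by rewrite lerD2l lef_pV2 ?posrE// ler_nat ltnS.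
have c1 := nondecreasing_cvg_mu (mu := P) mF (bigcupT_measurable _ mF) ndF.
have -> : [set w | 1 < Y w] = \bigcup_n F n.
  apply/seteqP; split => [w /= Yw|w [n _]]; last first.
    by rewrite /F/=; apply: lt_trans; rewrite ltrDl invr_gt0.
  have Y0 : 0 < Y w - 1 by rewrite subr_gt0.
  have [k _ kP] := near_infty_natSinv_lt (PosNum Y0); exists k => //.
  by have /= := kP k (leqnn k); rewrite /F/= ltrBrDl.
apply: cvg_unique c1 _ => //.
rewrite (_ : P \o F = EFin \o (fun n : nat => (1 + n.+1%:R^-1) `^ (- alpha))); last first.
  by apply/funext => n /=; rewrite PY// ltrDl invr_gt0.
apply: cvg_EFin; first exact: nearW.
rewrite [X in _ --> X](_ : _ = expR (- alpha * ln 1)); last by rewrite ln1 mulr0 expR0.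
rewrite (_ : fine \o _ = (fun n : nat => expR (- alpha * ln (1 + n.+1%:R^-1)))); last first.
  by apply/funext => n /=; rewrite /powR gt_eqF// ltr_pwDl// invr_ge0.
apply: (@cvg_comp _ _ _ (fun n : nat => - alpha * ln (1 + n.+1%:R^-1)) expR); last exact: continuous_expR.
apply: cvgMr.
apply: (@cvg_comp _ _ _ (fun n : nat => 1 + n.+1%:R^-1) (@ln R)); last first.
  by apply: continuous_ln.
have h : (1 + n.+1%:R^-1 : R) @[n --> \oo] --> (1 + 0 : R).
  by apply: cvgD; [exact: cvg_cst|exact: cvg_harmonic].
by rewrite addr0 in h; exact: h.
Qed.

(** The image of Lebesgue measure under the radius, restricted to ]1, oo[, has total mass 1 and
    Pareto tails, so it is the law of Y. *)
Lemma pareto_pradius (g : R -> \bar R) : measurable_fun setT g -> (forall y, 0 <= g y)%E ->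
  (\int[P]_w g (Y w) = \int[leb]_(u in [set u | (1 < pradius u)%R]) g (pradius u))%E.
Proof.
move=> mg g0; have [mY PY] := YP.
have mrad := measurable_pradius.
have mD : measurable [set u | 1 < pradius u] by apply: measurable_ltr_set.
pose D1 : set R := `]1, +oo[%classic.
have mD1 : measurable D1 by exact: measurable_itv.
pose m1 : {measure set R -> \bar R} := mpush P mY.
pose m2 : {measure set R -> \bar R} := [the measure _ _ of mrestr (mpush leb mrad) mD1].
have E : forall A : set R, measurable A -> m1 A = m2 A.
  (* Y <= 0 has probability 0, so both measures live on the positive half-line, where the rays
     decide. *)
  move=> A mA; have m1A : m1 A = m1 (A `&` (`]0, +oo[%classic : set R)).
    rewrite /m1/= /pushforward.
    have P1 := pareto_gt1.
    apply/eqP; rewrite eq_le; apply/andP; split; last first.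
      apply: le_measure; rewrite ?inE//; last by move=> w [].
        apply: (measurable_preimage mY).
        by apply: measurableI => //; exact: measurable_itv.
      exact: (measurable_preimage mY).
    have mC : measurable (~` [set w | 1 < Y w]).
      by apply: measurableC; apply: measurable_ltr_set.
    apply: (@le_trans _ _ (P (Y @^-1` (A `&` (`]0, +oo[%classic : set R)) `|` ~` [set w | 1 < Y w]))).
      apply: le_measure; rewrite ?inE.
      - exact: (measurable_preimage mY).
      - apply: measurableU => //; apply: (measurable_preimage mY).
        by apply: measurableI => //; exact: measurable_itv.
      - move=> w Aw; have [Yw|Yw] := ltP 1 (Y w); last by right => /=; rewrite ltNge Yw.
        by left; split => //=; rewrite in_itv/= andbT (lt_trans ltr01).
    apply: le_trans (measureU2 _ _ _) _ => //.
      apply: (measurable_preimage mY).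
      by apply: measurableI => //; exact: measurable_itv.
    rewrite [X in (_ + X)%E](_ : _ = 0%E) ?adde0//.
    have -> : 0%E = P (~` [set w | 1 < Y w]); last by [].
    by rewrite probability_setC ?P1 ?subee//; exact: measurable_ltr_set.
  have m2A : m2 A = m2 (A `&` (`]0, +oo[%classic : set R)).
    rewrite /m2/= /mrestr; congr (pushforward _ _ _); rewrite -setIA; congr (_ `&` _).
    by apply/seteqP; split => y; rewrite /D1/= !in_itv/= !andbT => y1; [split=> //; exact: (lt_trans ltr01)|case: y1].
  rewrite m1A m2A; apply: (@measure_eq_pos m1 m2).
  - move=> y y0; rewrite /m1 /m2/= /mrestr/= /pushforward/=.
    have -> : pradius @^-1` (`]y, +oo[ `&` D1) = [set u | Num.max y 1 < pradius u].
      by apply/seteqP; split => u; rewrite /D1/= !in_itv/= !andbT gt_max => /andP.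
    have -> : Y @^-1` `]y, +oo[ = [set w | y < Y w].
      by apply/seteqP; split => u /=; rewrite !in_itv/= !andbT.
    rewrite pradius_tail ?lt_max ?y0//; have [y1|y1] := ltP 1 y; first by rewrite PY.
    rewrite powR1; apply/eqP; rewrite eq_le; apply/andP; split.
      by apply: probability_le1; apply: measurable_ltr_set.
    rewrite -pareto_gt1; apply: le_measure; rewrite ?inE; try exact: measurable_ltr_set.
    by move=> w /=; apply: le_lt_trans.
  - by move=> y y0; apply: le_lt_trans (probability_le1 _ _) _; rewrite ?ltry//; apply: (measurable_preimage mY); exact: measurable_itv.
  - by apply: measurableI => //; exact: measurable_itv.
  - exact: subIsetr.
transitivity (\int[m1]_y g y)%E; first by rewrite ge0_integral_mpush.
transitivity (\int[m2]_y g y)%E; first by apply: eq_measure_integral => A mA _; exact: E.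
rewrite /m2/= ge0_integral_mrestr// [LHS]ge0_integral_pushforward//; last exact: measurable_funTS.
by congr (integral _ _ _); apply/seteqP; split => u; rewrite /D1/= in_itv/= andbT.
Qed.

End pareto_variable.
End pareto_measure.

(** * Continuous functions of finitely many coordinates *)

Section window_continuity.
Context (R : realType) (d : nat).
Implicit Types (f g : pathZ R d -> R) (v : pathZ R d).

Lemma matrix_continuous_dist m n (f : 'M[R]_(m, n) -> R) : continuous f ->
  forall A e, 0 < e -> exists2 r, 0 < r & forall B, `|A - B| < r -> `|f A - f B| < e.
Proof.
move=> cf A e e0.
have /(@cvgrPdist_lt R R^o _ (nbhs _) (nbhs_filter _)) /(_ _ e0) := cf A.
move=> /nbhs_ballP[r r0 Hr]; exists r => // B AB; apply: Hr.
by rewrite mx_norm_ball.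
Qed.

(** The test functions for which weak convergence of the windows [-h, h] can be used. *)
Definition wcont f := exists h : nat, exists2 F : 'M[R]_(h.*2.+1, d) -> R,
  continuous F & forall v, f v = F (window (- h%:Z) h.*2.+1 v).

Lemma window_unwin_continuous a n b m (F : 'M[R]_(n, d) -> R) : continuous F ->
  continuous (fun A : 'M[R]_(m, d) => F (window a n (unwin b A))).
Proof.
move=> cF; apply: matrix_continuousP => A e e0.
have /(@cvgrPdist_lt R R^o _ (nbhs _) (nbhs_filter _)) /(_ _ e0) := cF (window a n (unwin b A)).
move=> /nbhs_ballP[r r0 Hr]; exists r => // B AB; apply: Hr; split => // i j.
rewrite -ball_normE/= !mxE; apply: le_lt_trans AB.
rewrite /unwin; case: insubP => [k _ _|_]; last by rewrite !mxE subrr normr0.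
case: ifP => _; last by rewrite !mxE subrr normr0.
rewrite !mxE [leRHS]/Num.norm/= mx_normrE; apply/bigmax_geP; right => /=.
by exists (k, j); rewrite ?mxE.
Qed.

Lemma window_unwin_window a n (b : int) m v : b <= a -> a + n%:Z <= b + m%:Z ->
  window a n (unwin b (window b m v)) = window a n v.
Proof.
move=> ba ab; apply/matrixP => i j; rewrite !mxE unwin_window//.
by have := ltn_ord i; lia.
Qed.

Lemma wcont_window a n (F : 'M[R]_(n, d) -> R) : continuous F ->
  wcont (fun v => F (window a n v)).
Proof.
move=> cF; exists (`|a| + n)%N.
exists (fun A => F (window a n (unwin (- (`|a| + n)%:Z) A))).
  exact: window_unwin_continuous.
by move=> v; rewrite window_unwin_window//; lia.
Qed.

Lemma wcont_bshift k f : wcont f -> wcont (fun v => f (bshift k v)).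
Proof.
move=> [h [F cF fE]]; have -> : (fun v => f (bshift k v)) =
    (fun v => F (window (- h%:Z - k) h.*2.+1 v)).
  apply/funext => v; rewrite fE; congr F; apply/matrixP => i j.
  by rewrite !mxE /bshift addrAC.
exact: wcont_window.
Qed.

Lemma wcont_scale a f : wcont f -> wcont (fun v => f (scale a v)).
Proof.
move=> [h [F cF fE]]; exists h; exists (fun A => F (a *: A)); last first.
  move=> v; rewrite fE; congr F; apply/matrixP => i j.
  by rewrite !mxE.
apply: matrix_continuousP => A e e0.
have [r r0 Hr] := matrix_continuous_dist cF (a *: A) e0.
exists (r / (`|a| + 1)) => [|B AB]; first by rewrite divr_gt0// ltr_wpDl.
apply: Hr; rewrite -scalerBr normrZ; apply: (@le_lt_trans _ _ ((`|a| + 1) * `|A - B|)).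
  by rewrite ler_wpM2r// lerDl.
by rewrite mulrC -ltr_pdivlMr// ltr_wpDl.
Qed.

Lemma matrix_continuousM m n (F G : 'M[R]_(m, n) -> R) : continuous F -> continuous G ->
  continuous (fun A => F A * G A).
Proof.
move=> cF cG A.
by apply: (@cvgM R 'M[R]_(m, n) (nbhs A) (nbhs_filter A) F G); [exact: cF|exact: cG].
Qed.

(** Both functions can be read off the common window of half-width h + k. *)
Lemma wcont_op2 (op : R -> R -> R) f g :
  (forall l (F G : 'M[R]_(l, d) -> R), continuous F -> continuous G ->
     continuous (fun A => op (F A) (G A))) ->
  wcont f -> wcont g -> wcont (fun v => op (f v) (g v)).
Proof.
move=> cop [h [F cF fE]] [k [G cG gE]]; pose l := (h + k)%N.
exists l; exists (fun A => op (F (window (- h%:Z) h.*2.+1 (unwin (- l%:Z) A)))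
                       (G (window (- k%:Z) k.*2.+1 (unwin (- l%:Z) A)))); last first.
  by move=> v; rewrite !window_unwin_window ?fE ?gE// /l; lia.
by apply: cop; exact: window_unwin_continuous.
Qed.

Lemma wcontM f g : wcont f -> wcont g -> wcont (fun v => f v * g v).
Proof. by apply: (@wcont_op2 *%R) => l F G; exact: matrix_continuousM. Qed.

Lemma measurable_wcont f : wcont f -> measurable_fun setT (f : path_space R d -> R).
Proof.
move=> [h [F cF fE]]; rewrite (_ : f = F \o window (- h%:Z) h.*2.+1); last exact/funext.
apply: (@measurableT_comp _ _ _ _ (borel 'M[R]_(h.*2.+1, d)) _ F).
  exact: continuous_borel.
exact: measurable_window.
Qed.

Lemma wcont_norm (N : vnorm R d) (phi : R -> R) : continuous phi ->
  wcont (fun v => phi (N (v 0))).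
Proof.
move=> cphi; have -> : (fun v : pathZ R d => phi (N (v 0))) =
    (fun v => (fun A : 'M[R]_(1, d) => phi (N A)) (window 0 1 v)).
  by apply/funext => v; congr (phi (N _)); apply/rowP => j; rewrite mxE addr0.
apply: (@wcont_window 0 1 (fun A => phi (N A))) => A.
apply: (@continuous_comp 'M[R]_(1, d) R R N phi); first exact: vnorm_continuous.
exact: cphi.
Qed.

Lemma wcont_cylinder h (U : set 'M[R]_(h.*2.+1, d)) : open U -> exists f : nat -> pathZ R d -> R,
  [/\ forall n, wcont (f n), forall n v, 0 <= f n v <= 1,
      forall n m v, (n <= m)%N -> f n v <= f m v &
      forall v, f n v @[n --> \oo] --> (\1_U (window (- h%:Z) h.*2.+1 v) : R)].
Proof.
move=> oU; have [f [cf f01 fnd fc]] := @open_approx_matrix R _ _ U oU.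
exists (fun n v => f n (window (- h%:Z) h.*2.+1 v)); split => //.
- by move=> n; exact: wcont_window.
- by move=> n m v nm; exact: fnd.
Qed.

(** Sets that are open in some window: a family stable under intersection, generating the product
    sigma-algebra, whose indicators are increasing limits of [wcont] functions. *)
Definition cylinders : set (set (path_space R d)) :=
  [set E | exists h (U : set 'M[R]_(h.*2.+1, d)),
     open U /\ E = window (- h%:Z) h.*2.+1 @^-1` U].

Lemma widen_cylinder (a : int) n (l : nat) (U : set 'M[R]_(n, d)) :
  (- l%:Z <= a) -> a + n%:Z <= l.+1%:Z -> open U ->
  exists2 V : set 'M[R]_(l.*2.+1, d), open V &
    window a n @^-1` U = window (- l%:Z) l.*2.+1 @^-1` V.
Proof.
move=> la al oU; exists [set A | U (window a n (unwin (- l%:Z) A))].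
  rewrite openE => A UA; move: oU; rewrite openE => /(_ _ UA) /nbhs_ballP[r r0 Hr].
  apply/nbhs_ballP; exists r => // B [_ AB]; apply: Hr; split=> // i j.
  rewrite -ball_normE/= !mxE /unwin; case: insubP => [k _ _|_]; last by rewrite !mxE subrr normr0.
  case: ifP => _; last by rewrite !mxE subrr normr0.
  by have := AB k j; rewrite -ball_normE/= !mxE.
apply/seteqP; split => v /=; rewrite window_unwin_window//; lia.
Qed.

Lemma setI_cylinders : setI_closed cylinders.
Proof.
move=> _ _ [h [U [oU ->]]] [k [V [oV ->]]]; pose l := (h + k)%N.
have [U' oU' ->] : exists2 U' : set 'M[R]_(l.*2.+1, d), open U' &
    window (- h%:Z) h.*2.+1 @^-1` U = window (- l%:Z) l.*2.+1 @^-1` U'.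
  by apply: widen_cylinder => //; rewrite /l; lia.
have [V' oV' ->] : exists2 V' : set 'M[R]_(l.*2.+1, d), open V' &
    window (- k%:Z) k.*2.+1 @^-1` V = window (- l%:Z) l.*2.+1 @^-1` V'.
  by apply: widen_cylinder => //; rewrite /l; lia.
by exists l, (U' `&` V'); split => //; exact: openI.
Qed.

Lemma measurable_path_cylinders : @measurable _ (path_space R d) = <<s cylinders >>.
Proof.
apply/seteqP; split; last first.
  apply: smallest_sub; first exact: sigma_algebra_measurable.
  move=> _ [h [U [oU ->]]]; apply: (@measurable_preimage _ _ (path_space R d) (borel 'M[R]_(h.*2.+1, d))).
    exact: measurable_window.
  exact: open_measurable_borel.
apply: smallest_sub; first exact: smallest_sigma_algebra.
move=> _ [t [B [mB ->]]].
suff : <<s @open 'rV[R]_d >> `<=`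
    [set B : set 'rV[R]_d | <<s cylinders >> [set x : pathZ R d | B (x t)]].
  by move=> /(_ B); apply.
apply: smallest_sub.
  split.
  - rewrite /= (_ : [set _ | _] = set0); first exact: sigma_algebra0.
    by apply/seteqP; split.
  - move=> A /= HA; have := sigma_algebraCD HA.
    by rewrite (_ : setT `\` _ = [set x : pathZ R d | (setT `\` A) (x t)]).
  - move=> F HF /=; have := @sigma_algebra_bigcup _ setT cylinders _ HF.
    by rewrite (_ : \bigcup_i _ = [set x : pathZ R d | (\bigcup_k F k) (x t)]).
move=> U oU /=; apply: sub_sigma_algebra.
have [V oV VE] : exists2 V : set 'M[R]_(`|t|.*2.+1, d), open V &
    window t 1 @^-1` U = window (- `|t|%:Z) `|t|.*2.+1 @^-1` V.
  by apply: widen_cylinder => //; lia.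
exists `|t|%N, V; split=> //; rewrite -VE; apply/seteqP; split => x /=.
  by rewrite (_ : window t 1 x = x t)//; apply/rowP => j; rewrite mxE addr0.
by rewrite (_ : window t 1 x = x t)//; apply/rowP => j; rewrite mxE addr0.
Qed.

Lemma path_measure_unique (mu1 mu2 : {measure set (path_space R d) -> \bar R}) :
  (mu1 setT < +oo)%E -> (forall E, cylinders E -> mu1 E = mu2 E) ->
  forall A, measurable A -> mu1 A = mu2 A.
Proof.
move=> fin1 H A mA.
apply: (@measure_unique _ R (path_space R d) cylinders (fun=> setT)) => //.
- exact: measurable_path_cylinders.
- exact: setI_cylinders.
- by move=> _; exists 0%N, setT; split => //; exact: openT.
- by rewrite bigcup_const.
Qed.

End window_continuity.

Lemma bounded_integrable (R : realType) d (T : measurableType d)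
    (mu : {measure set T -> \bar R}) (f : T -> R) M : (mu setT < +oo)%E ->
  measurable_fun setT f -> (forall x, `|f x| <= M) -> mu.-integrable setT (EFin \o f).
Proof.
move=> fin mf fM; apply: measurable_bounded_integrable => //.
exists M; split; first by rewrite num_real.
by move=> z Mz x _ /=; rewrite (le_trans (fM x))// ltW.
Qed.

Lemma le_integral_fin (R : realType) d (T : measurableType d)
    (mu : {measure set T -> \bar R}) (f g : T -> R) :
  measurable_fun setT f -> measurable_fun setT g ->
  (forall x, 0 <= f x) -> (forall x, f x <= g x) ->
  (\int[mu]_x (f x)%:E <= \int[mu]_x (g x)%:E)%E.
Proof.
move=> mf mg f0 fg; apply: ge0_le_integral => //; try exact/measurable_EFinP.
- by move=> x _; rewrite lee_fin.
- by move=> x _; rewrite lee_fin.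
Qed.

Lemma cvg_powR (R : realType) (s a : R) : 0 < s -> t `^ a @[t --> s] --> s `^ a.
Proof.
move=> s0; rewrite {2}/powR gt_eqF//.
have h : expR (a * ln t) @[t --> s] --> expR (a * ln s).
  apply: (@cvg_comp _ _ _ (fun t => a * ln t) expR); last exact: continuous_expR.
  by apply: cvgMr; exact: continuous_ln.
apply: cvg_trans h; apply: near_eq_cvg; near=> t.
by rewrite /powR gt_eqF//; near: t; exact: lt_nbhsr.
Unshelve. all: by end_near. Qed.

(** * The tail measure and mass transport *)

Section tail_measure.
Context (R : realType) (d : nat) (N : vnorm R d) (alpha : R).
Context (dT : measure_display) (OT : measurableType dT) (PT : probability OT R).
Variables (Th : OT -> pathZ R d) (L : probability (path_space R d) R).
Hypothesis alpha0 : 0 < alpha.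
Hypothesis mTh : measurable_fun setT (Th : OT -> path_space R d).
Hypothesis Th0 : forall w, N (Th w 0) = 1.
Hypothesis L_shift : forall k (A : set (path_space R d)), measurable A -> L (bshift k @^-1` A) = L A.

Local Notation leb := (@lebesgue_measure R).
Local Notation rd := (pradius alpha).
Local Notation beta := (leb \x PT)%E.
Implicit Types (v : pathZ R d) (f g : pathZ R d -> R) (b : R * OT).

Definition EL f : R := fine (\int[L]_v (f v)%:E)%E.

Definition tailL (u : R) : R := fine (L [set v | u < N (v 0)]).

Definition tail_path b : pathZ R d := scale (rd b.1) (Th b.2).

Local Notation S0 := tail_path.

(** Regular variation, with the conditional expectation written as a quotient. The Pareto factor of
    the limit appears as the radius restricted to ]1, oo[, which puts the limit under [beta]. *)
Hypothesis RV : forall f M, wcont f -> (forall v, 0 <= f v <= M) ->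
  EL (fun v => f (scale u^-1 v) * (u < N (v 0))%R%:R) / tailL u @[u --> +oo] -->
  fine (\int[beta]_b (f (S0 b) * (1 < rd b.1)%R%:R)%:E)%E.

Lemma measurable_tail_path : measurable_fun setT (S0 : _ -> path_space R d).
Proof.
apply: measurable_path => t j.
rewrite (_ : (fun b => _) = (fun b => rd b.1 * Th b.2 t ord0 j)); last first.
  by apply/funext => b; rewrite /S0 /scale mxE.
apply: measurable_funM.
  by apply: (measurableT_comp (f := rd)); [exact: measurable_pradius|exact: measurable_fst].
apply: (measurableT_comp (f := fun w => Th w t ord0 j)); last exact: measurable_snd.
by apply: (measurableT_comp (f := fun v : path_space R d => v t ord0 j)) => //; exact: measurable_coord_entry.
Qed.

Lemma tail_path_norm0 b : N (S0 b 0) = rd b.1.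
Proof. by rewrite vnormZ Th0 mulr1 gtr0_norm// pradius_gt0. Qed.

Lemma beta_tail y : 0 < y -> beta [set b | y < rd b.1] = (y `^ (- alpha))%:E.
Proof.
move=> y0; rewrite (_ : [set b | _] = [set u | y < rd u] `*` setT); last first.
  by apply/seteqP; split => b //= [].
rewrite product_measure1E//; last by apply: measurable_ltr_set => //; exact: measurable_pradius.
transitivity (leb [set u | (y < rd u)%R] * 1)%E; last by rewrite mule1 pradius_tail.
by congr (_ * _)%E; exact: probability_setT.
Qed.

Lemma measurable_rd1 : measurable_fun setT (fun b : R * OT => rd b.1).
Proof. by apply: (measurableT_comp (f := rd)); [exact: measurable_pradius|exact: measurable_fst]. Qed.

Lemma measurable_beta_tail y : measurable [set b : R * OT | y < rd b.1].
Proof. by apply: measurable_ltr_set => //; exact: measurable_rd1. Qed.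

Lemma integral_beta (g : R * OT -> \bar R) : measurable_fun setT g -> (forall b, 0 <= g b)%E ->
  (\int[beta]_b g b = \int[PT]_w \int[leb]_u g (u, w))%E.
Proof. by move=> mg g0; exact: fubini_tonelli2. Qed.

Lemma measurable_beta_ind y : measurable_fun setT (fun b : R * OT => (y < rd b.1)%R%:R : R).
Proof.
rewrite (_ : (fun b => _) = \1_[set b : R * OT | y < rd b.1]); last first.
  by apply/funext => b; rewrite indicE mem_setE.
by apply: measurable_indic; exact: measurable_beta_tail.
Qed.

Lemma integral_beta_ind y : 0 < y ->
  (\int[beta]_b ((y < rd b.1)%R%:R)%:E = (y `^ (- alpha))%:E)%E.
Proof.
move=> y0; rewrite (_ : (fun b : R * OT => _) = (fun b => (\1_[set b | y < rd b.1] b)%:E)); last first.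
  by apply/funext => b; rewrite indicE mem_setE.
rewrite integral_indic//; last exact: measurable_beta_tail.
by rewrite setIT; exact: beta_tail.
Qed.

(** Scaling the path is scaling its radius, so the homogeneity of the radius measure applies for
    each fixed Theta. *)
Lemma integral_beta_scale (f : pathZ R d -> \bar R) (c : R) : 0 < c ->
  measurable_fun setT (f : path_space R d -> \bar R) -> (forall v, 0 <= f v)%E ->
  (\int[beta]_b f (scale c (S0 b)) = (c `^ alpha)%:E * \int[beta]_b f (S0 b))%E.
Proof.
move=> c0 mf f0.
have mf1 : measurable_fun setT (fun b => f (S0 b)).
  by apply: (measurableT_comp (f := f : path_space R d -> _)) => //; exact: measurable_tail_path.
have mf2 : measurable_fun setT (fun b => f (scale c (S0 b))).
  apply: (measurableT_comp (f := f : path_space R d -> _)) => //.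
  apply: (measurableT_comp (f := scale c : path_space R d -> path_space R d)).
    exact: measurable_scale.
  exact: measurable_tail_path.
rewrite !integral_beta//.
rewrite -ge0_integralZl//; last 3 first.
- exact: (@measurable_fun_fubini_tonelli_G _ _ _ _ _ leb (fun b => f (S0 b))).
- by move=> w _; apply: integral_ge0.
- by rewrite lee_fin powR_ge0.
apply: eq_integral => w _ /=.
have mg : measurable_fun setT (fun y : R => f (scale y (Th w))).
  apply: (measurableT_comp (f := f : path_space R d -> _)) => //.
  apply: measurable_path => t j.
  rewrite (_ : (fun y : R => scale y (Th w) t ord0 j) = (fun y : R => y * Th w t ord0 j)).
    by apply: measurable_funM.
  by apply/funext => y; rewrite mxE.
have ci : 0 < c^-1 by rewrite invr_gt0.
have := @pradius_scale _ _ alpha0 c^-1 (fun y => f (scale y (Th w))) ci mg (fun=> f0 _).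
have -> : c^-1 `^ (- alpha) = c `^ alpha.
  by rewrite -(powR_inv1 (ltW c0)) -powRrM mulN1r opprK.
move=> <-.
by apply: eq_integral => u _; rewrite scaleA invrK mulrC.
Qed.

Lemma tailL_ge0 u : 0 <= tailL u.
Proof. by rewrite fine_ge0. Qed.

Lemma measurable_tail_set u : measurable [set v : path_space R d | u < N (v 0)].
Proof. by apply: measurable_ltr_set => //; exact: measurable_vnorm. Qed.

Lemma measurable_tail_ind y : measurable_fun setT (fun v : path_space R d => (y < N (v 0))%R%:R : R).
Proof.
rewrite (_ : (fun v => _) = \1_[set v : path_space R d | y < N (v 0)]); last first.
  by apply/funext => v; rewrite indicE mem_setE.
by apply: measurable_indic; exact: measurable_tail_set.
Qed.

Lemma tailL_fin u : (tailL u)%:E = L [set v | u < N (v 0)].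
Proof.
rewrite /tailL fineK// ge0_fin_numE// (le_lt_trans (probability_le1 _ _)) ?ltry//.
exact: measurable_tail_set.
Qed.

Lemma le_tailL u u' : u <= u' -> tailL u' <= tailL u.
Proof.
move=> uu'; rewrite -lee_fin !tailL_fin le_measure ?inE//; try exact: measurable_tail_set.
by move=> v /=; exact: le_lt_trans.
Qed.

Lemma ELE f M : measurable_fun setT (f : path_space R d -> R) ->
  (forall v, 0 <= f v <= M) -> (EL f)%:E = (\int[L]_v (f v)%:E)%E.
Proof.
move=> mf fM; rewrite /EL fineK//; apply: integrable_fin_num => //.
apply: (@bounded_integrable _ _ _ _ _ M) => //.
  by apply: (@le_lt_trans _ _ 1%E); [exact: probability_le1|exact: ltry].
by move=> v; have /andP[f0 f1] := fM v; rewrite ger0_norm.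
Qed.

Lemma le_EL f g M : measurable_fun setT (f : path_space R d -> R) ->
  measurable_fun setT (g : path_space R d -> R) ->
  (forall v, 0 <= f v) -> (forall v, f v <= g v) -> (forall v, g v <= M) -> EL f <= EL g.
Proof.
move=> mf mg f0 fg gM; rewrite -lee_fin (@ELE f M)// ?(@ELE g M)//.
- exact: le_integral_fin.
- by move=> v; rewrite gM (le_trans (f0 v) (fg v)).
- by move=> v; rewrite f0 (le_trans (fg v)).
Qed.

Lemma EL_indic (A : set (path_space R d)) : measurable A -> EL (\1_A) = fine (L A).
Proof. by move=> mA; rewrite /EL integral_indic// setIT. Qed.

Lemma tailLE u : tailL u = EL (fun v => (u < N (v 0))%R%:R).
Proof.
rewrite /tailL -EL_indic; last exact: measurable_tail_set.
by congr EL; apply/funext => v; rewrite indicE mem_setE.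
Qed.

(** With f = 1, regular variation says that [tailL] divided by itself tends to 1. If the tail
    vanished at u it would vanish beyond u, and the quotient, being 0/0 = 0, would tend to 0. *)
Lemma tailL_gt0 u : 0 < tailL u.
Proof.
have w1 : wcont (fun v : pathZ R d => 1 : R).
  apply: (@wcont_window _ _ 0 1 (fun=> 1)); apply: matrix_continuousP => A e e0.
  by exists 1 => // B _; rewrite subrr normr0.
have := RV w1 (M := 1) (fun v => _); rewrite ler01 lexx => /(_ (fun=> erefl)) H.
have E1 : fine (\int[beta]_b (1 * (1 < rd b.1)%R%:R)%:E)%E = 1.
  under eq_integral do rewrite mul1r.
  by rewrite integral_beta_ind//= powR1.
rewrite E1 in H; rewrite lt_neqAle tailL_ge0 andbT eq_sym; apply/negP => /eqP tu.
suff /(cvg_unique _ H) H0 : EL (fun v => 1 * (u0 < N (v 0))%R%:R) / tailL u0 @[u0 --> +oo] --> (0 : R).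
  by have /eqP := H0 (@Rhausdorff R); rewrite oner_eq0.
apply: cvg_near_cst; near=> u'.
have -> : tailL u' = 0.
  apply/eqP; rewrite eq_le tailL_ge0 andbT -tu; apply: le_tailL.
  by near: u'; apply: nbhs_pinfty_ge; exact: num_real.
by rewrite invr0 mulr0.
Unshelve. all: by end_near. Qed.

Lemma clamp_continuous : continuous (@clamp R).
Proof.
move=> s; apply/cvgrPdist_lt => e e0; near=> t.
apply: le_lt_trans (clamp_dist _ _) _.
by near: t; exact: cvgr_dist_lt.
Unshelve. all: by end_near. Qed.

Lemma wcont_clamp (a c : R) : wcont (fun v => clamp (a * N (v 0) + c)).
Proof.
apply: (@wcont_norm _ _ N (fun y => clamp (a * y + c))) => y.
apply: (@continuous_comp R R R (fun y => a * y + c) (@clamp R)); last exact: clamp_continuous.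
by apply: cvgD; [apply: cvgMr; exact: cvg_id|exact: cvg_cst].
Qed.

Lemma clamp01 s : 0 <= (clamp s : R) <= 1.
Proof. by rewrite clamp_ge0 clamp_le1. Qed.

(** The indicator of |v_0| > s is not continuous. It is enclosed between two ramps of width eta,
    whose limits are at least (s + eta)^(-alpha) for the lower one and at most (s - eta)^(-alpha)
    for the upper one. *)
Lemma tailL_ratio s : 1 < s -> tailL (s * u) / tailL u @[u --> +oo] --> s `^ (- alpha).
Proof.
move=> s1; have s0 : 0 < s by exact: lt_trans s1.
apply/cvgrPdist_lt => e e0.
have /cvgrPdist_lt/(_ _ (divr_gt0 e0 (ltr0Sn R 1))) := @cvg_powR R s (- alpha) s0.
move=> /nbhs_ballP[r /= r0 Hr].
(* The bound r/2 keeps the powers at s + eta and s - eta within e/2 of the power at s; the bound s -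
   1 keeps both ramps inside |v_0| > 1, the region that regular variation describes. *)
pose eta := Num.min (r / 2) (s - 1).
have eta0 : 0 < eta by rewrite lt_min divr_gt0//= subr_gt0.
have etar : eta < r by rewrite gt_min; apply/orP; left; lra.
have etas : 1 <= s - eta by rewrite lerBrDl -lerBrDr ge_min lexx orbT.
pose Fm v := clamp (eta^-1 * N (v 0) + - s / eta).
pose Fp v := clamp (eta^-1 * N (v 0) + (1 - s / eta)).
have mc a c : measurable_fun setT (fun v : path_space R d => clamp (a * N (v 0) + c)).
  by apply: measurable_wcont; exact: wcont_clamp.
have FmE v : eta^-1 * N (v 0) + - s / eta = (N (v 0) - s) / eta by field; rewrite gt_eqF.
have FpE v : eta^-1 * N (v 0) + (1 - s / eta) = (N (v 0) - (s - eta)) / eta by field; rewrite gt_eqF.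
have mb := measurable_beta_ind.
have mN := measurable_tail_ind.
have bI := integral_beta_ind.
have mcb a c : measurable_fun setT (fun b => clamp (a * N (S0 b 0) + c) * (1 < rd b.1)%R%:R).
  apply: measurable_funM => //.
  apply: (measurableT_comp (f := fun v : path_space R d => clamp (a * N (v 0) + c))) => //.
  exact: measurable_tail_path.
have lm := RV (wcont_clamp eta^-1 (- s / eta)) (fun v => clamp01 _).
have lp := RV (wcont_clamp eta^-1 (1 - s / eta)) (fun v => clamp01 _).
set Lm := fine _ in lm; set Lp := fine _ in lp.
have fin a c : (\int[beta]_b (clamp (a * N (S0 b 0) + c) * (1 < rd b.1)%R%:R)%:E)%E \is a fin_num.
  rewrite ge0_fin_numE; last by apply: integral_ge0 => b _; rewrite lee_fin mulr_ge0 ?clamp_ge0.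
  apply: (@le_lt_trans _ _ (\int[beta]_b ((1 < rd b.1)%R%:R)%:E)%E); last by rewrite bI// ltry.
  apply: le_integral_fin; [exact: mcb|exact: mb| |].
  - by move=> b; rewrite mulr_ge0 ?clamp_ge0.
  - by move=> b; rewrite ler_piMl ?clamp_le1.
have hm : (s + eta) `^ (- alpha) <= Lm.
  rewrite -lee_fin /Lm fineK// -bI ?addr_gt0//.
  apply: le_integral_fin; [exact: mb|exact: mcb|by move=> b; case: (_ < _)|].
  - move=> b; case: (ltP (s + eta) (rd b.1)) => [h|_]; last by rewrite mulr_ge0 ?clamp_ge0.
    rewrite FmE tail_path_norm0 clamp1; last by rewrite ler_pdivlMr// mul1r; lra.
    by rewrite (_ : 1 < rd b.1) ?mulr1//; lra.
have hp : Lp <= (s - eta) `^ (- alpha).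
  rewrite -lee_fin /Lp fineK// -bI ?(lt_le_trans ltr01)//.
  apply: le_integral_fin; [exact: mcb|exact: mb| |].
  - by move=> b; rewrite mulr_ge0 ?clamp_ge0.
  - move=> b; rewrite FpE tail_path_norm0; case: (ltP (s - eta) (rd b.1)) => h.
      by rewrite mulr_ile1 ?clamp_le1 ?clamp_ge0//; case: (1 < _).
    by rewrite clamp0 ?mul0r// pmulr_lle0 ?invr_gt0// subr_le0.
have Hrm : s `^ (- alpha) - e / 2 < Lm.
  have /Hr : ball s r (s + eta) by rewrite -ball_normE/= opprD addrA subrr sub0r normrN gtr0_norm.
  rewrite ltr_norml => /andP[_]; lra.
have Hrp : Lp < s `^ (- alpha) + e / 2.
  have /Hr : ball s r (s - eta) by rewrite -ball_normE/= opprB addrC subrK gtr0_norm.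
  rewrite ltr_norml => /andP[h _]; lra.
have e20 : 0 < e / 2 by rewrite divr_gt0.
near=> u.
have u0 : 0 < u by near: u; apply: nbhs_pinfty_gt; exact: num_real.
have t0 := tailL_gt0 u.
have scN (v : pathZ R d) : N (scale u^-1 v 0) = N (v 0) / u.
  by rewrite vnormZ gtr0_norm ?invr_gt0// mulrC.
have mcs a c : measurable_fun setT (fun v : path_space R d => clamp (a * N (scale u^-1 v 0) + c) * (u < N (v 0))%R%:R).
  apply: measurable_funM => //.
  by apply: (measurableT_comp (f := fun v : path_space R d => clamp (a * N (v 0) + c))) => //; exact: measurable_scale.
have hm' : EL (fun v => clamp (eta^-1 * N (scale u^-1 v 0) + - s / eta) * (u < N (v 0))%R%:R) <= tailL (s * u).
  rewrite tailLE; apply: (@le_EL _ _ 1) => //.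
  - by move=> v; rewrite mulr_ge0 ?clamp_ge0.
  - move=> v; rewrite FmE scN; case: (ltP (s * u)) => h.
      by rewrite mulr_ile1 ?clamp_le1 ?clamp_ge0//; case: (u < _).
    by rewrite clamp0 ?mul0r// pmulr_lle0 ?invr_gt0// subr_le0 ler_pdivrMr.
  - by move=> v; case: (_ < _).
have hp' : tailL (s * u) <= EL (fun v => clamp (eta^-1 * N (scale u^-1 v 0) + (1 - s / eta)) * (u < N (v 0))%R%:R).
  rewrite tailLE; apply: (@le_EL _ _ 1) => //.
  - move=> v; case: (ltP (s * u)) => h; last by rewrite mulr_ge0 ?clamp_ge0.
    rewrite FpE scN clamp1; last first.
      rewrite ler_pdivlMr// mul1r lerBrDr addrC subrK ler_pdivlMr//; exact: ltW.
    rewrite (_ : u < N (v 0)) ?mulr1//; apply: le_lt_trans h; rewrite ler_peMl// ltW//.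
  - by move=> v; rewrite mulr_ile1 ?clamp_le1 ?clamp_ge0//; case: (u < _).
have H1 : `|Lm - EL (fun v => clamp (eta^-1 * N (scale u^-1 v 0) + - s / eta) * (u < N (v 0))%R%:R) / tailL u| < e / 2.
  by near: u; exact: cvgr_dist_lt.
have H2 : `|Lp - EL (fun v => clamp (eta^-1 * N (scale u^-1 v 0) + (1 - s / eta)) * (u < N (v 0))%R%:R) / tailL u| < e / 2.
  by near: u; exact: cvgr_dist_lt.
have h1 : EL (fun v => clamp (eta^-1 * N (scale u^-1 v 0) + - s / eta) * (u < N (v 0))%R%:R) / tailL u <= tailL (s * u) / tailL u.
  by rewrite ler_wpM2r// invr_ge0 ltW.
have h2 : tailL (s * u) / tailL u <= EL (fun v => clamp (eta^-1 * N (scale u^-1 v 0) + (1 - s / eta)) * (u < N (v 0))%R%:R) / tailL u.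
  by rewrite ler_wpM2r// invr_ge0 ltW.
move: H1 H2 h1 h2 Hrm Hrp; rewrite !ltr_norml; clear.
move=> /andP[H1 H1'] /andP[H2 H2'] h1 h2 Hrm Hrp.
by apply/andP; split; lra.
Unshelve. all: by end_near. Qed.

Lemma beta_integral_fin f M delta : measurable_fun setT (f : path_space R d -> R) ->
  (forall v, 0 <= f v <= M) -> 0 < delta -> (forall v, N (v 0) <= delta -> f v = 0) ->
  (\int[beta]_b (f (S0 b))%:E)%E \is a fin_num.
Proof.
move=> mf fM delta0 fd; rewrite ge0_fin_numE; last first.
  by apply: integral_ge0 => b _; rewrite lee_fin; have /andP[] := fM (S0 b).
have M0 : 0 <= M by have /andP[f0 f1] := fM (fun=> 0); exact: le_trans f1.
apply: (@le_lt_trans _ _ (\int[beta]_b (M * (delta < rd b.1)%R%:R)%:E)%E).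
  apply: le_integral_fin.
  - apply: (measurableT_comp (f := f : path_space R d -> R)) => //.
    exact: measurable_tail_path.
  - by apply: measurable_funM => //; exact: measurable_beta_ind.
  - by move=> b; have /andP[] := fM (S0 b).
  - move=> b; case: (ltP delta (rd b.1)) => h.
      by rewrite mulr1; have /andP[] := fM (S0 b).
    by rewrite fd ?mulr0// tail_path_norm0.
under eq_integral do rewrite EFinM.
rewrite ge0_integralZl//.
- by rewrite integral_beta_ind// -EFinM ltry.
- by apply/measurable_EFinP; exact: measurable_beta_ind.
Qed.

(** Regular variation at level x_n only sees |v_0| > x_n. Taken at the lower level delta x_n it
    covers the support of f; the homogeneity of [beta] then yields a factor delta^alpha, which the
    ratio of the tails at delta x_n and x_n cancels. *)
Lemma vague_cvg f M delta (x : nat -> R) : wcont f -> (forall v, 0 <= f v <= M) ->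
  0 < delta < 1 -> (forall v, N (v 0) <= delta -> f v = 0) ->
  (forall n, 0 < x n) -> x n @[n --> \oo] --> +oo ->
  EL (fun v => f (scale (x n)^-1 v)) / tailL (x n) @[n --> \oo] -->
  fine (\int[beta]_b (f (S0 b))%:E)%E.
Proof.
move=> cf fM /andP[delta0 delta1] fd x0 xoo.
have mf := measurable_wcont cf.
have I := beta_integral_fin mf fM delta0 fd.
have dxoo : delta * x n @[n --> \oo] --> +oo.
  have /cvgryPge H := xoo; apply/cvgryPge => A; near=> n.
  by rewrite mulrC -ler_pdivrMr//; near: n; exact: H.
have c1 := cvg_comp _ _ dxoo (RV (wcont_scale delta cf) (fun v => fM (scale delta v))).
rewrite /= in c1.
have E1 : fine (\int[beta]_b (f (scale delta (S0 b)) * (1 < rd b.1)%R%:R)%:E)%E =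
    delta `^ alpha * fine (\int[beta]_b (f (S0 b))%:E)%E.
  rewrite -[delta `^ alpha]/(fine (delta `^ alpha)%:E) -fineM//; congr fine.
  rewrite -(@integral_beta_scale (fun v => (f v)%:E))//.
  - apply: eq_integral => b _; case: (ltP 1 (rd b.1)) => h; first by rewrite mulr1.
    rewrite mulr0 fd// vnormZ tail_path_norm0 gtr0_norm//.
    by rewrite ler_piMr// ltW.
  - exact/measurable_EFinP.
  - by move=> v; rewrite lee_fin; have /andP[] := fM v.
rewrite E1 in c1.
have sd : 1 < delta^-1 by rewrite invf_gt1.
have c2 := cvg_comp _ _ dxoo (tailL_ratio sd); rewrite /= in c2.
have da0 : delta `^ alpha != 0 by rewrite gt_eqF// powR_gt0.
have dE : delta^-1 `^ (- alpha) = delta `^ alpha.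
  by rewrite -(powR_inv1 (ltW delta0)) -powRrM mulN1r opprK.
rewrite dE in c2.
set J := fine _ in c1 *.
have JE : J = delta `^ alpha * J * (delta `^ alpha)^-1 by rewrite mulrC mulrA mulVf// mul1r.
rewrite [X in _ --> X]JE; apply: cvg_trans (cvgM c1 (cvgV da0 c2)).
apply: near_eq_cvg; apply: nearW => n /=.
have t1 := tailL_gt0 (delta * x n); have t2 := tailL_gt0 (x n).
rewrite mulrA mulVf ?gt_eqF// mul1r.
have -> : EL (fun v => f (scale delta (scale (delta * x n)^-1 v)) * (delta * x n < N (v 0))%R%:R) =
    EL (fun v => f (scale (x n)^-1 v)).
  congr EL; apply/funext => v; rewrite scaleA invfM mulrA mulfV ?gt_eqF// mul1r.
  case: ltP => h; first by rewrite mulr1.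
  rewrite mulr0 fd// vnormZ gtr0_norm ?invr_gt0// mulrC ler_pdivrMr//.
by field; rewrite !gt_eqF.
Unshelve. all: by end_near. Qed.

Lemma EL_bshift k f M : measurable_fun setT (f : path_space R d -> R) ->
  (forall v, 0 <= f v <= M) -> EL (fun v => f (bshift k v)) = EL f.
Proof.
move=> mf fM; congr fine.
transitivity (\int[mpush L (measurable_bshift k)]_v (f v)%:E)%E.
  rewrite ge0_integral_mpush//; first exact/measurable_EFinP.
  by move=> v; rewrite lee_fin; have /andP[] := fM v.
by apply: eq_measure_integral => A mA _; exact: L_shift.
Qed.

Lemma cylinder_norm_gt (delta : R) (t : int) : cylinders [set v : pathZ R d | delta < N (v t)].
Proof.
have oU : open [set A : 'rV[R]_d | delta < N A].
  have /continuousP/(_ [set y | delta < y]) := @vnorm_continuous R d N.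
  by apply; exact: open_gt.
have [V oV VE] : exists2 V : set 'M[R]_(`|t|.*2.+1, d), open V &
    window t 1 @^-1` [set A : 'rV[R]_d | delta < N A] = window (- `|t|%:Z) `|t|.*2.+1 @^-1` V.
  by apply: widen_cylinder => //; lia.
exists `|t|%N, V; split=> //; rewrite -VE; apply/seteqP; split => v /=.
  by rewrite (_ : window t 1 v = v t)//; apply/rowP => j; rewrite mxE addr0.
by rewrite (_ : window t 1 v = v t)//; apply/rowP => j; rewrite mxE addr0.
Qed.

Lemma measurable_cylinder E : cylinders E -> measurable (E : set (path_space R d)).
Proof. by move=> cE; rewrite measurable_path_cylinders; exact: sub_sigma_algebra. Qed.

Definition tail_measure : {measure set (path_space R d) -> \bar R} :=
  mpush [the measure _ _ of beta] measurable_tail_path.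

(** By stationarity, a function of X / x_n and the same function of its shift have equal means, and
    [vague_cvg] gives the limit of each. That lemma wants functions vanishing for small v_0; for a
    function together with its shift, this means that E stays away from small v_0 and from small
    v_j. *)
Lemma cylinder_shift (j : int) delta E : cylinders E -> 0 < delta < 1 ->
  E `<=` [set v | delta < N (v 0)] -> E `<=` [set v | delta < N (v j)] ->
  tail_measure (bshift j @^-1` E) = tail_measure E.
Proof.
move=> cE d01 E0 Ej; have mE := measurable_cylinder cE.
have mbE : measurable (bshift j @^-1` E : set (path_space R d)).
  exact: (measurable_preimage (measurable_bshift j)).
case: (cE) => h [U [oU EU]]; have [f [cf f01 fnd fc]] := wcont_cylinder oU.
have fcE v : f n v @[n --> \oo] --> (\1_E v : R) by rewrite EU; exact: fc.
(* The approximations increase to the indicator of E, so they vanish off E and inherit its distance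
   from small v_0 and v_j. *)
have fE n v : ~ E v -> f n v = 0.
  move=> nE; apply/eqP; rewrite eq_le; have /andP[-> _] := f01 n v; rewrite andbT.
  have <- : \1_E v = 0 :> R by rewrite indicE memNset.
  rewrite -(cvg_lim (@Rhausdorff R) (fcE v)); apply: limr_ge.
    by apply/cvg_ex; eexists; exact: fcE.
  by near=> m; apply: fnd; near: m; exists n.
(* Any positive levels tending to infinity serve, since the levels do not enter the limits that are
   compared. *)
pose x (n : nat) : R := n.+1%:R.
have xoo : x n @[n --> \oo] --> +oo by apply/cvgryPge => A; near=> n; rewrite /x -natr1 ler_wpDr//; near: n; exact: nbhs_infty_ger.
have mf n := measurable_wcont (cf n).
have I n : (\int[beta]_b (f n (bshift j (S0 b)))%:E = \int[beta]_b (f n (S0 b))%:E)%E.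
  have z1 v : N (v 0) <= delta -> f n v = 0.
    by move=> vd; apply: fE => /E0 /=; rewrite ltNge vd.
  have z2 v : N (v 0) <= delta -> f n (bshift j v) = 0.
    by move=> vd; apply: fE => /Ej /=; rewrite /bshift subrr ltNge vd.
  have cb := wcont_bshift j (cf n).
  have c1 := vague_cvg (cf n) (f01 n) d01 z1 (fun k => ltr0Sn R k) xoo.
  have c2 := vague_cvg cb (fun v => f01 n (bshift j v)) d01 z2 (fun k => ltr0Sn R k) xoo.
  have d0 : 0 < delta by case/andP: d01.
  rewrite -(fineK (beta_integral_fin (mf n) (f01 n) d0 z1)).
  rewrite -(fineK (beta_integral_fin (measurable_wcont cb) (fun v => f01 n (bshift j v)) d0 z2)).
  congr EFin; apply: (cvg_unique _ c2 _) => //; apply: cvg_trans c1.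
  apply: near_eq_cvg; apply: nearW => k /=; congr (_ / _).
  rewrite -(@EL_bshift j (fun v => f n (scale (x k)^-1 v)) 1)//.
  by apply: (measurableT_comp (f := f n : path_space R d -> R)) => //; exact: measurable_scale.
have key (F : R * OT -> pathZ R d) : measurable_fun setT (F : _ -> path_space R d) ->
    (\int[beta]_b (f n (F b))%:E)%E @[n --> \oo] --> beta (F @^-1` E).
  move=> mF.
  have -> : beta (F @^-1` E) = (\int[beta]_b (\1_E (F b))%:E)%E.
    transitivity (\int[beta]_b (\1_(F @^-1` E) b)%:E)%E; last by [].
    rewrite integral_indic// ?setIT//; exact: (measurable_preimage mF).
  have := @cvg_monotone_convergence _ _ _ [the measure _ _ of beta] setT measurableT (fun n b => (f n (F b))%:E).
  move=> /(_ _ _ _); rewrite (_ : (fun b => limn _) = (fun b => (\1_E (F b))%:E)); last first.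
    apply/funext => b; apply/cvg_lim => //; apply: cvg_EFin; first exact: nearW.
    exact: fcE.
  apply.
  - by move=> n; apply/measurable_EFinP; apply: (measurableT_comp (f := f n : path_space R d -> R)).
  - by move=> n b _; rewrite lee_fin; have /andP[] := f01 n (F b).
  - by move=> b _ n m nm; rewrite lee_fin; exact: fnd.
have k1 := key S0 measurable_tail_path.
have k2 := key (fun b => bshift j (S0 b)) (measurableT_comp (measurable_bshift j) measurable_tail_path).
rewrite (_ : (fun n => _) = (fun n => \int[beta]_b (f n (S0 b))%:E)%E) in k2; last exact/funext.
exact: (cvg_unique _ k2 k1).
Unshelve. all: by end_near. Qed.

(** The sets [V k] have finite mass, and on each of them the measure and its shift agree on
    cylinders, hence on all measurable sets. They exhaust the paths with v_0 and v_j both nonzero,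
    outside of which g is 0. *)
Lemma mass_transport (g : pathZ R d -> \bar R) (j : int) :
  measurable_fun setT (g : path_space R d -> \bar R) -> (forall v, 0 <= g v)%E ->
  (forall v, N (v 0) = 0 -> g v = 0%E) -> (forall v, N (v j) = 0 -> g v = 0%E) ->
  (\int[beta]_b g (S0 b) = \int[beta]_b g (bshift j (S0 b)))%E.
Proof.
move=> mg g0 gz0 gzj; pose nu := tail_measure.
(* The index is raised by 2 because [cylinder_shift] asks for a level below 1. *)
pose dl (k : nat) : R := k.+2%:R^-1.
have dl01 k : 0 < dl k < 1 by rewrite invr_gt0 ltr0Sn/= invf_lt1// ltr1n.
pose V k : set (path_space R d) := [set v | dl k < N (v 0)] `&` [set v | dl k < N (v j)].
have cV k : cylinders (V k) by apply: setI_cylinders; exact: cylinder_norm_gt.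
have mV k := measurable_cylinder (cV k).
pose nuj := mpush nu (measurable_bshift j).
have E k A : measurable A -> mrestr nuj (mV k) A = mrestr nu (mV k) A.
  apply: (@path_measure_unique R d (mrestr nuj (mV k)) (mrestr nu (mV k))).
  - rewrite /= /mrestr setTI.
    have -> : nuj (V k) = nu (V k).
      apply: (@cylinder_shift j (dl k)) => //; by move=> v [].
    apply: (@le_lt_trans _ _ (beta [set b | dl k < rd b.1])).
      rewrite /nu /tail_measure mpushE; apply: le_measure; rewrite ?inE.
      + exact: (measurable_preimage measurable_tail_path).
      + exact: measurable_beta_tail.
      + by move=> b [/=]; rewrite tail_path_norm0.
    by rewrite beta_tail ?ltry//; case/andP: (dl01 k).
  - move=> B cB; apply: (@cylinder_shift j (dl k)) => //.
    + exact: setI_cylinders.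
    + by move=> v [_ []].
    + by move=> v [_ []].
have EV k : (\int[nu]_(v in V k) g v = \int[nuj]_(v in V k) g v)%E.
  transitivity (\int[mrestr nu (mV k)]_v g v)%E.
    by apply/esym; exact: ge0_integral_mrestr.
  transitivity (\int[mrestr nuj (mV k)]_v g v)%E; last exact: ge0_integral_mrestr.
  by apply: eq_measure_integral => A mA _; apply/esym; exact: E.
have UV : \bigcup_k V k = [set v | 0 < N (v 0)] `&` [set v | 0 < N (v j)].
  apply/seteqP; split => [v [k _ [/= h1 h2]]|v [/= h1 h2]].
    have /andP[dk _] := dl01 k.
    by split; [exact: lt_trans h1|exact: lt_trans h2].
  have hm : 0 < Num.min (N (v 0)) (N (v j)) by rewrite lt_min h1.
  have [k _ kP] := near_infty_natSinv_lt (PosNum hm); exists k => //.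
  have /= := kP k.+1 (leqW (leqnn k)); rewrite lt_min => /andP[h3 h4].
  by split.
have ndV : {homo V : n m / (n <= m)%N >-> (n <= m)%O}.
  move=> n m nm; apply/subsetPset => v [/= h1 h2].
  have dnm : dl m <= dl n by rewrite /dl lef_pV2 ?posrE// ler_nat !ltnS.
  by split; apply: le_lt_trans dnm _.
have lim (mu : {measure set (path_space R d) -> \bar R}) :
    (\int[mu]_(v in V k) g v @[k --> \oo] --> \int[mu]_v g v)%E.
  have := @ge0_nondecreasing_set_cvg_integral _ _ _ V g mu ndV mV.
  move=> /(_ (fun k => measurable_funTS mg) (fun k v _ => g0 v)).
  rewrite UV integral_mkcond (_ : g \_ _ = g)//; apply/funext => v.
  rewrite patchE; case: ifPn => //; rewrite notin_setE => /not_andP[/=|/=] /negP.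
    by rewrite -leNgt => h; rewrite gz0//; apply/eqP; rewrite eq_le h vnorm_ge0.
  by rewrite -leNgt => h; rewrite gzj//; apply/eqP; rewrite eq_le h vnorm_ge0.
have l1 := lim nu; have l2 := lim nuj.
rewrite (_ : (fun k => _) = (fun k => \int[nuj]_(v in V k) g v)%E) in l1; last exact/funext.
have := cvg_unique _ l1 l2; rewrite /nuj /nu /tail_measure !ge0_integral_mpush//.
- by apply.
- apply: (measurableT_comp (f := g : path_space R d -> \bar R)) => //.
  exact: measurable_bshift.
Qed.

End tail_measure.

(** * Measurability of the norms *)

Section modulus_measurability.
Context (R : realType) (d : nat) (N : vnorm R d).

(** The two constructors of [int] split the sum into series over the natural numbers, whose
    measurability is at hand. *)
Lemma esum_int (f : int -> \bar R) : (forall t, 0 <= f t)%E ->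
  (\esum_(t in [set: int]) f t = \sum_(n <oo) f (Posz n) + \sum_(n <oo) f (Negz n))%E.
Proof.
move=> f0; rewrite (esumID [set t : int | 0 <= t])// !setTI; congr (_ + _)%E.
  rewrite nneseries_esumT//; apply: reindex_esum; split.
  - by [].
  - by move=> n m _ _ [].
  - by move=> [n|n] //= _; exists n.
rewrite nneseries_esumT//; apply: reindex_esum; split.
- by move=> n _ /=.
- by move=> n m _ _ [].
- by move=> [n|n] h; [exfalso; apply: h|exists n].
Qed.

Lemma measurable_powN (r : R) (t : int) :
  measurable_fun setT (fun v : path_space R d => N (v t) `^ r).
Proof.
apply: (measurableT_comp (f := fun y : R => y `^ r)); first exact: measurable_powR.
exact: measurable_vnorm.
Qed.

Lemma measurable_psum (r : R) : measurable_fun setT (psum N r : path_space R d -> \bar R).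
Proof.
have -> : psum N r = (fun v => (\sum_(n <oo) (N (v (Posz n)) `^ r)%:E + \sum_(n <oo) (N (v (Negz n)) `^ r)%:E)%E).
  by apply/funext => v; apply: esum_int => t; rewrite lee_fin powR_ge0.
apply: emeasurable_funD; apply: ge0_emeasurable_sum.
- by move=> n v _ _; rewrite lee_fin powR_ge0.
- by move=> n _; apply/measurable_EFinP; exact: measurable_powN.
- by move=> n v _ _; rewrite lee_fin powR_ge0.
- by move=> n _; apply/measurable_EFinP; exact: measurable_powN.
Qed.

Lemma measurable_lpnorm (p : \bar R) : (0 < p)%E ->
  measurable_fun setT (lpnorm N p : path_space R d -> \bar R).
Proof.
case: p => [r||]//; rewrite ?lte_fin => r0.
  apply: (@measurableT_comp _ _ _ _ _ _ (fun y : \bar R => (y `^ r^-1)%E)).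
    exact: measurable_poweR.
  exact: measurable_psum.
apply: (@measurability _ _ (path_space R d) _ setT (lpnorm N +oo : path_space R d -> \bar R) _ (ErealGenOInfty.measurableE R)) => //.
move=> _ [B [a ->] <-]; rewrite setTI.
rewrite (_ : _ @^-1` _ = \bigcup_(t : int) [set v : path_space R d | a < N (v t)]); last first.
  apply/seteqP; split => [v /=|v [t _] /= h].
    rewrite in_itv/= andbT => /ereal_sup_gt[_ [t _ <-] h].
    by exists t => //=; rewrite -lte_fin.
  rewrite in_itv/= andbT; apply: (@lt_le_trans _ _ (N (v t))%:E); first by rewrite lte_fin.
  by apply: ereal_sup_ubound; exists t.
apply: countable_bigcupT_measurable => [|t]; first exact: countableP.
by apply: measurable_ltr_set => //; exact: measurable_vnorm.
Qed.

Lemma measurable_modulus (p : \bar R) : (0 < p)%E ->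
  measurable_fun setT (modulus N p : path_space R d -> \bar R).
Proof.
move=> p0; rewrite (_ : modulus N p = (fun v => lpnorm N p v `^ mexp p)%E).
  apply: (@measurableT_comp _ _ _ _ _ _ (fun y : \bar R => (y `^ mexp p)%E)).
    exact: measurable_poweR.
  exact: measurable_lpnorm.
by apply/funext => v; exact: modulusE.
Qed.

End modulus_measurability.

(** * The path normalized by its alpha-norm *)

Section cluster_measure.
Context (R : realType) (d : nat) (N : vnorm R d) (alpha : R) (p : \bar R).
Context (dT : measure_display) (OT : measurableType dT) (PT : probability OT R).
Variables (Th : OT -> pathZ R d) (L : probability (path_space R d) R).
Hypothesis alpha0 : 0 < alpha.
Hypothesis p0 : (0 < p)%E.
Hypothesis mTh : measurable_fun setT (Th : OT -> path_space R d).
Hypothesis Th0 : forall w, N (Th w 0) = 1.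
Hypothesis L_shift : forall k (A : set (path_space R d)), measurable A -> L (bshift k @^-1` A) = L A.

Local Notation leb := (@lebesgue_measure R).
Local Notation rd := (pradius alpha).
Local Notation beta := (leb \x PT)%E.
Local Notation S0 := (tail_path alpha Th).
Local Notation md := (modulus N p).
Implicit Types (v : pathZ R d) (b : R * OT).

Hypothesis RV : forall f M, wcont f -> (forall v, 0 <= f v <= M) ->
  EL L (fun v => f (scale u^-1 v) * (u < N (v 0))%R%:R) / tailL N L u @[u --> +oo] -->
  fine (\int[beta]_b (f (S0 b) * (1 < rd b.1)%R%:R)%:E)%E.

Hypothesis Th_psum : forall w, (psum N alpha (Th w) < +oo)%E.
Hypothesis Th_md : forall w, (md (Th w) < +oo)%E.

Let mS0 := @measurable_tail_path R d alpha dT OT Th mTh.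

Definition anorm w : R := fine (psum N alpha (Th w)) `^ alpha^-1.

Definition cluster_path b : pathZ R d := scale (rd b.1 / anorm b.2) (Th b.2).

Local Notation S1 := cluster_path.

Lemma psum_Th_fin w : psum N alpha (Th w) \is a fin_num.
Proof. by rewrite ge0_fin_numE ?psum_ge0. Qed.

Lemma psum_ge1 w : 1 <= fine (psum N alpha (Th w)).
Proof.
rewrite -lee_fin fineK ?psum_Th_fin//; apply: esum_ge; exists [set 0]; first by split.
by rewrite fsbig_set1 Th0 powR1.
Qed.

Lemma anorm_gt0 w : 0 < anorm w.
Proof. by rewrite powR_gt0// (lt_le_trans _ (psum_ge1 w)). Qed.

Lemma anormE w : anorm w `^ alpha = fine (psum N alpha (Th w)).
Proof.
rewrite /anorm -powRrM mulVf ?gt_eqF// powRr1//.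
by rewrite (le_trans _ (psum_ge1 w)).
Qed.

Lemma Th_le_anorm w t : N (Th w t) <= anorm w.
Proof.
have h : N (Th w t) `^ alpha <= fine (psum N alpha (Th w)).
  rewrite -lee_fin fineK ?psum_Th_fin//; apply: esum_ge; exists [set t]; first by split.
  by rewrite fsbig_set1.
have -> : N (Th w t) = (N (Th w t) `^ alpha) `^ alpha^-1.
  by rewrite -powRrM mulfV ?gt_eqF// powRr1// vnorm_ge0.
rewrite /anorm ge0_ler_powR ?nnegrE ?powR_ge0 ?invr_ge0 ?(ltW alpha0)//.
exact: le_trans ler01 (psum_ge1 w).
Qed.

Lemma measurable_anorm : measurable_fun setT anorm.
Proof.
apply: (measurableT_comp (f := fun y : R => y `^ alpha^-1)); first exact: measurable_powR.
apply: (measurableT_comp (f := fine)) => //.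
by apply: (measurableT_comp (f := psum N alpha : path_space R d -> _)) => //; exact: measurable_psum.
Qed.

Lemma measurable_cluster_path : measurable_fun setT (S1 : _ -> path_space R d).
Proof.
apply: measurable_path => t j.
rewrite (_ : (fun b => _) = (fun b => rd b.1 * (anorm b.2)^-1 * Th b.2 t ord0 j)); last first.
  by apply/funext => b; rewrite /S1 /scale mxE.
apply: measurable_funM; first apply: measurable_funM.
- by apply: (measurableT_comp (f := rd)); [exact: measurable_pradius|exact: measurable_fst].
- apply: (measurableT_comp (f := fun w => (anorm w)^-1)); last exact: measurable_snd.
  rewrite (_ : (fun w => _) = (fun w => anorm w `^ (-1))); last first.
    by apply/funext => w; rewrite powR_inv1// ltW// anorm_gt0.
  apply: (measurableT_comp (f := fun y : R => y `^ (-1))); first exact: measurable_powR.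
  exact: measurable_anorm.
apply: (measurableT_comp (f := fun w => Th w t ord0 j)); last exact: measurable_snd.
by apply: (measurableT_comp (f := fun v : path_space R d => v t ord0 j)) => //; exact: measurable_coord_entry.
Qed.

Lemma cluster_path_le b t : N (S1 b t) <= rd b.1.
Proof.
rewrite vnormZ ger0_norm; last by rewrite divr_ge0// ltW ?pradius_gt0 ?anorm_gt0.
rewrite -mulrA ler_piMr ?(ltW (pradius_gt0 _ _))//.
by rewrite mulrC ler_pdivrMr ?anorm_gt0// mul1r Th_le_anorm.
Qed.

(** The share of time t in |v|_alpha^alpha. These weights add up to 1 over t when that sum is
    positive and finite, ignore positive scalings and move along with shifts. For an infinite sum
    [fine] makes them 0. *)
Definition weight_at (t : int) v : R := N (v t) `^ alpha / fine (psum N alpha v).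

Lemma weight_at_ge0 t v : 0 <= weight_at t v.
Proof. by rewrite divr_ge0 ?powR_ge0// fine_ge0// psum_ge0. Qed.

Lemma measurable_weight_at t : measurable_fun setT (weight_at t : path_space R d -> R).
Proof.
apply: measurable_funM; first exact: measurable_powN.
rewrite (_ : (fun v => _) = (fun v => fine (psum N alpha v) `^ (-1))); last first.
  by apply/funext => w; rewrite powR_inv1// fine_ge0// psum_ge0.
apply: (measurableT_comp (f := fun y : R => y `^ (-1))); first exact: measurable_powR.
by apply: (measurableT_comp (f := fine)) => //; exact: measurable_psum.
Qed.

Lemma weight_at_scale t c v : 0 < c -> weight_at t (scale c v) = weight_at t v.
Proof.
move=> c0; rewrite /weight_at psumZ vnormZ gtr0_norm// powRM ?vnorm_ge0 ?(ltW c0)//.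
have ca : c `^ alpha != 0 by rewrite gt_eqF// powR_gt0.
have [->|h] := eqVneq (psum N alpha v) +oo%E.
  by rewrite mulr_infty gtr0_sg ?powR_gt0// mul1e/= invr0 !mulr0.
rewrite fineM//= ?ge0_fin_numE ?psum_ge0 ?ltey// invfM.
by rewrite mulrACA mulfV// mul1r.
Qed.

Lemma psum_bshift k v r : psum N r (bshift k v) = psum N r v.
Proof. by rewrite [RHS](reindex_esum [set: int] [set: int] _ _ (bshift_set_bij k)). Qed.

Lemma weight_at_bshift t v : weight_at t (bshift t v) = weight_at 0 v.
Proof. by rewrite /weight_at psum_bshift /bshift subrr. Qed.

(** Dividing the radius by |Theta|_alpha costs the factor |Theta|_alpha^(-alpha), and this is the
    weight of time 0 because |Theta_0| = 1. *)
Lemma integral_cluster (g : pathZ R d -> \bar R) :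
  measurable_fun setT (g : path_space R d -> \bar R) -> (forall v, 0 <= g v)%E ->
  (\int[beta]_b g (S1 b) = \int[beta]_b (g (S0 b) * (weight_at 0 (S0 b))%:E))%E.
Proof.
move=> mg g0.
have m1 : measurable_fun setT (fun b => g (S1 b)).
  by apply: (measurableT_comp (f := g : path_space R d -> _)) => //; exact: measurable_cluster_path.
have m2 : measurable_fun setT (fun b => (g (S0 b) * (weight_at 0 (S0 b))%:E)%E).
  apply: emeasurable_funM.
    exact: (measurableT_comp (f := g : path_space R d -> _)).
  apply/measurable_EFinP.
  by apply: (measurableT_comp (f := weight_at 0 : path_space R d -> _)) => //; exact: measurable_weight_at.
rewrite !integral_beta//; last by move=> b; rewrite mule_ge0// lee_fin weight_at_ge0.
apply: eq_integral => w _.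
have mgw : measurable_fun setT (fun y : R => g (scale y (Th w))).
  apply: (measurableT_comp (f := g : path_space R d -> _)) => //.
  apply: measurable_path => t j.
  rewrite (_ : (fun y : R => scale y (Th w) t ord0 j) = (fun y : R => y * Th w t ord0 j)).
    by apply: measurable_funM.
  by apply/funext => y; rewrite mxE.
have := @pradius_scale _ _ alpha0 _ (fun y => g (scale y (Th w))) (anorm_gt0 w) mgw (fun=> g0 _).
move=> ->; rewrite powRN anormE muleC -ge0_integralZr//; last 2 first.
- by apply: (measurableT_comp mgw); exact: measurable_pradius.
- by rewrite lee_fin invr_ge0 fine_ge0// psum_ge0.
apply: eq_integral => u _; congr (_ * _%:E)%E.
by rewrite weight_at_scale ?pradius_gt0// /weight_at Th0 powR1 mul1r.
Qed.

(** Mass transport for g times the weight of time j: the weight provides the vanishing at v_j = 0,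
    the assumption on g that at v_0 = 0. The shift turns the weight of time j into that of time 0,
    which [integral_cluster] absorbs. *)
Lemma mass_transport_cluster (g : pathZ R d -> \bar R) (j : int) :
  measurable_fun setT (g : path_space R d -> \bar R) -> (forall v, 0 <= g v)%E ->
  (forall v, N (v 0) = 0 -> g v = 0%E) ->
  (\int[beta]_b (g (S0 b) * (weight_at j (S0 b))%:E) = \int[beta]_b g (bshift j (S1 b)))%E.
Proof.
move=> mg g0 gz.
have mgj : measurable_fun setT (fun v : path_space R d => g (bshift j v)).
  by apply: (measurableT_comp (f := g : path_space R d -> _)) => //; exact: measurable_bshift.
transitivity (\int[beta]_b (g (bshift j (S0 b)) * (weight_at 0 (S0 b))%:E))%E; last first.
  by apply/esym; exact: (integral_cluster (g := fun v => g (bshift j v)) mgj (fun=> g0 _)).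
rewrite (@mass_transport _ _ N alpha _ _ PT Th L alpha0 mTh Th0 L_shift RV
  (fun v => g v * (weight_at j v)%:E)%E j).
- by apply: eq_integral => b _; rewrite weight_at_bshift.
- by apply: emeasurable_funM => //; apply/measurable_EFinP; exact: measurable_weight_at.
- by move=> v; rewrite mule_ge0// lee_fin weight_at_ge0.
- by move=> v v0; rewrite gz// mul0e.
- by move=> v vj; rewrite /weight_at vj powR0 ?gt_eqF// mul0r mule0.
Qed.

(** Although [beta] is infinite, radii above delta have mass delta^(-alpha), so a constant on them
    is an integrable bound. *)
Lemma cluster_dct (f_ : nat -> R * OT -> R) (f : R * OT -> R) M delta : 0 < delta ->
  (forall n, measurable_fun setT (f_ n)) ->
  (forall b, f_ n b @[n --> \oo] --> f b) ->
  (forall n b, 0 <= f_ n b <= M * (delta < rd b.1)%R%:R) ->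
  [/\ forall n, (\int[beta]_b (f_ n b)%:E)%E \is a fin_num,
      (\int[beta]_b (f b)%:E)%E \is a fin_num &
      fine (\int[beta]_b (f_ n b)%:E)%E @[n --> \oo] --> fine (\int[beta]_b (f b)%:E)%E].
Proof.
move=> delta0 mf_ ff fM.
have mf : measurable_fun setT f.
  by apply: (measurable_fun_cvg mf_) => b _; exact: ff.
have mI : measurable_fun setT (fun b : R * OT => M * (delta < rd b.1)%R%:R).
  by apply: measurable_funM => //; exact: measurable_beta_ind.
have Iint : [the measure _ _ of beta].-integrable setT (fun b => (M * (delta < rd b.1)%R%:R)%:E).
  under eq_fun do rewrite EFinM; apply: integrableZl => //.
  apply/integrableP; split; first by apply/measurable_EFinP; exact: measurable_beta_ind.
  under eq_integral do rewrite gee0_abs ?lee_fin//.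
  by rewrite integral_beta_ind// ltry.
have [|||||int_f _ cv] := @dominated_convergence _ _ _ [the measure _ _ of beta] setT measurableT
  (fun n b => (f_ n b)%:E) (fun b => (f b)%:E) (fun b => (M * (delta < rd b.1)%R%:R)%:E).
- by move=> n; apply/measurable_EFinP; exact: mf_.
- by apply/measurable_EFinP; exact: mf.
- by apply: aeW => b _; apply: cvg_EFin; [exact: nearW|exact: ff].
- exact: Iint.
- by apply: aeW => b n _; rewrite gee0_abs lee_fin; have /andP[] := fM n b.
have fin := integrable_fin_num measurableT int_f.
split => //.
- move=> n; apply: integrable_fin_num => //.
  apply: le_integrable Iint => //; first by apply/measurable_EFinP; exact: mf_.
  move=> b _; have /andP[h1 h2] := fM n b.
  by rewrite !gee0_abs ?lee_fin// (le_trans h1).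
- by apply: fine_cvg; rewrite fineK.
Qed.
End cluster_measure.

(** * Telescoping sums over the integers *)

Section symmetric_sums.
Context (R : realType).
Implicit Types (f : int -> R).

(** [Negz n] is -n-1, so the sum runs over the times from -K to K-1. This asymmetry is the origin of
    the end points 1-K and K+1 after telescoping. *)
Definition symsum (K : nat) f : R := \sum_(n < K) (f (Posz n) + f (Negz n)).

Lemma symsumB K f g : symsum K f - symsum K g = symsum K (fun t => f t - g t).
Proof.
rewrite /symsum -sumrB; apply: eq_bigr => n _.
by rewrite opprD addrACA.
Qed.

Lemma symsum_telescope K f :
  symsum K (fun t => f (- t) - f (1 - t)) = f (1 - K%:Z) - f (K%:Z + 1).
Proof.
elim: K => [|K IHK]; first by rewrite /symsum big_ord0 subr0 add0r subrr.
rewrite {1}/symsum big_ord_recr/= -/(symsum K (fun t : int => f (- t) - f (1 - t))) IHK.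
have -> : - Negz K = (K%:Z + 1) by lia.
have -> : 1 + (K%:Z + 1) = K.+1%:Z + 1 by lia.
have -> : 1 - K.+1%:Z = - K%:Z by lia.
ring.
Qed.

End symmetric_sums.

(** * Half paths and their cut-off *)

Section half_paths.
Context (R : realType) (d : nat) (N : vnorm R d).
Implicit Types (v : pathZ R d).

Definition half (a : int) v : pathZ R d := fun t => if a <= t then v t else 0.

Lemma half_bshift a j v : half a (bshift j v) = bshift j (half (a - j) v).
Proof. by apply/funext => t; rewrite /half /bshift lerD2r. Qed.

Variable eps : R.
Hypothesis eps0 : 0 < eps.

Lemma cut_ext v v' : (forall t, v t = v' t \/ N (v t) <= eps /\ N (v' t) <= eps) ->
  cutoff N eps v = cutoff N eps v'.
Proof.
move=> h; apply/funext => t; rewrite /cutoff /pathmap.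
by case: (h t) => [|[h1 h2]]; [move=> ->|rewrite /= !cutv0].
Qed.

(** Entries at most eps are cut to 0, and all entries beyond some K are of this kind. After the
    cut-off a half path thus ends at K, is the whole path if it starts early, and is the zero path
    if it starts late. *)
Lemma cut_half v : vanishing N v -> exists K : nat,
  [/\ forall (k : nat) a, (K <= k)%N -> cutoff N eps (block a k%:Z v) = cutoff N eps (half a v),
      forall a : int, a <= - K%:Z -> cutoff N eps (half a v) = cutoff N eps v &
      forall a : int, K%:Z < a -> cutoff N eps (half a v) = fun=> 0].
Proof.
move=> /(_ _ eps0)[K HK]; exists K; split.
- move=> k a Kk; apply: cut_ext => t; rewrite /block /half.
  case: (boolP (a <= t)) => at_ /=; last by left.
  case: ifPn => tk; first by left.
  by right; rewrite vnorm0 (ltW eps0); split=> //; apply: HK; lia.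
- move=> a aK; apply: cut_ext => t; rewrite /half.
  case: ifPn => at_; first by left.
  by right; rewrite vnorm0 (ltW eps0); split=> //; apply: HK; lia.
- move=> a aK; apply/funext => t; rewrite /cutoff /pathmap /half.
  case: (boolP (a <= t)) => at_; rewrite cutv0 ?vnorm0 ?(ltW eps0)//; apply: HK; lia.
Qed.

Lemma cut_half_succ a v : N (v a) <= eps -> cutoff N eps (half a v) = cutoff N eps (half (a + 1) v).
Proof.
move=> va; apply: cut_ext => t; rewrite /half.
have [->|ta] := eqVneq t a.
  by rewrite lexx ifF ?vnorm0; [right; rewrite (ltW eps0)|lia].
by left; rewrite (_ : (a + 1 <= t) = (a <= t))//; lia.
Qed.

Lemma cut_block_succ (k : nat) v : N (v 0) <= eps -> cutoff N eps (block 0 k%:Z v) = cutoff N eps (block 1 k%:Z v).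
Proof.
move=> va; apply: cut_ext => t; rewrite /block.
have [->|ta] := eqVneq t 0.
  by case: (k); rewrite /= vnorm0; right; rewrite (ltW eps0).
by left; rewrite (_ : (1 <= t) = (0 <= t))//; lia.
Qed.

End half_paths.

Lemma near_lt_limn_esup (R : realType) (u : nat -> \bar R) (a : \bar R) :
  (limn_esup u < a)%E -> \forall n \near \oo, (u n < a)%E.
Proof.
move=> /ereal_inf_lt[_ [V FV <-] ua]; apply: filterS FV => n Vn.
by apply: le_lt_trans ua; apply: ereal_sup_ubound; exists n.
Qed.

Lemma sum_ltn_le (R : realType) (n k : nat) : \sum_(m < n) (m < k)%N%:R <= k%:R :> R.
Proof.
rewrite -natr_sum ler_nat; suff -> : (\sum_(m < n) (m < k) = minn n k)%N by exact: geq_minr.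
elim: n => [|n IHn]; first by rewrite big_ord0 min0n.
by rewrite big_ord_recr/= IHn; lia.
Qed.

(** * Limits of cut-off functionals *)

Section cut_limit.
Context (R : realType) (d : nat) (N : vnorm R d) (alpha : R) (p : \bar R).
Context (dT : measure_display) (OT : measurableType dT) (PT : probability OT R).
Variables (Th : OT -> pathZ R d) (L : probability (path_space R d) R).
Hypothesis alpha0 : 0 < alpha.
Hypothesis p0 : (0 < p)%E.
Hypothesis mTh : measurable_fun setT (Th : OT -> path_space R d).
Hypothesis Th0 : forall w, N (Th w 0) = 1.
Hypothesis L_shift : forall k (A : set (path_space R d)), measurable A -> L (bshift k @^-1` A) = L A.

Local Notation leb := (@lebesgue_measure R).
Local Notation rd := (pradius alpha).
Local Notation beta := (leb \x PT)%E.
Local Notation S0 := (tail_path alpha Th).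
Local Notation md := (modulus N p).
Implicit Types (v : pathZ R d) (b : R * OT).

Hypothesis RV : forall f M, wcont f -> (forall v, 0 <= f v <= M) ->
  EL L (fun v => f (scale u^-1 v) * (u < N (v 0))%R%:R) / tailL N L u @[u --> +oo] -->
  fine (\int[beta]_b (f (S0 b) * (1 < rd b.1)%R%:R)%:E)%E.

Hypothesis Th_psum : forall w, (psum N alpha (Th w) < +oo)%E.

Local Notation S1 := (cluster_path N alpha Th).

Variables (Lip M : R) (Psi : pathZ R d -> R) (eps : R).
Hypothesis gPsi : good_functional N p Lip M Psi.
Hypothesis Psi0 : Psi (fun=> 0) = 0.
Hypothesis eps01 : 0 < eps < 1.

Let eps0 : 0 < eps. Proof. by case/andP: eps01. Qed.

Local Notation ct := (cutoff N eps).

Let PsiM v : 0 <= Psi v <= M. Proof. by have [h _ _] := gPsi. Qed.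
Let Psi_shift k v : Psi (bshift k v) = Psi v. Proof. by have [_ h _] := gPsi. Qed.
Let M0 : 0 <= M. Proof. by have /andP[h1 h2] := PsiM (fun=> 0); exact: le_trans h2. Qed.

Definition IB (f : R * OT -> R) : R := fine (\int[beta]_b (f b)%:E)%E.

(* A finite measure of [beta] supports such functions. *)
Definition dominated (delta C : R) (f : R * OT -> R) :=
  measurable_fun setT f /\ forall b, 0 <= f b <= C * (delta < rd b.1)%R%:R.

Lemma dominated_fin delta C f : 0 < delta -> dominated delta C f ->
  (\int[beta]_b (f b)%:E)%E \is a fin_num.
Proof.
move=> d0 [mf fC].
have ff b : f b @[_ --> \oo] --> f b by exact: cvg_cst.
by have [_ h _] := @cluster_dct _ _ _ _ PT alpha0 (fun=> f) f C delta d0 (fun=> mf) ff (fun=> fC).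
Qed.

Lemma IBE delta C f : 0 < delta -> dominated delta C f -> (IB f)%:E = (\int[beta]_b (f b)%:E)%E.
Proof. by move=> d0 df; rewrite fineK// (dominated_fin d0 df). Qed.

Lemma dominatedD delta C1 C2 f g : dominated delta C1 f -> dominated delta C2 g ->
  dominated delta (C1 + C2) (fun b => f b + g b).
Proof.
move=> [mf fC] [mg gC]; split; first exact: measurable_funD.
move=> b; have /andP[h1 h2] := fC b; have /andP[h3 h4] := gC b.
by rewrite addr_ge0//= mulrDl lerD.
Qed.

Lemma IBD delta C1 C2 f g : 0 < delta -> dominated delta C1 f -> dominated delta C2 g ->
  IB (fun b => f b + g b) = IB f + IB g.
Proof.
move=> d0 df dg; apply: EFin_inj; rewrite EFinD.
rewrite (IBE d0 (dominatedD df dg)) (IBE d0 df) (IBE d0 dg).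
have [mf fC] := df; have [mg gC] := dg.
under eq_integral do rewrite EFinD.
apply: (@ge0_integralD _ _ _ [the measure _ _ of beta] setT measurableT (fun b => (f b)%:E) (fun b => (g b)%:E)).
- by move=> b _; rewrite lee_fin; have /andP[] := fC b.
- by apply/measurable_EFinP; exact: mf.
- by move=> b _; rewrite lee_fin; have /andP[] := gC b.
- by apply/measurable_EFinP; exact: mg.
Qed.

Lemma IB_cvg delta C (f_ : nat -> R * OT -> R) f : 0 < delta ->
  (forall n, dominated delta C (f_ n)) -> (forall b, f_ n b @[n --> \oo] --> f b) ->
  IB (f_ n) @[n --> \oo] --> IB f.
Proof.
move=> d0 df ff; have [_ _] := @cluster_dct _ _ _ _ PT alpha0 f_ f C delta d0
  (fun n => (df n).1) ff (fun n => (df n).2); exact.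
Qed.

Lemma dominated_symsum delta C K (f : int -> R * OT -> R) : (forall j, dominated delta C (f j)) ->
  dominated delta (C *+ K.*2) (fun b => symsum K (fun j => f j b)).
Proof.
move=> df; elim: K => [|K IHK].
  split; first by under eq_fun do rewrite /symsum big_ord0; exact: measurable_cst.
  by move=> b; rewrite /symsum big_ord0 mulr0n mul0r lexx.
rewrite (_ : (fun b => _) = (fun b => symsum K (fun j => f j b) + (f (Posz K) b + f (Negz K) b))).
  rewrite doubleS -[_.+2]addn2 mulrnDr mulr2n; apply: dominatedD IHK _; exact: dominatedD.
by apply/funext => b; rewrite /symsum big_ord_recr.
Qed.

Lemma IB_symsum delta C K (f : int -> R * OT -> R) : 0 < delta -> (forall j, dominated delta C (f j)) ->
  IB (fun b => symsum K (fun j => f j b)) = symsum K (fun j => IB (f j)).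
Proof.
move=> d0 df; elim: K => [|K IHK].
  rewrite /IB; under eq_integral do rewrite /symsum big_ord0.
  by rewrite integral0 /symsum big_ord0.
rewrite (_ : (fun b => _) = (fun b => symsum K (fun j => f j b) + (f (Posz K) b + f (Negz K) b))).
  rewrite (IBD d0 (dominated_symsum K df) (dominatedD (df _) (df _))) IHK (IBD d0 (df _) (df _)).
  by rewrite [RHS]/symsum big_ord_recr.
by apply/funext => b; rewrite /symsum big_ord_recr.
Qed.

(** A continuous stand-in for 1(|v_0| > eps), with ramp from eps/2 to eps. It is 1 wherever removing
    the entry at time 0 can change a functional cut off at eps, so multiplying the change by it is
    harmless; its support avoids small v_0. *)
Definition chi v : R := clamp (2 / eps * N (v 0) - 1).

Lemma chi01 v : 0 <= chi v <= 1.
Proof. by rewrite clamp_ge0 clamp_le1. Qed.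

Lemma chi0 v : N (v 0) <= eps / 2 -> chi v = 0.
Proof.
move=> h; rewrite /chi clamp0// subr_le0 mulrC -ler_pdivlMr ?divr_gt0//.
by rewrite invf_div mul1r.
Qed.

Lemma chi1 v : eps < N (v 0) -> chi v = 1.
Proof.
move=> h; rewrite /chi clamp1// lerBrDr mulrAC ler_pdivlMr//.
by rewrite -[1 + 1]/(2%:R) ler_pM2l// ltW.
Qed.

Lemma wcont_chi : wcont chi.
Proof. exact: wcont_clamp. Qed.

Lemma wcont_cut_block a (k : int) : wcont (fun v => Psi (ct (block a k v))).
Proof.
have [n hn] : exists n : nat, k < a + n%:Z by exists (`|k - a|.+1)%N; lia.
rewrite (_ : (fun v => _) = (fun v => wfun Psi (cutv N eps) a k a (window a n v))).
  apply: (@wcont_window _ _ a n (@wfun R d Psi (cutv N eps) a k a n)).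
  apply: wfun_continuous; [exact: p0|exact: gPsi| |].
  - exact: ncontinuous_cutv.
  - exact: cutv_00.
by apply/funext => v; rewrite wfunE.
Qed.

(** The value on the path from time a on. The factor sends paths of infinite |.|_alpha to 0: on the
    others the value is the limit of values on blocks, which makes the function measurable on the
    whole path space. *)
Definition cut_start a v : R := Psi (ct (half a v)) * (psum N alpha v < +oo)%E%:R.

Local Notation U := cut_start.

Lemma cut_start_ge0 a v : 0 <= U a v <= M.
Proof.
have /andP[h1 h2] := PsiM (ct (half a v)).
by rewrite /U; case: (_ < _)%E; rewrite ?mulr1 ?mulr0 ?h1 ?lexx.
Qed.

Lemma cvg_cut_block a v : (psum N alpha v < +oo)%E ->
  Psi (ct (block a k%:Z v)) @[k --> \oo] --> U a v.
Proof.
move=> vf; have [K [h _ _]] := cut_half eps0 (psum_vanishing alpha0 vf).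
apply: cvg_near_cst; near=> k; rewrite /U vf mulr1 h//.
by near: k; exact: nbhs_infty_ge.
Unshelve. all: by end_near. Qed.

Lemma measurable_psum_fin : measurable_fun setT (fun v : path_space R d => (psum N alpha v < +oo)%E%:R : R).
Proof.
have mS : measurable [set v : path_space R d | (psum N alpha v < +oo)%E].
  by apply: measurable_lte_set => //; exact: measurable_psum.
rewrite (_ : (fun v => _) = \1_[set v : path_space R d | (psum N alpha v < +oo)%E]).
  exact: measurable_indic.
by apply/funext => v; rewrite indicE mem_setE.
Qed.

Lemma measurable_cut_start a : measurable_fun setT (U a : path_space R d -> R).
Proof.
apply: (@measurable_fun_cvg _ _ _ _
  (fun (k : nat) (v : path_space R d) => Psi (ct (block a k%:Z v)) * (psum N alpha v < +oo)%E%:R)).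
  move=> k; apply: measurable_funM; last exact: measurable_psum_fin.
  by apply: measurable_wcont; exact: wcont_cut_block.
move=> v _; case: (boolP (psum N alpha v < +oo)%E) => vf.
  rewrite -[X in _ --> X]mulr1; apply: cvgM; last exact: cvg_cst.
  exact: cvg_cut_block.
by rewrite /U (negbTE vf) mulr0; under eq_cvg do rewrite mulr0; exact: cvg_cst.
Qed.

Lemma cut_start_bshift a j v : U a (bshift j v) = U (a - j) v.
Proof. by rewrite /U half_bshift psum_bshift /cutoff pathmap_bshift Psi_shift. Qed.

Lemma cut_start_step a v : (U a v - U (a + 1) v) = (U a v - U (a + 1) v) * chi (bshift (- a) v).
Proof.
case: (ltP eps (N (v a))) => h.
  by rewrite chi1 ?mulr1// /bshift opprK add0r.
by rewrite /U cut_half_succ// subrr mul0r.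
Qed.

Definition startA v : R := U 0 v * chi v.
Definition startB v : R := U 1 v * chi v.

(** A shift by j turns the starts 0 and 1 into the starts -j and 1 - j. The factor [chi] drops out
    of the difference by [cut_start_step], and what remains telescopes. *)
Lemma start_telescope K v :
  symsum K (fun j => startA (bshift j v)) - symsum K (fun j => startB (bshift j v)) =
  U (1 - K%:Z) v - U (K%:Z + 1) v.
Proof.
rewrite symsumB -(symsum_telescope K (fun a => U a v)).
congr (symsum K _); apply/funext => j.
rewrite /startA /startB !cut_start_bshift -mulrBl sub0r.
by have := cut_start_step (- j) v; rewrite opprK [- j + 1]addrC => <-.
Qed.

Lemma psum_cluster b : (psum N alpha (S1 b) < +oo)%E.
Proof.
by rewrite psumZ lte_mul_pinfty ?lee_fin ?powR_ge0.
Qed.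

Lemma psum_tail_path b : (psum N alpha (S0 b) < +oo)%E.
Proof.
by rewrite psumZ lte_mul_pinfty ?lee_fin ?powR_ge0.
Qed.

Lemma dominated_S0 (f : pathZ R d -> R) : measurable_fun setT (f : path_space R d -> R) ->
  (forall v, 0 <= f v <= M) -> (forall v, N (v 0) <= eps / 2 -> f v = 0) ->
  dominated (eps / 2) M (fun b => f (S0 b)).
Proof.
move=> mf fM fz; split.
  apply: (measurableT_comp (f := f : path_space R d -> R)) => //.
  exact: measurable_tail_path.
move=> b; case: ltP => h; first by rewrite mulr1.
by rewrite fz ?mulr0 ?lexx// tail_path_norm0.
Qed.

Lemma dominated_S1 (f : pathZ R d -> R) : measurable_fun setT (f : path_space R d -> R) ->
  (forall v, 0 <= f v <= M) -> (forall v, (forall t, N (v t) <= eps / 2) -> f v = 0) ->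
  dominated (eps / 2) M (fun b => f (S1 b)).
Proof.
move=> mf fM fz; split.
  apply: (measurableT_comp (f := f : path_space R d -> R)) => //.
  exact: measurable_cluster_path.
move=> b; case: ltP => h; first by rewrite mulr1.
rewrite fz ?mulr0 ?lexx// => t; apply: le_trans h; exact: cluster_path_le.
Qed.

Lemma cut_small v : (forall t, N (v t) <= eps) -> Psi (ct v) = 0.
Proof.
move=> h; rewrite -[RHS]Psi0; congr Psi; apply/funext => t.
by rewrite /cutoff /pathmap cutv0.
Qed.

Lemma cut_start_small a v : (forall t, N (v t) <= eps / 2) -> U a v = 0.
Proof.
move=> h; rewrite /U cut_small ?mul0r// => t; rewrite /half.
case: ifP => _; rewrite ?vnorm0 ?(ltW eps0)// (le_trans (h t))//.
by rewrite ler_pdivrMr// ler_peMr ?ler1n// ltW.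
Qed.

Lemma measurable_start a : measurable_fun setT (fun v : path_space R d => U a v * chi v).
Proof.
apply: measurable_funM; first exact: measurable_cut_start.
exact: measurable_wcont wcont_chi.
Qed.

Lemma start_bounds a v : 0 <= U a v * chi v <= M.
Proof.
have /andP[h1 h2] := cut_start_ge0 a v; have /andP[h3 h4] := chi01 v.
by rewrite mulr_ge0//= (le_trans _ h2)// ler_piMr.
Qed.

Lemma symsum_weight v : (0 < psum N alpha v < +oo)%E ->
  [/\ forall K, 0 <= symsum K (fun j => weight_at N alpha j v) <= 1 &
      symsum K (fun j => weight_at N alpha j v) @[K --> \oo] --> (1 : R)].
Proof.
move=> /andP[v0 vf]; have vn : psum N alpha v \is a fin_num by rewrite ge0_fin_numE ?psum_ge0.
have fv0 : 0 < fine (psum N alpha v) by rewrite fine_gt0// v0 vf.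
pose a (n : nat) : R := N (v (Posz n)) `^ alpha + N (v (Negz n)) `^ alpha.
have a0 n : 0 <= a n by rewrite addr_ge0 ?powR_ge0.
have aS : (\sum_(n <oo) (a n)%:E = psum N alpha v)%E.
  rewrite [RHS]esum_int; last by move=> t; rewrite lee_fin powR_ge0.
  by rewrite -nneseriesD// => n _ _; rewrite lee_fin powR_ge0.
have E K : symsum K (fun j => weight_at N alpha j v) = (\sum_(0 <= n < K) a n) / fine (psum N alpha v).
  rewrite big_mkord mulr_suml; apply: eq_bigr => n _.
  by rewrite /weight_at -mulrDl.
have le1 K : \sum_(0 <= n < K) a n <= fine (psum N alpha v).
  rewrite -lee_fin fineK// -aS -sumEFin.
  by apply: nneseries_lim_ge => n _ _; rewrite lee_fin.
split=> [K|].
  by rewrite E divr_ge0 ?sumr_ge0 ?(ltW fv0)//= ler_pdivrMr// mul1r.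
rewrite -(mulfV (negbT (gt_eqF fv0))).
under eq_cvg do rewrite E.
apply: cvgM; last exact: cvg_cst.
have h : (\sum_(0 <= n < K) a n)%:E @[K --> \oo] --> (fine (psum N alpha v))%:E.
  rewrite fineK// -aS; under eq_cvg do rewrite -sumEFin.
  by apply: is_cvg_nneseries => n _ _; rewrite lee_fin.
exact: (fine_cvg h).
Qed.

Lemma psum_gt0 b : (0 < psum N alpha (S0 b))%E.
Proof.
apply: (@lt_le_trans _ _ (N (S0 b 0) `^ alpha)%:E).
  by rewrite lte_fin powR_gt0// tail_path_norm0// pradius_gt0.
by apply: esum_ge; exists [set 0]; [split|rewrite fsbig_set1].
Qed.

(** Mass transport for each time j separately: the weight of time j in S0 is traded for a shift of
    S1 by j. The factor [chi] supplies the vanishing at v_0 = 0. *)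
Lemma start_transport a K :
  IB (fun b => U a (S0 b) * chi (S0 b) * symsum K (fun j => weight_at N alpha j (S0 b))) =
  IB (fun b => symsum K (fun j => U a (bshift j (S1 b)) * chi (bshift j (S1 b)))).
Proof.
have e20 : 0 < eps / 2 by rewrite divr_gt0.
have d1 j : dominated (eps / 2) M (fun b => U a (bshift j (S1 b)) * chi (bshift j (S1 b))).
  apply: (@dominated_S1 (fun v => U a (bshift j v) * chi (bshift j v))).
  - apply: (measurableT_comp (f := (fun v => U a v * chi v) : path_space R d -> _)).
      exact: measurable_start.
    exact: measurable_bshift.
  - by move=> v; exact: start_bounds.
  - by move=> v h; rewrite cut_start_bshift cut_start_small// mul0r.
have w1 j b : weight_at N alpha j (S0 b) <= 1.
  rewrite /weight_at ler_pdivrMr; last by rewrite fine_gt0// psum_gt0 psum_tail_path.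
  rewrite mul1r -lee_fin fineK ?ge0_fin_numE ?psum_ge0 ?psum_tail_path//.
  by apply: esum_ge; exists [set j]; [split|rewrite fsbig_set1].
have d0 j : dominated (eps / 2) M (fun b => U a (S0 b) * chi (S0 b) * weight_at N alpha j (S0 b)).
  split.
    apply: (measurableT_comp (f := (fun v => U a v * chi v * weight_at N alpha j v) : path_space R d -> R)).
      by apply: measurable_funM; [exact: measurable_start|exact: measurable_weight_at].
    exact: measurable_tail_path.
  move=> b; have /andP[h1 h2] := start_bounds a (S0 b); rewrite mulr_ge0 ?weight_at_ge0//=.
  case: ltP => h.
    by rewrite mulr1 (le_trans _ h2)// ler_piMr.
  by rewrite chi0 ?mulr0 ?mul0r// tail_path_norm0.
transitivity (symsum K (fun j => IB (fun b => U a (S0 b) * chi (S0 b) * weight_at N alpha j (S0 b)))).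
  rewrite -(IB_symsum K e20 d0); congr IB; apply/funext => b.
  by rewrite /symsum mulr_sumr; apply: eq_bigr => n _; rewrite mulrDr.
rewrite (IB_symsum K e20 d1); congr symsum; apply/funext => j.
apply: EFin_inj; rewrite (IBE e20 (d0 j)) (IBE e20 (d1 j)).
rewrite -(@mass_transport_cluster _ _ N alpha _ _ PT Th L alpha0 mTh Th0 L_shift RV Th_psum
  (fun v => (U a v * chi v)%:E) j)//.
- by apply/measurable_EFinP; exact: measurable_start.
- by move=> v; rewrite lee_fin; have /andP[] := start_bounds a v.
- by move=> v v0; rewrite chi0 ?mulr0// v0 ltW.
Qed.

Lemma start_weight_cvg a :
  IB (fun b => U a (S0 b) * chi (S0 b) * symsum K (fun j => weight_at N alpha j (S0 b))) @[K --> \oo] -->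
  IB (fun b => U a (S0 b) * chi (S0 b)).
Proof.
have e20 : 0 < eps / 2 by rewrite divr_gt0.
have sw b := @symsum_weight (S0 b).
have swp b : (0 < psum N alpha (S0 b) < +oo)%E by rewrite psum_gt0 psum_tail_path.
apply: (IB_cvg (delta := eps / 2) (C := M)) => // [K|b]; last first.
  rewrite -[X in _ --> X]mulr1; apply: cvgM; first exact: cvg_cst.
  by have [] := sw b (swp b).
split.
  apply: (measurableT_comp (f := (fun v => U a v * chi v * symsum K (fun j => weight_at N alpha j v)) : path_space R d -> R)).
    apply: measurable_funM; first exact: measurable_start.
    apply: measurable_sum => i; apply: measurable_funD; exact: measurable_weight_at.
  exact: measurable_tail_path.
move=> b; have /andP[h1 h2] := start_bounds a (S0 b); have [h _] := sw b (swp b).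
have /andP[h3 h4] := h K; rewrite mulr_ge0//=.
case: ltP => h'.
  by rewrite mulr1 (le_trans _ h2)// ler_piMr.
by rewrite chi0 ?mulr0 ?mul0r// tail_path_norm0.
Qed.

(** The weights of all times of S0 add up to 1, so they may be inserted; transport replaces them
    with shifts of S1, along which the difference of the two starts telescopes. As K grows, the half
    path from 1 - K becomes the whole path and the one from K + 1 is cut to 0. *)
Lemma start_difference :
  IB (fun b => startA (S0 b)) = IB (fun b => startB (S0 b)) + IB (fun b => Psi (ct (S1 b))).
Proof.
have e20 : 0 < eps / 2 by rewrite divr_gt0.
have dU a : dominated (eps / 2) M (fun b => U a (S1 b)).
  apply: dominated_S1; first exact: measurable_cut_start.
  - exact: cut_start_ge0.
  - exact: cut_start_small.
have dS a K : dominated (eps / 2) (M *+ K.*2) (fun b => symsum K (fun j => U a (bshift j (S1 b)) * chi (bshift j (S1 b)))).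
  apply: dominated_symsum => j.
  apply: (@dominated_S1 (fun v => U a (bshift j v) * chi (bshift j v))).
  - apply: (measurableT_comp (f := (fun v => U a v * chi v) : path_space R d -> _)).
      exact: measurable_start.
    exact: measurable_bshift.
  - by move=> v; exact: start_bounds.
  - by move=> v h; rewrite cut_start_bshift cut_start_small// mul0r.
pose F a K := IB (fun b => U a (S0 b) * chi (S0 b) * symsum K (fun j => weight_at N alpha j (S0 b))).
(* The identity is arranged without differences, because [IB] is additive on nonnegative dominated
   functions. *)
have id1 K : F 0 K + IB (fun b => U (K%:Z + 1) (S1 b)) = F 1 K + IB (fun b => U (1 - K%:Z) (S1 b)).
  rewrite /F !start_transport -(IBD e20 (dS _ _) (dU _)) -(IBD e20 (dS _ _) (dU _)).
  congr IB; apply/funext => b; apply/eqP; rewrite -subr_eq -addrA eq_sym [_ + (_ - _)]addrC -subr_eq.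
  by apply/eqP; rewrite -[RHS]opprB -(start_telescope K (S1 b)) opprB.
have l0 : IB (fun b => U (K%:Z + 1) (S1 b)) @[K --> \oo] --> (0 : R).
  have -> : 0 = IB (fun b => 0) by rewrite /IB integral0.
  apply: (IB_cvg e20 (fun K => dU _)) => b.
  have [K0 [_ _ h]] := cut_half eps0 (psum_vanishing alpha0 (psum_cluster b)).
  apply: cvg_near_cst; near=> K; rewrite /U h ?Psi0 ?mul0r//.
  have : (K0 <= K)%N by near: K; exact: nbhs_infty_ge.
  by lia.
have l1 : IB (fun b => U (1 - K%:Z) (S1 b)) @[K --> \oo] --> IB (fun b => Psi (ct (S1 b))).
  apply: (IB_cvg e20 (fun K => dU _)) => b.
  have [K0 [_ h _]] := cut_half eps0 (psum_vanishing alpha0 (psum_cluster b)).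
  apply: cvg_near_cst; near=> K; rewrite /U h ?psum_cluster ?mulr1//.
  have : (K0 < K)%N by near: K; exact: nbhs_infty_gt.
  by lia.
have c0 := cvgD (@start_weight_cvg 0) l0; have c1 := cvgD (@start_weight_cvg 1) l1.
move: c0 c1 => /(_ _) c0 /(_ _) c1; rewrite addr0 in c0.
apply: (cvg_unique _ c0 _) => //.
by apply: cvg_trans c1; apply: near_eq_cvg; apply: nearW => K; exact: esym (id1 K).
Unshelve. all: by end_near. Qed.

Definition windowA (a : int) (k : nat) v : R := Psi (ct (block a k%:Z v)) * chi v.

Lemma wcont_windowA a k : wcont (windowA a k).
Proof. by apply: wcontM; [exact: wcont_cut_block|exact: wcont_chi]. Qed.

Lemma windowA_bounds a k v : 0 <= windowA a k v <= M.
Proof.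
have /andP[h1 h2] := PsiM (ct (block a k%:Z v)); have /andP[h3 h4] := chi01 v.
by rewrite mulr_ge0//= (le_trans _ h2)// ler_piMr.
Qed.

Lemma windowA0 a k v : N (v 0) <= eps / 2 -> windowA a k v = 0.
Proof. by move=> h; rewrite /windowA chi0// mulr0. Qed.

Lemma window_cvg a : IB (fun b => windowA a k (S0 b)) @[k --> \oo] -->
  IB (fun b => U a (S0 b) * chi (S0 b)).
Proof.
have e20 : 0 < eps / 2 by rewrite divr_gt0.
apply: (IB_cvg (delta := eps / 2) (C := M)) => // [k|b].
  apply: dominated_S0; first exact: measurable_wcont (wcont_windowA a k).
  - exact: windowA_bounds.
  - exact: windowA0.
by apply: cvgM; [apply: cvg_cut_block; exact: psum_tail_path|exact: cvg_cst].
Qed.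

Lemma window_limit : IB (fun b => windowA 0 k (S0 b)) - IB (fun b => windowA 1 k (S0 b)) @[k --> \oo] -->
  IB (fun b => Psi (ct (S1 b))).
Proof.
have -> : IB (fun b => Psi (ct (S1 b))) = IB (fun b => startA (S0 b)) - IB (fun b => startB (S0 b)).
  by rewrite start_difference addrC addKr.
by apply: cvgB; exact: window_cvg.
Qed.

Variable x : nat -> R.
Hypothesis x0 : forall n, 0 < x n.
Hypothesis xoo : x n @[n --> \oo] --> +oo.

Definition exceed_prob (k n : nat) (delta : R) : R :=
  fine (L ([set v | ((delta * x n)%:E < lpnorm N +oo%E (block k%:Z n%:Z v))%E] `&`
           [set v | delta * x n < N (v 0)])).

Hypothesis anticlustering : forall delta : R, 0 < delta ->
  limn_esup (fun n => (exceed_prob k n delta / tailL N L (delta * x n))%:E)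
    @[k --> \oo] --> (0 : \bar R).

Local Notation sc n := (scale (x n)^-1).
Local Notation gA a k n := (fun v => windowA a k (sc n v)).

Lemma measurable_gA a k n : measurable_fun setT (gA a k n : path_space R d -> R).
Proof.
apply: (measurableT_comp (f := windowA a k : path_space R d -> R)).
  exact: measurable_wcont (wcont_windowA a k).
exact: measurable_scale.
Qed.

Lemma window_difference k v :
  Psi (ct (block 0 k%:Z v)) - Psi (ct (block 1 k%:Z v)) = windowA 0 k v - windowA 1 k v.
Proof.
rewrite /windowA -mulrBl; case: (ltP eps (N (v 0))) => h; first by rewrite chi1 ?mulr1.
by rewrite cut_block_succ// subrr mul0r.
Qed.

Lemma measurable_gP a (k : int) n :
  measurable_fun setT (fun v : path_space R d => Psi (ct (block a k (sc n v)))).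
Proof.
apply: (measurableT_comp (f := (fun v => Psi (ct (block a k v))) : path_space R d -> R)).
  by apply: measurable_wcont; exact: wcont_cut_block.
exact: measurable_scale.
Qed.

Lemma window_start (m n : nat) :
  EL L (fun v => Psi (ct (block 1 m.+1%:Z (sc n v)))) = EL L (fun v => Psi (ct (block 0 m%:Z (sc n v)))).
Proof.
rewrite -(@EL_bshift _ _ L L_shift 1 (fun v => Psi (ct (block 1 m.+1%:Z (sc n v)))) M); last 2 first.
- exact: measurable_gP.
- by move=> v; exact: PsiM.
congr EL; apply/funext => v.
rewrite -bshift_scale block_bshift /cutoff pathmap_bshift Psi_shift subrr.
by congr (Psi (pathmap _ (block _ _ _))); lia.
Qed.

Lemma EL_integrable C f : measurable_fun setT (f : path_space R d -> R) ->
  (forall v, `|f v| <= C) -> L.-integrable setT (EFin \o f).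
Proof.
move=> mf fC; apply: (bounded_integrable (M := C)) => //.
by apply: (@le_lt_trans _ _ 1%E); [exact: probability_le1|exact: ltry].
Qed.

Lemma ELB C f g : measurable_fun setT (f : path_space R d -> R) ->
  measurable_fun setT (g : path_space R d -> R) ->
  (forall v, `|f v| <= C) -> (forall v, `|g v| <= C) ->
  EL L (fun v => f v - g v) = EL L f - EL L g.
Proof.
move=> mf mg fC gC; have fi := EL_integrable mf fC; have gi := EL_integrable mg gC.
rewrite /EL -fineB; last 2 first.
- exact: integrable_fin_num.
- exact: integrable_fin_num.
congr fine; rewrite -(integralB measurableT fi gi).
by apply: eq_integral => v _.
Qed.

Lemma EL_abs_le C f (E : set (path_space R d)) : 0 <= C -> measurable_fun setT (f : path_space R d -> R) ->
  measurable E -> (forall v, `|f v| <= C * (\1_E v : R)) -> `|EL L f| <= C * fine (L E).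
Proof.
move=> C0 mf mE fC.
have fi : L.-integrable setT (EFin \o f).
  apply: (EL_integrable (C := C)) => // v; apply: le_trans (fC v) _.
  by rewrite ler_piMr// indicE; case: (_ \in _).
have LE : L E \is a fin_num.
  by rewrite ge0_fin_numE// (le_lt_trans (probability_le1 _ mE)) ?ltry.
rewrite -lee_fin EFinM fineK// /EL -fine_abse ?integrable_fin_num// fineK ?abse_fin_num ?integrable_fin_num//.
apply: le_trans (le_abse_integral _ _ _) _ => //; first by apply/measurable_EFinP.
have -> : (C%:E * L E = \int[L]_v (C * (\1_E v : R))%:E)%E.
  under eq_integral do rewrite EFinM.
  rewrite ge0_integralZl//; last by apply/measurable_EFinP; exact: measurable_indic.
  by rewrite integral_indic// setIT.
apply: ge0_le_integral => //.
- by apply: measurableT_comp => //; apply/measurable_EFinP.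
- by apply/measurable_EFinP; apply: measurable_funM => //; exact: measurable_indic.
- by move=> v _; rewrite lee_fin.
Qed.

Let abs_bound (f : pathZ R d -> R) : (forall v, 0 <= f v <= M) -> forall v, `|f v| <= M.
Proof. by move=> fM v; have /andP[h1 h2] := fM v; rewrite ger0_norm. Qed.

Definition start_mean (k n : nat) : R := EL L (gA 0 k n) - EL L (gA 1 k n).

Lemma start_meanE k n : start_mean k n =
  EL L (fun v => Psi (ct (block 0 k%:Z (sc n v)))) - EL L (fun v => Psi (ct (block 1 k%:Z (sc n v)))).
Proof.
have A a := measurable_gA a k n; have B a := measurable_gP a k%:Z n.
have Ab a v : `|windowA a k (sc n v)| <= M by apply: abs_bound; exact: windowA_bounds.
have Bb a v : `|Psi (ct (block a k%:Z (sc n v)))| <= M by apply: abs_bound => v'; exact: PsiM.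
rewrite /start_mean -(ELB (A 0) (A 1) (Ab 0) (Ab 1)) -(ELB (B 0) (B 1) (Bb 0) (Bb 1)).
by congr EL; apply/funext => v; rewrite -window_difference.
Qed.

(** [start_mean k] compares the blocks over [0, k] and [1, k]. By stationarity the latter is
    distributed as the block over [0, k-1], so that a sum over starting times becomes a sum over
    lengths, all seen from time 0. *)
Lemma telescope_mean m n :
  EL L (fun v => Psi (ct (block 0 m%:Z (sc n v)))) = \sum_(k < m.+1) start_mean k n.
Proof.
elim: m => [|m IHm].
  rewrite big_ord_recr big_ord0/= add0r start_meanE.
  rewrite [X in _ - X](_ : _ = 0) ?subr0//.
  rewrite (_ : (fun v => _) = fun=> 0); first by rewrite /EL integral0.
  apply/funext => v; apply: cut_small => t; rewrite /block ifF; first by rewrite vnorm0 ltW.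
  by lia.
by rewrite big_ord_recr/= -IHm start_meanE window_start addrC subrK.
Qed.

Lemma scale_gt n v t : (eps < N (sc n v t)) = (eps * x n < N (v t)).
Proof. by rewrite vnormZ gtr0_norm ?invr_gt0// mulrC ltr_pdivlMr. Qed.

Definition start_diff k n v : R := windowA 0 k (sc n v) - windowA 1 k (sc n v).

Lemma measurable_start_diff k n : measurable_fun setT (start_diff k n : path_space R d -> R).
Proof. by apply: measurable_funB; exact: measurable_gA. Qed.

Lemma start_mean_diff k n : start_mean k n = EL L (start_diff k n).
Proof.
have Ab a v : `|windowA a k (sc n v)| <= M by apply: abs_bound; exact: windowA_bounds.
by rewrite (ELB (measurable_gA 0 k n) (measurable_gA 1 k n) (Ab 0) (Ab 1)).
Qed.

Lemma start_diff_le k n v : `|start_diff k n v| <= M * (\1_[set v : path_space R d | eps * x n < N (v 0)] v : R).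
Proof.
have -> : \1_[set v : path_space R d | eps * x n < N (v 0)] v = (eps * x n < N (v 0))%R%:R :> R.
  by rewrite indicE mem_setE.
case: ltP => h; last first.
  rewrite /start_diff -window_difference cut_block_succ// ?subrr ?normr0 ?mulr0//.
  by rewrite leNgt scale_gt -leNgt.
rewrite mulr1 /start_diff ler_norml; have /andP[h1 h2] := windowA_bounds 0 k (sc n v).
by have /andP[h3 h4] := windowA_bounds 1 k (sc n v); apply/andP; split; lra.
Qed.

Lemma start_mean_le k n : `|start_mean k n| <= M * tailL N L (eps * x n).
Proof.
rewrite start_mean_diff; apply: EL_abs_le => //.
- exact: measurable_start_diff.
- exact: measurable_tail_set.
- exact: start_diff_le.
Qed.

Definition exceed_set k n : set (path_space R d) :=
  [set v | ((eps * x n)%:E < lpnorm N +oo%E (block k%:Z n%:Z v))%E] `&`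
  [set v | eps * x n < N (v 0)].

Lemma measurable_exceed_set k n : measurable (exceed_set k n).
Proof.
apply: measurableI; last exact: measurable_tail_set.
rewrite -[X in measurable X]setTI; apply: emeasurable_fun_o_infty => //.
apply: (measurableT_comp (f := lpnorm N +oo%E : path_space R d -> \bar R)).
  exact: measurable_lpnorm.
exact: measurable_block.
Qed.

(** If |v_0| is not large, both differences are 0. If it is, then off [exceed_set] all entries in
    [k, n] are cut away, and prolonging the block from k to m changes nothing. *)
Lemma start_diff_close k m n v : (k <= m <= n)%N ->
  `|start_diff m n v - start_diff k n v| <= 2 * M * (\1_(exceed_set k n) v : R).
Proof.
move=> /andP[km mn]; rewrite indicE; case: (boolP (v \in exceed_set k n)) => vE.
  rewrite mulr1 /start_diff.
  have /andP[h1 h2] := windowA_bounds 0 k (sc n v).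
  have /andP[h3 h4] := windowA_bounds 1 k (sc n v).
  have /andP[h5 h6] := windowA_bounds 0 m (sc n v).
  have /andP[h7 h8] := windowA_bounds 1 m (sc n v).
  by rewrite ler_norml; apply/andP; split; lra.
rewrite mulr0; have [h|h] := ltP (eps * x n) (N (v 0)); last first.
  have h' : N (sc n v 0) <= eps by rewrite leNgt scale_gt -leNgt.
  by rewrite /start_diff -!window_difference !cut_block_succ// !subrr normr0.
have hk (t : int) : k%:Z <= t <= n%:Z -> N (sc n v t) <= eps.
  move=> tkn; rewrite leNgt scale_gt; apply/negP => ht.
  move: vE; rewrite notin_setE; apply; split => //=.
  apply: (@lt_le_trans _ _ (N (v t))%:E); first by rewrite lte_fin.
  by apply: ereal_sup_ubound; exists t => //; rewrite /block tkn.
have E (a : int) : ct (block a m%:Z (sc n v)) = ct (block a k%:Z (sc n v)).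
  apply: cut_ext => // t; rewrite /block; case: (boolP (a <= t)) => at_ /=; last by left.
  case: (boolP (t <= k%:Z)) => tk; first by rewrite (le_trans tk)//; left.
  case: ifP => tm; last by left.
  by right; rewrite vnorm0 (ltW eps0); split => //; apply: hk; lia.
by rewrite /start_diff -!window_difference !E subrr normr0.
Qed.

Lemma start_mean_close k m n : (k <= m <= n)%N ->
  `|start_mean m n - start_mean k n| <= 2 * M * exceed_prob k n eps.
Proof.
move=> kmn; rewrite !start_mean_diff.
have b j v : `|start_diff j n v| <= M.
  by apply: le_trans (start_diff_le j n v) _; rewrite ler_piMr// indicE; case: (_ \in _).
rewrite -(ELB (measurable_start_diff m n) (measurable_start_diff k n) (b m) (b k)).
apply: EL_abs_le; first by rewrite mulr_ge0.
- by apply: measurable_funB; exact: measurable_start_diff.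
- exact: measurable_exceed_set.
- by move=> v; exact: start_diff_close.
Qed.

(** The lengths m < k are few and are bounded by the tail alone; for every other length the window
    is shortened to k at the price of [exceed_prob]. *)
Lemma total_mean_close k n : (k <= n)%N ->
  `|EL L (fun v => Psi (ct (block 0 n%:Z (sc n v)))) - n.+1%:R * start_mean k n| <=
  2 * M * (k%:R * tailL N L (eps * x n) + n.+1%:R * exceed_prob k n eps).
Proof.
move=> kn; have ep0 : 0 <= exceed_prob k n eps by exact: fine_ge0.
have tl0 := tailL_ge0 N L (eps * x n).
have -> : n.+1%:R * start_mean k n = \sum_(m < n.+1) start_mean k n.
  by rewrite sumr_const card_ord mulr_natl.
rewrite telescope_mean -sumrB; apply: le_trans (ler_norm_sum _ _ _) _.
apply: (@le_trans _ _ (\sum_(m < n.+1) (2 * M * ((m < k)%N%:R * tailL N L (eps * x n) + exceed_prob k n eps)))).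
  apply: ler_sum => m _; case: (ltnP m k) => mk.
    rewrite mul1r; apply: (@le_trans _ _ (2 * M * tailL N L (eps * x n))).
      rewrite -mulrA mulr2n mulrDl mul1r; apply: le_trans (ler_normB _ _) _.
      by apply: lerD; exact: start_mean_le.
    by apply: ler_wpM2l; [exact: mulr_ge0|rewrite lerDl].
  rewrite mul0r add0r; apply: start_mean_close; rewrite mk/=.
  by rewrite -ltnS.
rewrite -mulr_sumr; apply: ler_wpM2l; first exact: mulr_ge0.
rewrite big_split/=; apply: lerD; last by rewrite sumr_const card_ord mulr_natl.
by rewrite -mulr_suml; apply: ler_wpM2r => //; exact: sum_ltn_le.
Qed.

Lemma small_tail_ratio delta : 0 < delta < 1 ->
  tailL N L (delta * x n) / tailL N L (x n) @[n --> \oo] --> (delta `^ alpha)^-1.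
Proof.
move=> /andP[delta0 delta1].
have dxoo : delta * x n @[n --> \oo] --> +oo.
  have /cvgryPge H := xoo; apply/cvgryPge => A; near=> n.
  by rewrite mulrC -ler_pdivrMr//; near: n; exact: H.
have sd : 1 < delta^-1 by rewrite invf_gt1.
have c2 := cvg_comp _ _ dxoo (tailL_ratio alpha0 mTh Th0 RV sd); rewrite /= in c2.
have dE : delta^-1 `^ (- alpha) = delta `^ alpha.
  by rewrite -(powR_inv1 (ltW delta0)) -powRrM mulN1r opprK.
have da0 : delta `^ alpha != 0 by rewrite gt_eqF// powR_gt0.
rewrite dE in c2; apply: cvg_trans (cvgV da0 c2).
apply: near_eq_cvg; apply: nearW => n /=.
by rewrite mulrA mulVf ?gt_eqF// mul1r invf_div.
Unshelve. all: by end_near. Qed.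

(** The mean over n + 1 starting times is close to n times that of a window of fixed length k, to
    which [vague_cvg] applies; the limit in k is [window_limit]. *)
Lemma cut_functional_cvg :
  EL L (fun v => Psi (ct (block 0 n%:Z (sc n v)))) / (n%:R * tailL N L (x n)) @[n --> \oo] -->
  IB (fun b => Psi (ct (S1 b))).
Proof.
(* s is the limit of the ratio of the tails at eps x_n and x_n. The product 2 M (s + 1) collects the
   bounds to come, and the summand 1 keeps C positive. *)
set J := IB _; pose s : R := (eps `^ alpha)^-1; pose C : R := 2 * M * (s + 1) + 1.
have s0 : 0 <= s by rewrite invr_ge0 powR_ge0.
have C0 : 0 < C by rewrite ltr_wpDl// !mulr_ge0// addr_ge0.
apply/cvgrPdist_lt => e e0.
have e40 : 0 < e / 4 by rewrite divr_gt0.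
have e80 : 0 < e / (8 * C) by rewrite divr_gt0// mulr_gt0.
pose Jk k := IB (fun b => windowA 0 k (S0 b)) - IB (fun b => windowA 1 k (S0 b)).
(* One window length serves twice, for the limit over windows and for anticlustering; it is fixed
   before n grows. *)
have [k [k1 k2]] : exists k, `|J - Jk k| < e / 4 /\
    (limn_esup (fun n => (exceed_prob k n eps / tailL N L (eps * x n))%:E) < (e / (8 * C))%:E)%E.
  have H1 : \forall k \near \oo, `|J - Jk k| < e / 4.
    by have /cvgrPdist_lt := window_limit; exact.
  have H2 : \forall k \near \oo, (limn_esup (fun n => (exceed_prob k n eps / tailL N L (eps * x n))%:E) < (e / (8 * C))%:E)%E.
    have H := anticlustering eps0.
    by apply: (H _ (open_ereal_lt' _)); rewrite lte_fin.
  by have [k [h1 h2]] := filter_ex (filterI H1 H2); exists k.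
have e2 : 0 < eps / 2 < 1 by rewrite divr_gt0//= ltr_pdivrMr// mul1r; case/andP: eps01 => h1 h2; lra.
have V a := vague_cvg alpha0 mTh Th0 RV (wcont_windowA a k) (windowA_bounds a k) e2 (windowA0 a k) x0 xoo.
have sm : start_mean k n / tailL N L (x n) @[n --> \oo] --> Jk k.
  by under eq_cvg do rewrite /start_mean mulrBl; exact: cvgB (V 0) (V 1).
have q_small := near_lt_limn_esup k2.
have ratio := small_tail_ratio eps01.
near=> n.
have n0 : (0 < n)%N by near: n; exact: nbhs_infty_gt.
have nk : (k <= n)%N by near: n; exact: nbhs_infty_ge.
have n0' : 0 < n%:R :> R by rewrite ltr0n.
have h1 : `|Jk k - start_mean k n / tailL N L (x n)| < e / 4.
  by near: n; move/cvgrPdist_lt: sm; exact.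
have h2 : ((exceed_prob k n eps / tailL N L (eps * x n))%:E < (e / (8 * C))%:E)%E.
  by near: n; exact: q_small.
have h3 : tailL N L (eps * x n) / tailL N L (x n) < s + 1.
  near: n; move/cvgrPdist_lt: ratio => /(_ _ ltr01); apply: filterS => n.
  by rewrite ltr_norml => /andP[h _]; rewrite /s; lra.
have h4 : k.+1%:R / n%:R < e / (8 * C).
  rewrite ltr_pdivrMr// mulrC -ltr_pdivrMr//; near: n; exact: nbhs_infty_gtr.
have t1 : 0 < tailL N L (x n) by exact: (tailL_gt0 alpha0 RV).
have t2 : 0 < tailL N L (eps * x n) by exact: (tailL_gt0 alpha0 RV).
have E0 : 0 <= exceed_prob k n eps by exact: fine_ge0.
have B := total_mean_close nk; have B' := start_mean_le k n.
move: h2; rewrite lte_fin ltr_pdivrMr// => h2.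
move: h3; rewrite ltr_pdivrMr// => h3.
move: h4; rewrite ltr_pdivrMr// => h4.
suff key : `|EL L (fun v => Psi (ct (block 0 n%:Z (sc n v)))) / (n%:R * tailL N L (x n)) -
    start_mean k n / tailL N L (x n)| < e / 2.
  have -> : J - EL L (fun v => Psi (ct (block 0 n%:Z (sc n v)))) / (n%:R * tailL N L (x n)) =
    (J - Jk k) + (Jk k - start_mean k n / tailL N L (x n)) -
    (EL L (fun v => Psi (ct (block 0 n%:Z (sc n v)))) / (n%:R * tailL N L (x n)) -
     start_mean k n / tailL N L (x n)) by ring.
  apply: le_lt_trans (ler_normB _ _) _; apply: le_lt_trans (lerD (ler_normD _ _) (lexx _)) _.
  by rewrite (_ : e = e / 4 + e / 4 + e / 2); [apply: ltrD => //; exact: ltrD|field].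
have -> : start_mean k n / tailL N L (x n) = n%:R * start_mean k n / (n%:R * tailL N L (x n)).
  by field; rewrite !gt_eqF.
have nt0 : 0 < n%:R * tailL N L (x n) by exact: mulr_gt0.
rewrite -mulrBl normrM (gtr0_norm (_ : 0 < (_)^-1)) ?invr_gt0// ltr_pdivrMr//.
set phi := EL L _ in B *; set mn := start_mean k n in B B' *.
set T := tailL N L (eps * x n) in B B' h2 h3 t2 *; set t := tailL N L (x n) in h3 t1 nt0 *.
set E := exceed_prob k n eps in B h2 E0 *.
have n1 : 1 <= n%:R :> R by rewrite ler1n.
(* There are n + 1 starting times but the normalization counts n. The surplus term is a single
   [start_mean], bounded by the tail like those of the short blocks. *)
have tri : `|phi - n%:R * mn| <= `|phi - n.+1%:R * mn| + `|mn|.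
  have -> : phi - n%:R * mn = (phi - n.+1%:R * mn) + mn by rewrite -natr1; ring.
  exact: ler_normD.
have Ce : e / (8 * C) * C = e / 8 by field; rewrite gt_eqF.
move: h2 h4 Ce (ltW e80); set g := e / (8 * C) => h2 h4 Ce g0.
have step1 : `|phi - n%:R * mn| <= 2 * M * (k.+1%:R * T + (2 * n%:R) * E).
  apply: le_trans tri _; apply: le_trans (lerD B B') _.
  have : 2 * M * (n.+1%:R * E) <= 2 * M * (2 * n%:R * E).
    by apply: ler_wpM2l; [exact: mulr_ge0|apply: ler_wpM2r => //; rewrite -natr1; lra].
  have : 0 <= M * T by rewrite mulr_ge0// ltW.
  have -> : 2 * M * (k.+1%:R * T + 2 * n%:R * E) = 2 * M * (k%:R * T) + 2 * (M * T) + 2 * M * (2 * n%:R * E).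
    by rewrite -natr1; ring.
  move=> p1 p2; rewrite [2 * M * (_ + _)]mulrDr addrAC; apply: lerD => //.
  by rewrite lerD2l ler_peMl// ler1n.
apply: (le_lt_trans step1).
have step2 : k.+1%:R * T + (2 * n%:R) * E <= 3 * g * n%:R * T.
  have : k.+1%:R * T <= g * n%:R * T by rewrite ler_wpM2r// ltW.
  have : n%:R * E <= n%:R * (g * T) by rewrite ler_wpM2l// ltW.
  have -> : 3 * g * n%:R * T = g * n%:R * T + 2 * (n%:R * (g * T)) by ring.
  by move=> p1 p2; rewrite -mulrA lerD// ler_wpM2l.
apply: (@le_lt_trans _ _ (2 * M * (3 * g * n%:R * ((s + 1) * t)))).
  apply: ler_wpM2l; first exact: mulr_ge0.
  apply: le_trans step2 _; apply: ler_wpM2l; last exact: ltW.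
  by apply: mulr_ge0; [exact: mulr_ge0|exact: ltW].
have -> : 2 * M * (3 * g * n%:R * ((s + 1) * t)) = 3 * (g * (C - 1)) * (n%:R * t) by rewrite /C; ring.
rewrite mulrC [X in _ < X]mulrC ltr_pM2l//.
by rewrite mulrBr mulr1 Ce; lra.
Unshelve. all: by end_near. Qed.

End cut_limit.

(** * Lipschitz functionals of the modulus and of random paths *)

Section good_functionals.
Context (R : realType) (d : nat) (N : vnorm R d) (p : \bar R).
Hypothesis p0 : (0 < p)%E.
Local Notation md := (modulus N p).
Implicit Types (v : pathZ R d).

Lemma modulus_fin v : (md v < +oo)%E -> md v \is a fin_num.
Proof. by move=> h; rewrite ge0_fin_numE ?modulus_ge0. Qed.

Lemma fine_modulus_dist v u : (md v < +oo)%E -> (md u < +oo)%E ->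
  `|fine (md v) - fine (md u)| <= fine (md (pathB v u)).
Proof.
have h (w w' : pathZ R d) : (md w < +oo)%E -> (md w' < +oo)%E ->
    fine (md w) - fine (md w') <= fine (md (pathB w w')).
  move=> wf wf'; have bf := modulusB_lty p0 wf wf'.
  rewrite lerBlDr -lee_fin EFinD !fineK ?modulus_fin//.
  have -> : w = padd (pathB w w') w' by apply/funext => t; rewrite /padd /pathB subrK.
  apply: le_trans (modulusD _ _ _ p0) _.
  by apply: leeD => //; apply: le_modulus => // t; rewrite /padd /pathB addrK.
move=> vf uf; rewrite ler_norml h// andbT lerNl opprB.
by rewrite (modulus_distC N v u p0) h.
Qed.

Lemma good_modulus (h : R -> R) L M : (forall s, 0 <= h s <= M) ->
  (forall s t, `|h s - h t| <= L * `|s - t|) -> 0 <= L ->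
  good_functional N p L M (fun v => h (fine (md v))).
Proof.
move=> hM hL L0; split.
- by move=> v; exact: hM.
- by move=> k v; rewrite modulus_bshift.
- move=> v u vf uf; apply: le_trans (hL _ _) _.
  by apply: ler_wpM2l => //; exact: fine_modulus_dist.
Qed.

Lemma vanishing_map (h : 'rV[R]_d -> 'rV[R]_d) v : (forall u, N (h u) <= N u) ->
  vanishing N v -> vanishing N (pathmap h v).
Proof.
move=> hN vv e e0; have [K HK] := vv e e0; exists K => t /HK; apply: le_trans.
exact: hN.
Qed.

Variables (L M : R) (Psi : pathZ R d -> R).
Hypothesis gPsi : good_functional N p L M Psi.

Lemma good_close v u eta : (md v < +oo)%E -> (md u < +oo)%E -> (md (pathB v u) <= eta%:E)%E ->
  `|Psi v - Psi u| <= `|L| * eta.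
Proof.
move=> vf uf vu; have [_ _ h] := gPsi; apply: le_trans (h v u vf uf) _.
have bf := modulusB_lty p0 vf uf.
apply: (@le_trans _ _ (`|L| * fine (md (pathB v u)))).
  by apply: ler_wpM2r; rewrite ?fine_ge0 ?modulus_ge0 ?ler_norm.
by apply: ler_wpM2l => //; rewrite -lee_fin fineK ?modulus_fin.
Qed.

Lemma good_cvg v (u : nat -> pathZ R d) : (md v < +oo)%E -> (forall n, (md (u n) < +oo)%E) ->
  (forall e, 0 < e -> \forall n \near \oo, (md (pathB v (u n)) < e%:E)%E) ->
  Psi (u n) @[n --> \oo] --> Psi v.
Proof.
move=> vf uf vu; apply/cvgrPdist_lt => e e0.
have c0 : 0 < e / (`|L| + 1) by rewrite divr_gt0// ltr_wpDl.
have := vu _ c0; apply: filterS => n /ltW /(good_close vf (uf n)) h.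
apply: le_lt_trans h _; rewrite mulrA ltr_pdivrMr; last by rewrite ltr_wpDl.
by rewrite mulrC ltr_pM2l// ltrDl.
Qed.

Variable h : 'rV[R]_d -> 'rV[R]_d.
Hypothesis hc : ncontinuous N h.
Hypothesis hN : forall u, N (h u) <= N u.

Let h0 : h 0 = 0.
Proof. by apply: (@vnorm_eq0 _ _ N); apply/eqP; rewrite eq_le vnorm_ge0 andbT -[leRHS](vnorm0 N). Qed.

Lemma wcont_good_block (a k : int) : wcont (fun v => Psi (pathmap h (block a k v))).
Proof.
have [n hn] : exists n : nat, k < a + n%:Z by exists (`|k - a|.+1)%N; lia.
rewrite (_ : (fun v => _) = (fun v => wfun Psi h a k a (window a n v))).
  apply: (@wcont_window _ _ a n (@wfun R d Psi h a k a n)).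
  by apply: wfun_continuous; [exact: p0|exact: gPsi| |].
by apply/funext => v; rewrite wfunE.
Qed.

Lemma modulus_map_le v : (md (pathmap h v) <= md v)%E.
Proof. by apply: le_modulus => // t; exact: hN. Qed.

Lemma cvg_good_block v : (md v < +oo)%E -> vanishing N v ->
  Psi (pathmap h (block (- k%:Z) k%:Z v)) @[k --> \oo] --> Psi (pathmap h v).
Proof.
move=> vf vv; have hf := le_lt_trans (modulus_map_le v) vf.
apply: good_cvg => // [n|e e0].
  by apply: le_lt_trans (modulus_map_le _) _; exact: modulus_block_lty.
have [K HK] := modulus_tail p0 hf (vanishing_map hN vv) e0.
by near=> k; rewrite pathmap_block//; apply: HK; near: k; exact: nbhs_infty_ge.
Unshelve. all: by end_near. Qed.

(** Measurability of [Psi] on the whole path space is not at hand. Along a map with values of finite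
    modulus and decaying entries, [Psi] is a limit of continuous functions of windows. *)
Lemma measurable_good d' (T : measurableType d') (F : T -> pathZ R d) :
  measurable_fun setT (F : T -> path_space R d) -> (forall b, (md (F b) < +oo)%E) ->
  (forall b, vanishing N (F b)) -> measurable_fun setT (fun b => Psi (pathmap h (F b))).
Proof.
move=> mF Ff Fv; apply: (@measurable_fun_cvg _ _ _ _ (fun (k : nat) b => Psi (pathmap h (block (- k%:Z) k%:Z (F b))))).
  move=> k; apply: (measurableT_comp (f := (fun v => Psi (pathmap h (block (- k%:Z) k%:Z v))) : path_space R d -> R)) => //.
  by apply: measurable_wcont; exact: wcont_good_block.
by move=> b _; exact: cvg_good_block.
Qed.

End good_functionals.

(** * Removing the cut-off *)

Section path_approximation.
Context (R : realType) (d : nat) (N : vnorm R d) (p : \bar R).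
Hypothesis p0 : (0 < p)%E.
Local Notation md := (modulus N p).
Implicit Types (v u : pathZ R d).

(** Total, with a default value off ell^p, so that functions on ell^p and on its quotient can be
    evaluated at any path. *)
Definition toell v : ell N p :=
  if pselect (lpnorm N p v < +oo)%E is left h then exist _ v h else point.

Lemma toellK v : (lpnorm N p v < +oo)%E -> ell_val (toell v) = v.
Proof. by move=> h; rewrite /toell; case: pselect. Qed.

Lemma ell_valK (x : ell N p) : toell (ell_val x) = x.
Proof.
rewrite /toell; case: pselect => [h|]; last by case; exact: (svalP x).
by apply: val_inj.
Qed.

Lemma ell_md (x : ell N p) : (md (ell_val x) < +oo)%E.
Proof. by rewrite modulus_lty//; exact: (svalP x). Qed.

Definition rdist (x y : ell N p) : R := fine (md (pathB (ell_val x) (ell_val y))).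

Lemma rdistE (x y : ell N p) : (rdist x y)%:E = elldist x y.
Proof. by rewrite /rdist fineK// modulus_fin//; apply: modulusB_lty => //; exact: ell_md. Qed.

Lemma rdist_ge0 x y : 0 <= rdist x y.
Proof. by rewrite fine_ge0// modulus_ge0. Qed.

Lemma rdistxx x : rdist x x = 0.
Proof. by rewrite /rdist modulus0// => t; rewrite /pathB subrr. Qed.

Lemma rdistC x y : rdist x y = rdist y x.
Proof. by rewrite /rdist modulus_distC. Qed.

Lemma rdist_tri x y z : rdist x z <= rdist x y + rdist y z.
Proof. by rewrite -lee_fin EFinD !rdistE; exact: modulusB. Qed.

Variables (F : pathZ R d -> R) (M : R).
Hypothesis FM : forall v, 0 <= F v <= M.
Hypothesis F_shift : forall k v, F (bshift k v) = F v.
Hypothesis F_lsc : forall v e, (md v < +oo)%E -> 0 < e ->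
  exists2 r, 0 < r & forall u, (md u < +oo)%E -> (md (pathB v u) < r%:E)%E -> F v - e < F u.

Let FE (x : ell N p) : R := F (ell_val x).
Let FEM x : 0 <= FE x <= M. Proof. exact: FM. Qed.

(** The infimum runs over ell^p, where all distances are finite; the value 0 elsewhere keeps it
    bounded and shift-invariant. *)
Definition path_infconv (k : nat) v : R :=
  if (md v < +oo)%E then infconv rdist FE k%:R (toell v) else 0.

Lemma path_infconvE k v : (md v < +oo)%E -> path_infconv k v = infconv rdist FE k%:R (toell v).
Proof. by move=> h; rewrite /path_infconv h. Qed.

Lemma path_infconv_le k v : (md v < +oo)%E -> path_infconv k v <= F v.
Proof.
move=> h; rewrite path_infconvE//.
apply: le_trans (infconv_le_fun rdist_ge0 rdistxx FEM (toell v) (ler0n R k)) _.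
by rewrite /FE toellK// -modulus_lty.
Qed.

Lemma path_infconv_cvg v : (md v < +oo)%E -> path_infconv k v @[k --> \oo] --> F v.
Proof.
move=> vf; have vK : ell_val (toell v) = v by rewrite toellK// -modulus_lty.
have : infconv rdist FE k%:R (toell v) @[k --> \oo] --> FE (toell v).
  apply: (infconv_cvg rdist_ge0 rdistxx FEM) => e e0.
  have [r r0 Hr] := F_lsc (ell_md (toell v)) e0; exists r => // y.
  by rewrite -lte_fin rdistE => h; apply: Hr => //; exact: ell_md.
rewrite /FE vK; apply: cvg_trans; apply: near_eq_cvg; apply: nearW => k.
by rewrite path_infconvE.
Qed.

(** Shift invariance is the point: shifts are isometries of ell^p that preserve [F], so the infimum
    at a shifted path can be reindexed by shifting the competitor back. *)
Lemma good_path_infconv k : good_functional N p k%:R M (path_infconv k).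
Proof.
have k0 := ler0n R k.
have M0 : 0 <= M by have /andP[h1 h2] := FM (fun=> 0); exact: le_trans h2.
have lip v u : (md v < +oo)%E -> (md u < +oo)%E ->
    path_infconv k v <= path_infconv k u + k%:R * fine (md (pathB v u)).
  move=> vf uf; rewrite !path_infconvE//.
  apply: le_trans (infconv_lipschitz rdist_ge0 rdist_tri FEM _ (toell u) k0) _.
  by rewrite /rdist !toellK// -modulus_lty.
split.
- move=> v; rewrite /path_infconv; case: ifP => _; last by rewrite lexx.
  exact: (infconv_bound rdist_ge0 rdistxx FEM).
- have h l v : (md v < +oo)%E -> path_infconv k v <= path_infconv k (bshift l v).
    move=> vf; have bf : (md (bshift l v) < +oo)%E by rewrite modulus_bshift.
    rewrite [leRHS]path_infconvE//; apply: infconv_ge => y.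
    have yf : (md (bshift (- l) (ell_val y)) < +oo)%E by rewrite modulus_bshift ell_md.
    rewrite path_infconvE//.
    apply: le_trans (infconv_le rdist_ge0 FEM (toell v) (toell (bshift (- l) (ell_val y))) k0) _.
    rewrite /FE /rdist !toellK -?modulus_lty// F_shift lerD2l ler_wpM2l//.
    rewrite -(modulus_bshift N p (- l) (pathB (bshift l v) _)).
    rewrite (_ : bshift (- l) (pathB (bshift l v) (ell_val y)) = pathB v (bshift (- l) (ell_val y)))//.
    by apply/funext => t; rewrite /bshift /pathB opprK addrK.
  move=> l v; have [vf|vf] := boolP (md v < +oo)%E.
    have h' := h (- l) (bshift l v); rewrite bshiftD addNr bshift0 modulus_bshift in h'.
    by apply/eqP; rewrite eq_le h// h'.
  by rewrite /path_infconv modulus_bshift (negbTE vf).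
- move=> v u vf uf; rewrite ler_norml; apply/andP; split.
    rewrite lerBrDr addrC lerBlDr; apply: le_trans (lip u v uf vf) _.
    by rewrite (modulus_distC N u v p0).
  by rewrite lerBlDr addrC; exact: lip.
Qed.

End path_approximation.

(** * Integrals with respect to beta *)

Section beta_integrals.
Context (R : realType) (alpha : R).
Context (dT : measure_display) (OT : measurableType dT) (PT : probability OT R).
Local Notation leb := (@lebesgue_measure R).
Local Notation beta := (leb \x PT)%E.
Implicit Types (f g : R * OT -> R).

Definition betaI f := [the measure _ _ of beta].-integrable setT (EFin \o f).

Lemma betaI_le f g : measurable_fun setT f -> (forall b, `|f b| <= g b) -> betaI g -> betaI f.
Proof.
move=> mf fg; apply: le_integrable => //; first by apply/measurable_EFinP; exact: mf.
by move=> b _ /=; rewrite lee_fin (le_trans (fg b))// ler_norm.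
Qed.

Lemma betaI_fin f : betaI f -> (\int[beta]_b (f b)%:E)%E \is a fin_num.
Proof. by move=> fi; exact: integrable_fin_num fi. Qed.

Lemma betaI_IBE f : betaI f -> (IB PT f)%:E = (\int[beta]_b (f b)%:E)%E.
Proof. by move=> fi; rewrite fineK// betaI_fin. Qed.

Lemma le_IB f g : betaI f -> betaI g -> (forall b, f b <= g b) -> IB PT f <= IB PT g.
Proof.
move=> fi gi fg; rewrite -lee_fin !betaI_IBE//.
by apply: le_integral => // b _; rewrite lee_fin.
Qed.

Lemma IB_dct (f_ : nat -> R * OT -> R) f g : (forall n, measurable_fun setT (f_ n)) ->
  (forall b, f_ n b @[n --> \oo] --> f b) -> (forall n b, `|f_ n b| <= g b) -> betaI g ->
  betaI f /\ IB PT (f_ n) @[n --> \oo] --> IB PT f.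
Proof.
move=> mf_ ff fg gi.
have mf : measurable_fun setT f.
  by apply: (measurable_fun_cvg mf_) => b _; exact: ff.
have [|||||int_f _ cv] := @dominated_convergence _ _ _ [the measure _ _ of beta] setT measurableT
  (fun n b => (f_ n b)%:E) (fun b => (f b)%:E) (fun b => (g b)%:E).
- by move=> n; apply/measurable_EFinP; exact: mf_.
- by apply/measurable_EFinP; exact: mf.
- by apply: aeW => b _; apply: cvg_EFin; [exact: nearW|exact: ff].
- exact: gi.
- by apply: aeW => b n _; rewrite lee_fin.
have fin := integrable_fin_num measurableT int_f.
by split=> //; apply: fine_cvg; rewrite fineK.
Qed.

Lemma IB_indic (E : set (R * OT)) : measurable E -> IB PT (\1_E) = fine (beta E).
Proof. by move=> mE; rewrite /IB integral_indic// setIT. Qed.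

Lemma betaI_indic (E : set (R * OT)) C : measurable E -> (beta E < +oo)%E ->
  betaI (fun b => C * \1_E b).
Proof.
move=> mE fE; rewrite /betaI (_ : EFin \o _ = (fun b => C%:E * (\1_E b : R)%:E)%E)//.
apply: integrableZl => //; apply/integrableP; split.
  by apply/measurable_EFinP; exact: measurable_indic.
under eq_integral do rewrite gee0_abs ?lee_fin//.
by rewrite integral_indic// setIT.
Qed.

Lemma IB_add f g : betaI f -> betaI g -> IB PT (fun b => f b + g b) = IB PT f + IB PT g.
Proof.
move=> fi gi; have fn := betaI_fin fi; have gn := betaI_fin gi.
rewrite /IB -fineD//; congr fine; rewrite -(integralD measurableT fi gi).
by apply: eq_integral => b _.
Qed.

Lemma IBZ_indic (E : set (R * OT)) C : 0 <= C -> measurable E -> (beta E < +oo)%E -> IB PT (fun b => C * \1_E b) = C * fine (beta E).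
Proof.
move=> C0 mE fE; rewrite /IB; under eq_integral do rewrite EFinM.
rewrite ge0_integralZl//; last by apply/measurable_EFinP; exact: measurable_indic.
by rewrite integral_indic// setIT fineM// ge0_fin_numE.
Qed.

End beta_integrals.

(** * The cluster index and exceedances of the norm *)

Section cluster_limit.
Context (R : realType) (d : nat) (N : vnorm R d) (alpha : R) (p : \bar R).
Context (dT : measure_display) (OT : measurableType dT) (PT : probability OT R).
Variables (Th : OT -> pathZ R d) (L : probability (path_space R d) R).
Hypothesis alpha0 : 0 < alpha.
Hypothesis p0 : (0 < p)%E.
Hypothesis mTh : measurable_fun setT (Th : OT -> path_space R d).
Hypothesis Th0 : forall w, N (Th w 0) = 1.
Hypothesis L_shift : forall k (A : set (path_space R d)), measurable A -> L (bshift k @^-1` A) = L A.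

Local Notation leb := (@lebesgue_measure R).
Local Notation rd := (pradius alpha).
Local Notation beta := (leb \x PT)%E.
Local Notation S0 := (tail_path alpha Th).
Local Notation md := (modulus N p).
Local Notation q := (mexp p).
Implicit Types (v : pathZ R d) (b : R * OT).

Hypothesis RV : forall f M, wcont f -> (forall v, 0 <= f v <= M) ->
  EL L (fun v => f (scale u^-1 v) * (u < N (v 0))%R%:R) / tailL N L u @[u --> +oo] -->
  fine (\int[beta]_b (f (S0 b) * (1 < rd b.1)%R%:R)%:E)%E.

Hypothesis Th_psum : forall w, (psum N alpha (Th w) < +oo)%E.
Hypothesis Th_md : forall w, (md (Th w) < +oo)%E.

Local Notation S1 := (cluster_path N alpha Th).

(* |Theta|_p / |Theta|_alpha *)
Definition norm_ratio w : R := fine (lpnorm N p (Th w)) / anorm N alpha Th w.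

Local Notation kap := norm_ratio.

Definition cluster_index : \bar R := (\int[PT]_w (kap w `^ alpha)%:E)%E.

Local Notation c := cluster_index.

Let an0 w : 0 < anorm N alpha Th w. Proof. exact: anorm_gt0. Qed.

Lemma lpnorm_Th_fin w : lpnorm N p (Th w) \is a fin_num.
Proof. by rewrite ge0_fin_numE ?lpnorm_ge0// -modulus_lty. Qed.

Lemma norm_ratio_gt0 w : 0 < kap w.
Proof.
rewrite divr_gt0//; apply: (@lt_le_trans _ _ 1) => //.
by rewrite -(Th0 w) -lee_fin fineK ?lpnorm_Th_fin// lpnorm_ge.
Qed.

Lemma measurable_norm_ratio : measurable_fun setT kap.
Proof.
apply: measurable_funM.
  apply: (measurableT_comp (f := fine)) => //.
  by apply: (measurableT_comp (f := lpnorm N p : path_space R d -> _)) => //; exact: measurable_lpnorm.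
rewrite (_ : (fun w => _) = (fun w => anorm N alpha Th w `^ (-1))); last first.
  by apply/funext => w; rewrite powR_inv1// ltW.
apply: (measurableT_comp (f := fun y : R => y `^ (-1))); first exact: measurable_powR.
exact: measurable_anorm.
Qed.

(** The integrand is positive everywhere, so a zero integral would make the whole probability space
    negligible. *)
Lemma cluster_index_gt0 : (0 < c)%E.
Proof.
rewrite lt_neqAle integral_ge0 ?andbT; last by move=> w _; rewrite lee_fin powR_ge0.
apply/negP => /eqP c0.
have mk : measurable_fun setT (fun w => (kap w `^ alpha)%:E).
  apply/measurable_EFinP; apply: (measurableT_comp (f := fun y : R => y `^ alpha)).
    exact: measurable_powR.
  exact: measurable_norm_ratio.
have : (\int[PT]_w `|(kap w `^ alpha)%:E| = 0)%E.
  by rewrite c0; apply: eq_integral => w _; rewrite gee0_abs// lee_fin powR_ge0.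
move/(ae_eq_integral_abs PT measurableT mk) => ae0.
have [A [mA A0 TA]] : PT.-negligible [set: OT].
  apply: (negligibleS _ ae0) => w _ /= H.
  have h : kap w `^ alpha = 0 by apply: EFin_inj; exact: H.
  by have := powR_gt0 alpha (norm_ratio_gt0 w); rewrite h ltxx.
have : (PT [set: OT] <= PT A)%E by apply: le_measure; rewrite ?inE.
by rewrite A0 probability_setT lee_fin ler10.
Qed.

Lemma lpnorm_cluster b : lpnorm N p (S1 b) = (rd b.1 * kap b.2)%:E.
Proof.
rewrite lpnormZ// ger0_norm; last by rewrite divr_ge0// ltW ?pradius_gt0.
by rewrite -[lpnorm N p (Th b.2)]fineK ?lpnorm_Th_fin// -EFinM /kap mulrAC mulrA.
Qed.

Lemma cluster_md b : md (S1 b) = ((rd b.1 * kap b.2) `^ q)%:E.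
Proof. by rewrite modulusE// lpnorm_cluster poweR_EFin. Qed.

Lemma cluster_md_lty b : (md (S1 b) < +oo)%E.
Proof. by rewrite cluster_md ltry. Qed.

Lemma cluster_vanishing b : vanishing N (S1 b).
Proof. by apply: (psum_vanishing alpha0); exact: psum_cluster. Qed.

Let mS1 : measurable_fun setT (S1 : _ -> path_space R d).
Proof. exact: measurable_cluster_path. Qed.

Lemma measurable_cluster_md : measurable_fun setT (fun b => fine (md (S1 b))).
Proof.
apply: (measurableT_comp (f := fine)) => //.
by apply: (measurableT_comp (f := md : path_space R d -> _)) => //; exact: measurable_modulus.
Qed.

Definition md_set (r : R) : set (R * OT) := [set b | r < fine (md (S1 b))].

Lemma measurable_md_set r : measurable (md_set r).
Proof. by apply: measurable_ltr_set => //; exact: measurable_cluster_md. Qed.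

(** With y = r^(1/q), the event at fixed Theta is that the radius exceeds y divided by [kap]. Its
    mass y^(-alpha) [kap]^alpha is then integrated over Theta. *)
Lemma beta_md_set r : 0 < r -> beta (md_set r) = (((r `^ q^-1) `^ (- alpha))%:E * c)%E.
Proof.
move=> r0; have q0 := mexp_gt0 p0; pose y := r `^ q^-1.
have y0 : 0 < y by rewrite powR_gt0.
transitivity (\int[beta]_b (\1_(md_set r) b : R)%:E)%E.
  by rewrite integral_indic ?setIT//; exact: measurable_md_set.
rewrite integral_beta//; last first.
  by apply/measurable_EFinP; apply: measurable_indic; exact: measurable_md_set.
rewrite /c -ge0_integralZl//; last 3 first.
- apply/measurable_EFinP; apply: (measurableT_comp (f := fun y : R => y `^ alpha)).
    exact: measurable_powR.
  exact: measurable_norm_ratio.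
- by move=> w _; rewrite lee_fin powR_ge0.
- by rewrite lee_fin powR_ge0.
apply: eq_integral => w _; have k0 := norm_ratio_gt0 w.
transitivity (leb [set u | y / kap w < rd u]).
  transitivity (\int[leb]_u (\1_[set u | (y / kap w < rd u)%R] u : R)%:E)%E; last first.
    rewrite integral_indic ?setIT//.
    by apply: measurable_ltr_set => //; exact: measurable_pradius.
  apply: eq_integral => u _; congr (_%:E); rewrite !indicE; congr (_ : bool)%:R.
  transitivity (r < fine (md (S1 (u, w)))); first by rewrite /md_set mem_setE.
  transitivity (y / kap w < rd u); last by rewrite mem_setE.
  rewrite cluster_md /= ltr_pdivrMr//.
  rewrite -lte_fin -poweR_EFin (_ : r = y `^ q); last by rewrite -powRrM mulVf ?gt_eqF// powRr1// ltW.
  rewrite (gt_poweR q0 (ltW y0)) ?lte_fin// lee_fin.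
  by apply: mulr_ge0; apply: ltW => //; exact: pradius_gt0.
transitivity (((y / kap w) `^ (- alpha))%:E); first by apply: pradius_tail => //; exact: divr_gt0.
rewrite -EFinM; congr EFin.
rewrite powRM ?invr_ge0 ?(ltW y0) ?(ltW k0)//; congr (_ * _).
by rewrite -(powR_inv1 (ltW k0)) -powRrM mulN1r opprK.
Qed.

Section functionals.
Variables (Lip M : R) (Psi : pathZ R d -> R).
Hypothesis gPsi : good_functional N p Lip M Psi.

Lemma measurable_good_cluster : measurable_fun setT (fun b => Psi (S1 b)).
Proof.
apply: (measurable_good p0 gPsi (@ncontinuous_id _ _ N) (fun=> lexx _) mS1).
- exact: cluster_md_lty.
- exact: cluster_vanishing.
Qed.

Lemma measurable_good_cut eps : 0 < eps -> measurable_fun setT (fun b => Psi (cutoff N eps (S1 b))).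
Proof.
move=> eps0; rewrite /cutoff.
have := @measurable_good _ _ _ _ p0 _ _ _ gPsi _ (ncontinuous_cutv N eps0) (cutv_le N eps) _ _ _ mS1.
by apply; [exact: cluster_md_lty|exact: cluster_vanishing].
Qed.

Let eps_ n : R := n.+2%:R^-1.

Lemma eps01 n : 0 < eps_ n < 1.
Proof. by rewrite invr_gt0 ltr0Sn/= invf_lt1// ltr1n. Qed.

Lemma eps_lt r : 0 < r -> \forall n \near \oo, eps_ n < r.
Proof.
move=> r0; have [k _ kP] := near_infty_natSinv_lt (PosNum r0); exists k => // n kn.
by have /= := kP n.+1 (leqW kn).
Qed.

Lemma cut_good_cvg b : Psi (cutoff N (eps_ n) (S1 b)) @[n --> \oo] --> Psi (S1 b).
Proof.
apply: (good_cvg p0 gPsi (cluster_md_lty b)) => [n|e e0].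
  by apply: le_lt_trans (modulus_cut_le _ p0 _ _) _; exact: cluster_md_lty.
have [r r0 H] := modulus_cutB p0 (cluster_md_lty b) (cluster_vanishing b) e0.
near=> n; apply: H; have /andP[-> _] := eps01 n; rewrite /=.
by near: n; exact: eps_lt.
Unshelve. all: by end_near. Qed.

Variable r0 : R.
Hypothesis r00 : 0 < r0.
Hypothesis Psir : forall v, (md v <= r0%:E)%E -> Psi v = 0.
Hypothesis c_fin : (c < +oo)%E.

Lemma md_set_fin r : 0 < r -> (beta (md_set r) < +oo)%E.
Proof. by move=> r1; rewrite beta_md_set// lte_mul_pinfty ?lee_fin ?powR_ge0. Qed.

Lemma betaI_md r C : 0 < r -> betaI PT (fun b => C * \1_(md_set r) b).
Proof. by move=> r1; apply: betaI_indic; [exact: measurable_md_set|exact: md_set_fin]. Qed.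

Lemma good_md_bound v : `|Psi v| <= M * (r0%:E < md v)%E%:R.
Proof.
have [H _ _] := gPsi; have /andP[h1 h2] := H v; rewrite ger0_norm//.
by case: ltP => h; rewrite ?mulr1// Psir ?mulr0.
Qed.

Lemma md_set_ind r b : \1_(md_set r) b = (r%:E < md (S1 b))%E%:R :> R.
Proof.
rewrite indicE; congr (_ : bool)%:R; transitivity (r < fine (md (S1 b))).
  by rewrite /md_set mem_setE.
by rewrite -lte_fin fineK// modulus_fin// cluster_md_lty.
Qed.

Let M0 : 0 <= M.
Proof. by have [H _ _] := gPsi; have /andP[h1 h2] := H (fun=> 0); exact: le_trans h2. Qed.

Lemma betaI_good : betaI PT (fun b => Psi (S1 b)).
Proof.
apply: (betaI_le measurable_good_cluster _ (betaI_md M r00)) => b.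
by rewrite md_set_ind; exact: good_md_bound.
Qed.

Lemma good_cut_bound eps b : `|Psi (cutoff N eps (S1 b))| <= M * \1_(md_set r0) b.
Proof.
apply: le_trans (good_md_bound _) _; rewrite md_set_ind ler_wpM2l// ler_nat.
case: ltP => // h; rewrite (_ : (r0%:E < md (S1 b))%E)//.
by apply: lt_le_trans h _; exact: modulus_cut_le.
Qed.

Lemma betaI_good_cut eps : 0 < eps -> betaI PT (fun b => Psi (cutoff N eps (S1 b))).
Proof.
move=> e0; apply: (betaI_le (measurable_good_cut e0) _ (betaI_md M r00)) => b.
exact: good_cut_bound.
Qed.

(** The cut-off lowers the modulus, so every cut-off version vanishes where the modulus of S1 is at
    most r0. The common bound M on the complement is integrable because c is finite. *)
Lemma IB_cut_cvg : IB PT (fun b => Psi (cutoff N (eps_ n) (S1 b))) @[n --> \oo] --> IB PT (fun b => Psi (S1 b)).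
Proof.
have [||||_] := @IB_dct _ _ _ PT (fun n b => Psi (cutoff N (eps_ n) (S1 b))) (fun b => Psi (S1 b)) (fun b => M * \1_(md_set r0) b); last exact.
- by move=> n; apply: measurable_good_cut; have /andP[] := eps01 n.
- exact: cut_good_cvg.
- by move=> n b; exact: good_cut_bound.
- exact: betaI_md.
Qed.

End functionals.

Variable x : nat -> R.
Hypothesis x0 : forall n, 0 < x n.
Hypothesis xoo : x n @[n --> \oo] --> +oo.
Hypothesis anticlustering : forall delta : R, 0 < delta ->
  limn_esup (fun n => (exceed_prob N L x k n delta / tailL N L (delta * x n))%:E)
    @[k --> \oo] --> (0 : \bar R).

Local Notation z n v := (block 0 n%:Z (scale (x n)^-1 v)).

Definition level_count n : R := n%:R * tailL N L (x n).
Local Notation a := level_count.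

Hypothesis small_values : forall eta e : R, 0 < eta -> 0 < e ->
  exists2 r, 0 < r & forall eps, 0 < eps < r -> \forall n \near \oo,
    fine (L [set v | (eta%:E < md (trunc N eps (z n v)))%E]) / a n < e.

Lemma level_count_gt0 n : (0 < n)%N -> 0 < a n.
Proof. by move=> n0; rewrite mulr_gt0 ?ltr0n//; exact: (tailL_gt0 alpha0 RV). Qed.

Lemma EL_abs_leG C f (G : pathZ R d -> R) : measurable_fun setT (f : path_space R d -> R) ->
  measurable_fun setT (G : path_space R d -> R) ->
  (forall v, `|f v| <= G v) -> (forall v, G v <= C) -> `|EL L f| <= EL L G.
Proof.
move=> mf mG fG GC.
have fi := EL_integrable L mf (fun v => le_trans (fG v) (GC v)).
have Gi : L.-integrable setT (EFin \o G).
  apply: (@EL_integrable R d L C G) => // v; rewrite ger0_norm//.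
  exact: le_trans (normr_ge0 _) (fG v).
rewrite -lee_fin /EL -fine_abse ?integrable_fin_num// !fineK ?abse_fin_num ?integrable_fin_num//.
apply: le_trans (le_abse_integral _ _ _) _ => //; first by apply/measurable_EFinP.
apply: ge0_le_integral => //.
- by apply: measurableT_comp => //; apply/measurable_EFinP.
- by apply/measurable_EFinP.
- by move=> v _; rewrite lee_fin.
Qed.

Lemma EL_lin (C s t : R) (f g : pathZ R d -> R) : measurable_fun setT (f : path_space R d -> R) ->
  measurable_fun setT (g : path_space R d -> R) ->
  (forall v, `|f v| <= C) -> (forall v, `|g v| <= C) ->
  EL L (fun v => s * f v + t * g v) = s * EL L f + t * EL L g.
Proof.
move=> mf mg fC gC; have fi := EL_integrable L mf fC; have gi := EL_integrable L mg gC.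
have fn := integrable_fin_num measurableT fi; have gn := integrable_fin_num measurableT gi.
apply: EFin_inj; rewrite EFinD !EFinM.
have sfi := integrableZl measurableT s fi; have tgi := integrableZl measurableT t gi.
have E : (\int[L]_v (s * f v + t * g v)%:E = s%:E * \int[L]_v (f v)%:E + t%:E * \int[L]_v (g v)%:E)%E.
  rewrite -(integralZl measurableT fi) -(integralZl measurableT gi).
  by rewrite -(integralD measurableT sfi tgi); apply: eq_integral => v _.
by rewrite /EL E !fineK// fin_numD !fin_numM.
Qed.

Lemma measurable_block_scale (a' b' : int) n :
  measurable_fun setT ((fun v => block a' b' (scale (x n)^-1 v)) : path_space R d -> path_space R d).
Proof.
apply: (measurableT_comp (f := block a' b' : path_space R d -> path_space R d)).
  exact: measurable_block.
exact: measurable_scale.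
Qed.

Lemma measurable_trunc eps : measurable_fun setT (trunc N eps : path_space R d -> path_space R d).
Proof.
apply: measurable_path => t j.
rewrite (_ : (fun v => _) = (fun v : path_space R d => v t ord0 j * (N (v t) <= eps)%R%:R)).
  apply: measurable_funM; first exact: measurable_coord_entry.
  rewrite (_ : (fun v => _) = (fun v : path_space R d => 1 - \1_[set v : path_space R d | eps < N (v t)] v)).
    apply: measurable_funB => //; apply: measurable_indic.
    by apply: measurable_ltr_set => //; exact: measurable_vnorm.
  apply/funext => v; rewrite indicE (_ : (v \in _) = (eps < N (v t))); last by rewrite mem_setE.
  by rewrite leNgt; case: (_ < _); rewrite ?subrr ?subr0.
by apply/funext => v; rewrite /trunc; case: ifP => _; rewrite ?mulr1// mulr0 mxE.
Qed.

Definition small_set eta eps n : set (path_space R d) :=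
  [set v | (eta%:E < md (trunc N eps (z n v)))%E].

Lemma measurable_small_set eta eps n : measurable (small_set eta eps n).
Proof.
rewrite -[X in measurable X]setTI; apply: emeasurable_fun_o_infty => //.
apply: (measurableT_comp (f := md : path_space R d -> \bar R)); first exact: measurable_modulus.
apply: (measurableT_comp (f := trunc N eps : path_space R d -> path_space R d)).
  exact: measurable_trunc.
exact: measurable_block_scale.
Qed.

Lemma measurable_good_z Lip M Psi n : good_functional N p Lip M Psi ->
  measurable_fun setT (fun v : path_space R d => Psi (z n v)).
Proof.
move=> gP; apply: (measurableT_comp (f := (fun v => Psi (block 0 n%:Z v)) : path_space R d -> R)).
  apply: measurable_wcont; exact: (wcont_good_block p0 gP (@ncontinuous_id _ _ N) (fun=> lexx _)).
exact: measurable_scale.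
Qed.

Lemma measurable_good_cut_z Lip M Psi eps n : 0 < eps -> good_functional N p Lip M Psi ->
  measurable_fun setT (fun v : path_space R d => Psi (cutoff N eps (z n v))).
Proof.
move=> e0 gP; apply: (measurableT_comp (f := (fun v => Psi (cutoff N eps (block 0 n%:Z v))) : path_space R d -> R)).
  apply: measurable_wcont; exact: (wcont_good_block p0 gP (ncontinuous_cutv N e0) (cutv_le N eps)).
exact: measurable_scale.
Qed.

Lemma modulus_sub_cut eps v : 0 < eps -> (md (pathB v (cutoff N eps v)) <= md (trunc N (2 * eps) v))%E.
Proof.
move=> e0; apply: le_modulus => // t; apply: le_trans (cutvB _ _ e0) _.
by rewrite /trunc; case: ifP => //; rewrite vnorm0.
Qed.

Section functional_limit.
Variables (Lip M : R) (Psi : pathZ R d -> R) (r0 : R).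
Hypothesis gPsi : good_functional N p Lip M Psi.
Hypothesis r00 : 0 < r0.
Hypothesis Psir : forall v, (md v <= r0%:E)%E -> Psi v = 0.
Hypothesis c_fin : (c < +oo)%E.

Let PsiM v : 0 <= Psi v <= M. Proof. by have [h _ _] := gPsi. Qed.
Let M0 : 0 <= M. Proof. by have /andP[h1 h2] := PsiM (fun=> 0); exact: le_trans h2. Qed.

(** A continuous indicator of a large modulus, 0 up to r0/4 and 1 from r0/2 on. The Lipschitz error
    of the cut-off must be charged only where the modulus is large: a bound over the whole space
    would be lost in the division by [level_count]. *)
Let hat (s : R) : R := clamp (4 / r0 * s - 1).
Let H v : R := hat (fine (md v)).

Let hat_low s : s <= r0 / 4 -> hat s = 0.
Proof.
by move=> h; rewrite /hat clamp0// subr_le0 mulrC -ler_pdivlMr ?divr_gt0// invf_div mul1r.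
Qed.

Let hat_high s : r0 / 2 <= s -> hat s = 1.
Proof.
move=> h; rewrite /hat clamp1// lerBrDr mulrAC ler_pdivlMr//.
by apply: le_trans (ler_wpM2l _ h) => //; rewrite -[1 + 1]/(2%:R); lra.
Qed.

Let good_H : good_functional N p (4 / r0) 1 H.
Proof.
apply: good_modulus => //; last by rewrite divr_ge0// ltW.
- by move=> s; rewrite clamp_ge0 clamp_le1.
- move=> s t; apply: le_trans (clamp_dist _ _) _.
  by rewrite opprB addrA subrK -mulrBr normrM ger0_norm// divr_ge0// ltW.
Qed.

Let H0 v : (md v <= (r0 / 4)%:E)%E -> H v = 0.
Proof.
move=> h; apply: hat_low; rewrite -lee_fin fineK// modulus_fin//.
by apply: le_lt_trans h _; exact: ltry.
Qed.

(** Three cases. If the small entries exceed eta in modulus, the error is at most M. If the modulus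
    is at most r0, both values are 0. Otherwise the Lipschitz bound applies, and since the cut-off
    costs at most eta <= r0/2 of the modulus, [H] is 1 there. *)
Lemma cut_error eta eps v : 0 < eta <= r0 / 2 -> 0 < eps -> (md v < +oo)%E ->
  `|Psi v - Psi (cutoff N eps v)| <=
  `|Lip| * eta * H (cutoff N eps v) + M * (eta%:E < md (trunc N (2 * eps) v))%E%:R.
Proof.
move=> /andP[eta0 etar] e0 vf; have cf := le_lt_trans (modulus_cut_le N p0 eps v) vf.
have /andP[h1 h2] := PsiM v; have /andP[h3 h4] := PsiM (cutoff N eps v).
have HH : 0 <= H (cutoff N eps v) by rewrite clamp_ge0.
case: ltP => hs.
  rewrite mulr1; apply: (@le_trans _ _ M); last by rewrite lerDr !mulr_ge0// ltW.
  by rewrite ler_norml; apply/andP; split; lra.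
rewrite mulr0 addr0; have hd := le_trans (modulus_sub_cut v e0) hs.
have [hr|hr] := leP (md v) r0%:E.
  rewrite !Psir ?subrr ?normr0 ?mulr_ge0 ?(ltW eta0)//.
  by apply: le_trans hr; exact: modulus_cut_le.
have H1 : H (cutoff N eps v) = 1.
  apply: hat_high; have := fine_modulus_dist p0 vf cf; rewrite ler_norml => /andP[_ h].
  have : fine (md (pathB v (cutoff N eps v))) <= eta.
    by rewrite -lee_fin fineK// modulus_fin//; exact: modulusB_lty.
  have : r0 < fine (md v) by rewrite -lte_fin fineK// modulus_fin.
  by move=> g1 g2; lra.
by rewrite H1 mulr1; exact: (good_close p0 gPsi vf cf hd).
Qed.

(** The cut-off version converges by [cut_functional_cvg]. The same lemma for [H] keeps the
    Lipschitz part of the error bounded by a multiple of eta after normalization, and the condition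
    on small values disposes of the rest. *)
Lemma functional_cvg : EL L (fun v => Psi (z n v)) / a n @[n --> \oo] --> IB PT (fun b => Psi (S1 b)).
Proof.
apply/cvgrPdist_lt => e e0.
pose K := IB PT (fun b => H (S1 b)).
have K0 : 0 <= K by apply: fine_ge0; apply: integral_ge0 => b _; rewrite lee_fin clamp_ge0.
have r40 : 0 < r0 / 4 by rewrite divr_gt0.
have C0 : 0 < 8 * (`|Lip| * (K + 1) + 1) by rewrite mulr_gt0// ltr_wpDl// mulr_ge0// addr_ge0.
(* The bound r0/2 is the one of [cut_error]; the other makes |Lip| eta (K + 1) at most e/8. *)
pose eta := Num.min (r0 / 2) (e / (8 * (`|Lip| * (K + 1) + 1))).
have eta0 : 0 < eta by rewrite lt_min !divr_gt0.
have etab : `|Lip| * eta * (K + 1) <= e / 8.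
  apply: (@le_trans _ _ ((`|Lip| * (K + 1) + 1) * eta)).
    by rewrite mulrAC ler_wpM2r ?(ltW eta0)// lerDl.
  have : eta <= e / (8 * (`|Lip| * (K + 1) + 1)) by rewrite ge_min lexx orbT.
  rewrite ler_pdivlMr// => h; rewrite ler_pdivlMr// mulrC mulrA mulrC; exact: h.
have M10 : 0 < M + 1 by rewrite ltr_wpDl.
have e1 : 0 < e / (8 * (M + 1)) by rewrite divr_gt0// mulr_gt0.
have [r rp Hr] := small_values eta0 e1.
(* The cut-off at eps alters entries up to 2 eps, hence 2 eps and not eps has to stay below r. *)
have [j [j1 j2]] : exists j, `|IB PT (fun b => Psi (S1 b)) - IB PT (fun b => Psi (cutoff N j.+2%:R^-1 (S1 b)))| < e / 4 /\
    2 * j.+2%:R^-1 < r.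
  have A : \forall j \near \oo, `|IB PT (fun b => Psi (S1 b)) - IB PT (fun b => Psi (cutoff N j.+2%:R^-1 (S1 b)))| < e / 4.
    have /cvgrPdist_lt h := IB_cut_cvg gPsi r00 Psir c_fin.
    by apply: h; rewrite divr_gt0.
  have B : \forall j \near \oo, (j.+2%:R^-1 : R) < r / 2 by apply: eps_lt; rewrite divr_gt0.
  have [j [h1 h2]] := filter_ex (filterI A B); exists j; split => //.
  by rewrite mulrC -ltr_pdivlMr.
set eps : R := j.+2%:R^-1 in j1 j2.
have ep1 : 0 < eps < 1 := eps01 j.
have eps0 : 0 < eps by case/andP: ep1.
have Psi00 : Psi (fun=> 0) = 0 by apply: Psir; rewrite modulus0// lee_fin ltW.
have H00 : H (fun=> 0) = 0 by apply: H0; rewrite modulus0// lee_fin ltW.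
have cP := @cut_functional_cvg _ _ N alpha p _ _ PT Th L alpha0 p0 mTh Th0 L_shift RV Th_psum _ _ _ eps gPsi Psi00 ep1 x x0 xoo anticlustering.
have cH := @cut_functional_cvg _ _ N alpha p _ _ PT Th L alpha0 p0 mTh Th0 L_shift RV Th_psum _ _ _ eps good_H H00 ep1 x x0 xoo anticlustering.
have HK : IB PT (fun b => H (cutoff N eps (S1 b))) <= K.
  apply: le_IB.
  - exact: (betaI_good_cut good_H r40 H0 c_fin eps0).
  - exact: (betaI_good good_H r40 H0 c_fin).
  - move=> b; apply: le_clamp; rewrite lerD2r ler_wpM2l ?divr_ge0 ?(ltW r00)//.
    have cf := cluster_md_lty b; have cl := modulus_cut_le N p0 eps (S1 b).
    by rewrite -lee_fin !fineK// modulus_fin// (le_lt_trans cl).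
near=> n.
have n0 : (0 < n)%N by near: n; exact: nbhs_infty_gt.
have an := level_count_gt0 n0.
have h1 : `|IB PT (fun b => Psi (cutoff N eps (S1 b))) - EL L (fun v => Psi (cutoff N eps (z n v))) / a n| < e / 4.
  by near: n; move/cvgrPdist_lt: cP; apply; rewrite divr_gt0.
have h2 : EL L (fun v => H (cutoff N eps (z n v))) / a n < K + 1.
  near: n; move/cvgrPdist_lt: cH => /(_ _ ltr01); apply: filterS => n.
  rewrite ltr_norml => /andP[h _]; apply: (@lt_le_trans _ _ (IB PT (fun b => H (cutoff N eps (S1 b))) + 1)).
    by rewrite -ltrBlDl; move: h; rewrite ltrNl opprB.
  by rewrite lerD2r.
have h3 : fine (L (small_set eta (2 * eps) n)) / a n < e / (8 * (M + 1)).
  by near: n; apply: Hr; rewrite mulr_gt0.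
have mP := measurable_good_z n gPsi.
have mc := measurable_good_cut_z n eps0 gPsi.
have mH := measurable_good_cut_z n eps0 good_H.
have mE := measurable_small_set eta (2 * eps) n.
have B1 : `|EL L (fun v => Psi (z n v)) - EL L (fun v => Psi (cutoff N eps (z n v)))| <=
    `|Lip| * eta * EL L (fun v => H (cutoff N eps (z n v))) + M * fine (L (small_set eta (2 * eps) n)).
  have PB v : `|Psi v| <= M by have /andP[q1 q2] := PsiM v; rewrite ger0_norm.
  rewrite -(@ELB _ _ L M _ _ mP mc (fun v => PB _) (fun v => PB _)).
  have mI : measurable_fun setT (\1_(small_set eta (2 * eps) n) : path_space R d -> R) by exact: measurable_indic.
  have HB v : `|H (cutoff N eps (z n v))| <= 1 by rewrite ger0_norm ?clamp_ge0 ?clamp_le1.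
  have IB1 v : `|\1_(small_set eta (2 * eps) n) v : R| <= 1 by rewrite indicE; case: (_ \in _); rewrite ?normr1 ?normr0.
  rewrite -EL_indic// -(EL_lin _ _ mH mI HB IB1).
  apply: (EL_abs_leG (C := `|Lip| * eta + M)).
  - exact: measurable_funB.
  - by apply: measurable_funD; apply: measurable_funM.
  - move=> v; have := @cut_error eta eps (z n v) _ eps0 (modulus_block_lty _ p0 _ _ _).
    rewrite eta0 ge_min lexx => /(_ erefl) h; apply: le_trans h _; rewrite lerD2l ler_wpM2l//.
    by rewrite indicE (_ : (v \in _) = (eta%:E < md (trunc N (2 * eps) (z n v)))%E)//; rewrite mem_setE.
  - move=> v; apply: lerD; first by rewrite ler_piMr ?mulr_ge0 ?(ltW eta0)// (le_trans (ler_norm _)).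
    by rewrite ler_piMr// (le_trans (ler_norm _)).
have B2 : `|EL L (fun v => Psi (z n v)) / a n - EL L (fun v => Psi (cutoff N eps (z n v))) / a n| < e / 4.
  rewrite -mulrBl normrM (gtr0_norm (_ : 0 < (a n)^-1)) ?invr_gt0//.
  apply: (@le_lt_trans _ _ ((`|Lip| * eta * EL L (fun v => H (cutoff N eps (z n v))) + M * fine (L (small_set eta (2 * eps) n))) / a n)).
    by rewrite ler_wpM2r// invr_ge0 ltW.
  rewrite mulrDl -!mulrA; rewrite (_ : e / 4 = e / 8 + e / 8); last by field.
  apply: ler_ltD.
    apply: le_trans etab; rewrite mulrA; apply: ler_wpM2l; last exact: ltW.
    by rewrite mulr_ge0// ltW.
  apply: (@le_lt_trans _ _ (M * (e / (8 * (M + 1))))); first by rewrite ler_wpM2l// ltW.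
  rewrite (_ : M * (e / (8 * (M + 1))) = e / 8 * (M / (M + 1))); last by field; rewrite gt_eqF.
  by rewrite gtr_pMr ?divr_gt0// ltr_pdivrMr// mul1r ltrDl.
set A := IB PT _ in j1 *; set B := IB PT _ in j1 h1 *.
set A' := EL L _ / a n in B2 *; set B' := EL L _ / a n in B2 h1 *.
have -> : A - A' = (A - B) + (B - B') - (A' - B') by ring.
apply: le_lt_trans (ler_normB _ _) _; apply: le_lt_trans (lerD (ler_normD _ _) (lexx _)) _.
apply: (@lt_trans _ _ (e / 4 + e / 4 + e / 4)); first by apply: ltrD => //; exact: ltrD.
by rewrite [ltRHS](_ : e = e / 4 + e / 4 + e / 4 + e / 4) ?ltrDl ?divr_gt0//; field.
Unshelve. all: by end_near. Qed.

End functional_limit.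

Section lower_limit.
Variables (F : pathZ R d -> R) (M : R).
Hypothesis FM : forall v, 0 <= F v <= M.
Hypothesis F_shift : forall k v, F (bshift k v) = F v.
Hypothesis F_lsc : forall v e, (md v < +oo)%E -> 0 < e ->
  exists2 r, 0 < r & forall u, (md u < +oo)%E -> (md (pathB v u) < r%:E)%E -> F v - e < F u.
Hypothesis F1 : forall v, (md v <= 1)%E -> F v = 0.

Let good k := good_path_infconv N p0 FM F_shift k.

Let M0 : 0 <= M. Proof. by have /andP[h1 h2] := FM (fun=> 0); exact: le_trans h2. Qed.

Let infconv1 k v : (md v <= 1%:E)%E -> path_infconv N p F k v = 0.
Proof.
move=> h; have vf : (md v < +oo)%E by apply: le_lt_trans h _; exact: ltry.
apply/eqP; rewrite eq_le -{1}(F1 h) (path_infconv_le p0 FM k vf)/=.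
by have [/(_ v)/andP[]] := good k.
Qed.

Lemma measurable_lsc_z n : measurable_fun setT (fun v : path_space R d => F (z n v)).
Proof.
apply: (@measurable_fun_cvg _ _ _ _ (fun k (v : path_space R d) => path_infconv N p F k (z n v))).
  by move=> k; exact: (measurable_good_z n (good k)).
by move=> v _; apply: (path_infconv_cvg p0 FM F_lsc); exact: modulus_block_lty.
Qed.

Lemma lsc_cluster_cvg : (c < +oo)%E -> betaI PT (fun b => F (S1 b)) /\
  IB PT (fun b => path_infconv N p F k (S1 b)) @[k --> \oo] --> IB PT (fun b => F (S1 b)).
Proof.
move=> c_fin.
apply: (@IB_dct _ _ _ PT (fun k b => path_infconv N p F k (S1 b)) _ (fun b => M * \1_(md_set 1) b)).
- by move=> k; exact: (measurable_good_cluster (good k)).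
- by move=> b; apply: (path_infconv_cvg p0 FM F_lsc); exact: cluster_md_lty.
- by move=> k b; rewrite md_set_ind; apply: good_md_bound; [exact: good|exact: infconv1].
- exact: betaI_md.
Qed.

(** Each Lipschitz envelope of [F] vanishes on modulus at most 1, so [functional_cvg] applies to it;
    it bounds [F] from below, and its integral comes within e/2 of that of [F]. *)
Lemma lower_limit : (c < +oo)%E -> forall e, 0 < e ->
  \forall n \near \oo, IB PT (fun b => F (S1 b)) - e < EL L (fun v => F (z n v)) / a n.
Proof.
move=> c_fin e e0; have [FI cv] := lsc_cluster_cvg c_fin.
have e20 : 0 < e / 2 by rewrite divr_gt0.
have [k _ Hk] : \forall k \near \oo, `|IB PT (fun b => F (S1 b)) - IB PT (fun b => path_infconv N p F k (S1 b))| < e / 2.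
  by move/cvgrPdist_lt: cv; apply.
have {}Hk := Hk k (leqnn k).
have cvk := functional_cvg (good k) ltr01 (infconv1 k) c_fin.
near=> n.
have n0 : (0 < n)%N by near: n; exact: nbhs_infty_gt.
have an := level_count_gt0 n0.
have h : `|IB PT (fun b => path_infconv N p F k (S1 b)) - EL L (fun v => path_infconv N p F k (z n v)) / a n| < e / 2.
  by near: n; move/cvgrPdist_lt: cvk; apply.
have le : EL L (fun v => path_infconv N p F k (z n v)) / a n <= EL L (fun v => F (z n v)) / a n.
  rewrite ler_wpM2r ?invr_ge0 ?(ltW an)//.
  apply: (@le_EL _ _ _ _ _ M).
  - exact: (measurable_good_z n (good k)).
  - exact: measurable_lsc_z.
  - by move=> v; have [/(_ (z n v))/andP[]] := good k.
  - by move=> v; apply: path_infconv_le => //; exact: modulus_block_lty.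
  - by move=> v; have /andP[] := FM (z n v).
move: Hk h; rewrite !ltr_norml => /andP[_ h1] /andP[_ h2].
apply: lt_le_trans le; move: h1 h2.
set A := IB PT _; set B := IB PT _; set D := EL L _ / a n => h1 h2.
rewrite (_ : A - e = D - (e / 2 - (A - B)) - (e / 2 - (B - D))); last by field.
by rewrite -addrA -opprD ltrBlDr ltrDl addr_gt0// subr_gt0.
Unshelve. all: by end_near. Qed.

End lower_limit.

Definition exceedance n : set (path_space R d) := [set v | (1 < md (z n v))%E].

Lemma measurable_exceedance n : measurable (exceedance n).
Proof.
rewrite -[X in measurable X]setTI; apply: emeasurable_fun_o_infty => //.
apply: (measurableT_comp (f := md : path_space R d -> \bar R)); first exact: measurable_modulus.
exact: measurable_block_scale.
Qed.

Lemma EL_exceedance n : EL L (fun v => (1 < md (z n v))%E%:R) = fine (L (exceedance n)).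
Proof.
rewrite -EL_indic; last exact: measurable_exceedance.
by congr EL; apply/funext => v; rewrite indicE (_ : (v \in _) = (1 < md (z n v))%E)//; rewrite mem_setE.
Qed.

Lemma lsc_above v : (md v < +oo)%E -> (1 < md v)%E ->
  exists2 r, 0 < r & forall u, (md u < +oo)%E -> (md (pathB v u) < r%:E)%E -> (1 < md u)%E.
Proof.
move=> vf v1; have fv := modulus_fin vf.
exists (fine (md v) - 1) => [|u uf]; first by rewrite subr_gt0 -lte_fin fineK.
have bf := modulus_fin (modulusB_lty p0 vf uf).
rewrite -[md (pathB v u)]fineK// lte_fin => h.
have := fine_modulus_dist p0 vf uf; rewrite ler_norml => /andP[_ h'].
rewrite -[md u]fineK ?modulus_fin// lte_fin.
by have := le_lt_trans h' h; rewrite ltrD2l ltrN2.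
Qed.

Lemma exceedance_lower : (c < +oo)%E -> forall e, 0 < e ->
  \forall n \near \oo, fine c - e < fine (L (exceedance n)) / a n.
Proof.
move=> c_fin e e0.
have := @lower_limit (fun v => (1 < md v)%E%:R) 1 _ _ _ _ c_fin e e0.
have -> : IB PT (fun b => (1 < md (S1 b))%E%:R) = fine c.
  transitivity (IB PT (\1_(md_set 1))).
    by congr IB; apply/funext => b; rewrite md_set_ind.
  rewrite IB_indic; last exact: measurable_md_set.
  by rewrite beta_md_set// !powR1 mul1e.
move=> H; have {}H := H _ _ _ _; apply: filterS (H _ _ _ _) => [n||||].
- by rewrite EL_exceedance.
- by move=> v; case: (_ < _)%E; rewrite ?lexx ?ler01.
- by move=> k v; rewrite modulus_bshift.
- move=> v e' vf e'0; case: (ltP 1%E (md v)) => v1.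
    have [r rp Hr] := lsc_above vf v1; exists r => // u uf vu.
    by rewrite Hr// gtrBl.
  by exists 1 => // u _ _; rewrite sub0r; apply: (@lt_le_trans _ _ 0) => //; rewrite oppr_lt0.
- by move=> v; rewrite leNgt => /negbTE ->.
Qed.

(** The indicator is dominated by a ramp from 1 - eta to 1. The limit for the ramp is at most the
    mass of modulus > 1 - eta, which is c times a power of 1 - eta, and this power tends to 1 with
    eta. *)
Lemma exceedance_upper : (c < +oo)%E -> forall e, 0 < e ->
  \forall n \near \oo, fine (L (exceedance n)) / a n < fine c + e.
Proof.
move=> c_fin e e0.
have q0 := mexp_gt0 p0; have c0 : 0 <= fine c by rewrite fine_ge0// ltW// cluster_index_gt0.
have [eta /andP[eta0 eta1] Heta] : exists2 eta : R, 0 < eta < 1 &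
    ((1 - eta) `^ q^-1) `^ (- alpha) * fine c < fine c + e / 2.
  have hc : ((t `^ q^-1) `^ (- alpha)) * fine c @[t --> (1 : R)] --> ((1 `^ q^-1) `^ (- alpha)) * fine c.
    apply: cvgM; last exact: cvg_cst.
    rewrite -powRrM; under eq_cvg do rewrite -powRrM.
    exact: cvg_powR.
  have /cvgrPdist_lt/(_ (e / 2)) := hc; rewrite divr_gt0// => /(_ erefl).
  rewrite !powR1 mul1r => -[r /= r0 Hr].
  exists (Num.min (r / 2) (1 / 2)).
    by rewrite lt_min !divr_gt0//= gt_min; apply/orP; right; rewrite ltr_pdivrMr//; lra.
  have := Hr (1 - Num.min (r / 2) (1 / 2)).
  rewrite /ball/= opprB addrC subrK ger0_norm; last by rewrite le_min !divr_ge0// ltW.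
  rewrite gt_min ltr_pdivrMr// mulr2n mulrDr mulr1 ltrDl r0/= => /(_ erefl).
  by rewrite distrC ltr_norml ltrBlDl => /andP[_].
pose h s : R := clamp ((s - 1) / eta + 1).
have gh : good_functional N p eta^-1 1 (fun v => h (fine (md v))).
  apply: good_modulus => //; last by rewrite invr_ge0 ltW.
    by move=> s; rewrite clamp_ge0 clamp_le1.
  move=> s t; apply: le_trans (clamp_dist _ _) _.
  rewrite opprD addrACA subrr addr0 -mulrBl opprB addrA subrK normrM mulrC.
  by rewrite gtr0_norm ?invr_gt0.
have h0 s : s <= 1 - eta -> h s = 0.
  move=> hs; rewrite /h clamp0// -lerBrDr sub0r ler_pdivrMr// mulN1r.
  by rewrite lerBlDr addrC.
have h1 s : 1 < s -> h s = 1.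
  by move=> hs; rewrite /h clamp1// lerDr divr_ge0// ?ltW// subr_gt0.
have r0 : 0 < 1 - eta by rewrite subr_gt0.
have hz v : (md v <= (1 - eta)%:E)%E -> h (fine (md v)) = 0.
  move=> hv; have vf : (md v < +oo)%E by apply: le_lt_trans hv _; exact: ltry.
  by apply: h0; rewrite -lee_fin fineK// modulus_fin.
have cv := functional_cvg gh r0 hz c_fin.
have Ib : IB PT (fun b => h (fine (md (S1 b)))) < fine c + e / 2.
  apply: le_lt_trans Heta.
  have -> : ((1 - eta) `^ q^-1) `^ (- alpha) * fine c = IB PT (fun b => 1 * \1_(md_set (1 - eta)) b).
    under eq_fun do rewrite mul1r.
    rewrite IB_indic; last exact: measurable_md_set.
    by rewrite beta_md_set// fineM// ge0_fin_numE// ltW// cluster_index_gt0.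
  apply: le_IB; [exact: (betaI_good gh r0 hz c_fin)|exact: betaI_md|] => b.
  rewrite mul1r md_set_ind; case: ltP => hb; last by rewrite hz.
  exact: clamp_le1.
near=> n.
have n0 : (0 < n)%N by near: n; exact: nbhs_infty_gt.
have an := level_count_gt0 n0.
have H : `|IB PT (fun b => h (fine (md (S1 b)))) - EL L (fun v => h (fine (md (z n v)))) / a n| < e / 2.
  by near: n; move/cvgrPdist_lt: cv; apply; rewrite divr_gt0.
apply: (@le_lt_trans _ _ (EL L (fun v => h (fine (md (z n v)))) / a n)).
  rewrite ler_wpM2r ?invr_ge0 ?(ltW an)// -EL_exceedance.
  apply: (@le_EL _ _ _ _ _ 1).
  - rewrite (_ : (fun v => _) = \1_(exceedance n)); first exact: measurable_indic (measurable_exceedance n).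
    by apply/funext => v; rewrite indicE (_ : (v \in _) = (1 < md (z n v))%E)//; rewrite mem_setE.
  - exact: (measurable_good_z n gh).
  - by move=> v; case: (_ < _)%E.
  - move=> v; case: ltP => hv; last exact: clamp_ge0.
    by rewrite h1// -lte_fin fineK// modulus_fin//; exact: modulus_block_lty.
  - by move=> v; exact: clamp_le1.
move: H; rewrite ltr_norml => /andP[H _].
have {}H : EL L (fun v => h (fine (md (z n v)))) / a n < IB PT (fun b => h (fine (md (S1 b)))) + e / 2.
  by rewrite -ltrBlDl; move: H; rewrite ltrNl opprB.
apply: (lt_trans H); rewrite [X in _ < _ + X](splitr e) addrA ltrD2r; exact: Ib.
Unshelve. all: by end_near. Qed.

Lemma exceedance_cvg : (c < +oo)%E -> fine (L (exceedance n)) / a n @[n --> \oo] --> fine c.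
Proof.
move=> c_fin; apply/cvgrPdist_lt => e e0.
have A := exceedance_lower c_fin e0; have B := exceedance_upper c_fin e0.
near=> n.
have h1 : fine c - e < fine (L (exceedance n)) / a n by near: n.
have h2 : fine (L (exceedance n)) / a n < fine c + e by near: n.
by rewrite ltr_norml ltrNl opprB ltrBlDl h2/= ltrBlDl -ltrBlDr.
Unshelve. all: by end_near. Qed.

(** For each cut-off level the limit is finite and given by [cut_functional_cvg]. The cut-off only
    lowers the modulus, so these are lower bounds, and by monotone convergence they increase to
    infinity. *)
Lemma exceedance_infinite : c = +oo%E ->
  (fine (L (exceedance n)) / a n)%:E @[n --> \oo] --> +oo%E.
Proof.
move=> coo; pose h s : R := clamp (s - 1).
have gh : good_functional N p 1 1 (fun v => h (fine (md v))).
  apply: good_modulus => //; first by move=> s; rewrite clamp_ge0 clamp_le1.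
  by move=> s t; apply: le_trans (clamp_dist _ _) _; rewrite opprB addrA subrK mul1r.
have h00 : h (fine (md (fun=> 0))) = 0.
  by rewrite modulus0//= /h clamp0// sub0r oppr_le0.
have mc n : measurable_fun setT (fun b => h (fine (md (cutoff N n.+2%:R^-1 (S1 b))))).
  by apply: (measurable_good_cut gh); have /andP[] := eps01 n.
have dom n : dominated alpha (n.+2%:R^-1 / 2) 1 (fun b => h (fine (md (cutoff N n.+2%:R^-1 (S1 b))))).
  split => // b; rewrite clamp_ge0 mul1r; case: ltP => hb; first exact: clamp_le1.
  rewrite (_ : cutoff N n.+2%:R^-1 (S1 b) = (fun=> 0)) ?h00 ?lexx//.
  apply/funext => t; rewrite /cutoff /pathmap cutv0//.
  apply: (le_trans (cluster_path_le alpha0 Th0 Th_psum b t)); apply: le_trans hb _.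
  by rewrite ler_piMr// invf_le1// ler1n.
have ndh b n m : (n <= m)%N ->
    h (fine (md (cutoff N n.+2%:R^-1 (S1 b)))) <= h (fine (md (cutoff N m.+2%:R^-1 (S1 b)))).
  move=> nm; apply: le_clamp; rewrite lerD2r -lee_fin.
  have fin k : (md (cutoff N k.+2%:R^-1 (S1 b)) < +oo)%E.
    by apply: le_lt_trans (modulus_cut_le N p0 _ _) _; exact: cluster_md_lty.
  rewrite !fineK ?modulus_fin//; apply: le_modulus => // t.
  by apply: cutv_mono; rewrite ?invr_gt0// lef_pV2 ?posrE// ler_nat !ltnS.
(* The functional is 1 where the modulus exceeds 2, and this set already has infinite mass, a
   positive multiple of c. *)
have lim : (\int[beta]_b (h (fine (md (S1 b))))%:E)%E = +oo%E.
  apply/eqP; rewrite -leye_eq; apply: (@le_trans _ _ (\int[beta]_b (\1_(md_set 2) b : R)%:E)%E).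
    have b2 : beta (md_set 2) = +oo%E by rewrite beta_md_set// coo mulr_infty gtr0_sg ?mul1e// !powR_gt0.
    rewrite integral_indic ?setIT//; last exact: measurable_md_set.
    by rewrite leye_eq; apply/eqP; exact: b2.
  apply: le_integral_fin.
  - by apply: measurable_indic; exact: measurable_md_set.
  - exact: (measurable_good_cluster gh).
  - by move=> b; rewrite indicE; case: (_ \in _).
  - move=> b; rewrite md_set_ind; case: ltP => h2; last exact: clamp_ge0.
    rewrite /h clamp1// lerBrDr -[1 + 1]/(2%:R) -lee_fin fineK ?modulus_fin ?cluster_md_lty//.
    exact: ltW.
have MCT : (\int[beta]_b (h (fine (md (cutoff N n.+2%:R^-1 (S1 b)))))%:E)%E @[n --> \oo] --> +oo%E.
  have := @cvg_monotone_convergence _ _ _ [the measure _ _ of beta] setT measurableT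
    (fun n b => (h (fine (md (cutoff N n.+2%:R^-1 (S1 b)))))%:E).
  move=> /(_ _ _ _); rewrite (_ : (fun b => limn _) = (fun b => (h (fine (md (S1 b))))%:E)); last first.
    apply/funext => b; apply/cvg_lim => //; apply: cvg_EFin; first exact: nearW.
    have cg := cut_good_cvg gh (b := b).
    exact: cg.
  rewrite lim; apply.
  - by move=> n; apply/measurable_EFinP; exact: mc.
  - by move=> n b _; rewrite lee_fin clamp_ge0.
  - by move=> b _ n m nm; rewrite lee_fin ndh.
apply/cvgeryP/cvgryPgt => A.
have [j _ Hj] : \forall j \near \oo, (A%:E < \int[beta]_b (h (fine (md (cutoff N j.+2%:R^-1 (S1 b)))))%:E)%E.
  by move/cvgeyPgt: MCT; apply.
have {}Hj := Hj j (leqnn j).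
have ej0 : 0 < (j.+2%:R^-1 : R) by have /andP[] := eps01 j.
rewrite -(IBE PT alpha0 _ (dom j)) ?divr_gt0// lte_fin in Hj.
have cv := @cut_functional_cvg _ _ N alpha p _ _ PT Th L alpha0 p0 mTh Th0 L_shift RV Th_psum _ _ _ _ gh h00 (eps01 j) x x0 xoo anticlustering.
near=> n.
have n0 : (0 < n)%N by near: n; exact: nbhs_infty_gt.
have an := level_count_gt0 n0.
have H : A < EL L (fun v => h (fine (md (cutoff N j.+2%:R^-1 (z n v))))) / a n.
  near: n; move/cvgrPdist_lt: cv => /(_ (IB PT (fun b => h (fine (md (cutoff N j.+2%:R^-1 (S1 b))))) - A)).
  rewrite subr_gt0 => /(_ Hj); apply: filterS => n.
  by rewrite ltr_norml ltrD2l ltrN2 => /andP[_].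
apply: lt_le_trans H _; rewrite ler_wpM2r ?invr_ge0 ?(ltW an)// -EL_exceedance.
apply: (@le_EL _ _ _ _ _ 1).
- exact: (measurable_good_cut_z n ej0 gh).
- rewrite (_ : (fun v => _) = \1_(exceedance n)); first exact: measurable_indic (measurable_exceedance n).
  by apply/funext => v; rewrite indicE (_ : (v \in _) = (1 < md (z n v))%E)//; rewrite mem_setE.
- by move=> v; exact: clamp_ge0.
- move=> v; case: ltP => hv; first exact: clamp_le1.
  rewrite /h clamp0// subr_le0 -lee_fin fineK; last first.
    by rewrite modulus_fin// (le_lt_trans (modulus_cut_le N p0 _ _))// modulus_block_lty.
  by apply: le_trans hv; exact: modulus_cut_le.
- by move=> v; case: (_ < _)%E.
Unshelve. all: by end_near. Qed.

Section conditional_limit.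
Variables (f : pathZ R d -> R) (M : R).
Hypothesis fM : forall v, 0 <= f v <= M.
Hypothesis f_shift : forall k v, f (bshift k v) = f v.
Hypothesis f_cont : forall v e, (md v < +oo)%E -> 0 < e ->
  exists2 r, 0 < r & forall u, (md u < +oo)%E -> (md (pathB v u) < r%:E)%E -> `|f v - f u| < e.
Hypothesis c_fin : (c < +oo)%E.

Let F v : R := f v * (1 < md v)%E%:R.

Let cut_off_lsc (g : pathZ R d -> R) : (forall v, 0 <= g v <= M) ->
  (forall v e, (md v < +oo)%E -> 0 < e ->
  exists2 r, 0 < r & forall u, (md u < +oo)%E -> (md (pathB v u) < r%:E)%E -> `|g v - g u| < e) ->
  forall v e, (md v < +oo)%E -> 0 < e ->
  exists2 r, 0 < r & forall u, (md u < +oo)%E -> (md (pathB v u) < r%:E)%E ->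
    g v * (1 < md v)%E%:R - e < g u * (1 < md u)%E%:R.
Proof.
move=> gM gc v e vf e0; case: (ltP 1%E (md v)) => v1.
  have [r rp Hr] := lsc_above vf v1; have [s sp Hs] := gc v e vf e0.
  exists (Num.min r s) => [|u uf]; first by rewrite lt_min rp.
  rewrite EFin_min lt_min => /andP[ur us]; rewrite Hr// !mulr1.
  by have := Hs u uf us; rewrite ltr_norml => /andP[_]; rewrite ltrBlDr ltrBlDr addrC.
exists 1 => // u _ _; rewrite mulr0 sub0r; apply: (@lt_le_trans _ _ 0); first by rewrite oppr_lt0.
by rewrite mulr_ge0//; have /andP[] := gM u.
Qed.

Let ind_bounds (g : pathZ R d -> R) : (forall v, 0 <= g v <= M) ->
  forall v, 0 <= g v * (1 < md v)%E%:R <= M.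
Proof.
move=> gM v; have /andP[h1 h2] := gM v.
by case: (_ < _)%E; rewrite ?mulr1 ?h1// mulr0 lexx (le_trans h1).
Qed.

Let one_below (g : pathZ R d -> R) v : (md v <= 1)%E -> g v * (1 < md v)%E%:R = 0.
Proof. by rewrite leNgt => /negbTE ->; rewrite mulr0. Qed.

Let g v : R := M - f v.

Let gM v : 0 <= g v <= M.
Proof. by have /andP[h1 h2] := fM v; rewrite subr_ge0 h2 gerBl. Qed.

Let g_cont v e : (md v < +oo)%E -> 0 < e ->
  exists2 r, 0 < r & forall u, (md u < +oo)%E -> (md (pathB v u) < r%:E)%E -> `|g v - g u| < e.
Proof.
move=> vf e0; have [r rp Hr] := f_cont vf e0; exists r => // u uf vu.
by rewrite /g opprB addrC addrA subrK distrC Hr.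
Qed.

Let G v : R := g v * (1 < md v)%E%:R.

Let F_shift k v : F (bshift k v) = F v. Proof. by rewrite /F f_shift modulus_bshift. Qed.
Let G_shift k v : G (bshift k v) = G v. Proof. by rewrite /G /g f_shift modulus_bshift. Qed.

(** [F] and [G] are both lower semicontinuous, being nonnegative continuous functions on the open
    set of modulus > 1, and their sum is M times its indicator. The lower bound for [G] and the
    upper bound for the exceedance together give the upper bound for [F]. *)
Lemma conditional_limit :
  EL L (fun v => F (z n v)) / fine (L (exceedance n)) @[n --> \oo] --> IB PT (fun b => F (S1 b)) / fine c.
Proof.
have c0 : 0 < fine c by rewrite fine_gt0// cluster_index_gt0.
have Flsc := cut_off_lsc fM f_cont; have Glsc := cut_off_lsc gM g_cont.
have FM := ind_bounds fM; have GM := ind_bounds gM.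
have [FI _] := lsc_cluster_cvg FM F_shift Flsc (one_below f) c_fin.
have [GI _] := lsc_cluster_cvg GM G_shift Glsc (one_below g) c_fin.
have exc := exceedance_cvg c_fin.
have M0 : 0 <= M by have /andP[h1 h2] := fM (fun=> 0); exact: le_trans h2.
have FG v : F v = M * (1 < md v)%E%:R - G v by rewrite /F /G /g mulrBl opprB addrCA subrr addr0.
have mI n : measurable_fun setT (fun v : path_space R d => (1 < md (z n v))%E%:R : R).
  rewrite (_ : (fun v => _) = \1_(exceedance n)); first exact: measurable_indic (measurable_exceedance n).
  by apply/funext => v; rewrite indicE (_ : (v \in _) = (1 < md (z n v))%E)//; rewrite mem_setE.
have mG := measurable_lsc_z GM G_shift Glsc.
have ELF n : EL L (fun v => F (z n v)) = M * fine (L (exceedance n)) - EL L (fun v => G (z n v)).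
  have C1 v : `|(1 < md (z n v))%E%:R : R| <= 1 + M.
    by case: (_ < _)%E; rewrite ?normr1 ?normr0 ?lerDl ?addr_ge0.
  have C2 v : `|G (z n v)| <= 1 + M.
    by have /andP[h1 h2] := GM (z n v); rewrite ger0_norm// (le_trans h2)// lerDr.
  rewrite -EL_exceedance -mulN1r -(EL_lin _ _ (mI n) (mG n) C1 C2).
  by congr EL; apply/funext => v; rewrite FG mulN1r.
have IBF : IB PT (fun b => F (S1 b)) = M * fine c - IB PT (fun b => G (S1 b)).
  apply/eqP; rewrite eq_sym subr_eq -(IB_add FI GI); apply/eqP.
  have -> : M * fine c = IB PT (fun b => M * \1_(md_set 1) b).
    rewrite IBZ_indic//; [|exact: measurable_md_set|exact: md_set_fin].
    by rewrite beta_md_set// !powR1 mul1e.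
  by congr IB; apply/funext => b; rewrite md_set_ind -mulrDl [f _ + _]addrC subrK.
have lim : EL L (fun v => F (z n v)) / a n @[n --> \oo] --> IB PT (fun b => F (S1 b)).
  apply/cvgrPdist_lt => e e0; have e20 : 0 < e / 2 by rewrite divr_gt0.
  have e30 : 0 < e / 2 / (M + 1) by rewrite divr_gt0// ltr_wpDl.
  have A := lower_limit FM F_shift Flsc (one_below f) c_fin e0.
  have B := lower_limit GM G_shift Glsc (one_below g) c_fin e20.
  have C := exceedance_upper c_fin e30.
  near=> n.
  have h1 : IB PT (fun b => F (S1 b)) - e < EL L (fun v => F (z n v)) / a n by near: n; exact: A.
  have h2 : IB PT (fun b => G (S1 b)) - e / 2 < EL L (fun v => G (z n v)) / a n by near: n; exact: B.
  have h3 : fine (L (exceedance n)) / a n < fine c + e / 2 / (M + 1) by near: n; exact: C.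
  rewrite ltr_norml ltrNl opprB ltrBlDl; apply/andP; split; last by rewrite ltrBlDl -ltrBlDr.
  rewrite ELF IBF mulrBl -mulrA.
  have h4 : M * (fine (L (exceedance n)) / a n) <= M * fine c + e / 2.
    apply: (@le_trans _ _ (M * (fine c + e / 2 / (M + 1)))); first by rewrite ler_wpM2l// ltW.
    rewrite mulrDr lerD2l mulrCA ler_piMr ?(ltW e20)// ler_pdivrMr ?mul1r ?lerDl//.
    by rewrite ltr_wpDl.
  apply: (@lt_le_trans _ _ ((M * fine c + e / 2) - (IB PT (fun b => G (S1 b)) - e / 2))).
    by apply: ler_ltD => //; rewrite ltrN2.
  by rewrite le_eqVlt; apply/orP; left; apply/eqP; field.
apply: cvg_trans (cvgM lim (cvgV (negbT (gt_eqF c0)) exc)); apply: near_eq_cvg; near=> n.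
have n0 : (0 < n)%N by near: n; exact: nbhs_infty_gt.
have an := level_count_gt0 n0.
by rewrite /= invf_div mulrA divfK// gt_eqF.
Unshelve. all: by end_near. Qed.

End conditional_limit.

End cluster_limit.

(** * Sequence spaces and their Borel sets *)

Section metric_topology.
Context (R : realType) (S : ptopologicalType) (dist : S -> S -> R).
Hypothesis dist_ge0 : forall x y, 0 <= dist x y.
Hypothesis distxx : forall x, dist x x = 0.
Hypothesis distC : forall x y, dist x y = dist y x.
Hypothesis dist_tri : forall x y z, dist x z <= dist x y + dist y z.
Hypothesis openP : forall U : set S, open U <->
  forall x, U x -> exists2 e, 0 < e & forall y, dist x y < e -> U y.

Lemma metric_ball_open x e : open [set y | dist x y < e].
Proof.
apply/openP => y /= xy; exists (e - dist x y) => [|z yz]; first by rewrite subr_gt0.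
by apply: (le_lt_trans (dist_tri x y z)); rewrite -ltrBrDl.
Qed.

Lemma metric_near x e : 0 < e -> \forall y \near x, dist x y < e.
Proof.
move=> e0; apply: open_nbhs_nbhs; split; first exact: metric_ball_open.
by rewrite /= distxx.
Qed.

Lemma metric_continuous (f : S -> R) :
  (forall x e, 0 < e -> exists2 r, 0 < r & forall y, dist x y < r -> `|f x - f y| < e) ->
  continuous f.
Proof.
move=> H x; apply/cvgrPdist_lt => e e0; have [r r0 Hr] := H x e e0.
by apply: filterS (metric_near x r0) => y; exact: Hr.
Qed.

Lemma metric_continuous_eps (f : S -> R) : continuous f ->
  forall x e, 0 < e -> exists2 r, 0 < r & forall y, dist x y < r -> `|f x - f y| < e.
Proof.
move=> cf x e e0; have /cvgrPdist_lt/(_ e e0) := cf x.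
rewrite /= nbhsE => -[U [oU Ux] UH].
by have [r r0 Hr] := (openP U).1 oU x Ux; exists r => // y /Hr /UH.
Qed.

Lemma metric_cvg x (u : nat -> S) : (forall e, 0 < e -> \forall n \near \oo, dist x (u n) < e) ->
  u n @[n --> \oo] --> x.
Proof.
move=> H A; rewrite nbhsE => -[U [oU Ux] UA].
have [r r0 Hr] := (openP U).1 oU x Ux.
by apply: filterS (H r r0) => n /Hr /UA.
Qed.

Lemma metric_open_approx : open_approx R S.
Proof.
move=> U oU.
have U01 A : 0 <= (\1_U A : R) <= 1 by rewrite indicE; case: (_ \in _); rewrite ?lexx ?ler01.
exists (fun k => infconv dist \1_U k%:R); split.
- move=> k; apply: metric_continuous => A e e0; exists (e / k.+1%:R) => [|B AB].
    by rewrite divr_gt0.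
  apply: (@le_lt_trans _ _ (k%:R * dist A B)).
    have k0 : 0 <= k%:R :> R by [].
    have h1 := infconv_lipschitz dist_ge0 dist_tri U01 A B k0.
    have h2 := infconv_lipschitz dist_ge0 dist_tri U01 B A k0.
    by rewrite ler_distl h1 andbT lerBlDr distC.
  rewrite ltr_pdivlMr// in AB; apply: le_lt_trans AB.
  by rewrite mulrC ler_wpM2l// ler_nat.
- by move=> k A; exact: infconv_bound.
- by move=> k l A kl; apply: le_infconv => //; rewrite ler_nat.
- move=> A; apply: infconv_cvg => // e e0; rewrite !indicE.
  have [|AU] := boolP (A \in U); last first.
    by exists 1 => // B _; have /andP[B0 _] := U01 B; rewrite sub0r (@lt_le_trans _ _ 0)// oppr_lt0.
  rewrite inE => UA; have [r r0 rU] := (openP U).1 oU A UA.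
  exists r => // B AB; rewrite indicE (mem_set (rU B AB)).
  by rewrite ltrBlDr ltrDl.
Qed.

End metric_topology.

(** The indicator of an open set is a limit of continuous functions, so its composition with the
    limit map is a double limit of measurable real functions. No separability enters, which matters
    for ell^oo. *)
Lemma measurable_borel_cvg (R : realType) (S : ptopologicalType) d (T : measurableType d)
    (f_ : nat -> T -> S) (f : T -> S) : open_approx R S ->
  (forall n, measurable_fun setT (f_ n : T -> borel S)) ->
  (forall t, f_ n t @[n --> \oo] --> f t) -> measurable_fun setT (f : T -> borel S).
Proof.
move=> oa mf_ ff; apply: measurable_to_borel => U oU.
have [h [ch _ _ hU]] := oa U oU.
have mh k : measurable_fun setT (fun t => h k (f t)).
  apply: (@measurable_fun_cvg _ _ _ _ (fun n t => h k (f_ n t))).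
    by move=> n; apply: (measurableT_comp (f := h k : borel S -> R)) => //; exact: continuous_borel.
  by move=> t _; apply: (cvg_comp _ _ (ff t)); exact: ch.
have mU : measurable_fun setT (fun t => \1_U (f t) : R).
  by apply: (measurable_fun_cvg mh) => t _; exact: hU.
rewrite (_ : f @^-1` U = [set t | 1 / 2 < (\1_U (f t) : R)]); first exact: measurable_ltr_set.
apply/seteqP; split => t /=.
  by move=> Ut; rewrite indicE mem_set// ltr_pdivrMr// mul1r ltr1n.
by apply: contraPP => nU; rewrite indicE memNset//=; apply/negP; rewrite -leNgt divr_ge0.
Qed.

(** A map that is measurable in one argument and continuous in the other. The scalar is rounded down
    to a multiple of 1/(n + 1); the rounded map splits over countably many values and converges to
    the given one. This avoids product sigma-algebras on spaces that may fail to be separable. *)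
Lemma measurable_curried_borel (R : realType) (S : ptopologicalType) d (T : measurableType d)
    (g : R -> S -> S) (Y : T -> R) (Q : T -> S) : open_approx R S ->
  (forall a, measurable_fun setT (g a : borel S -> borel S)) ->
  (forall a (u : nat -> R) q, u n @[n --> \oo] --> a -> g (u n) q @[n --> \oo] --> g a q) ->
  measurable_fun setT Y -> measurable_fun setT (Q : T -> borel S) ->
  measurable_fun setT (fun t => g (Y t) (Q t) : borel S).
Proof.
move=> oa mg cg mY mQ.
pose fl (n : nat) (y : R) : R := (Num.floor (n.+1%:R * y))%:~R / n.+1%:R.
apply: (@measurable_borel_cvg R S _ _ (fun n t => g (fl n (Y t)) (Q t))) => // [n|t].
  apply: measurable_to_borel => U oU.
  rewrite (_ : _ @^-1` U = \bigcup_(k : int) ([set t | Num.floor (n.+1%:R * Y t) = k] `&`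
      (fun t => g (k%:~R / n.+1%:R) (Q t)) @^-1` U)); last first.
    apply/seteqP; split => t /= => [Ut|[k _ [<-]]//].
    by exists (Num.floor (n.+1%:R * Y t)).
  apply: countable_bigcupT_measurable => [|k]; first exact: countableP.
  apply: measurableI.
    rewrite (_ : [set t | _] = [set t | k%:~R <= n.+1%:R * Y t] `&` [set t | n.+1%:R * Y t < (k + 1)%:~R]).
      apply: measurableI.
        rewrite (_ : [set t | _] = ~` [set t | n.+1%:R * Y t < k%:~R]).
          by apply: measurableC; apply: measurable_ltr_set => //; exact: measurable_funM.
        by apply/seteqP; split => t /=; rewrite leNgt => /negP.
      by apply: measurable_ltr_set => //; exact: measurable_funM.
    apply/seteqP; split => t /=.
      by move=> <-; split; [exact: floor_le|exact: floorD1_gt].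
    by move=> [h1 h2]; apply/eqP; rewrite floor_eq h1.
  apply: (measurable_preimage (f := fun t => g (k%:~R / n.+1%:R) (Q t) : borel S)).
    exact: (measurableT_comp (mg _)).
  exact: open_measurable_borel.
apply: cg; apply/cvgrPdist_lt => e e0.
have H : (n.+1%:R^-1 : R) @[n --> \oo] --> (0 : R) by exact: cvg_harmonic.
move/cvgrPdist_lt: H => /(_ e e0); apply: filterS => n.
rewrite sub0r normrN gtr0_norm// => ne.
have n0 : 0 < n.+1%:R :> R by [].
have h1 := floor_le (n.+1%:R * Y t); have h2 := floorD1_gt (n.+1%:R * Y t).
have -> : Y t - fl n (Y t) = (n.+1%:R * Y t - (Num.floor (n.+1%:R * Y t))%:~R) / n.+1%:R.
  by rewrite /fl; field; rewrite gt_eqF.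
rewrite ger0_norm; last by rewrite divr_ge0// subr_ge0.
apply: le_lt_trans ne; rewrite -[leRHS]div1r ler_pM2r ?invr_gt0// lerBlDl.
by move: h2; rewrite intrD => /ltW.
Qed.

Section ell_spaces.
Context (R : realType) (d : nat) (N : vnorm R d) (p : \bar R).
Hypothesis p0 : (0 < p)%E.
Local Notation md := (modulus N p).
Local Notation ellp := (ell N p).
Local Notation rdist := (@rdist R d N p).
Local Notation cls := (@shift_class R d N p).
Implicit Types (v u : pathZ R d) (x y : ellp) (q : ell_tilde N p).

Lemma ell_openP (U : set ellp) : open U <->
  forall x, U x -> exists2 e, 0 < e & forall y, rdist x y < e -> U y.
Proof.
have -> : open U = dist_open (@elldist R d N p) U by [].
split=> oU x Ux; have [e e0 He] := oU x Ux; exists e => // y.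
  by rewrite -lte_fin rdistE//; exact: He.
by rewrite -rdistE// lte_fin; exact: He.
Qed.

Lemma ell_open_approx : open_approx R ellp.
Proof.
exact: (metric_open_approx (@rdist_ge0 _ _ N p) (rdistxx p0) (rdistC p0) (rdist_tri p0) ell_openP).
Qed.

Lemma ell_cvg x (u : nat -> ellp) : (forall e, 0 < e -> \forall n \near \oo, rdist x (u n) < e) ->
  u n @[n --> \oo] --> x.
Proof. exact: (metric_cvg ell_openP). Qed.

Lemma rdist_lt x y (e : R) : (rdist x y < e) = (md (pathB (ell_val x) (ell_val y)) < e%:E)%E.
Proof. by rewrite -lte_fin rdistE. Qed.

Lemma toell_block_measurable (a b : int) :
  measurable_fun setT ((fun v => toell N p (block a b v)) : path_space R d -> borel ellp).
Proof.
pose n : nat := `|b - a|.+1.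
pose zz (A : 'M[R]_(n, d)) : pathZ R d := block a b (unwin a A).
have zf A : (lpnorm N p (zz A) < +oo)%E by exact: lpnorm_block_fin.
have cz : continuous (fun A : 'M[R]_(n, d) => toell N p (zz A)).
  move=> A B; rewrite nbhsE => -[U [oU Ux] UB].
  have [e e0 He] := (ell_openP U).1 oU _ Ux.
  have [||r r0 Hr] := @finitely_supported_close _ _ N p p0 _ zz a n _ _ A e e0.
  - by move=> A' t ta; rewrite /zz /block; case: ifP => //; rewrite unwin0.
  - move=> t A' e' e'0; have [r r0 Hr] := unwin_continuous N a t A' e'0.
    exists r => // B' /Hr h; rewrite /zz /block; case: ifP => // _.
    by rewrite subrr vnorm0.
  apply/nbhs_ballP; exists r => // A' AA'; apply: UB; apply: He.
  by rewrite rdist_lt !toellK//; apply: Hr; rewrite mx_norm_ball in AA'.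
rewrite (_ : (fun v => _) = (fun A => toell N p (zz A)) \o window a n); last first.
  apply/funext => v /=; congr toell; apply/funext => t; rewrite /zz /block.
  by case: ifP => // tab; rewrite unwin_window//; lia.
apply: (measurableT_comp (f := (fun A => toell N p (zz A)) : borel 'M[R]_(n, d) -> borel ellp)).
  exact: continuous_measurable_borel.
exact: measurable_window.
Qed.

(** For p = oo, measurable coordinates alone need not give a Borel map. The decay of the entries
    makes the map a limit in d_p of blocks, each of which factors through a space of matrices. *)
Lemma toell_measurable d' (T : measurableType d') (F : T -> pathZ R d) :
  measurable_fun setT (F : T -> path_space R d) -> (forall b, (md (F b) < +oo)%E) ->
  (forall b, vanishing N (F b)) -> measurable_fun setT ((fun b => toell N p (F b)) : T -> borel ellp).
Proof.
move=> mF Ff Fv.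
apply: (measurable_borel_cvg ell_open_approx (f_ := fun k b => toell N p (block (- k%:Z) k%:Z (F b)))).
  move=> k; apply: (measurableT_comp (f := (fun v => toell N p (block (- k%:Z) k%:Z v)) : path_space R d -> borel ellp)) => //.
  exact: toell_block_measurable.
move=> b; apply: ell_cvg => e e0; have [K HK] := modulus_tail p0 (Ff b) (Fv b) e0.
near=> k; rewrite rdist_lt !toellK -?modulus_lty//; last exact: modulus_block_lty.
by apply: HK; near: k; exact: nbhs_infty_ge.
Unshelve. all: by end_near. Qed.

Definition ellshift (k : int) x : ellp := toell N p (bshift k (ell_val x)).

Lemma ellshiftE k x : ell_val (ellshift k x) = bshift k (ell_val x).
Proof. by rewrite toellK// lpnorm_bshift; exact: (svalP x). Qed.

Lemma shift_classP x y : cls x = cls y <-> exists k, bshift k (ell_val x) = ell_val y.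
Proof.
split.
  by move=> /eqP; rewrite eqmodE /= => /asboolP.
by move=> h; apply/eqP; rewrite eqmodE /=; apply/asboolP.
Qed.

Lemma shift_class_shift k x : cls (ellshift k x) = cls x.
Proof. by apply/esym/shift_classP; exists k; rewrite ellshiftE. Qed.

Lemma class_representative q : cls (representative q) = q.
Proof. exact: reprK. Qed.

Lemma representative_class x : exists k, bshift k (ell_val x) = ell_val (representative (cls x)).
Proof. by apply/shift_classP; rewrite class_representative. Qed.

Lemma tilde_dist_le x y : (tilde_dist (cls x) (cls y) <= (rdist x y)%:E)%E.
Proof.
apply: ereal_inf_lbound; exists 0, x, y; split => //.
by rewrite rdistE// bshift0.
Qed.

(** Shifts are isometries, so the infimum over pairs of representatives is not affected by fixing
    the first one. This lets near-optimal representatives be chained, as the triangle inequality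
    requires. *)
Lemma tilde_dist_lt q r (e : \bar R) x : cls x = q -> (tilde_dist q r < e)%E ->
  exists2 y, cls y = r & ((rdist x y)%:E < e)%E.
Proof.
move=> xq /ereal_inf_lt[_ [k [a [b [aq br ->]]]]] h.
have [j xj] : exists j, bshift j (ell_val x) = ell_val a by apply/shift_classP; rewrite xq aq.
exists (ellshift (- (k + j)) b); first by rewrite shift_class_shift.
rewrite rdistE// /elldist ellshiftE; apply: le_lt_trans h.
rewrite -xj bshiftD !lpdistE -(modulus_bshift N p (- (k + j)) (pathB (bshift _ _) _)).
by rewrite (_ : bshift _ (pathB _ _) = pathB (bshift (- (k + j)) (bshift (k + j) (ell_val x))) (bshift (- (k + j)) (ell_val b)))// bshiftD addNr bshift0.
Qed.

Lemma tilde_dist_ge0 q r : (0 <= tilde_dist q r)%E.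
Proof.
by apply: le_ereal_inf_tmp => _ [k [a [b [_ _ ->]]]]; rewrite lpdistE modulus_ge0.
Qed.

Definition tdist q r : R := fine (tilde_dist q r).

Lemma tdistE q r : (tdist q r)%:E = tilde_dist q r.
Proof.
rewrite fineK// ge0_fin_numE ?tilde_dist_ge0//.
rewrite -(class_representative q) -(class_representative r).
by apply: le_lt_trans (tilde_dist_le _ _) _; exact: ltry.
Qed.

Lemma tdist_le x y : tdist (cls x) (cls y) <= rdist x y.
Proof. by rewrite -lee_fin tdistE; exact: tilde_dist_le. Qed.

Lemma tdist_lt q r e x : cls x = q -> tdist q r < e -> exists2 y, cls y = r & rdist x y < e.
Proof.
move=> xq; rewrite -lte_fin tdistE => /(tilde_dist_lt xq)[y yr h].
by exists y.
Qed.

Lemma tdist_ge0 q r : 0 <= tdist q r.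
Proof. by rewrite -lee_fin tdistE tilde_dist_ge0. Qed.

Lemma tdistxx q : tdist q q = 0.
Proof.
apply/eqP; rewrite eq_le tdist_ge0 andbT -(class_representative q).
by apply: le_trans (tdist_le _ _) _; rewrite rdistxx.
Qed.

Lemma tdistC q r : tdist q r = tdist r q.
Proof.
have h q' r' : tdist q' r' <= tdist r' q'.
  apply/ler_addgt0Pr => e e0.
  have lt : tdist r' q' < tdist r' q' + e by rewrite ltrDl.
  have [y yr h] := tdist_lt (class_representative r') lt.
  by rewrite -{1}yr -{1}(class_representative r') (le_trans (tdist_le _ _))// rdistC// ltW.
by apply/eqP; rewrite eq_le !h.
Qed.

Lemma tdist_tri q r s : tdist q s <= tdist q r + tdist r s.
Proof.
apply/ler_addgt0Pr => e e0; have e20 : 0 < e / 2 by rewrite divr_gt0.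
have lt1 : tdist q r < tdist q r + e / 2 by rewrite ltrDl.
have lt2 : tdist r s < tdist r s + e / 2 by rewrite ltrDl.
have [y yr h1] := tdist_lt (class_representative q) lt1.
have [z zs h2] := tdist_lt yr lt2.
rewrite -{1}zs -{1}(class_representative q) (le_trans (tdist_le _ _))//.
apply: le_trans (rdist_tri p0 _ y _) _.
by rewrite [in leRHS](splitr e) addrACA lerD// ltW.
Qed.

Lemma tilde_openP (U : set (ell_tilde N p)) : open U <->
  forall q, U q -> exists2 e, 0 < e & forall r, tdist q r < e -> U r.
Proof.
have -> : open U = dist_open (@tilde_dist R d N p) U by [].
split=> oU q Uq; have [e e0 He] := oU q Uq; exists e => // r.
  by rewrite -lte_fin tdistE; exact: He.
by rewrite -tdistE lte_fin; exact: He.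
Qed.

Lemma tilde_open_approx : open_approx R (ell_tilde N p).
Proof. exact: (metric_open_approx tdist_ge0 tdistxx tdistC tdist_tri tilde_openP). Qed.

Lemma tilde_cvg q (u : nat -> ell_tilde N p) :
  (forall e, 0 < e -> \forall n \near \oo, tdist q (u n) < e) -> u n @[n --> \oo] --> q.
Proof. exact: (metric_cvg tilde_openP). Qed.

Lemma shift_class_measurable : measurable_fun setT (cls : borel ellp -> borel (ell_tilde N p)).
Proof.
apply: continuous_measurable_borel; apply/continuousP => U oU; apply/ell_openP => x Ux.
have [e e0 He] := (tilde_openP U).1 oU _ Ux; exists e => // y xy; apply: He.
exact: le_lt_trans (tdist_le _ _) xy.
Qed.

Lemma tilde_continuous_close (f : ell_tilde N p -> R) : continuous f ->
  forall v e, (md v < +oo)%E -> 0 < e -> exists2 r, 0 < r & forall u, (md u < +oo)%E ->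
    (md (pathB v u) < r%:E)%E -> `|f (cls (toell N p v)) - f (cls (toell N p u))| < e.
Proof.
move=> cf v e vf e0.
have [r r0 Hr] := metric_continuous_eps tilde_openP cf (cls (toell N p v)) e0.
exists r => // u uf vu; apply: Hr; apply: le_lt_trans (tdist_le _ _) _.
by rewrite rdist_lt !toellK// -modulus_lty.
Qed.

Lemma class_toell_shift k v : cls (toell N p (bshift k v)) = cls (toell N p v).
Proof.
have [vf|vf] := boolP (lpnorm N p v < +oo)%E.
  by apply/esym/shift_classP; exists k; rewrite !toellK// lpnorm_bshift.
rewrite /toell; case: pselect => [vf'|_]; last by case: pselect => // vf'; rewrite vf' in vf.
by rewrite -(lpnorm_bshift N p k) vf' in vf.
Qed.

Lemma tilde_norm_class x : tilde_norm (cls x) = lpnorm N p (ell_val x).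
Proof. by have [k h] := representative_class x; rewrite /tilde_norm -h lpnorm_bshift. Qed.

Lemma tilde_scale_class a x : tilde_scale a (cls x) = cls (ellscale a x).
Proof.
have [k h] := representative_class x.
by apply/esym/shift_classP; exists k; rewrite -[RHS]/(scale a (ell_val (representative (cls x)))) -h.
Qed.

End ell_spaces.

(** * Image laws, normalized restrictions and conditional laws *)

Section probability_tools.
Local Open Scope ereal_scope.
Context d1 d2 (T1 : measurableType d1) (T2 : measurableType d2) (R : realType).

Section pushforward_probability.
Variables (P : probability T1 R) (f : T1 -> T2) (mf : measurable_fun setT f).

Lemma mpush_setT : mpush P mf setT = 1.
Proof. by transitivity (P setT); [|exact: probability_setT]. Qed.

Definition pushprob : probability T2 R :=
  HB.pack (Measure.sort (mpush P mf)) (Measure_isProbability.Build _ _ _ (mpush P mf) mpush_setT).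

Lemma ge0_integral_pushprob (g : T2 -> \bar R) : measurable_fun setT g ->
  (forall y, 0 <= g y) -> \int[pushprob]_y g y = \int[P]_x g (f x).
Proof. by move=> mg g0; exact: (@ge0_integral_mpush _ _ _ _ _ P f mf g mg g0). Qed.

End pushforward_probability.

Section normalized_restriction.
Variables (mu : {measure set T1 -> \bar R}) (E : set T1) (c : R).
Hypothesis mE : measurable E.
Hypothesis c0 : (0 < c)%R.
Hypothesis muE : mu E = c%:E.

Let k : {nonneg R} := NngNum (ltW (divr_gt0 ltr01 c0)).

Let m : {measure set T1 -> \bar R} := [the measure _ _ of mscale k (mrestr mu mE)].

Let m1 : m setT = 1.
Proof. by rewrite /m/= /mscale/= /mrestr setTI muE -EFinM div1r mulVf// gt_eqF. Qed.

Definition normalized_restriction : probability T1 R :=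
  HB.pack (Measure.sort m) (Measure_isProbability.Build _ _ _ m m1).

Lemma normalized_restrictionE A : normalized_restriction A = (c^-1)%:E * mu (A `&` E).
Proof. by rewrite /normalized_restriction/= /mscale/= /mrestr div1r. Qed.

Lemma ge0_integral_normalized (g : T1 -> \bar R) : measurable_fun setT g -> (forall y, 0 <= g y) ->
  \int[normalized_restriction]_y g y = (c^-1)%:E * \int[mu]_(x in E) g x.
Proof.
move=> mg g0; transitivity (\int[m]_y g y); first by [].
by rewrite ge0_integral_mscale//= div1r ge0_integral_mrestr.
Qed.

End normalized_restriction.
End probability_tools.

Section conditional_law.
Context (dO : measure_display) (O : measurableType dO) (R : realType) (P : probability O R).
Context (S : ptopologicalType) (Z : O -> borel S) (B : set O).
Hypothesis mZ : measurable_fun setT Z.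
Hypothesis mB : measurable B.

Let b0 : 0 <= (fine (P B))^-1. Proof. by rewrite invr_ge0 fine_ge0. Qed.

Let k : {nonneg R} := NngNum b0.

Let nu : {measure set (borel S) -> \bar R} :=
  [the measure _ _ of mscale k (mpush [the measure _ _ of mrestr P mB] mZ)].

Let cond_lawE A : measurable A -> cond_law P Z B A = nu A.
Proof.
move=> mA; rewrite /nu/= /mscale/= /pushforward /mrestr /cond_law /cprob.
have mZA := measurable_preimage mZ mA.
rewrite mulrC EFinM fineK// ge0_fin_numE//.
by apply: (le_lt_trans (probability_le1 P _)); [exact: measurableI|exact: ltry].
Qed.

Let cond_law0 : cond_law P Z B set0 = 0%E.
Proof. by rewrite /cond_law /cprob preimage_set0 set0I measure0 mul0r. Qed.

Let cond_law_ge0 A : (0 <= cond_law P Z B A)%E.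
Proof. by rewrite lee_fin divr_ge0// fine_ge0. Qed.

Let cond_law_sigma_additive : semi_sigma_additive (cond_law P Z B).
Proof.
move=> F mF tF mUF; rewrite cond_lawE//.
rewrite (_ : (fun n => _) = (fun n => \sum_(0 <= i < n) nu (F i))%E); last first.
  by apply/funext => n; apply: eq_bigr => i _; rewrite cond_lawE.
exact: measure_semi_sigma_additive.
Qed.

(** The set function [cond_law] itself, and not a copy, packed as a measure, so that measure theory
    applies to the integrals in [weak_cvg]. If P B = 0 it is the zero measure. *)
Definition cond_measure : {measure set (borel S) -> \bar R} :=
  HB.pack (cond_law P Z B)
    (isMeasure.Build _ _ _ (cond_law P Z B) cond_law0 cond_law_ge0 cond_law_sigma_additive).

Lemma integral_cond_law (f : S -> R) (C : R) : measurable_fun setT (f : borel S -> R) ->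
  (forall s, 0 <= f s <= C) ->
  (\int[cond_law P Z B]_(s in [set: borel S]) (f s)%:E)%E =
  (fine (\int[P]_w (f (Z w) * \1_B w)%:E)%E / fine (P B))%:E.
Proof.
move=> mf fC; transitivity (\int[cond_measure]_s (f s)%:E)%E; first by [].
transitivity (\int[nu]_s (f s)%:E)%E.
  by apply: eq_measure_integral => A mA _; exact: cond_lawE.
have f0 s : (0 <= (f s)%:E)%E by rewrite lee_fin; have /andP[] := fC s.
have mfE : measurable_fun setT (fun s : borel S => (f s)%:E) by apply/measurable_EFinP.
rewrite /nu ge0_integral_mscale//= ge0_integral_mpush// ge0_integral_mrestr//; last exact: (measurableT_comp mfE mZ).
rewrite mulrC EFinM; congr (_ * _)%E.
rewrite integral_mkcond fineK.
  apply: eq_integral => w _; rewrite patchE indicE; case: (boolP (w \in B)) => wB; rewrite ?mulr1 ?mulr0//.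
rewrite ge0_fin_numE; last first.
  by apply: integral_ge0 => w _; rewrite lee_fin mulr_ge0//; have /andP[] := fC (Z w).
have PC : (\int[P]_w (cst C%:E w) = C%:E)%E.
  by rewrite integral_cst//; transitivity (C%:E * 1)%E; [congr (_ * _)%E; exact: probability_setT|rewrite mule1].
apply: (@le_lt_trans _ _ (\int[P]_w (cst C%:E w))%E); last by rewrite PC ltry.
apply: ge0_le_integral => //.
- by move=> w _; rewrite lee_fin mulr_ge0//; have /andP[] := fC (Z w).
- apply/measurable_EFinP; apply: measurable_funM; last exact: measurable_indic.
  exact: (measurableT_comp mf).
- move=> w _; rewrite lee_fin; have /andP[h1 h2] := fC (Z w); by rewrite (le_trans _ h2)// ler_piMr.
Qed.

End conditional_law.

(** * Scaling, length and direction on the quotient *)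

Section tilde_maps.
Context (R : realType) (d : nat) (N : vnorm R d) (p : \bar R).
Hypothesis p0 : (0 < p)%E.
Local Notation md := (modulus N p).
Local Notation ellp := (ell N p).
Local Notation rdist := (@rdist R d N p).
Local Notation cls := (@shift_class R d N p).
Local Notation tdist := (@tdist R d N p).
Implicit Types (v u : pathZ R d) (x y : ellp) (q : ell_tilde N p).

Lemma ell_val_scale a x : ell_val (ellscale a x) = scale a (ell_val x).
Proof. by []. Qed.

Lemma rdist_scale a x y : rdist (ellscale a x) (ellscale a y) = `|a| `^ mexp p * rdist x y.
Proof.
apply: EFin_inj; rewrite EFinM !rdistE// /elldist !lpdistE -modulusZ//; congr modulus.
by apply/funext => t; rewrite /pathB /scale scalerBr.
Qed.

Lemma rdist_scale_diff a b x : rdist (ellscale a x) (ellscale b x) = `|a - b| `^ mexp p * fine (md (ell_val x)).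
Proof.
apply: EFin_inj; rewrite EFinM rdistE// fineK ?modulus_fin ?ell_md// /elldist lpdistE -modulusZ//; congr modulus.
by apply/funext => t; rewrite /pathB /scale scalerBl.
Qed.

Lemma tilde_scale_measurable a :
  measurable_fun setT ((fun q => tilde_scale a q) : borel (ell_tilde N p) -> borel (ell_tilde N p)).
Proof.
apply: continuous_measurable_borel; apply/continuousP => U oU; apply/(tilde_openP p0) => q Uq.
have [e e0 He] := (tilde_openP p0 U).1 oU _ Uq.
have c0 : 0 < `|a| `^ mexp p + 1 by rewrite ltr_wpDl// powR_ge0.
exists (e / (`|a| `^ mexp p + 1)) => [|r qr]; first by rewrite divr_gt0.
have [y yr h] := tdist_lt p0 (class_representative q) qr.
apply: He; rewrite -yr -{1}(class_representative q) !tilde_scale_class.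
apply: le_lt_trans (tdist_le p0 _ _) _; rewrite rdist_scale.
rewrite ltr_pdivlMr// mulrC in h; apply: le_lt_trans h.
by rewrite ler_wpM2r ?rdist_ge0// lerDl.
Qed.

Lemma tilde_scale_cvg a (u : nat -> R) q : u n @[n --> \oo] --> a ->
  tilde_scale (u n) q @[n --> \oo] --> tilde_scale a q.
Proof.
move=> ua; apply: (tilde_cvg p0) => e e0; have q0 := mexp_gt0 p0.
set m := fine (md (ell_val (representative q))).
have m0 : 0 <= m by rewrite fine_ge0// modulus_ge0.
have e1 : 0 < e / (m + 1) by rewrite divr_gt0// ltr_wpDl.
have d0 : 0 < (e / (m + 1)) `^ (mexp p)^-1 by rewrite powR_gt0.
move/cvgrPdist_lt: ua => /(_ _ d0); apply: filterS => n un.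
rewrite -{1 2}(class_representative q) !tilde_scale_class.
apply: le_lt_trans (tdist_le p0 _ _) _; rewrite rdist_scale_diff -/m.
apply: (@le_lt_trans _ _ (e / (m + 1) * m)).
  rewrite ler_wpM2r// [leRHS](_ : _ = ((e / (m + 1)) `^ (mexp p)^-1) `^ mexp p); last first.
    by rewrite -powRrM mulVf ?gt_eqF// powRr1// ltW.
  by rewrite ge0_ler_powR ?nnegrE ?(ltW q0) ?(ltW d0)// ltW.
by rewrite mulrAC -mulrA gtr_pMr// ltr_pdivrMr ?mul1r ?ltrDl// ltr_wpDl.
Qed.

Lemma tilde_scale_measurable2 d' (T : measurableType d') (Y : T -> R) (Q : T -> ell_tilde N p) :
  measurable_fun setT Y -> measurable_fun setT (Q : T -> borel (ell_tilde N p)) ->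
  measurable_fun setT ((fun t => tilde_scale (Y t) (Q t)) : T -> borel (ell_tilde N p)).
Proof.
move=> mY mQ; apply: (measurable_curried_borel (tilde_open_approx p0)) => //.
- exact: tilde_scale_measurable.
- exact: tilde_scale_cvg.
Qed.

Definition tilde_length q : R := fine (tilde_norm q).

Lemma tilde_length_measurable : measurable_fun setT (tilde_length : borel (ell_tilde N p) -> R).
Proof.
have q0 := mexp_gt0 p0; pose g q := fine (md (ell_val (representative q))).
have gE x : g (cls x) = fine (md (ell_val x)).
  by rewrite /g; have [k <-] := representative_class x; rewrite modulus_bshift.
have cg : continuous g.
  apply: (metric_continuous (@tdistxx _ _ N p p0) (@tdist_tri _ _ N p p0) (@tilde_openP _ _ N p p0)) => q e e0.
  exists e => // r qr; have [y <- h] := tdist_lt p0 (class_representative q) qr.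
  rewrite gE; apply: le_lt_trans h; apply: fine_modulus_dist => //; exact: ell_md.
rewrite (_ : tilde_length = (fun q => g q `^ (mexp p)^-1)).
  apply: (measurableT_comp (f := fun y : R => y `^ (mexp p)^-1)); first exact: measurable_powR.
  exact: continuous_borel.
apply/funext => q; rewrite /tilde_length /tilde_norm lpnormE//.
by rewrite -[modulus _ _ _]fineK ?modulus_fin ?ell_md// poweR_EFin.
Qed.

(** The direction of a class. It undoes a positive scaling of a class of norm 1, so that the law of
    Y Q determines that of Q. *)
Definition tilde_unit q : ell_tilde N p := tilde_scale (tilde_length q)^-1 q.

Lemma tilde_length_ge0 q : 0 <= tilde_length q.
Proof. by rewrite fine_ge0// lpnorm_ge0. Qed.

Lemma tilde_unit_measurable :
  measurable_fun setT (tilde_unit : borel (ell_tilde N p) -> borel (ell_tilde N p)).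
Proof.
apply: tilde_scale_measurable2; last exact: measurable_id.
rewrite (_ : (fun q => _) = (fun q => tilde_length q `^ (-1))); last first.
  by apply/funext => q; rewrite powR_inv1// tilde_length_ge0.
apply: (measurableT_comp (f := fun y : R => y `^ (-1))); first exact: measurable_powR.
exact: tilde_length_measurable.
Qed.

Lemma tilde_unit_scale a q : 0 < a -> tilde_norm q = 1%E -> tilde_unit (tilde_scale a q) = q.
Proof.
rewrite -(class_representative q); move: (representative q) => x a0; rewrite tilde_norm_class => x1.
rewrite /tilde_unit tilde_scale_class /tilde_length tilde_norm_class/= lpnormZ//.
rewrite [ell_val _]/(ell_val x) x1 mule1/= gtr0_norm// tilde_scale_class.
apply/shift_classP; exists 0; rewrite bshift0; apply/funext => t /=.
by rewrite !ell_val_scale /scale scalerA mulVf ?scale1r// gt_eqF.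
Qed.

Lemma tilde_scale_toell a v : (lpnorm N p v < +oo)%E ->
  tilde_scale a (cls (toell N p v)) = cls (toell N p (scale a v)).
Proof.
move=> vf; rewrite tilde_scale_class; apply/shift_classP; exists 0.
by rewrite bshift0 ell_val_scale !toellK// lpnormZ_fin.
Qed.

End tilde_maps.

Lemma measure_ae_eq (R : realType) d (T : measurableType d) (P : {measure set T -> \bar R})
    (A B : set T) : measurable A -> measurable B -> {ae P, forall w, A w <-> B w} -> P A = P B.
Proof.
move=> mA mB AB.
have E (C : set T) : measurable C -> P C = (\int[P]_w (\1_C w : R)%:E)%E.
  by move=> mC; rewrite integral_indic// setIT.
rewrite !E//; apply: ae_eq_integral => //.
- by apply/measurable_EFinP; exact: measurable_indic.
- by apply/measurable_EFinP; exact: measurable_indic.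
apply: filterS AB => w AB _; congr (_%:E); rewrite !indicE; congr (_ : bool)%:R.
by apply/idP/idP; rewrite !inE; apply AB.
Qed.

Lemma pareto_gt0 (R : realType) d (T : measurableType d) (P : probability T R) alpha (Y : T -> R) :
  pareto P alpha Y -> {ae P, forall w, 0 < Y w}.
Proof.
move=> YP; have [mY _] := YP; have P1 := pareto_gt1 YP.
have mS : measurable [set w | 1 < Y w] by exact: measurable_ltr_set.
apply: (@negligibleS _ _ _ P (~` [set w | 1 < Y w])).
  by move=> w /=; apply: contra_not => h; exact: lt_trans h.
exists (~` [set w | 1 < Y w]); split => //; first exact: measurableC.
by transitivity (1 - P [set w | (1 < Y w)%R])%E; [exact: probability_setC|rewrite P1 subee].
Qed.

Lemma measurable_normalize (R : realType) (d : nat) (N : vnorm R d) (p : \bar R) : (0 < p)%E ->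
  measurable_fun setT (normalize N p : path_space R d -> path_space R d).
Proof.
move=> p0; apply: measurable_path => t j.
rewrite (_ : (fun w => _) = (fun v => fine (lpnorm N p v) `^ (-1) * v t ord0 j)); last first.
  by apply/funext => v; rewrite /normalize /scale mxE powR_inv1// fine_ge0// lpnorm_ge0.
apply: measurable_funM; last exact: measurable_coord_entry.
apply: (measurableT_comp (f := fun y : R => y `^ (-1))); first exact: measurable_powR.
by apply: (measurableT_comp (f := fine)) => //; exact: measurable_lpnorm.
Qed.

(** * The spectral cluster process *)

Section cluster_process.
Context (R : realType) (d : nat) (N : vnorm R d) (alpha : R) (p : \bar R).
Context (dT : measure_display) (OT : measurableType dT) (PT : probability OT R).
Variables (Th : OT -> pathZ R d).
Hypothesis alpha0 : 0 < alpha.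
Hypothesis p0 : (0 < p)%E.
Hypothesis mTh : measurable_fun setT (Th : OT -> path_space R d).
Hypothesis Th0 : forall w, N (Th w 0) = 1.

Local Notation leb := (@lebesgue_measure R).
Local Notation rd := (pradius alpha).
Local Notation beta := (leb \x PT)%E.
Local Notation md := (modulus N p).
Local Notation q := (mexp p).
Implicit Types (v : pathZ R d) (b : R * OT).

Hypothesis Th_psum : forall w, (psum N alpha (Th w) < +oo)%E.
Hypothesis Th_md : forall w, (md (Th w) < +oo)%E.

Local Notation S1 := (cluster_path N alpha Th).
Local Notation kap := (norm_ratio N alpha p Th).
Local Notation c := (cluster_index N alpha p PT Th).
Local Notation md1 := (md_set N alpha p Th 1).
Local Notation cls := (@shift_class R d N p).
Local Notation toell := (toell N p).

Hypothesis c_fin : (c < +oo)%E.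

Lemma cluster_index_fine : 0 < fine c.
Proof. by rewrite fine_gt0// cluster_index_gt0. Qed.

Lemma beta_md1 : [the measure _ _ of beta] md1 = (fine c)%:E.
Proof.
transitivity (((1 `^ q^-1) `^ (- alpha))%:E * c)%E; first exact: beta_md_set.
by rewrite !powR1 mul1e fineK// ge0_fin_numE// ltW// cluster_index_gt0.
Qed.

(** This product space is the sample space on which the cluster process is built: length and shape
    of S1 are functions on it. *)
Definition cluster_prob : probability _ R :=
  @normalized_restriction _ _ R [the measure _ _ of beta] md1 (fine c)
    (measurable_md_set p0 mTh Th0 Th_psum 1) cluster_index_fine beta_md1.

Local Notation PQ := cluster_prob.

Definition cluster_length b : R := rd b.1 * kap b.2.

Definition cluster_shape w : ell N p := toell (normalize N p (Th w)).

Local Notation len := cluster_length.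
Local Notation shape := cluster_shape.

Let kap0 w : 0 < kap w. Proof. exact: norm_ratio_gt0. Qed.
Let an0 w : 0 < anorm N alpha Th w. Proof. exact: anorm_gt0. Qed.

Let ln w : R := fine (lpnorm N p (Th w)).

Let ln0 w : 0 < ln w.
Proof. by rewrite -(divfK (negbT (gt_eqF (an0 w))) (ln w)) mulr_gt0// kap0. Qed.

Lemma cluster_length_gt0 b : 0 < len b.
Proof. by rewrite mulr_gt0// pradius_gt0. Qed.

Lemma measurable_cluster_length : measurable_fun setT len.
Proof.
apply: measurable_funM; first exact: measurable_rd1.
apply: (measurableT_comp (f := kap)); last exact: measurable_snd.
exact: measurable_norm_ratio.
Qed.

Lemma md1E b : md1 b = (1 < len b).
Proof.
have E : (1 < (len b) `^ q) = (1 < len b).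
  have E0 : (1 : R) `^ q = 1 by rewrite powR1.
  rewrite -!lte_fin -poweR_EFin -[X in (X%:E < _ `^ _)%E]E0 gt_poweR ?mexp_gt0//.
  by rewrite lee_fin ltW// cluster_length_gt0.
by rewrite /md_set /= cluster_md//= E.
Qed.

Lemma lpnorm_normalize w : lpnorm N p (normalize N p (Th w)) = 1%E.
Proof.
rewrite lpnormZ// gtr0_norm ?invr_gt0; last exact: ln0.
rewrite -[lpnorm N p (Th w)]fineK; last exact: lpnorm_Th_fin.
by rewrite -EFinM mulVf// gt_eqF// ln0.
Qed.

Lemma cluster_shapeE w : ell_val (shape w) = normalize N p (Th w).
Proof. by rewrite toellK// lpnorm_normalize ltry. Qed.

Lemma normalize_vanishing w : vanishing N (normalize N p (Th w)).
Proof.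
apply: (psum_vanishing alpha0); rewrite psumZ lte_mul_pinfty ?lee_fin ?powR_ge0//.
Qed.

Lemma measurable_cluster_shape : measurable_fun setT (shape : OT -> borel (ell N p)).
Proof.
have m := measurableT_comp (measurable_normalize N p0) mTh.
apply: (toell_measurable p0 m) => [w|w]; last exact: normalize_vanishing.
by rewrite modulus_lty// lpnorm_normalize ltry.
Qed.

Lemma cluster_path_decomposition b : tilde_scale (len b) (cls (shape b.2)) = cls (toell (S1 b)).
Proof.
rewrite tilde_scale_toell//; last by rewrite lpnorm_normalize ltry.
congr (cls (toell _)); rewrite /normalize scaleA; congr scale.
by rewrite /len /norm_ratio; field; rewrite !gt_eqF// ln0.
Qed.

(* The law of the length under [cluster_prob], as the image of the part of
   Lebesgue measure on which the radius exceeds one. *)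
Let I (A : set R) : \bar R := leb [set u | A (rd u) /\ 1 < rd u].

(** At fixed Theta the length is the radius times [kap], so homogeneity turns the condition on the
    length into the factor [kap]^alpha and a term free of Theta. The product form gives
    independence, and a full set in either place gives the other marginal. *)
Lemma cluster_prob_product (A : set R) (E : set OT) : measurable A -> measurable E ->
  PQ [set b | A (len b) /\ E b.2] =
  ((fine c)^-1%:E * (I A * \int[PT]_w ((kap w `^ alpha)%:E * (\1_E w)%:E)))%E.
Proof.
move=> mA mE.
have mS : measurable [set b : R * OT | A (len b) /\ E b.2].
  apply: measurableI; first exact: (measurable_preimage measurable_cluster_length).
  apply: (measurable_preimage (f := snd)) => //; exact: measurable_snd.
rewrite normalized_restrictionE; congr (_ * _)%E.
pose g (y : R) : \bar R := (\1_A y * (1 < y)%R%:R : R)%:E.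
have mg : measurable_fun setT g.
  apply/measurable_EFinP; apply: measurable_funM; first exact: measurable_indic.
  rewrite (_ : (fun y : R => (1 < y)%R%:R) = \1_[set y : R | 1 < y]).
    by apply: measurable_indic; exact: measurable_ltr_set.
  by apply/funext => y; rewrite indicE mem_setE.
have g0 y : (0 <= g y)%E by rewrite lee_fin mulr_ge0// indicE.
have IE : (\int[leb]_u g (rd u))%E = I A.
  transitivity (\int[leb]_u (\1_[set u | A (rd u) /\ (1 < rd u)%R] u : R)%:E)%E; last first.
    rewrite integral_indic ?setIT//; apply: measurableI; first exact: (measurable_preimage (@measurable_pradius R alpha)).
    by apply: measurable_ltr_set => //; exact: measurable_pradius.
  apply: eq_integral => u _; congr (_%:E); rewrite !indicE -natrM mulnb; congr (_ : bool)%:R.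
  apply/idP/idP; first by move=> /andP[]; rewrite !inE.
  by rewrite [X in X -> _]inE => -[Au h]; rewrite mem_set.
transitivity (\int[beta]_b (g (len b) * (\1_E b.2)%:E))%E.
  transitivity (\int[beta]_b (\1_([set b | A (len b) /\ E b.2] `&` md1) b : R)%:E)%E.
    rewrite integral_indic ?setIT//.
    by apply: measurableI => //; exact: measurable_md_set.
  apply: eq_integral => b _; rewrite /g -EFinM; congr (_%:E); rewrite !indicE -!natrM !mulnb; congr (_ : bool)%:R.
  apply/idP/idP; rewrite inE.
    by move=> [[Ab Eb]]; rewrite md1E => h; rewrite (mem_set Ab) (mem_set Eb) h.
  move=> /andP[/andP[Ab h] Eb]; rewrite !inE in Ab Eb; split => //.
  by rewrite md1E.
rewrite integral_beta//; last 2 first.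
- apply: emeasurable_funM.
    by apply: (measurableT_comp mg); exact: measurable_cluster_length.
  apply/measurable_EFinP; apply: (measurableT_comp (f := \1_E : OT -> R)); last exact: measurable_snd.
  exact: measurable_indic.
- by move=> b; rewrite mule_ge0.
have mk : measurable_fun setT (fun w => (kap w `^ alpha)%:E).
  apply/measurable_EFinP; apply: (measurableT_comp (f := fun y : R => y `^ alpha)).
    exact: measurable_powR.
  exact: measurable_norm_ratio.
rewrite -ge0_integralZl//; last 2 first.
- by apply: emeasurable_funM => //; apply/measurable_EFinP; exact: measurable_indic.
- by move=> w _; rewrite mule_ge0// lee_fin powR_ge0.
apply: eq_integral => w _ /=.
have ik : 0 < (kap w)^-1 by rewrite invr_gt0.
have := @pradius_scale _ _ alpha0 _ g ik mg g0.
rewrite -[(kap w)^-1](powR_inv1 (ltW (kap0 w))) -powRrM mulN1r opprK powR_inv1 ?ltW// IE => H.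
rewrite ge0_integralZr//; last first.
  apply: (measurableT_comp (f := g) (g := fun u : R => rd u * kap w)) => //.
  by apply: measurable_funM => //; exact: measurable_pradius.
rewrite [RHS]muleCA [RHS]muleA -H muleC [RHS]muleC; congr (_ * _)%E.
by apply: eq_integral => u _; rewrite /len invrK.
Qed.

Let I1 : I setT = 1%E.
Proof.
rewrite /I (_ : [set u | _] = [set u | 1 < rd u]); last by apply/seteqP; split => u //= [].
by rewrite pradius_tail// powR1.
Qed.

Let kap_fin : (\int[PT]_w ((kap w `^ alpha)%:E * (\1_(setT : set OT) w)%:E) = (fine c)%:E)%E.
Proof.
rewrite fineK ?ge0_fin_numE ?ltW ?cluster_index_gt0//.
by apply: eq_integral => w _; rewrite indicE in_setT mule1.
Qed.

Lemma cluster_prob_length (A : set R) : measurable A -> PQ [set b | A (len b)] = I A.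
Proof.
move=> mA; have := cluster_prob_product mA (@measurableT _ OT).
rewrite kap_fin (_ : [set b | _ /\ _] = [set b | A (len b)]); last by apply/seteqP; split => b //= [].
by move=> ->; rewrite muleCA -EFinM mulVf ?mule1// gt_eqF// cluster_index_fine.
Qed.

Lemma cluster_prob_shape (E : set OT) : measurable E ->
  PQ [set b | E b.2] = ((fine c)^-1%:E * \int[PT]_w ((kap w `^ alpha)%:E * (\1_E w)%:E))%E.
Proof.
move=> mE; have := cluster_prob_product (@measurableT _ R) mE.
rewrite I1 mul1e (_ : [set b | _ /\ _] = [set b | E b.2])//.
by apply/seteqP; split => b //= [].
Qed.

Lemma cluster_pareto : pareto PQ alpha len.
Proof.
split=> [|y y1]; first exact: measurable_cluster_length.
rewrite (cluster_prob_length (A := [set z | y < z])); last exact: measurable_ltr_set.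
rewrite /I (_ : [set u | _] = [set u | y < rd u]).
  by rewrite pradius_tail// (lt_trans ltr01).
apply/seteqP; split => u /=; first by case.
by move=> h; split=> //; exact: lt_trans h.
Qed.

Let shape_set (B : set (borel (ell_tilde N p))) : measurable B ->
  measurable [set w | B (cls (shape w))].
Proof.
move=> mB; apply: (measurable_preimage (f := (fun w => cls (shape w)) : OT -> borel (ell_tilde N p))) => //.
apply: (measurableT_comp (f := cls : borel (ell N p) -> borel (ell_tilde N p))).
  exact: shift_class_measurable.
exact: measurable_cluster_shape.
Qed.

Lemma cluster_indep : indep_elements PQ len (fun b => cls (shape b.2) : borel (ell_tilde N p)).
Proof.
move=> A B mA mB; have mE := shape_set mB.
have := cluster_prob_product mA mE; have := cluster_prob_length mA; have := cluster_prob_shape mE.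
move=> h1 h2 h3; transitivity (PQ [set b | A (len b) /\ B (cls (shape b.2))]); first by [].
transitivity (PQ [set b | A (len b)] * PQ [set b | B (cls (shape b.2))])%E; last by [].
by rewrite h1 h2; apply: etrans h3 _; rewrite muleCA.
Qed.

Lemma measurable_cluster_class :
  measurable_fun setT ((fun b => cls (toell (S1 b))) : _ -> borel (ell_tilde N p)).
Proof.
apply: (measurableT_comp (f := cls : borel (ell N p) -> borel (ell_tilde N p))).
  exact: shift_class_measurable.
apply: (toell_measurable p0).
- exact: measurable_cluster_path.
- exact: cluster_md_lty.
- exact: cluster_vanishing.
Qed.

Lemma tilde_unit_cluster b : tilde_unit (cls (toell (S1 b))) = cls (shape b.2).
Proof.
rewrite -cluster_path_decomposition tilde_unit_scale//; first exact: cluster_length_gt0.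
by rewrite tilde_norm_class// cluster_shapeE lpnorm_normalize.
Qed.

(** Continuous functions determine the law of Y Q through open sets. As Y > 0 and |Q|_p = 1 almost
    surely, Q is the direction of Y Q, and the direction of S1 is its shape. *)
Lemma cluster_shape_unique (dQ : measure_display) (OQ : measurableType dQ) (P' : probability OQ R)
    (Q : OQ -> ell_tilde N p) (Y : OQ -> R) :
  measurable_fun setT (Q : OQ -> borel (ell_tilde N p)) ->
  {ae P', forall w, tilde_norm (Q w) = 1%E} -> pareto P' alpha Y ->
  (forall f : ell_tilde N p -> R, continuous f -> (forall s, 0 <= f s <= 1) ->
    (\int[P']_w (f (tilde_scale (Y w) (Q w)))%:E = \int[PQ]_b (f (cls (toell (S1 b))))%:E)%E) ->
  forall B : set (borel (ell_tilde N p)), measurable B ->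
    P' (Q @^-1` B) = PQ [set b | B (cls (shape b.2))].
Proof.
move=> mQ Q1 PY H B mB; have mY := PY.1.
have mYQ := tilde_scale_measurable2 p0 mY mQ.
pose nu1 := pushprob P' mYQ; pose nu2 := pushprob PQ measurable_cluster_class.
have nuE (f : ell_tilde N p -> R) : continuous f -> (forall s, 0 <= f s <= 1) ->
    (\int[nu1]_s (f s)%:E = \int[nu2]_s (f s)%:E)%E.
  move=> cf f01; have mf : measurable_fun setT (fun s : borel (ell_tilde N p) => (f s)%:E).
    by apply/measurable_EFinP; exact: continuous_borel.
  have f0 s : (0 <= (f s)%:E)%E by rewrite lee_fin; have /andP[] := f01 s.
  transitivity (\int[P']_w (f (tilde_scale (Y w) (Q w)))%:E)%E.
    exact: (ge0_integral_pushprob P' mYQ mf f0).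
  rewrite H//; apply/esym; exact: (ge0_integral_pushprob PQ measurable_cluster_class mf f0).
have nuU (U : set (ell_tilde N p)) : open U -> nu1 U = nu2 U.
  move=> oU; have [h [ch h01 hnd hU]] := tilde_open_approx p0 oU.
  have mU : measurable (U : set (borel (ell_tilde N p))) by exact: open_measurable_borel.
  have cv (nu : {measure set (borel (ell_tilde N p)) -> \bar R}) :
      (\int[nu]_s (h n s)%:E)%E @[n --> \oo] --> nu U.
    have -> : nu U = (\int[nu]_s (\1_U s : R)%:E)%E by rewrite integral_indic// setIT.
    have := @cvg_monotone_convergence _ _ _ nu setT measurableT (fun n s => (h n s)%:E).
    move=> /(_ _ _ _); rewrite (_ : (fun t => limn _) = (fun s => (\1_U s)%:E)); last first.
      apply/funext => s; apply/cvg_lim => //; apply: cvg_EFin; first exact: nearW.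
      exact: hU.
    apply.
    - by move=> n; apply/measurable_EFinP; exact: continuous_borel.
    - by move=> n s _; rewrite lee_fin; have /andP[] := h01 n s.
    - by move=> s _ n m nm; rewrite lee_fin; exact: hnd.
  have c1 := cv nu1; have c2 := cv nu2.
  rewrite (_ : (fun n => _) = (fun n => \int[nu2]_s (h n s)%:E)%E) in c1; last first.
    by apply/funext => n; exact: nuE.
  exact: (cvg_unique _ c1 c2).
have fin1 : (nu1 setT < +oo)%E.
  by apply: (@le_lt_trans _ _ 1%E); [exact: probability_le1|exact: ltry].
have nuB := open_approx_measure_unique fin1 nuU.
have mUB : measurable (@tilde_unit R d N p @^-1` B : set (borel (ell_tilde N p))).
  by apply: (measurable_preimage (f := @tilde_unit R d N p : borel _ -> borel _)) => //; exact: tilde_unit_measurable.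
transitivity (nu1 (@tilde_unit R d N p @^-1` B)).
  transitivity (P' [set w | B (tilde_unit (tilde_scale (Y w) (Q w)))]); last by [].
  apply: measure_ae_eq.
  - exact: (measurable_preimage mQ).
  - exact: (measurable_preimage mYQ mUB).
  - by apply: filterS2 Q1 (pareto_gt0 PY) => w Qw Yw /=; rewrite tilde_unit_scale.
rewrite (nuB _ mUB); transitivity (PQ [set b | B (tilde_unit (cls (toell (S1 b))))]); first by [].
by congr (PQ _); apply/seteqP; split => b /=; rewrite tilde_unit_cluster.
Qed.

Lemma cluster_prob_integral (f : ell_tilde N p -> R) M : continuous f -> (forall s, 0 <= f s <= M) ->
  (\int[PQ]_b (f (cls (toell (S1 b))))%:E)%E =
  (IB PT (fun b => f (cls (toell (S1 b))) * (1 < md (S1 b))%E%:R) / fine c)%:E.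
Proof.
move=> cf fM.
have mf : measurable_fun setT (fun b => f (cls (toell (S1 b)))).
  apply: (measurableT_comp (f := f : borel (ell_tilde N p) -> R)); first exact: continuous_borel.
  exact: measurable_cluster_class.
have f0 b : (0 <= (f (cls (toell (S1 b))))%:E)%E by rewrite lee_fin; have /andP[] := fM (cls (toell (S1 b))).
have mfE : measurable_fun setT (fun b => (f (cls (toell (S1 b))))%:E) by apply/measurable_EFinP; exact: mf.
transitivity ((fine c)^-1%:E * \int[beta]_(b in md1) (f (cls (toell (S1 b))))%:E)%E.
  exact: (@ge0_integral_normalized _ _ R [the measure _ _ of beta] md1 (fine c)
    (measurable_md_set p0 mTh Th0 Th_psum 1) cluster_index_fine beta_md1 _ mfE f0).
have E b : f (cls (toell (S1 b))) * (1 < md (S1 b))%E%:R = f (cls (toell (S1 b))) * \1_md1 b.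
  by rewrite md_set_ind.
rewrite integral_mkcond mulrC EFinM; congr (_ * _)%E; rewrite betaI_IBE.
  apply: eq_integral => b _; rewrite E patchE indicE; case: (boolP (b \in md1)) => bE; rewrite ?mulr1 ?mulr0//.
have bI := betaI_md alpha0 p0 mTh Th0 Th_psum Th_md c_fin M (@ltr01 R).
apply: (betaI_le _ _ bI).
  under eq_fun do rewrite E.
  by apply: measurable_funM => //; apply: measurable_indic; exact: measurable_md_set.
move=> b; have /andP[h1 h2] := fM (cls (toell (S1 b))).
by rewrite E normrM ger0_norm// ger0_norm ?indicE// ler_wpM2r.
Qed.

End cluster_process.

(** * A Pareto variable independent of a random element *)

Section pareto_product.
Context (R : realType) (alpha : R) (dT : measure_display) (OT : measurableType dT) (PT : probability OT R).
Context (d' : measure_display) (T' : measurableType d').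
Variables (Y : OT -> R) (Th : OT -> T').
Hypothesis alpha0 : 0 < alpha.
Hypothesis mTh : measurable_fun setT Th.
Hypothesis YP : pareto PT alpha Y.
Hypothesis ind : indep_elements PT Y Th.
Local Notation leb := (@lebesgue_measure R).
Local Notation rd := (pradius alpha).
Local Notation beta := (leb \x PT)%E.

(** Independence makes the joint law a product; under Fubini's theorem the Pareto factor becomes the
    radius restricted to ]1, oo[. *)
Lemma pareto_indep_integral (k : R * T' -> \bar R) : measurable_fun setT k -> (forall z, 0 <= k z)%E ->
  (\int[PT]_w k (Y w, Th w) = \int[beta]_b (k (rd b.1, Th b.2) * (1 < rd b.1)%R%:R%:E))%E.
Proof.
move=> mk k0; have [mY _] := YP.
have mJ : measurable_fun setT (fun w => (Y w, Th w)) by exact: measurable_fun_pair.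
pose lY := pushprob PT mY; pose lT := pushprob PT mTh.
have JE A : measurable A -> (lY \x lT)%E A = pushprob PT mJ A.
  move=> mA; apply: (product_measure_unique _ mA) => B C mB mC.
  exact: ind.
transitivity (\int[pushprob PT mJ]_z k z)%E.
  by apply/esym; exact: (ge0_integral_pushprob PT mJ mk k0).
transitivity (\int[(lY \x lT)%E]_z k z)%E.
  by apply: eq_measure_integral => A mA _; apply/esym; exact: JE.
transitivity (\int[lT]_t \int[lY]_y k (y, t))%E; first exact: fubini_tonelli2.
have mk1 t : measurable_fun setT (fun y => k (y, t)) by apply: (measurableT_comp mk); apply: measurable_fun_pair; [exact: measurable_id|exact: measurable_cst].
transitivity (\int[PT]_w \int[lY]_y k (y, Th w))%E.
  apply: (@ge0_integral_pushprob _ _ _ _ _ PT Th mTh (fun t => \int[lY]_y k (y, t))%E).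
    exact: (@measurable_fun_fubini_tonelli_G _ _ _ _ _ lY k).
  by move=> t; exact: integral_ge0.
have mind : measurable_fun setT (fun u => (1 < rd u)%R%:R%:E : \bar R).
  apply/measurable_EFinP; rewrite (_ : (fun u => _) = \1_[set u | 1 < rd u]).
    apply: measurable_indic; apply: measurable_ltr_set => //; exact: measurable_pradius.
  by apply/funext => u; rewrite indicE mem_setE.
rewrite integral_beta; last 2 first.
- apply: emeasurable_funM.
    apply: (measurableT_comp (f := k)) => //; apply: measurable_fun_pair; first exact: measurable_rd1.
    by apply: (measurableT_comp mTh); exact: measurable_snd.
  by apply: (measurableT_comp mind); exact: measurable_fst.
- by move=> b; rewrite mule_ge0.
apply: eq_integral => w _.
transitivity (\int[PT]_w' k (Y w', Th w))%E.
  exact: (ge0_integral_pushprob PT mY (mk1 _) (fun y => k0 _)).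
rewrite (pareto_pradius alpha0 YP (mk1 _))//.
rewrite integral_mkcond; apply: eq_integral => u _ /=; rewrite patchE (_ : (u \in _) = (1 < rd u)); last by rewrite mem_setE.
by case: (1 < rd u); rewrite ?mule1 ?mule0.
Qed.

End pareto_product.

(** * From the time series to its path law *)

Section real_form.
Context (R : realType) (d : nat) (N : vnorm R d) (alpha : R) (p : \bar R).
Context (dX : measure_display) (OX : measurableType dX) (P : probability OX R) (X : int -> OX -> 'rV[R]_d).
Context (dT : measure_display) (OT : measurableType dT) (PT : probability OT R).
Variables (Theta : int -> OT -> 'rV[R]_d) (Y : OT -> R).
Hypothesis alpha0 : 0 < alpha.
Hypothesis p0 : (0 < p)%E.
Local Notation md := (modulus N p).
Implicit Types (v : pathZ R d).

Lemma process_measurable d' (O : measurableType d') (Z : int -> O -> 'rV[R]_d) : process Z ->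
  measurable_fun setT ((fun w => Z ^~ w) : O -> path_space R d).
Proof. by move=> pZ; apply: measurable_to_path => t; exact: pZ. Qed.

Lemma lpnorm_alpha_psum v : (lpnorm N alpha%:E v < +oo)%E = (psum N alpha v < +oo)%E.
Proof.
apply/idP/idP => [h|h]; last by rewrite /= poweR_lty.
by apply: lty_poweRy h; rewrite invr_eq0 gt_eqF.
Qed.

Lemma measurable_if_path d' (O : measurableType d') (F G : O -> pathZ R d) (S : set O) :
  measurable S -> measurable_fun setT (F : O -> path_space R d) ->
  measurable_fun setT (G : O -> path_space R d) ->
  measurable_fun setT ((fun w => if w \in S then F w else G w) : O -> path_space R d).
Proof.
move=> mS mF mG; apply: measurable_path => t j.
rewrite (_ : (fun w => _) = (fun w => F w t ord0 j * \1_S w + G w t ord0 j * (1 - \1_S w))); last first.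
  apply/funext => w; rewrite indicE; case: ifP => _ /=; rewrite ?subrr ?subr0 ?mulr1 ?mulr0 ?addr0//.
  by rewrite add0r.
have mI : measurable_fun setT (\1_S : O -> R) by exact: measurable_indic.
have mE (H : O -> pathZ R d) : measurable_fun setT (H : O -> path_space R d) ->
    measurable_fun setT (fun w => H w t ord0 j).
  move=> mH; apply: (measurableT_comp (f := fun v : path_space R d => v t ord0 j)) => //.
  exact: measurable_coord_entry.
apply: measurable_funD; apply: measurable_funM; [exact: mE|exact: mI|exact: mE|].
by apply: measurable_funB => //; exact: measurable_cst.
Qed.

(** On the null set where a condition fails, Theta is replaced with one fixed good path. All later
    pointwise statements then hold everywhere, without almost-sure clauses. *)
Lemma exists_modification : process Theta -> {ae PT, forall w, N (Theta 0 w) = 1} ->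
  {ae PT, forall w, (lpnorm N p (Theta ^~ w) + lpnorm N alpha%:E (Theta ^~ w) < +oo)%E} ->
  exists Th : OT -> pathZ R d,
    [/\ measurable_fun setT (Th : OT -> path_space R d), forall w, N (Th w 0) = 1,
        forall w, (psum N alpha (Th w) < +oo)%E, forall w, (md (Th w) < +oo)%E &
        {ae PT, forall w, Th w = Theta ^~ w}].
Proof.
move=> pTh ae1 aef; have mTh := process_measurable pTh.
pose S := [set w | N (Theta 0 w) = 1 /\
  ((lpnorm N p (Theta ^~ w) < +oo)%E /\ (psum N alpha (Theta ^~ w) < +oo)%E)].
have mS : measurable S.
  apply: measurableI.
    apply: (measurable_preimage (f := fun w => N (Theta 0 w)) (B := [set 1])); last exact: measurable_set1.
    exact: (measurableT_comp (measurable_vnorm N 0) mTh).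
  apply: measurableI; apply: measurable_lte_set => //.
    by apply: (measurableT_comp (f := lpnorm N p : path_space R d -> _)) => //; exact: measurable_lpnorm.
  by apply: (measurableT_comp (f := psum N alpha : path_space R d -> _)) => //; exact: measurable_psum.
have aeS : {ae PT, forall w, S w}.
  apply: filterS2 ae1 aef => w h1 h2; split=> //; split.
    by apply: le_lt_trans h2; rewrite leeDl// lpnorm_ge0.
  by rewrite -lpnorm_alpha_psum; apply: le_lt_trans h2; rewrite leeDr// lpnorm_ge0.
(* The good event has probability one, so it is not empty and supplies the replacement. *)
have [w0 Sw0] : exists w, S w.
  apply/not_existsP => nS; have [A [mA A0 TA]] := aeS.
  have : (PT [set: OT] <= PT A)%E.
    by apply: le_measure; rewrite ?inE// => w _; apply: TA; exact: nS.
  by rewrite A0 probability_setT lee_fin ler10.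
exists (fun w => if w \in S then Theta ^~ w else Theta ^~ w0); split.
- apply: measurable_if_path => //; apply: measurable_path => t j; exact: measurable_cst.
- by move=> w; case: ifP => [|_]; [rewrite inE => -[]|case: Sw0].
- by move=> w; case: ifP => [|_]; [rewrite inE => -[_ []]|case: Sw0 => _ []].
- by move=> w; rewrite modulus_lty//; case: ifP => [|_]; [rewrite inE => -[_ []]|case: Sw0 => _ []].
- by apply: filterS aeS => w Sw; rewrite mem_set.
Qed.

Hypothesis X_process : process X.
Let mX := process_measurable X_process.

Definition path_law : probability (path_space R d) R := pushprob P mX.

Local Notation L := path_law.

Lemma path_law_shift : stationary P X ->
  forall k (A : set (path_space R d)), measurable A -> L (bshift k @^-1` A) = L A.
Proof. by move=> st k A mA; exact: st. Qed.

Lemma path_law_EL f M : measurable_fun setT (f : path_space R d -> R) -> (forall v, 0 <= f v <= M) ->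
  EL L f = fine (\int[P]_w (f (X ^~ w))%:E)%E.
Proof.
move=> mf fM; congr fine; apply: (ge0_integral_pushprob P mX (g := fun v => (f v)%:E)).
  by apply/measurable_EFinP.
by move=> v; rewrite lee_fin; have /andP[] := fM v.
Qed.

(** The weak convergence of conditional windows, rewritten for the path law: the integral against
    [cond_law] is a quotient of expectations, and the limit moves from Y and Theta to [beta] by
    [pareto_indep_integral]. *)
Lemma tail_limit (Th : OT -> pathZ R d) : measurable_fun setT (Th : OT -> path_space R d) ->
  {ae PT, forall w, Th w = Theta ^~ w} -> spectral_tail_process N P PT alpha X Theta Y ->
  forall f M, wcont f -> (forall v, 0 <= f v <= M) ->
  EL L (fun v => f (scale u^-1 v) * (u < N (v 0))%R%:R) / tailL N L u @[u --> +oo] -->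
  fine (\int[(@lebesgue_measure R \x PT)%E]_b
     (f (tail_path alpha Th b) * (1 < pradius alpha b.1)%R%:R)%:E)%E.
Proof.
move=> mTh aeTh [pTh _ YP ind wk] f M cf fM; have [h [F cF fF]] := cf.
have mTheta := process_measurable pTh; have [mY _] := YP.
(* Every matrix is the window of some path, so F is bounded on all matrices by the bounds of f. *)
have FM A : 0 <= F A <= M.
  rewrite [A](_ : _ = window (- h%:Z) h.*2.+1 (unwin (- h%:Z) A)) -?fF//.
  by apply/matrixP => i j; rewrite mxE unwinE mxE.
have bF : exists M : R, forall s, `|F s| <= M.
  by exists M => s; have /andP[h1 h2] := FM s; rewrite ger0_norm.
have mf := measurable_wcont cf.
have mB u : measurable [set w | u < N (X 0 w)].
  exact: (measurable_preimage mX (measurable_tail_set N u)).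
have mZ u : measurable_fun setT ((fun w => window (- h%:Z) h.*2.+1 (scale u^-1 (X ^~ w))) : OX -> borel _).
  apply: (measurableT_comp (f := window (- h%:Z) h.*2.+1 : path_space R d -> borel _)).
    exact: measurable_window.
  exact: (measurableT_comp (measurable_scale u^-1) mX).
have E u : (\int[cond_law P (fun w => window (- h%:Z) h.*2.+1 (scale u^-1 (X ^~ w)) : borel _)
    [set w | (u < N (X 0 w))%R]]_(s in [set: borel _]) (F s)%:E)%E =
    (EL L (fun v => f (scale u^-1 v) * (u < N (v 0))%R%:R) / tailL N L u)%:E.
  rewrite (@integral_cond_law _ _ _ P _ _ _ (mZ u) (mB u) F M); last 2 first.
  - exact: continuous_borel.
  - exact: FM.
  rewrite (@path_law_EL _ M).
  - congr (_ / _)%:E; congr fine; apply: eq_integral => w _; rewrite fF indicE.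
    by congr (_ * _)%:E; congr (_ : bool)%:R; rewrite mem_setE.
  - apply: measurable_funM; last exact: measurable_tail_ind.
    by apply: (measurableT_comp (f := f : path_space R d -> R)) => //; exact: measurable_scale.
  - move=> v; have /andP[h1 h2] := fM (scale u^-1 v).
    by case: (_ < _); rewrite ?mulr1 ?h1// mulr0 lexx (le_trans h1).
have msc (G : OT -> pathZ R d) : measurable_fun setT (G : OT -> path_space R d) ->
    measurable_fun setT ((fun w => scale (Y w) (G w)) : OT -> path_space R d).
  move=> mG; apply: measurable_path => t j.
  rewrite (_ : (fun w => _) = (fun w => Y w * G w t ord0 j)); last by apply/funext => w; rewrite mxE.
  apply: measurable_funM => //.
  by apply: (measurableT_comp (f := fun v : path_space R d => v t ord0 j)) => //; exact: measurable_coord_entry.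
have mW : measurable_fun setT ((fun w => window (- h%:Z) h.*2.+1 (scale (Y w) (Theta ^~ w))) : OT -> borel _).
  apply: (measurableT_comp (f := window (- h%:Z) h.*2.+1 : path_space R d -> borel _)).
    exact: measurable_window.
  exact: msc.
have f0 v : (0 <= (f v)%:E)%E by rewrite lee_fin; have /andP[] := fM v.
(* Passing to the modification changes events by null sets only. *)
have ind' : indep_elements PT Y (Th : OT -> path_space R d).
  move=> A B mA mB'; have mTB := measurable_preimage mTh mB'; have mThB := measurable_preimage mTheta mB'.
  have e1 : PT (Th @^-1` B) = PT ((fun w => Theta ^~ w) @^-1` B).
    by apply: measure_ae_eq => //; apply: filterS aeTh => w /= ->.
  rewrite e1 -(ind A B mA mB'); apply: measure_ae_eq.
  - by apply: measurableI => //; exact: (measurable_preimage mY).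
  - by apply: measurableI => //; exact: (measurable_preimage mY).
  - by apply: filterS aeTh => w /= ->.
pose k (z : R * path_space R d) : \bar R := (f (scale z.1 z.2))%:E.
have mk : measurable_fun setT k.
  apply/measurable_EFinP; apply: (measurableT_comp (f := f : path_space R d -> R)) => //.
  apply: measurable_path => t j.
  rewrite (_ : (fun w => _) = (fun z : R * path_space R d => z.1 * z.2 t ord0 j)); last first.
    by apply/funext => w; rewrite mxE.
  apply: measurable_funM; first exact: measurable_fst.
  apply: (measurableT_comp (f := fun v : path_space R d => v t ord0 j)); first exact: measurable_coord_entry.
  exact: measurable_snd.
have lim : (\int[pushforward PT ((fun w => window (- h%:Z) h.*2.+1 (scale (Y w) (Theta ^~ w))) : OT -> borel _)]_(s in [set: borel _]) (F s)%:E =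
    \int[(@lebesgue_measure R \x PT)]_b (f (tail_path alpha Th b) * (1 < pradius alpha b.1)%R%:R)%:E)%E.
  transitivity (\int[PT]_w (F (window (- h%:Z) h.*2.+1 (scale (Y w) (Theta ^~ w))))%:E)%E.
    apply: (ge0_integral_pushprob PT mW (g := fun s => (F s)%:E)).
      by apply/measurable_EFinP; exact: continuous_borel.
    by move=> s; rewrite lee_fin; have /andP[] := FM s.
  transitivity (\int[PT]_w (f (scale (Y w) (Th w)))%:E)%E.
    apply: ae_eq_integral => //.
    - apply/measurable_EFinP.
      apply: (measurableT_comp (f := F : borel _ -> R)) => //; exact: continuous_borel.
    - by apply/measurable_EFinP; apply: (measurableT_comp (f := f : path_space R d -> R)) => //; exact: msc.
    - by apply: filterS aeTh => w -> _; rewrite fF.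
  have := @pareto_indep_integral R alpha _ _ PT _ (path_space R d) Y Th alpha0 mTh YP ind' k mk (fun z => f0 _).
  by move=> H; apply: etrans H _; apply: eq_integral => b _; rewrite -EFinM.
have fin : (\int[(@lebesgue_measure R \x PT)]_b (f (tail_path alpha Th b) * (1 < pradius alpha b.1)%R%:R)%:E)%E \is a fin_num.
  rewrite -lim ge0_fin_numE.
    apply: (@le_lt_trans _ _ (\int[pushprob PT mW]_s (cst M%:E s))%E).
      apply: (@ge0_le_integral _ _ _ (pushprob PT mW)) => //.
      - by move=> s _; rewrite lee_fin; have /andP[] := FM s.
      - by apply/measurable_EFinP; exact: continuous_borel.
      - by move=> s _; rewrite lee_fin; have /andP[] := FM s.
    rewrite integral_cst//.
    have -> : (M%:E * pushprob PT mW setT = M%:E)%E.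
      by transitivity (M%:E * 1)%E; [congr (_ * _)%E; exact: probability_setT|rewrite mule1].
    exact: ltry.
  by apply: (@integral_ge0 _ _ _ (pushprob PT mW)) => s _; rewrite lee_fin; have /andP[] := FM s.
have c1 := wk h F cF bF; rewrite lim -(fineK fin) in c1.
have c2 : (EL L (fun v => f (scale u^-1 v) * (u < N (v 0))%R%:R) / tailL N L u)%:E @[u --> +oo] -->
    (fine (\int[(@lebesgue_measure R \x PT)]_b (f (tail_path alpha Th b) * (1 < pradius alpha b.1)%R%:R)%:E)%E)%:E.
  by apply: cvg_trans c1; apply: near_eq_cvg; apply: nearW => u; rewrite E.
exact: (fine_cvg c2).
Qed.

End real_form.

(** * Weak convergence, levels and the passage to the modulus *)

Section weak_convergence.
Context (R : realType) (S : ptopologicalType) (I : Type) (F : set_system I) (FF : Filter F).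
Variables (mu_ : I -> {measure set (borel S) -> \bar R}) (mu : {measure set (borel S) -> \bar R}).

(** A test function is the difference of max(f, 0) and max(-f, 0), which are continuous, nonnegative
    and bounded by M. Finite limits may be subtracted. *)
Lemma weak_cvg_ge0 : (forall f M, continuous (f : S -> R) -> (forall s, 0 <= f s <= M) ->
    (\int[mu]_s (f s)%:E)%E \is a fin_num /\
    (\int[mu_ i]_s (f s)%:E)%E @[i --> F] --> (\int[mu]_s (f s)%:E)%E) ->
  weak_cvg F (fun i => mu_ i : set (borel S) -> \bar R) mu.
Proof.
move=> H f cf [M fM].
pose h (e : R) s := Num.max (e * f s) 0.
have hb e s : `|e| = 1 -> 0 <= h e s <= M.
  move=> e1; rewrite /h le_max lexx orbT ge_max (le_trans (normr_ge0 (f s)))// andbT.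
  by apply: le_trans (ler_norm _) _; rewrite normrM e1 mul1r.
have ch e : continuous (h e).
  move=> s; apply: (@continuous_max _ _ (fun s => e * f s) (fun=> 0)); last exact: cvg_cst.
  by apply: cvgM; [exact: cvg_cst|exact: cf].
have [f1 c1] := H _ M (ch 1) (fun s => hb 1 s (normr1 _)).
have [f2 c2] := H _ M (ch (-1)) (fun s => hb (-1) s (normrN1 _)).
have E (nu : {measure set (borel S) -> \bar R}) :
    (\int[nu]_s (f s)%:E = \int[nu]_s (h 1 s)%:E - \int[nu]_s (h (-1) s)%:E)%E.
  rewrite integralE; congr (_ - _)%E; apply: eq_integral => s _.
    by rewrite funeposE /h mul1r EFin_max.
  by rewrite funenegE /h mulN1r EFin_max.
rewrite E (_ : (fun i => _) = (fun i => \int[mu_ i]_s (h 1 s)%:E - \int[mu_ i]_s (h (-1) s)%:E)%E).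
  by apply: cvgeB => //; rewrite fin_num_adde_defl// fin_numN.
by apply/funext => i; exact: E.
Qed.

End weak_convergence.

(** If x_n < A for some n >= 1, then n G(x_n) >= G(A) > 0 by monotonicity; for large n this
    contradicts the limit 0. *)
Lemma levels_diverge (R : realType) (G : R -> R) (x : nat -> R) : (forall u, 0 < G u) ->
  {homo G : u v /~ u <= v} -> n%:R * G (x n) @[n --> \oo] --> (0 : R) -> x n @[n --> \oo] --> +oo.
Proof.
move=> G0 Gni G_x; apply/cvgryPge => A; move/cvgrPdist_lt: G_x => /(_ _ (G0 A)) near_n.
near=> n; have n0 : (0 < n)%N by near: n; exact: nbhs_infty_gt.
have : `|0 - n%:R * G (x n)| < G A by near: n.
rewrite sub0r normrN; apply: contraTT; rewrite -ltNge -leNgt => xA.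
apply: le_trans (ler_norm _); apply: (le_trans (Gni _ _ (ltW xA))).
by rewrite ler_peMl ?ler1n// ltW.
Unshelve. all: by end_near. Qed.

Lemma tailL_anti (R : realType) (d : nat) (N : vnorm R d) (L : probability (path_space R d) R) :
  {homo tailL N L : u v /~ u <= v}.
Proof.
move=> u v uv; apply: fine_le; rewrite ?fin_num_measure//; try exact: measurable_tail_set.
apply: le_measure; rewrite ?inE; try exact: measurable_tail_set.
by move=> w /=; exact: le_lt_trans.
Qed.

Section levels.
Context (R : realType) (d : nat) (N : vnorm R d) (p : \bar R) (L : probability (path_space R d) R).
Variables (x : nat -> R).
Hypothesis p0 : (0 < p)%E.
Hypothesis x0 : forall n, 0 < x n.
Local Notation md := (modulus N p).
Local Notation q := (mexp p).

(** The power q fixes 1, so norm and modulus exceed 1 together, and the norm is homogeneous. *)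
Lemma exceedanceE n : exceedance N p x n = [set v | ((x n)%:E < lpnorm N p (block 0 n%:Z v))%E].
Proof.
apply/funext => v.
have h u : (1 < md u)%E = (1 < lpnorm N p u)%E by rewrite -(@modulus_gt _ _ N p u 1 p0 ler01) powR1.
rewrite /exceedance /= h block_scale lpnormZ// gtr0_norm ?invr_gt0//.
have e0 : (0 < (x n)^-1%:E)%E by rewrite lte_fin invr_gt0.
by rewrite -[in RHS](@lte_pmul2l _ ((x n)^-1%:E))// -EFinM mulVf ?gt_eqF.
Qed.

(** The modulus exceeds eta exactly when the norm exceeds eta^(1/q). The iterated limit is unfolded
    into a threshold for eps, after which n may depend on eps. *)
Lemma small_values_modulus :
  (forall delta : R, 0 < delta ->
       limn_esup (fun n =>
         (fine (L [set v | (delta%:E < lpnorm N p (trunc N eps (scale (x n)^-1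
                 (block 0%R n%:Z v))))%E]) / level_count N L x n)%:E)
         @[eps --> 0^'+] --> (0 : \bar R)) ->
  forall eta e : R, 0 < eta -> 0 < e ->
  exists2 r, 0 < r & forall eps, 0 < eps < r -> \forall n \near \oo,
    fine (L [set v | (eta%:E < md (trunc N eps (block 0 n%:Z (scale (x n)^-1 v))))%E])
      / level_count N L x n < e.
Proof.
move=> H eta e eta0 e0; have q0 := mexp_gt0 p0.
have d0 : 0 < eta `^ q^-1 by rewrite powR_gt0.
have etaE : eta = (eta `^ q^-1) `^ q by rewrite -powRrM mulVf ?gt_eqF// powRr1// ltW.
have : nbhs (0 : \bar R) [set y | (y < e%:E)%E].
  by apply: open_nbhs_nbhs; split; [exact: open_ereal_lt_ereal|rewrite /= lte_fin].
move=> /(H _ d0) /nbhs_ballP[r /= r0 Hr]; exists r => // eps /andP[eps0 epsr].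
have : ball 0 r eps by rewrite -ball_normE /= sub0r normrN gtr0_norm.
move=> /Hr /(_ eps0) /near_lt_limn_esup; apply: filterS => n.
rewrite lte_fin; congr (fine (L _) / _ < _).
apply/funext => v /=.
by rewrite block_scale -(@modulus_gt _ _ N p _ _ p0 (ltW d0)) -etaE.
Qed.

End levels.

Section cluster_of_process.
Context (R : realType) (d : nat) (N : vnorm R d) (alpha : R) (p : \bar R).
Context (dX : measure_display) (OX : measurableType dX) (P : probability OX R) (X : int -> OX -> 'rV[R]_d).
Context (dT : measure_display) (OT : measurableType dT) (PT : probability OT R).
Variables (Th : OT -> pathZ R d) (x : nat -> R).
Hypothesis X_process : process X.
Local Notation L := (path_law P X_process).
Local Notation md := (modulus N p).
Local Notation cls := (@shift_class R d N p).
Local Notation toell := (toell N p).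
Local Notation S1 := (cluster_path N alpha Th).
Hypothesis alpha0 : 0 < alpha.
Hypothesis p0 : (0 < p)%E.
Hypothesis mTh : measurable_fun setT (Th : OT -> path_space R d).
Hypothesis Th0 : forall w, N (Th w 0) = 1.
Hypothesis X_stationary : stationary P X.
Hypothesis RV : forall f M, wcont f -> (forall v, 0 <= f v <= M) ->
  EL L (fun v => f (scale u^-1 v) * (u < N (v 0))%R%:R) / tailL N L u @[u --> +oo] -->
  fine (\int[(@lebesgue_measure R \x PT)%E]_b
     (f (tail_path alpha Th b) * (1 < pradius alpha b.1)%R%:R)%:E)%E.
Hypothesis Th_psum : forall w, (psum N alpha (Th w) < +oo)%E.
Hypothesis Th_md : forall w, (md (Th w) < +oo)%E.
Hypothesis x0 : forall n, 0 < x n.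
Hypothesis xoo : x n @[n --> \oo] --> +oo.
Hypothesis anticlustering : forall delta : R, 0 < delta ->
  limn_esup (fun n => (exceed_prob N L x k n delta / tailL N L (delta * x n))%:E)
    @[k --> \oo] --> (0 : \bar R).
Hypothesis small_values : forall eta e : R, 0 < eta -> 0 < e ->
  exists2 r, 0 < r & forall eps, 0 < eps < r -> \forall n \near \oo,
    fine (L [set v | (eta%:E < md (trunc N eps (block 0 n%:Z (scale (x n)^-1 v))))%E])
      / level_count N L x n < e.
Hypothesis c_fin : (cluster_index N alpha p PT Th < +oo)%E.

Local Notation PQ := (cluster_prob alpha0 p0 mTh Th0 Th_psum Th_md c_fin).
Local Notation Z n := (fun w => cls (ellscale (x n)^-1 (ellblock N p 0 n%:Z (X ^~ w))) : borel (ell_tilde N p)).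
Local Notation B n := [set w | ((x n)%:E < lpnorm N p (block 0 n%:Z (X ^~ w)))%E].

Let mX := process_measurable X_process.

Let ZE n w : Z n w = cls (toell (block 0 n%:Z (scale (x n)^-1 (X ^~ w)))).
Proof. by rewrite /= -[ellscale _ _]ell_valK ell_val_scale block_scale. Qed.

Let mZ n : measurable_fun setT (Z n).
Proof.
rewrite (_ : Z n = fun w => cls (toell (block 0 n%:Z (scale (x n)^-1 (X ^~ w))))); last by apply/funext => w; exact: ZE.
apply: (measurableT_comp (f := cls : borel (ell N p) -> borel (ell_tilde N p))).
  exact: shift_class_measurable.
have m := measurableT_comp (@toell_block_measurable _ _ N _ p0 0 n%:Z) (measurable_scale (x n)^-1).
exact: (measurableT_comp m mX).
Qed.

Let mB n : measurable (B n).
Proof.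
have := measurable_exceedance N p0 x n; rewrite exceedanceE// => m.
exact: (measurable_preimage mX m).
Qed.

(** Composed with the class of a path, a continuous function on the quotient is shift-invariant and
    continuous for d_p, so [conditional_limit] applies to it. *)
Lemma cond_law_cluster_cvg (f : ell_tilde N p -> R) M : continuous f -> (forall s, 0 <= f s <= M) ->
  (\int[cond_law P (Z n) (B n)]_(s in [set: borel (ell_tilde N p)]) (f s)%:E)%E @[n --> \oo] -->
  (\int[PQ]_b (f (cls (toell (S1 b))))%:E)%E.
Proof.
move=> cf fM; rewrite (cluster_prob_integral _ _ _ _ _ _ _ cf fM).
pose g v := f (cls (toell v)).
have gM v : 0 <= g v <= M by exact: fM.
have g_shift k v : g (bshift k v) = g v by rewrite /g class_toell_shift.
have g_cont := @tilde_continuous_close _ _ _ _ p0 f cf.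
have lim := @conditional_limit _ _ _ _ _ _ _ _ _ _ alpha0 p0 mTh Th0 (path_law_shift X_process X_stationary)
  RV Th_psum Th_md x x0 xoo anticlustering small_values g M gM g_shift g_cont c_fin.
have E n : (\int[cond_law P (Z n) (B n)]_(s in [set: borel (ell_tilde N p)]) (f s)%:E)%E =
  (EL L (fun v => g (block 0 n%:Z (scale (x n)^-1 v)) * (1 < md (block 0 n%:Z (scale (x n)^-1 v)))%E%:R) /
   fine (L (exceedance N p x n)))%:E.
  rewrite (@integral_cond_law _ _ _ P _ _ _ (mZ n) (mB n) f M); last 2 first.
  - exact: continuous_borel.
  - exact: fM.
  have eB : B n = [set w | (1 < md (block 0 n%:Z (scale (x n)^-1 (X ^~ w))))%E].
    have := exceedanceE N p0 x0 n; move=> /(congr1 (preimage (fun w => X ^~ w))) e.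
    by apply/esym; exact: e.
  rewrite (@path_law_EL _ _ _ _ P X X_process _ M).
  - congr (_ / _)%:E.
      congr fine; apply: eq_integral => w _; rewrite ZE indicE eB; congr (_ * _)%:E.
      by congr (_ : bool)%:R; rewrite mem_setE.
    by congr (fine (P _)); rewrite eB.
  - rewrite (_ : (fun v => _) = (fun v => g (block 0 n%:Z (scale (x n)^-1 v)) * \1_(exceedance N p x n) v)).
      apply: measurable_funM; last exact: measurable_indic (measurable_exceedance N p0 x n).
      apply: (measurableT_comp (f := f : borel (ell_tilde N p) -> R)); first exact: continuous_borel.
      apply: (measurableT_comp (f := cls : borel (ell N p) -> borel (ell_tilde N p))).
        exact: shift_class_measurable.
      exact: (measurableT_comp (@toell_block_measurable _ _ N _ p0 0 n%:Z) (measurable_scale (x n)^-1)).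
    by apply/funext => v; rewrite indicE; congr (_ * (_ : bool)%:R); rewrite mem_setE.
  - move=> v; have /andP[h1 h2] := gM (block 0 n%:Z (scale (x n)^-1 v)).
    by case: (_ < _)%E; rewrite ?mulr1 ?h1// mulr0 lexx (le_trans h1).
under eq_fun do rewrite E.
by apply: cvg_EFin; [exact: nearW|exact: lim].
Qed.

(** The class of the shape, scaled by the length, is the class of S1, whose law under [PQ] is the
    limit of the conditional laws. *)
Lemma spectral_cluster_exists : spectral_cluster_process P PQ alpha X x
  (fun b => cls (cluster_shape N p Th b.2)) (cluster_length N alpha p Th).
Proof.
have mQ : measurable_fun setT ((fun b => cls (cluster_shape N p Th b.2)) : R * OT -> borel (ell_tilde N p)).
  apply: (measurableT_comp (f := cls : borel (ell N p) -> borel (ell_tilde N p))).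
    exact: shift_class_measurable.
  apply: (measurableT_comp (f := cluster_shape N p Th : OT -> borel (ell N p))); last exact: measurable_snd.
  exact: (measurable_cluster_shape alpha0 p0 mTh Th0 Th_psum Th_md).
split => //.
- apply: nearW => b; rewrite tilde_norm_class (cluster_shapeE p0 Th0 Th_psum Th_md).
  exact: (lpnorm_normalize p0 Th0 Th_psum Th_md).
- exact: cluster_pareto.
- exact: cluster_indep.
have mYQ := tilde_scale_measurable2 p0 (measurable_cluster_length p0 mTh Th0 Th_psum) mQ.
apply: (@weak_cvg_ge0 R _ _ \oo _ (fun n => cond_measure P (mZ n) (mB n)) (pushprob PQ mYQ)) => f M cf fM.
have E : (\int[pushprob PQ mYQ]_s (f s)%:E = \int[PQ]_b (f (cls (toell (S1 b))))%:E)%E.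
  rewrite ge0_integral_pushprob.
  - by apply: eq_integral => b _; rewrite cluster_path_decomposition.
  - by apply/measurable_EFinP; exact: continuous_borel.
  - by move=> s; rewrite lee_fin; have /andP[] := fM s.
split; rewrite E; first by rewrite (cluster_prob_integral _ _ _ _ _ _ _ cf fM).
exact: cond_law_cluster_cvg fM.
Qed.

(** Any cluster process along these levels provides a weak limit of the same conditional laws, so
    its Y Q gives continuous functions the same integrals as S1. *)
Lemma spectral_cluster_unique (dQ : measure_display) (OQ : measurableType dQ) (P' : probability OQ R)
    (Q : OQ -> ell_tilde N p) (Y : OQ -> R) : spectral_cluster_process P P' alpha X x Q Y ->
  forall C : set (borel (ell_tilde N p)), measurable C ->
    P' (Q @^-1` C) = PQ [set b | C (cls (cluster_shape N p Th b.2))].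
Proof.
move=> [mQ Q1 PY _ wk]; apply: (@cluster_shape_unique _ _ _ _ _ _ _ _ _ alpha0 p0 mTh Th0 Th_psum Th_md c_fin
  _ _ P' Q Y mQ Q1 PY) => f cf f01.
have [mY _] := PY; have mYQ := tilde_scale_measurable2 p0 mY mQ.
have bf : exists M : R, forall s, `|f s| <= M by exists 1 => s; have /andP[h1 h2] := f01 s; rewrite ger0_norm.
have c1 := wk f cf bf; have c2 := cond_law_cluster_cvg cf f01.
rewrite -(cvg_unique _ c1 c2)//; apply/esym.
apply: (ge0_integral_pushprob P' mYQ (g := fun s => (f s)%:E)).
  by apply/measurable_EFinP; exact: continuous_borel.
by move=> s; rewrite lee_fin; have /andP[] := f01 s.
Qed.

End cluster_of_process.

(** * The law of the normalized spectral tail process on sequences *)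

Section cluster_law.
Context (R : realType) (d : nat) (N : vnorm R d) (alpha : R) (p : \bar R).
Context (dT : measure_display) (OT : measurableType dT) (PT : probability OT R).
Variables (Theta : int -> OT -> 'rV[R]_d) (Th : OT -> pathZ R d).
Local Notation md := (modulus N p).
Local Notation toell := (toell N p).
Hypothesis alpha0 : 0 < alpha.
Hypothesis p0 : (0 < p)%E.
Hypothesis Theta_process : process Theta.
Hypothesis ThE : {ae PT, forall w, Th w = Theta ^~ w}.
Hypothesis mTh : measurable_fun setT (Th : OT -> path_space R d).
Hypothesis Th0 : forall w, N (Th w 0) = 1.
Hypothesis Th_psum : forall w, (psum N alpha (Th w) < +oo)%E.
Hypothesis Th_md : forall w, (md (Th w) < +oo)%E.

Let weight v : \bar R := (lpnorm N p (normalize N alpha%:E v) `^ alpha)%E.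

Let weight_Th w : weight (Th w) = (norm_ratio N alpha p Th w `^ alpha)%:E.
Proof.
have anE : fine (lpnorm N alpha%:E (Th w)) = anorm N alpha Th w by rewrite /= fine_poweR.
rewrite /weight /normalize anE lpnormZ// gtr0_norm; last by rewrite invr_gt0; exact: (anorm_gt0 Th0 Th_psum).
rewrite -[lpnorm N p _]fineK; last exact: (lpnorm_Th_fin p0 Th_md).
by rewrite -EFinM poweR_EFin mulrC.
Qed.

Let measurable_weight : measurable_fun setT (fun w => weight (Theta ^~ w)).
Proof.
have a0 : (0 < alpha%:E)%E by rewrite lte_fin.
apply: (measurableT_comp (f := fun y : \bar R => (y `^ alpha)%E)); first exact: measurable_poweR.
have m := measurableT_comp (measurable_lpnorm N p0) (measurable_normalize N a0).
exact: (measurableT_comp m (process_measurable Theta_process)).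
Qed.

Let measurable_ratio : measurable_fun setT (fun w => (norm_ratio N alpha p Th w `^ alpha)%:E).
Proof.
apply/measurable_EFinP; apply: (measurableT_comp (f := fun y : R => y `^ alpha)).
  exact: measurable_powR.
exact: (measurable_norm_ratio p0 mTh Th0 Th_psum).
Qed.

Lemma cluster_index_weight : cluster_index N alpha p PT Th = (\int[PT]_w weight (Theta ^~ w))%E.
Proof.
rewrite /cluster_index; apply: ae_eq_integral => //; by apply: filterS ThE => w Ew _; rewrite -weight_Th Ew.
Qed.

Lemma lpnorm_normalize_lty v : (lpnorm N p (normalize N p v) < +oo)%E.
Proof.
have [h|h] := ltP (lpnorm N p v) +oo%E; first exact: lpnormZ_fin.
rewrite /normalize; move: h; rewrite leye_eq => /eqP ->; rewrite invr0 lpnormZ// normr0.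
by rewrite mul0e ltry.
Qed.

Lemma image_ell_val (A : set (ell N p)) v : (lpnorm N p v < +oo)%E ->
  (@ell_val _ _ N p @` A) v = A (toell v).
Proof.
move=> vf; apply/propext; split => [[y Ay <-]|Av]; first by rewrite ell_valK.
by exists (toell v) => //; rewrite toellK.
Qed.

(** The integrand is written with Theta itself, whose entries need not decay on a null set.
    Replacing Theta with the zero path where |Theta|_alpha is infinite makes the shape Borel and
    leaves the product unchanged, the weight being 0 there. *)
Let measurable_shape_indic (A : set (borel (ell N p))) : measurable A ->
  measurable_fun setT (fun w => (weight (Theta ^~ w) *
    (\1_(@ell_val _ _ N p @` A) (normalize N p (Theta ^~ w)))%:E)%E).
Proof.
move=> mA; have mTheta := process_measurable Theta_process.
pose S := [set w | (psum N alpha (Theta ^~ w) < +oo)%E].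
have mS : measurable S.
  apply: measurable_lte_set => //.
  by apply: (measurableT_comp (f := psum N alpha : path_space R d -> _)) => //; exact: measurable_psum.
pose Th' w := if w \in S then Theta ^~ w else (fun=> 0) : pathZ R d.
have mTh' : measurable_fun setT (Th' : OT -> path_space R d).
  by apply: measurable_if_path => //; apply: measurable_path => t j; exact: measurable_cst.
have psum' w : (psum N alpha (Th' w) < +oo)%E.
  rewrite /Th'; case: ifPn => [|_]; first by rewrite inE.
  rewrite (_ : (fun=> 0) = scale 0 (fun=> 0)); last by apply/funext => t; rewrite /scale scale0r.
  by rewrite psumZ normr0 powR0 ?gt_eqF// mul0e ltry.
have msh : measurable_fun setT ((fun w => toell (normalize N p (Th' w))) : OT -> borel (ell N p)).
  apply: (toell_measurable p0).
  - exact: (measurableT_comp (measurable_normalize N p0) mTh').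
  - by move=> w; rewrite modulus_lty// lpnorm_normalize_lty.
  - by move=> w; apply: (psum_vanishing alpha0); rewrite psumZ lte_mul_pinfty ?lee_fin ?powR_ge0.
rewrite (_ : (fun w => _) = (fun w => weight (Theta ^~ w) *
    (\1_A (toell (normalize N p (Th' w))) : R)%:E)%E).
  apply: emeasurable_funM => //; apply/measurable_EFinP.
  by apply: (measurableT_comp (f := \1_A : borel (ell N p) -> R)) => //; exact: measurable_indic.
apply/funext => w; have [Sw|Sw] := boolP (w \in S).
  rewrite /Th' Sw !indicE; congr (_ * _%:R%:E)%E; congr (nat_of_bool _).
  apply/idP/idP; rewrite !inE image_ell_val//; exact: lpnorm_normalize_lty.
(* For an infinite |Theta|_alpha, [fine] returns 0 and so does its inverse; the normalized path, and
   with it the weight, is 0. *)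
rewrite (_ : weight _ = 0%E) ?mul0e//.
have : ~~ (psum N alpha (Theta ^~ w) < +oo)%E by apply: contra Sw => h; rewrite inE.
rewrite -lpnorm_alpha_psum// -leNgt leye_eq => /eqP h; rewrite /weight /normalize h invr0 lpnormZ// normr0 mul0e.
by rewrite poweR0r// gt_eqF.
Qed.

Hypothesis c_fin : (cluster_index N alpha p PT Th < +oo)%E.
Local Notation PQ := (cluster_prob alpha0 p0 mTh Th0 Th_psum Th_md c_fin).

Let measurable_shape2 : measurable_fun setT ((fun b => cluster_shape N p Th b.2) : R * OT -> borel (ell N p)).
Proof.
apply: (measurableT_comp (f := cluster_shape N p Th : OT -> borel (ell N p))); last exact: measurable_snd.
exact: (measurable_cluster_shape alpha0 p0 mTh Th0 Th_psum Th_md).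
Qed.

Definition cluster_law : probability (borel (ell N p)) R := pushprob PQ measurable_shape2.

Lemma cluster_lawE (A : set (borel (ell N p))) : measurable A ->
  cluster_law A = ((fine (cluster_index N alpha p PT Th))^-1%:E *
    \int[PT]_w (weight (Theta ^~ w) * (\1_(@ell_val _ _ N p @` A) (normalize N p (Theta ^~ w)))%:E))%E.
Proof.
move=> mA; have mE : measurable (cluster_shape N p Th @^-1` A).
  apply: (measurable_preimage (f := cluster_shape N p Th : OT -> borel (ell N p))) => //.
  exact: (measurable_cluster_shape alpha0 p0 mTh Th0 Th_psum Th_md).
have H := cluster_prob_shape alpha0 p0 mTh Th0 Th_psum Th_md c_fin mE.
apply: etrans H _; congr (_ * _)%E; apply: ae_eq_integral => //.
- by apply: emeasurable_funM => //; apply/measurable_EFinP; exact: measurable_indic.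
- exact: measurable_shape_indic.
apply: filterS ThE => w Ew _; rewrite -Ew weight_Th; congr (_ * _)%E.
rewrite !indicE; congr (_%:R%:E)%E; congr (nat_of_bool _); apply/idP/idP; rewrite !inE.
  by move=> Aw; rewrite image_ell_val//; exact: lpnorm_normalize_lty.
by rewrite image_ell_val//; exact: lpnorm_normalize_lty.
Qed.

End cluster_law.

Theorem proposition3p1 (R : realType) (d : nat) (N : vnorm R d)
    (alpha : R) (p : \bar R)
    (dX : measure_display) (OX : measurableType dX) (P : probability OX R)
    (X : int -> OX -> 'rV[R]_d)
    (dT : measure_display) (OT : measurableType dT) (PT : probability OT R)
    (Theta : int -> OT -> 'rV[R]_d) (Y : OT -> R)
    (x : nat -> R)
    (alpha_gt0 : 0 < alpha)
    (p_gt0 : (0 < p)%E)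
    (X_process : process X)
    (X_stationary : stationary P X)
    (X_RV : spectral_tail_process N P PT alpha X Theta Y)
    (Theta_fin : {ae PT, forall w,
       (lpnorm N p (Theta ^~ w) + lpnorm N alpha%:E (Theta ^~ w) < +oo)%E})
    (x_gt0 : forall n, 0 < x n)
    (x_level : n%:R * fine (P [set w | x n < N (X 0 w)]) @[n --> \oo] --> (0 : R))
    (anticlustering : forall delta : R, 0 < delta ->
       limn_esup (fun n => (cprob P
         [set w | ((delta * x n)%:E
                    < lpnorm N +oo%E (block k%:Z n%:Z (X ^~ w)))%E]
         [set w | delta * x n < N (X 0 w)])%:E) @[k --> \oo] --> (0 : \bar R))
    (small_values : forall delta : R, 0 < delta ->
       limn_esup (fun n =>
         (fine (P [set w | (delta%:E
             < lpnorm N p (trunc N eps (scale (x n)^-1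
                 (block 0%R n%:Z (X ^~ w)))))%E])
          / (n%:R * fine (P [set w | x n < N (X 0 w)])))%:E)
         @[eps --> 0^'+] --> (0 : \bar R))
    (growth_lt : (p < alpha%:E)%E ->
       n%:R / x n `^ fine p @[n --> \oo] --> (0 : R))
    (growth_eq : p = alpha%:E -> exists2 kappa : R, 0 < kappa &
       n%:R / x n `^ (alpha - kappa) @[n --> \oo] --> (0 : R)) :
  let weight w :=
    (lpnorm N p (normalize N alpha%:E (Theta ^~ w)) `^ alpha)%E in
  exists c : \bar R,
    [/\ (0 < c)%E,
        (fine (P [set w | ((x n)%:E < lpnorm N p (block 0%R n%:Z (X ^~ w)))%E])
          / (n%:R * fine (P [set w | x n < N (X 0 w)])))%:E @[n --> \oo] --> c,
        c = (\int[PT]_w weight w)%E &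
        (c < +oo)%E ->
        exists mu : probability (borel (ell N p)) R,
          [/\ forall A : set (borel (ell N p)), measurable A ->
                mu A = ((fine c)^-1%:E * \int[PT]_w (weight w *
                  (\1_(@ell_val _ _ N p @` A)
                     (normalize N p (Theta ^~ w)))%:E))%E,
              exists (dQ : measure_display) (OQ : measurableType dQ)
                (PQ : probability OQ R) (Q : OQ -> ell_tilde N p)
                (YQ : OQ -> R),
                spectral_cluster_process P PQ alpha X x Q YQ &
              forall (dQ : measure_display) (OQ : measurableType dQ)
                (PQ : probability OQ R) (Q : OQ -> ell_tilde N p)
                (YQ : OQ -> R),
                spectral_cluster_process P PQ alpha X x Q YQ ->
                forall B : set (borel (ell_tilde N p)), measurable B ->
                  PQ (Q @^-1` B) = mu (@shift_class _ _ N p @^-1` B)]].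
Proof.
move=> weight; have [pTh Th1 _ _ _] := X_RV.
(* The conditions on Theta hold almost surely; from here on a version satisfies them everywhere. *)
have [Th [mTh Th0 Th_psum Th_md ThE]] := exists_modification alpha_gt0 p_gt0 pTh Th1 Theta_fin.
pose L := path_law P X_process.
have RV := tail_limit alpha_gt0 X_process mTh ThE X_RV.
have tail0 := tailL_gt0 alpha_gt0 RV.
have x_infty := levels_diverge tail0 (@tailL_anti _ _ N L) x_level.
(* [cprob] unfolds to the quotient of [exceed_prob] and the tail at delta x_n under the path law. *)
have anti : forall delta : R, 0 < delta ->
    limn_esup (fun n => (exceed_prob N L x k n delta / tailL N L (delta * x n))%:E)
      @[k --> \oo] --> (0 : \bar R) by exact: anticlustering.
have small := @small_values_modulus _ _ N p L x p_gt0 small_values.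
have cE := cluster_index_weight alpha_gt0 p_gt0 pTh ThE mTh Th0 Th_psum Th_md.
have ratio n : (fine (P [set w | ((x n)%:E < lpnorm N p (block 0%R n%:Z (X ^~ w)))%E])
    / (n%:R * fine (P [set w | x n < N (X 0 w)])))%:E =
    (fine (L (exceedance N p x n)) / level_count N L x n)%:E.
  by rewrite exceedanceE.
exists (cluster_index N alpha p PT Th); split => //.
- exact: (cluster_index_gt0 _ p_gt0 mTh Th0 Th_psum Th_md).
- suff lim : (fine (L (exceedance N p x n)) / level_count N L x n)%:E @[n --> \oo] -->
      cluster_index N alpha p PT Th by under eq_fun do rewrite ratio.
  have [coo|cfin] := eqVneq (cluster_index N alpha p PT Th) +oo%E.
    rewrite coo; exact: (exceedance_infinite alpha_gt0 p_gt0 mTh Th0 (path_law_shift X_process X_stationary) RV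
      Th_psum Th_md x_gt0 x_infty anti coo).
  rewrite -ltey in cfin.
  rewrite -[cluster_index _ _ _ _ _]fineK; last first.
    by rewrite ge0_fin_numE// ltW//; exact: (cluster_index_gt0 _ p_gt0 mTh Th0 Th_psum Th_md).
  apply: cvg_EFin; first exact: nearW.
  exact: (exceedance_cvg alpha_gt0 p_gt0 mTh Th0 (path_law_shift X_process X_stationary) RV
    Th_psum Th_md x_gt0 x_infty anti small cfin).
move=> cfin; exists (cluster_law alpha_gt0 p_gt0 mTh Th0 Th_psum Th_md cfin); split.
- by move=> A mA; exact: (cluster_lawE _ _ pTh ThE).
- exists _, _, (cluster_prob alpha_gt0 p_gt0 mTh Th0 Th_psum Th_md cfin),
    (fun b => shift_class (cluster_shape N p Th b.2)), (cluster_length N alpha p Th).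
  exact: (spectral_cluster_exists alpha_gt0 p_gt0 mTh Th0 X_stationary RV Th_psum Th_md
    x_gt0 x_infty anti small cfin).
move=> dQ OQ PQ Q YQ QP B mB.
exact: (spectral_cluster_unique alpha_gt0 p_gt0 mTh Th0 X_stationary RV Th_psum Th_md
    x_gt0 x_infty anti small cfin QP mB).
Qed.
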